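(* Let $\Delta$ be the diagonal product with dihedral lamp groups $\Gamma_s=D_{2l_s}$ and parameters $(k_s)_{s\ge0}$ (infinite sequences; see context), where $(k_s)$ is a strictly increasing sequence of even integers with $k_0=0$ and $k_{s+1}>2k_s$ for all $s$. Set $$\theta:=\limsup_{s\to\infty}\frac{\log l_s}{\log k_s}\in[0,\infty].$$ Then (expressions at $\theta=\infty$ being understood as limits): (i) for $p\in[1,2]$, $$\alpha_p^\ast(\Delta)=\max\left\{\frac1{1+\theta},\frac23\right\};$$ (ii) for $q\in[2,\infty)$, $$\alpha_q^\ast(\Delta)=\frac1{1+\theta}\quad\text{if }0\le\theta\le\frac1q,$$ $$\max\left\{\frac{\theta+1-\frac2q}{\left(2-\frac1q\right)\theta+1-\frac2q},\ \frac23\right\}\le\alpha_q^\ast(\Delta)\le\frac{2\theta+1-\frac2q}{3\theta+1-\frac2q}\quad\text{if }\theta>\frac1q.$$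
   Context: Wreath product: elements of $\Gamma\wr\mathbb Z$ are pairs $(f,i)$ with $f:\mathbb Z\to\Gamma$ finitely supported and $i\in\mathbb Z$, with $(f,i)(g,j)=(f(\cdot)g(\cdot-i),i+j)$; $\gamma\delta_j$ is the function equal to $\gamma$ at $j$ and trivial elsewhere; $\boldsymbol e$ is the trivial function. Dihedral diagonal product: for each $s\ge0$, $\Gamma_s=D_{2l_s}$ is the dihedral group of order $2l_s$ generated by two involutions $a(s),b(s)$, where $l_s$ is a (finite) even positive integer, and $l_0=2$ (so $\Gamma_0\simeq\mathbb Z/2\times\mathbb Z/2$). Let $\Delta_s=\Gamma_s\wr\mathbb Z$ with generators $\tau(s)=(\boldsymbol e,1)$, $\alpha(s)=(a(s)\delta_0,0)$, $\beta(s)=(b(s)\delta_{k_s},0)$. The diagonal product $\Delta$ is the subgroup of $\prod_s\Delta_s$ generated by $\tau=(\tau(s))_s$, $\alpha=(\alpha(s))_s$, $\beta=(\beta(s))_s$, with word metric for this generating set. Compression exponent: for a Lipschitz map $\Psi:\Delta\to L_p=L_p([0,1])$, $\rho_\Psi(t)=\inf\{\|\Psi(x)-\Psi(y)\|_p:|x^{-1}y|_\Delta\ge t\}$, and $\alpha_p^\ast(\Delta)$ is the supremum over Lipschitz $\Psi$ of $\sup\{\alpha\ge0:\exists c>0,\ \rho_\Psi(t)\ge ct^\alpha\ \forall t\ge1\}$. *)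

(* Defs.v *)
From HB Require Import structures.
From mathcomp Require Import all_boot all_order all_algebra all_fingroup.
From mathcomp Require Import all_solvable.
From mathcomp Require Import all_classical all_reals all_analysis.

Set Implicit Arguments.
Unset Strict Implicit.
Unset Printing Implicit Defensive.

Import Order.TTheory GRing.Theory Num.Theory.
Import numFieldNormedType.Exports.

Local Open Scope classical_set_scope.
Local Open Scope ring_scope.

Definition dirprod (I : Type) (G : I -> groupType) : Type := forall i, G i.

Section DirectProduct.
Context (I : Type) (G : I -> groupType).
Local Open Scope group_scope.

HB.instance Definition _ := gen_eqMixin (dirprod G).
HB.instance Definition _ := gen_choiceMixin (dirprod G).

Definition dirprod_one : dirprod G := fun i => 1.
Definition dirprod_inv (x : dirprod G) : dirprod G := fun i => (x i)^-1.
Definition dirprod_mul (x y : dirprod G) : dirprod G := fun i => x i * y i.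

Fact dirprod_mulA : associative dirprod_mul.
Proof. by move=> x y z; apply: functional_extensionality_dep => i; exact: mulgA. Qed.

Fact dirprod_mul1 : left_id dirprod_one dirprod_mul.
Proof. by move=> x; apply: functional_extensionality_dep => i; exact: mul1g. Qed.

Fact dirprod_mulr1 : right_id dirprod_one dirprod_mul.
Proof. by move=> x; apply: functional_extensionality_dep => i; exact: mulg1. Qed.

Fact dirprod_mulV : left_inverse dirprod_one dirprod_inv dirprod_mul.
Proof. by move=> x; apply: functional_extensionality_dep => i; exact: mulVg. Qed.

Fact dirprod_mulrV : right_inverse dirprod_one dirprod_inv dirprod_mul.
Proof. by move=> x; apply: functional_extensionality_dep => i; exact: mulgV. Qed.

HB.instance Definition _ := isGroup.Build (dirprod G)
  dirprod_mulA dirprod_mul1 dirprod_mulr1 dirprod_mulV dirprod_mulrV.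

End DirectProduct.

Record wreath (G : groupType) := Wreath {
  lamp : int -> G;
  cursor : int;
  lamp_finite : finite_set [set j | lamp j <> 1%g] }.

Section WreathProduct.
Context (G : groupType).
Local Open Scope group_scope.
Implicit Types x y z : wreath G.

HB.instance Definition _ := gen_eqMixin (wreath G).
HB.instance Definition _ := gen_choiceMixin (wreath G).

Lemma wreath_ext x y :
  (forall j, lamp x j = lamp y j) -> cursor x = cursor y -> x = y.
Proof.
case: x y => [f i ff] [g j fg] /= /funext fg_eq ij; subst.
by congr Wreath; exact: Prop_irrelevance.
Qed.

Definition wreath_one : wreath G :=
  @Wreath G (fun=> 1) 0%R (sub_finite_set (fun j (n : 1 <> 1) => n erefl) (@finite_set0 int)).

Fact wreath_mul_finite x y :
  finite_set [set j | lamp x j * lamp y (j - cursor x)%R <> 1].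
Proof.
apply: (@sub_finite_set _ _ ([set j | lamp x j <> 1] `|`
  (fun j => j + cursor x)%R @` [set j | lamp y j <> 1])); last first.
  by rewrite finite_setU; split; [|apply: finite_image]; exact: lamp_finite.
move=> j /= xy; have [x1|] := pselect (lamp x j = 1); last by left.
right; exists (j - cursor x)%R; last by rewrite subrK.
by move=> y1; apply: xy; rewrite x1 y1 mulg1.
Qed.

Definition wreath_mul x y : wreath G :=
  Wreath (cursor x + cursor y)%R (wreath_mul_finite x y).

Fact wreath_inv_finite x : finite_set [set j | (lamp x (j + cursor x)%R)^-1 <> 1].
Proof.
apply: (@sub_finite_set _ _ ((fun j => j - cursor x)%R @` [set j | lamp x j <> 1])).
  move=> j /= xj; exists (j + cursor x)%R; last by rewrite addrK.
  by move=> x1; apply: xj; rewrite x1 invg1.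
by apply: finite_image; exact: lamp_finite.
Qed.

Definition wreath_inv x : wreath G := Wreath (- cursor x)%R (wreath_inv_finite x).

Fact wreath_mulA : associative wreath_mul.
Proof.
move=> x y z; apply: wreath_ext => [j|] /=; last by rewrite addrA.
by rewrite mulgA opprD addrA.
Qed.

Fact wreath_mul1 : left_id wreath_one wreath_mul.
Proof.
by move=> x; apply: wreath_ext => [j|] /=; rewrite ?add0r// subr0 mul1g.
Qed.

Fact wreath_mulr1 : right_id wreath_one wreath_mul.
Proof. by move=> x; apply: wreath_ext => [j|] /=; rewrite ?addr0// mulg1. Qed.

Fact wreath_mulV : left_inverse wreath_one wreath_inv wreath_mul.
Proof.
move=> x; apply: wreath_ext => [j|] /=; last by rewrite addNr.
by rewrite opprK mulVg.
Qed.

Fact wreath_mulrV : right_inverse wreath_one wreath_inv wreath_mul.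
Proof.
move=> x; apply: wreath_ext => [j|] /=; last by rewrite subrr.
by rewrite subrK mulgV.
Qed.

HB.instance Definition _ := isGroup.Build (wreath G)
  wreath_mulA wreath_mul1 wreath_mulr1 wreath_mulV wreath_mulrV.

Definition single_lamp (g : G) (j : int) : int -> G :=
  fun i => if i == j then g else 1.

Fact single_lamp_finite g j : finite_set [set i | single_lamp g j i <> 1].
Proof.
apply: (@sub_finite_set _ _ [set j]); last exact: finite_set1.
by move=> i /=; rewrite /single_lamp; case: eqP.
Qed.

Definition wreath_lamp (g : G) (j : int) : wreath G :=
  Wreath 0%R (single_lamp_finite g j).

Definition wreath_shift : wreath G := Wreath 1%R (lamp_finite wreath_one).

End WreathProduct.

Section WordMetric.
Context (G : groupType) (S : set G).
Local Open Scope group_scope.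

Definition is_word (w : seq G) : Prop := forall x, x \in w -> S x \/ S x^-1.

Definition generated_subgroup : set G :=
  [set \prod_(x <- w) x | w in is_word].

(* The value is 0 when x is not in the generated subgroup. *)
Definition word_length (x : G) : nat :=
  xget 0%N [set n | (exists w, [/\ is_word w, \prod_(y <- w) y = x & size w = n])
    /\ (forall w, is_word w -> \prod_(y <- w) y = x -> (n <= size w)%N)].

End WordMetric.

Section DiagonalProduct.
Context (G : nat -> groupType) (a b : forall s, G s) (k : nat -> nat).

Definition diag_tau : dirprod (fun s => wreath (G s)) := fun s => wreath_shift (G s).
Definition diag_alpha : dirprod (fun s => wreath (G s)) :=
  fun s => wreath_lamp (a s) 0.
Definition diag_beta : dirprod (fun s => wreath (G s)) :=
  fun s => wreath_lamp (b s) (k s)%:Z.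

Definition diag_gens : set (dirprod (fun s => wreath (G s))) :=
  [set x | [\/ x = diag_tau, x = diag_alpha | x = diag_beta]].

End DiagonalProduct.

(* dihedral_gtype m is the library's dihedral group of order m; its usual
   notation clashes with the one for directional derivatives. *)
Definition dihedral_generators (l : nat) (a b : dihedral_gtype (2 * l)) : Prop :=
  [/\ #[a]%g = 2%N, #[b]%g = 2%N &
      (<<[set a; b]%SET>>%g = [set: dihedral_gtype (2 * l)]%SET)].

(* L_p([0,1]), realized as L_p of the line for Lebesgue measure restricted to
   [0,1]; its elements are classes modulo almost everywhere equality. *)
Section Lp01.
Context (R : realType) (p : R) (p1 : (1 <= p%:E)%E).

Definition lebesgue01 : {measure set (measurableTypeR R) -> \bar R} :=
  mrestr (@lebesgue_measure R) (measurable_itv `[0%R, 1%R]).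

Definition Lp01 : Type := LspaceType lebesgue01 p1.

Definition Lp01_dist (f g : Lp01) : \bar R :=
  Lnorm lebesgue01 p%:E (fun x => ((f x : R) - (g x : R))%:E).

End Lp01.

Section Compression.
Context (R : realType) (p : R) (p1 : (1 <= p%:E)%E).
Context (G : groupType) (S : set G).

Let H := generated_subgroup S.

Definition subgroup_dist (x y : H) : nat :=
  word_length S ((val x)^-1 * val y)%g.

Definition lipschitz_map (Psi : H -> Lp01 p1) : Prop :=
  exists C : R, forall x y,
    (Lp01_dist (Psi x) (Psi y) <= (C * (subgroup_dist x y)%:R)%:E)%E.

Definition compression_fun (Psi : H -> Lp01 p1) (t : R) : \bar R :=
  ereal_inf [set Lp01_dist (Psi z.1) (Psi z.2)
            | z in [set z : H * H | t <= (subgroup_dist z.1 z.2)%:R]].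

Definition map_compression_exponent (Psi : H -> Lp01 p1) : \bar R :=
  ereal_sup [set e%:E | e in [set e : R | 0 <= e /\
    exists2 c : R, 0 < c &
      forall t : R, 1 <= t -> ((c * t `^ e)%:E <= compression_fun Psi t)%E]].

Definition compression_exponent : \bar R :=
  ereal_sup [set map_compression_exponent Psi | Psi in lipschitz_map].

End Compression.

Definition ext_eval (R : realType) (f : R -> R) (x : \bar R) : R :=
  match x with
  | r%:E => f r
  | +oo%E => lim (f t @[t --> +oo])
  | -oo%E => lim (f t @[t --> -oo])
  end.

(* Main.v *)
(* The commutator of a sweep of letters a and a sweep of letters b, shifted by
   k_s, changes lamps at level s only.  Hence the length of an element is
   comparable to its range plus, for each level s with k_s below the range, k_s
   times the sum over blocks of k_s/2 sites of the largest number of turns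
   (powers of the rotation ab) in the block.

   Lower bounds.  With r = ab, the maps r^i a^e -> 2i+1 and r^i a^e -> 2(i+e) from
   D_2l to a circle of length 2l have adjacent values and ignore right
   multiplication by a and b respectively.  The interpolation between them as the
   cursor crosses an interval of length k_s is a function on the group that changes
   by at most one at each step, and at k_s sites only, while it sees a number v of
   turns as k_s v.  Used site by site it embeds a level into l_p, and through
   signed sums into l_2; functions on cosets detect the range.  The weighted sum of
   these functions over all dyadic scales is Lipschitz, and comparing the two
   descriptions of a level with the word length yields 1/(1+theta), the mixed
   exponent and 2/3.

   Upper bounds.  At level s the group contains tori (Z/m)^(nK) with K = k_s/2, in
   which a signed sum of basis vectors of a block costs O(k_s) as a single basis vector
   does.  A cotype inequality bounds displacements by 2M along one random
   basis vector by such signed sums when M^q <= K.  With the Markov type inequality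
   for a walk of n^2 steps across n = r^2 blocks, this contradicts compression
   exponents above the claimed ones; M and r are chosen as powers of k_s. *)

From HB Require Import structures.
Require Import Defs.
From mathcomp Require Import all_boot all_order all_algebra all_fingroup.
From mathcomp Require Import all_solvable.
From mathcomp Require Import all_classical all_reals all_analysis.
From mathcomp Require Import measurable_realfun.
From mathcomp Require Import ring lra zify.

Set Implicit Arguments.
Unset Strict Implicit.
Unset Printing Implicit Defensive.

Import Order.TTheory GRing.Theory Num.Theory.
Import numFieldNormedType.Exports.

Local Open Scope classical_set_scope.
Local Open Scope ring_scope.

(** * Inequalities for scalar functions *)

Section RealInequalities.
Context {R : realType}.
Implicit Types (q p a b t x y T : R).

(** All inequalities behind the upper bounds are proved for real-valued functions only: the p-th
    power of the distance in L_p is an integral of p-th powers of scalar differences, so an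
    inequality between sums of such powers can be integrated over [0,1]. For p >= 2 martingales and
    Rademacher averages give these powers directly. For p < 2 they give squares, and the passage
    from squares to p-th powers is the reason for the exponent q = max(p, 2). The torus argument
    meets two obstacles: rotations at a site live on a circle of length l_s around which the walk
    must not wrap, which limits r M by l_s; and the cotype inequality is used only while M^q <= k_s
    / 2. Within these limits one gets (k r^3 M)^(e p) <= C r^(2q) k^p for a compression exponent e,
    and the choice of r and M changes at theta = 1/q. The lower bounds lose an arbitrarily small
    power of n, from weighting the scales and from singling out one level among about log n; this is
    harmless, the compression exponent being a supremum. Since theta is a limit superior, bounds are
    first obtained for exponents near theta and pass to the limit at the end. *)

Lemma ler_pow (q x y : R) : 0 <= q -> 0 <= x -> x <= y -> x `^ q <= y `^ q.
Proof.
move=> q0 x0 xy; apply: ge0_ler_powR => //; rewrite nnegrE //.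
exact: le_trans xy.
Qed.

(** Young's inequality for x and m^(q-1) with conjugate exponents q and q/(q-1), multiplied by q.
    This tangent form is the one that Jensen-type arguments can sum. *)
Lemma powR_tangent (q x m : R) : 1 <= q -> 0 <= x -> 0 <= m ->
  m `^ q + q * m `^ (q - 1) * (x - m) <= x `^ q.
Proof.
move=> q1 x0 m0.
have [->|qn1] := eqVneq q 1.
  by rewrite subrr powRr0 !powRr1//; lra.
have qgt : 1 < q by rewrite lt_neqAle eq_sym qn1.
have q0 : 0 < q by lra.
have q10 : q - 1 != 0 by lra.
have := @conjugate_powR R x (m `^ (q - 1)) q (q / (q - 1)) x0 (powR_ge0 _ _) q0.
rewrite divr_gt0 ?subr_gt0// => /(_ isT).
have -> : q^-1 + (q / (q - 1))^-1 = 1 by field; rewrite q10; lra.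
move=> /(_ erefl).
rewrite -powRrM (_ : (q - 1) * (q / (q - 1)) = q); last by field.
have mm : m * m `^ (q - 1) = m `^ q by rewrite mulr_powRB1.
move=> H.
have {}H : q * (x * m `^ (q - 1)) <= x `^ q + (q - 1) * m `^ q.
  have := ler_wpM2l (ltW q0) H; rewrite mulrDr.
  rewrite (_ : q * (x `^ q / q) = x `^ q); last by field; lra.
  by rewrite (_ : q * (m `^ q / (q / (q - 1))) = (q - 1) * m `^ q) //; field; lra.
move: H; rewrite mulrBr -(mulrA q _ m) (mulrC _ m) mm; lra.
Qed.

(** Jensen: the tangent lines of [powR_tangent] at the mean [m] sum to n m^q, since their linear
    parts cancel. *)
Lemma power_mean (I : finType) (q : R) (x : I -> R) : 1 <= q ->
  (\sum_i `|x i|) `^ q <= #|I|%:R `^ (q - 1) * \sum_i `|x i| `^ q.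
Proof.
move=> q1.
have [I0|I0] := eqVneq #|I| 0%N.
  have e (F : I -> R) : \sum_i F i = 0.
    by apply: big1 => i _; have := fintype0 i I0.
  by rewrite !e mulr0 powR0//; lra.
have n0 : 0 < #|I|%:R :> R by rewrite ltr0n lt0n.
set n : R := #|I|%:R in n0 *; set S : R := \sum_i `|x i|.
have S0 : 0 <= S by apply: sumr_ge0.
set m : R := S / n.
have m0 : 0 <= m by rewrite divr_ge0// ltW.
have H : n * m `^ q <= \sum_i `|x i| `^ q.
  have -> : n * m `^ q =
      \sum_i (m `^ q + q * m `^ (q - 1) * (`|x i| - m)).
    rewrite big_split/= -mulr_sumr sumrB/= !sumr_const -/S.
    rewrite -[m *+ _]mulr_natl -[X in _ = X + _]mulr_natl -/n.
    have -> : S - n * m = 0 by rewrite /m; field; lra.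
    by rewrite mulr0 addr0.
  by apply: ler_sum => i _; exact: powR_tangent.
rewrite -(@ler_pM2l _ n)// mulrA.
have -> : S = n * m by rewrite /m; field; lra.
rewrite powRM// ?(ltW n0)//.
have nn : n * n `^ (q - 1) = n `^ q by rewrite mulr_powRB1 ?(ltW n0)//; lra.
rewrite nn mulrCA ler_wpM2l//; exact: powR_ge0.
Qed.

Lemma power_mean_abs (I : finType) (q : R) (x : I -> R) : 1 <= q ->
  `|\sum_i x i| `^ q <= #|I|%:R `^ (q - 1) * \sum_i `|x i| `^ q.
Proof.
move=> q1; apply: le_trans (power_mean x q1).
by apply: ler_pow => //; [lra|exact: ler_norm_sum].
Qed.

Lemma average_pow (I : finType) (q : R) (x : I -> R) : 1 <= q ->
  `|(\sum_i x i) / #|I|%:R| `^ q <= (\sum_i `|x i| `^ q) / #|I|%:R.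
Proof.
move=> q1.
have [I0|I0] := eqVneq #|I| 0%N.
  by rewrite I0 invr0 !mulr0 normr0 powR0//; lra.
have n0 : 0 < #|I|%:R :> R by rewrite ltr0n lt0n.
rewrite normrM powRM// normfV (gtr0_norm n0).
rewrite ler_pdivlMr//; set n : R := #|I|%:R in n0 *.
have nn : n^-1 `^ q * n = (n `^ (q - 1))^-1.
  have -> : n^-1 `^ q = (n `^ q)^-1.
    by rewrite -(powR_inv1 (ltW n0)) -powRrM -powRN; congr powR; ring.
  rewrite -(mulr_powRB1 (ltW n0)); last lra.
  by field; rewrite ?gt_eqF ?powR_gt0//.
rewrite -mulrA nn ler_pdivrMr ?powR_gt0// mulrC; exact: power_mean_abs.
Qed.

Lemma power_sum2 (q x y : R) : 1 <= q ->
  `|x + y| `^ q <= 2 `^ (q - 1) * (`|x| `^ q + `|y| `^ q).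
Proof.
move=> q1; have := power_mean_abs (fun b : bool => if b then x else y) q1.
by rewrite !big_bool/= card_bool.
Qed.

Lemma power_sum3 (q x y z : R) : 1 <= q ->
  `|x + y + z| `^ q <= 3 `^ (q - 1) * (`|x| `^ q + `|y| `^ q + `|z| `^ q).
Proof.
move=> q1; have := power_mean_abs (fun i : 'I_3 => nth 0 [:: x; y; z] i) q1.
by rewrite !big_ord_recl !big_ord0/= card_ord !addr0 !addrA.
Qed.

(** Two regimes: for T y^2 <= x^2 the first term on the right suffices, otherwise the second. [T]
    will be the number of steps of a martingale or of nonzero terms of a signed sum. *)
Lemma powR_interpolate (q x y T : R) : 2 <= q -> 1 <= T -> 0 <= x -> 0 <= y ->
  x `^ (q - 2) * y ^+ 2 <= x `^ q / T + T `^ (q / 2 - 1) * y `^ q.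
Proof.
move=> q2 T1 x0 y0; have T0 : 0 < T by lra.
have [h|h] := leP (y ^+ 2 * T) (x ^+ 2).
  have [x00|xn0] := eqVneq x 0.
    have -> : y = 0.
      apply/eqP; rewrite -sqrf_eq0 eq_le sqr_ge0 andbT.
      by move: h; rewrite x00 expr0n/= pmulr_lle0.
    by rewrite expr0n mulr0 addr_ge0// ?mulr_ge0// ?powR_ge0// invr_ge0 ltW.
  apply: (@le_trans _ _ (x `^ q / T)); last first.
    by rewrite lerDl mulr_ge0// powR_ge0.
  rewrite ler_pdivlMr// -mulrA.
  have -> : x `^ q = x `^ (q - 2) * x ^+ 2.
    rewrite -powR_mulrn// -powRD; first by congr powR; ring.
    by rewrite xn0 implybT.
  by rewrite ler_wpM2l// powR_ge0.
apply: (@le_trans _ _ (T `^ (q / 2 - 1) * y `^ q)); last first.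
  by rewrite lerDr mulr_ge0// ?powR_ge0// invr_ge0 ltW.
have yn0 : y != 0.
  apply/eqP => y00; move: h; rewrite y00 expr0n/= mul0r ltNge sqr_ge0//.
have -> : y `^ q = y `^ (q - 2) * y ^+ 2.
  rewrite -powR_mulrn// -powRD; first by congr powR; ring.
  by rewrite yn0 implybT.
rewrite mulrA ler_wpM2r ?sqr_ge0//.
have e z : 0 <= z -> z `^ (q - 2) = (z ^+ 2) `^ (q / 2 - 1).
  by move=> z0; rewrite -powR_mulrn// -powRrM; congr powR; field.
rewrite e// e// [leRHS]mulrC -powRM ?sqr_ge0//; last exact: ltW.
by apply: ler_pow; [lra|exact: sqr_ge0|exact: ltW].
Qed.

Lemma expR_quad (u : R) : `|u| <= 1 / 2 -> expR u <= 1 + u + 2 * u ^+ 2.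
Proof.
move=> /[dup] h; rewrite ler_norml => /andP[h1 h2].
have e1 : (1 - u) * expR u <= 1.
  have := ler_wpM2r (expR_ge0 u) (expR_ge1Dx (- u)).
  by rewrite -expRD addNr expR0.
have e2 : 0 < 1 - u by lra.
rewrite -(ler_pM2l e2); apply: (le_trans e1).
have -> : (1 - u) * (1 + u + 2 * u ^+ 2) = 1 + u ^+ 2 * (1 - 2 * u) by ring.
rewrite lerDl mulr_ge0 ?sqr_ge0//; lra.
Qed.

(** One step of a martingale. The coefficient [c] depends on [a] and not on [b], so the linear term
    averages out over increments of mean zero. The quadratic term |a|^(q-2) b^2 of the expansion is
    split by [powR_interpolate], at the cost of a factor 1 + C/T that stays bounded over T steps. *)
Lemma powR_two_point (q : R) : 2 <= q -> exists2 C : R, 0 < C &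
  forall T a, 1 <= T -> exists c : R, forall b,
    `|a + b| `^ q <= (1 + C / T) * `|a| `^ q + c * b
                     + C * T `^ (q / 2 - 1) * `|b| `^ q.
Proof.
move=> q2; have q0 : 0 < q by lra.
pose C1 : R := (2 * q + 1) `^ q + q * (2 * q) `^ (q - 1).
pose C : R := 2 * q ^+ 2 + C1.
have C10 : 0 < C1 by rewrite addr_gt0 ?mulr_gt0 ?powR_gt0//; lra.
have C0 : 0 < C by rewrite addr_gt0 ?mulr_gt0 ?exprn_gt0//; lra.
exists C => // T a T1; have T0 : 0 < T by lra.
exists (q * Num.sg a * `|a| `^ (q - 1)) => b.
have TT : 1 <= T `^ (q / 2 - 1) by rewrite -{1}(powRr0 T); apply: ler_powR; lra.
(* Below this threshold t = b/a satisfies |q t| <= 1/2, so that (1 + t)^q <= exp(q t) can be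
   expanded by [expR_quad]; above it |a| <= 2q |b| and the error terms are of order |b|^q. *)
have [hb|hb] := leP `|b| (`|a| / (2 * q)); last first.
  have ab : `|a| <= 2 * q * `|b|.
    by move: hb; rewrite ltr_pdivrMr ?mulr_gt0 ?ltr0n// mulrC => /ltW.
  have h1 : `|a + b| `^ q <= (2 * q + 1) `^ q * `|b| `^ q.
    rewrite -powRM//; last lra.
    apply: ler_pow => //; first lra.
    by apply: le_trans (ler_normD _ _) _; lra.
  have h2 : - (q * Num.sg a * `|a| `^ (q - 1) * b) <=
      q * (2 * q) `^ (q - 1) * `|b| `^ q.
    apply: le_trans (ler_norm _) _; rewrite normrN !normrM.
    rewrite (gtr0_norm q0) (ger0_norm (powR_ge0 _ _)) -!mulrA.
    apply: ler_wpM2l; first exact: ltW.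
    apply: (@le_trans _ _ (`|a| `^ (q - 1) * `|b|)).
      by rewrite ler_piMl// ?mulr_ge0 ?powR_ge0// normr_sg; case: (a != 0).
    have -> : `|b| `^ q = `|b| `^ (q - 1) * `|b| by rewrite mulrC mulr_powRB1.
    rewrite mulrA ler_wpM2r// -powRM//; last lra.
    by apply: ler_pow => //; lra.
  have h3 : 0 <= (1 + C / T) * `|a| `^ q.
    by rewrite mulr_ge0 ?powR_ge0// addr_ge0// divr_ge0// ltW.
  have h4 : C1 * `|b| `^ q <= C * T `^ (q / 2 - 1) * `|b| `^ q.
    rewrite ler_wpM2r ?powR_ge0//.
    apply: (@le_trans _ _ (C * 1)); last by rewrite ler_wpM2l// ltW.
    rewrite mulr1 /C lerDr mulr_ge0 ?sqr_ge0//.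
  move: h4; rewrite /C1 mulrDl; lra.
have [a0|an0] := eqVneq a 0.
  have -> : b = 0.
    by apply/eqP; rewrite -normr_le0; move: hb; rewrite a0 normr0 mul0r.
  rewrite a0 addr0 normr0 powR0; last lra.
  by rewrite !mulr0 !addr0.
have na0 : 0 < `|a| by rewrite normr_gt0.
pose t := b / a.
have bE : b = a * t by rewrite /t; field.
have ht : `|q * t| <= 1 / 2.
  rewrite normrM (gtr0_norm q0) /t normrM normfV.
  move: hb; rewrite ler_pdivlMr ?mulr_gt0 ?ltr0n// => hb.
  rewrite mulrA ler_pdivrMr//; lra.
have ht1 : 0 <= 1 + t.
  have : `|t| <= 1 / 2.
    move: ht; rewrite normrM (gtr0_norm q0) => ht; apply: le_trans ht.
    by rewrite ler_peMl//; lra.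
  by rewrite ler_norml => /andP[]; lra.
have h1 : `|a + b| `^ q <= `|a| `^ q * (1 + q * t + 2 * (q * t) ^+ 2).
  have -> : a + b = a * (1 + t) by rewrite bE; ring.
  rewrite normrM powRM// (ger0_norm ht1) ler_wpM2l ?powR_ge0//.
  apply: le_trans (expR_quad ht).
  rewrite mulrC expRM; apply: ler_pow => //; [lra|exact: expR_ge1Dx].
apply: (le_trans h1).
have h2 : `|a| `^ q * (q * t) = q * Num.sg a * `|a| `^ (q - 1) * b.
  rewrite -(@mulr_powRB1 R `|a| q)// bE.
  have -> : q * Num.sg a * `|a| `^ (q - 1) * (a * t) =
      q * (Num.sg a * a) * `|a| `^ (q - 1) * t by ring.
  by rewrite -normrEsg; ring.
have h3 : `|a| `^ q * t ^+ 2 = `|a| `^ (q - 2) * `|b| ^+ 2.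
  have -> : `|a| `^ q = `|a| `^ (q - 2) * `|a| ^+ 2.
    rewrite -powR_mulrn// -powRD; first by congr powR; ring.
    by rewrite normr_eq0 an0 implybT.
  rewrite !real_normK ?num_real// bE; ring.
have h4 := powR_interpolate q2 T1 (normr_ge0 a) (normr_ge0 b).
have h5 : C * (`|a| `^ (q - 2) * `|b| ^+ 2) <=
    C / T * `|a| `^ q + C * T `^ (q / 2 - 1) * `|b| `^ q.
  have := ler_wpM2l (ltW C0) h4; rewrite mulrDr; lra.
have h6 : 2 * q ^+ 2 * (`|a| `^ (q - 2) * `|b| ^+ 2) <=
    C * (`|a| `^ (q - 2) * `|b| ^+ 2).
  rewrite ler_wpM2r ?mulr_ge0 ?powR_ge0 ?sqr_ge0// /C; lra.
rewrite !mulrDr mulr1 h2.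
have -> : `|a| `^ q * (2 * (q * t) ^+ 2) = 2 * q ^+ 2 * (`|a| `^ q * t ^+ 2) by ring.
rewrite h3; lra.
Qed.

Lemma iter_growth (C : R) (n k : nat) : 0 <= C -> (0 < n)%N -> (k <= n)%N ->
  (1 + C / n%:R) ^+ k <= expR C.
Proof.
move=> C0 n0 kn.
have h : 1 + C / n%:R <= expR (C / n%:R) by exact: expR_ge1Dx.
have nR : 0 < n%:R :> R by rewrite ltr0n.
apply: (@le_trans _ _ (expR (C / n%:R) ^+ k)).
  by rewrite lerXn2r// nnegrE ?expR_ge0// addr_ge0// divr_ge0// ltW.
rewrite -expRM_natl ler_expR mulrA ler_pdivrMr// mulrC ler_wpM2l// ler_nat//.
Qed.

End RealInequalities.

Lemma sum_cst (R : realType) (I : finType) (c : R) : \sum_(i : I) c = #|I|%:R * c.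
Proof. by rewrite sumr_const mulr_natl. Qed.

(** * Sums over words of fixed length *)

Section Words.
Context {A : finType} {R : realType}.

Fixpoint words (n : nat) : seq (seq A) :=
  if n is n'.+1 then [seq s :: w | s <- enum A, w <- words n'] else [:: [::]].

Lemma sum_words0 (F : seq A -> R) : \sum_(w <- words 0) F w = F [::].
Proof. by rewrite /= big_seq1. Qed.

Lemma sum_wordsS n (F : seq A -> R) :
  \sum_(w <- words n.+1) F w = \sum_s \sum_(w <- words n) F (s :: w).
Proof. by rewrite /= big_allpairs_dep big_enum. Qed.

Lemma sum_words_rcons n (F : seq A -> R) :
  \sum_(w <- words n.+1) F w = \sum_(w <- words n) \sum_s F (rcons w s).
Proof.
elim: n F => [|n IH] F.
  by rewrite sum_wordsS sum_words0; apply: eq_bigr => s _; rewrite sum_words0.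
rewrite sum_wordsS sum_wordsS; apply: eq_bigr => s _.
by rewrite (IH (fun w => F (s :: w))).
Qed.

Lemma sum_words_rev n (F : seq A -> R) :
  \sum_(w <- words n) F (rev w) = \sum_(w <- words n) F w.
Proof.
elim: n F => [|n IH] F; first by rewrite !sum_words0.
rewrite sum_wordsS sum_words_rcons [RHS]exchange_big/=.
apply: eq_bigr => s _; rewrite -(IH (fun w => F (rcons w s))).
by apply: eq_bigr => w _; rewrite rev_cons.
Qed.

Lemma sum_words_map n (h : A -> A) (F : seq A -> R) : injective h ->
  \sum_(w <- words n) F (map h w) = \sum_(w <- words n) F w.
Proof.
move=> hi; elim: n F => [|n IH] F; first by rewrite !sum_words0.
rewrite !sum_wordsS [RHS](reindex_inj hi)/=; apply: eq_bigr => s _.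
by rewrite (IH (fun w => F (h s :: w))).
Qed.

Lemma size_words n : (size (words n))%:R = #|A|%:R ^+ n :> R.
Proof.
elim: n => [|n IH]; first by rewrite expr0.
by rewrite /= size_allpairs natrM IH exprS cardE.
Qed.

Lemma eq_sum_words n (F G : seq A -> R) : (forall w, size w = n -> F w = G w) ->
  \sum_(w <- words n) F w = \sum_(w <- words n) G w.
Proof.
elim: n F G => [|n IH] F G h; first by rewrite !sum_words0 h.
rewrite !sum_wordsS; apply: eq_bigr => s _; apply: IH => w sw.
by apply: h; rewrite /= sw.
Qed.

Lemma sum_words_cst n (c : R) : \sum_(w <- words n) c = #|A|%:R ^+ n * c.
Proof. rewrite -size_words big_const_seq count_predT iter_addr addr0 mulr_natl//. Qed.

End Words.

(** * Markov type for stationary reversible walks *)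

Section MarkovType.
Context {R : realType} {X A : finType} (act : A -> X -> X) (inv : A -> A).
Hypothesis actK : forall s, cancel (act s) (act (inv s)).
Hypothesis invK : involutive inv.
Context (q : R) (q2 : 2 <= q) (a0 : (0 < #|A|)%N).
Implicit Types (z : X) (w : seq A).

Let N : R := #|A|%:R.
Let N0 : 0 < N. Proof. by rewrite ltr0n. Qed.

Definition run z w : X := foldl (fun z s => act s z) z w.

Lemma act_inj s : injective (act s).
Proof. exact: can_inj (actK s). Qed.

Lemma run_inj w : injective (run^~ w).
Proof.
by elim: w => [|s w IH] x y //= /IH /act_inj.
Qed.

Lemma sum_act s (F : X -> R) : \sum_z F (act s z) = \sum_z F z.
Proof. by rewrite [RHS](reindex_inj (@act_inj s)). Qed.

Lemma sum_run w (F : X -> R) : \sum_z F (run z w) = \sum_z F z.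
Proof. by rewrite [RHS](reindex_inj (@run_inj w)). Qed.

Context (f : X -> R).

(* Along a stationary reversible walk the displacement of f after 2n steps is the
   difference of two martingales: one reads every second step forwards, the
   other one backwards. *)
Definition avg z : R := (\sum_s f (act s z)) / N.

Fixpoint fwd z w : R :=
  if w is s1 :: s2 :: w' then
    f (act s2 (act s1 z)) - avg (act s1 z) + fwd (act s2 (act s1 z)) w'
  else 0.

Fixpoint bwd z w : R :=
  if w is s1 :: s2 :: w' then
    f z - avg (act s1 z) + bwd (act s2 (act s1 z)) w'
  else 0.

Lemma fwd_bwd n z w : size w = n.*2 -> f (run z w) - f z = fwd z w - bwd z w.
Proof.
elim: n z w => [|n IH] z [|s1 [|s2 w]] //=; first by rewrite !subrr.
rewrite doubleS => -[/IH {}IH]; rewrite -/(run _ w).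
have := IH (act s2 (act s1 z)); lra.
Qed.

Lemma fwd_cat2 n z w s1 s2 : size w = n.*2 ->
  fwd z (w ++ [:: s1; s2]) =
  fwd z w + (f (act s2 (act s1 (run z w))) - avg (act s1 (run z w))).
Proof.
elim: n z w => [|n IH] z [|t1 [|t2 w]] //=; first by rewrite add0r addr0.
by rewrite doubleS => -[/IH ->]; rewrite addrA.
Qed.

Definition opp_word w := rev (map inv w).

Lemma run_cat z w1 w2 : run z (w1 ++ w2) = run (run z w1) w2.
Proof. by rewrite /run foldl_cat. Qed.

Lemma run_opp z w : run (run z w) (opp_word w) = z.
Proof.
elim: w z => [|s w IH] z //=.
rewrite /opp_word /= rev_cons -cats1 run_cat -/(run _ w) -/(opp_word w) IH/=.
exact: actK.
Qed.

(** Reversibility: along the inverse word the walk retraces its path, and the backward martingale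
    becomes the forward one started at the end point. *)
Lemma bwd_opp n z w : size w = n.*2 -> fwd (run z w) (opp_word w) = bwd z w.
Proof.
elim: n z w => [|n IH] z [|s1 [|s2 w]] //=.
rewrite doubleS => -[sw].
rewrite /opp_word /= !rev_cons -!cats1 -catA/= -/(run _ w) -/(opp_word w).
rewrite (@fwd_cat2 n) ?size_rev ?size_map// IH// run_opp actK actK; lra.
Qed.

(** Stationarity: for a fixed word the end point is uniform when [z] is, and inverting and reversing
    permutes the words of a given length. *)
Lemma sum_fwd_bwd n (F : R -> R) :
  \sum_z \sum_(w <- words n.*2) F (bwd z w) =
  \sum_z \sum_(w <- words n.*2) F (fwd z w).
Proof.
transitivity (\sum_z \sum_(w <- words n.*2) F (fwd (run z w) (opp_word w))).
  apply: eq_bigr => z _; apply: eq_sum_words => w sw.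
  by rewrite (@bwd_opp n).
rewrite [LHS]exchange_big [RHS]exchange_big/=.
transitivity (\sum_(w <- words n.*2) \sum_z F (fwd z (opp_word w))).
  by apply: eq_bigr => w _; rewrite (sum_run w (fun z => F (fwd z (opp_word w)))).
rewrite /opp_word (sum_words_map _ (fun w => \sum_z F (fwd z (rev w)))); last first.
  exact: can_inj invK.
by rewrite (sum_words_rev _ (fun w => \sum_z F (fwd z w))).
Qed.

Let incr z s1 s2 : R := f (act s2 (act s1 z)) - avg (act s1 z).

Lemma sum_incr z s1 : \sum_s2 incr z s1 s2 = 0.
Proof.
rewrite /incr sumrB sumr_const /avg -mulr_natl -/N.
by rewrite mulrC divfK ?subrr// gt_eqF.
Qed.

Context (C : R) (C0 : 0 < C).
Hypothesis HC : forall T a : R, 1 <= T -> exists c : R, forall b,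
    `|a + b| `^ q <= (1 + C / T) * `|a| `^ q + c * b
                     + C * T `^ (q / 2 - 1) * `|b| `^ q.

(** Iterates [powR_two_point] with [T] the number of steps: the linear terms vanish by [sum_incr],
    the factor (1 + C/T)^T stays below exp C, and T errors of size T^(q/2 - 1) add up to T^(q/2). *)
Lemma fwd_moment (T : nat) : (0 < T)%N ->
  \sum_z \sum_(w <- words T.*2) `|fwd z w| `^ q <=
  expR C * C * T%:R `^ (q / 2) * N ^+ T.*2 *
    ((\sum_z \sum_s1 \sum_s2 `|incr z s1 s2| `^ q) / N ^+ 2).
Proof.
move=> T0; have T1 : 1 <= T%:R :> R by rewrite ler1n.
pose E := C * T%:R `^ (q / 2 - 1).
have E0 : 0 <= E by rewrite mulr_ge0 ?powR_ge0 ?ltW.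
pose g z := (\sum_s1 \sum_s2 `|incr z s1 s2| `^ q) / N ^+ 2.
have g0 z : 0 <= g z.
  by rewrite divr_ge0 ?exprn_ge0 ?(ltW N0)//; do 2!apply: sumr_ge0 => ? _; exact: powR_ge0.
pose B := 1 + C / T%:R.
have B1 : 1 <= B by rewrite /B lerDl divr_ge0 ?ltW// ltr0n.
(* The accumulated error [h] depends on the starting point; only its sum over [z] is controlled,
   because each step of the walk preserves such sums. The offset [y] is the part of the martingale
   already read. *)
have key n : exists h : X -> R, [/\ forall z, 0 <= h z,
    \sum_z h z <= n%:R * (E * \sum_z g z) &
    forall z y, \sum_(w <- words n.*2) `|y + fwd z w| `^ q <=
      N ^+ n.*2 * (B ^+ n * (`|y| `^ q + h z))].
  elim: n => [|n [h [h0 hs hh]]].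
    exists (fun=> 0); split => //.
      by rewrite big1// mul0r.
    by move=> z y; rewrite double0 sum_words0/= !addr0 !expr0 !mul1r.
  pose h' z := E * g z + (\sum_s1 \sum_s2 h (act s2 (act s1 z))) / N ^+ 2.
  exists h'; split.
  - move=> z; apply: addr_ge0; first by rewrite mulr_ge0.
    apply: divr_ge0; last by rewrite exprn_ge0// ltW.
    by do 2!apply: sumr_ge0 => ? _.
  - rewrite big_split/= -mulr_sumr -[n.+1]addn1 natrD mulrDl mul1r addrC.
    apply: lerD => //; apply: le_trans hs; rewrite -mulr_suml.
    rewrite exchange_big/=.
    under eq_bigr => s1 _.
      rewrite exchange_big/=.
      under eq_bigr => s2 _.
        rewrite (sum_act s1 (fun z => h (act s2 z))) (sum_act s2).
        over.
      over.
    rewrite /= !sum_cst -/N mulrA -expr2 mulrAC divff ?mul1r//.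
    by rewrite expf_neq0// gt_eqF.
  - move=> z y; rewrite doubleS sum_wordsS.
    under eq_bigr => s1 _ do rewrite sum_wordsS.
    have [c Hc] := @HC T%:R y T1.
    apply: (@le_trans _ _ (\sum_s1 \sum_s2 N ^+ n.*2 * (B ^+ n *
        ((B * `|y| `^ q + c * incr z s1 s2 + E * `|incr z s1 s2| `^ q)
        + B * h (act s2 (act s1 z)))))).
      apply: ler_sum => s1 _; apply: ler_sum => s2 _.
      under eq_bigr => w _ do rewrite /= addrA.
      apply: (le_trans (hh _ _)).
      rewrite ler_wpM2l ?exprn_ge0 ?(ltW N0)// ler_wpM2l ?exprn_ge0//; first lra.
      apply: lerD; first exact: Hc.
      by rewrite ler_peMl.
    under eq_bigr => s1 _.
      rewrite -mulr_sumr -mulr_sumr !big_split/= -!mulr_sumr sum_incr mulr0 addr0.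
      rewrite sumr_const -[_ *+ _]mulr_natl -/N.
      over.
    rewrite -mulr_sumr -mulr_sumr !big_split/= -!mulr_sumr.
    rewrite sumr_const -[_ *+ _]mulr_natl -/N.
    have -> : \sum_s1 \sum_s2 `|incr z s1 s2| `^ q = N ^+ 2 * g z.
      by rewrite /g; field; rewrite gt_eqF.
    rewrite /h'; set S := \sum_i \sum_i0 h _.
    rewrite -subr_ge0 !exprS.
    set NN := N ^+ n.*2; set BB := B ^+ n; set Y := `|y| `^ q; set G := g z.
    rewrite [X in 0 <= X](_ : _ =
       N ^+ 2 * NN * BB * (B - 1) * (E * G)); last first.
      by rewrite expr0; field; rewrite gt_eqF.
    have b0 : 0 <= B by lra.
    have nn0 : 0 <= N by exact: ltW.
    apply: mulr_ge0; last by apply: mulr_ge0 => //; exact: g0.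
    apply: mulr_ge0; last by rewrite subr_ge0.
    by apply: mulr_ge0; [apply: mulr_ge0|]; apply: exprn_ge0.
have [h [h0 hs hh]] := key T.
apply: (@le_trans _ _ (\sum_z N ^+ T.*2 * (B ^+ T * h z))).
  apply: ler_sum => z _; have := hh z 0.
  rewrite normr0 powR0 ?add0r; last by rewrite gt_eqF// (lt_le_trans _ q2).
  by under eq_bigr => w _ do rewrite add0r.
rewrite -!mulr_sumr.
have -> : (\sum_z \sum_s1 \sum_s2 `|incr z s1 s2| `^ q) / N ^+ 2 = \sum_z g z.
  by rewrite mulr_suml.
have G0 : 0 <= \sum_z g z by apply: sumr_ge0.
rewrite [leRHS](_ : _ = N ^+ T.*2 * (expR C * (T%:R * (E * \sum_z g z)))); last first.
  rewrite /E -(@mulr_powRB1 R T%:R (q / 2)) ?ler0n//; last by rewrite divr_gt0 ?(lt_le_trans _ q2).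
  ring.
rewrite ler_wpM2l ?exprn_ge0 ?(ltW N0)//.
apply: ler_pM => //; first by rewrite exprn_ge0// (le_trans _ B1).
  by apply: sumr_ge0.
by apply: iter_growth => //; exact: ltW.
Qed.

(** The first letter is absorbed by stationarity; then [avg z] is compared with [f z] by
    convexity. *)
Lemma incr_le : \sum_z \sum_s1 \sum_s2 `|incr z s1 s2| `^ q <=
  2 `^ q * N * \sum_z \sum_s `|f (act s z) - f z| `^ q.
Proof.
have q1 : 1 <= q by apply: le_trans q2; rewrite ler1n.
pose D := \sum_z \sum_s `|f (act s z) - f z| `^ q.
have -> : \sum_z \sum_s1 \sum_s2 `|incr z s1 s2| `^ q =
   N * \sum_z \sum_s `|f (act s z) - avg z| `^ q.
  rewrite exchange_big/=.
  rewrite (eq_bigr (fun=> \sum_z \sum_s `|f (act s z) - avg z| `^ q)); last first.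
    by move=> s1 _; rewrite (sum_act s1 (fun z => \sum_s `|f (act s z) - avg z| `^ q)).
  by rewrite sumr_const -mulr_natl.
rewrite [leRHS](_ : _ = N * (2 `^ q * D)); last by rewrite /D; ring.
rewrite ler_wpM2l ?(ltW N0)//.
rewrite /D mulr_sumr; apply: ler_sum => z _.
pose d s := f (act s z) - f z.
have aE : avg z - f z = (\sum_s d s) / N.
  rewrite /avg /d sumrB sumr_const -mulr_natl -/N mulrBl; congr (_ - _).
  by field; rewrite gt_eqF.
have h s : `|f (act s z) - avg z| `^ q <=
   2 `^ (q - 1) * (`|d s| `^ q + (\sum_s' `|d s'| `^ q) / N).
  have -> : f (act s z) - avg z = d s + (- ((\sum_s' d s') / N)).
    by rewrite -aE /d; ring.
  apply: le_trans (power_sum2 _ _ q1) _.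
  rewrite ler_wpM2l ?powR_ge0// lerD2l normrN.
  exact: average_pow.
apply: le_trans (ler_sum _ (fun s _ => h s)) _.
rewrite -mulr_sumr big_split/= sum_cst -/N.
rewrite (_ : N * _ = \sum_s `|d s| `^ q); last by field; rewrite gt_eqF.
rewrite [leRHS](_ : _ = 2 `^ (q - 1) * (2 * \sum_s `|d s| `^ q)).
  by rewrite [2 * _]mulr_natl mulr2n.
rewrite -(@mulr_powRB1 R 2 q) ?ler0n//; [rewrite /d; ring|exact: lt_le_trans q1].
Qed.

Lemma markov_type_aux (T : nat) : (0 < T)%N ->
  \sum_z \sum_(w <- words T.*2) `|f (run z w) - f z| `^ q <=
  2 `^ (q - 1) * 2 * (expR C * C) * 2 `^ q * T%:R `^ (q / 2) * N ^+ T.*2 *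
    ((\sum_z \sum_s `|f (act s z) - f z| `^ q) / N).
Proof.
have q1 : 1 <= q by apply: le_trans q2; rewrite ler1n.
move=> T0; have := fwd_moment T0; set F := \sum_z \sum_(w <- _) `|fwd z w| `^ q => FH.
have BH : \sum_z \sum_(w <- words T.*2) `|bwd z w| `^ q = F.
  exact: (sum_fwd_bwd T (fun x => `|x| `^ q)).
apply: (@le_trans _ _ (2 `^ (q - 1) * (2 * F))).
  apply: (@le_trans _ _ (2 `^ (q - 1) * (F + F))); last first.
    by rewrite [2 * F]mulr_natl mulr2n.
  rewrite -{2}BH /F -big_split/= mulr_sumr; apply: ler_sum => z _.
  rewrite -big_split/= mulr_sumr.
  rewrite (@eq_sum_words _ _ _ _ (fun w => `|fwd z w - bwd z w| `^ q)); last first.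
    by move=> w sw; rewrite (@fwd_bwd T).
  apply: ler_sum => w _.
  by have := power_sum2 (fwd z w) (- bwd z w) q1; rewrite normrN.
rewrite -!mulrA ler_wpM2l ?powR_ge0// ler_wpM2l//.
apply: (le_trans FH).
rewrite -!mulrA ler_wpM2l ?expR_ge0// ler_wpM2l ?(ltW C0)//.
set S := \sum_z \sum_s1 \sum_s2 _.
rewrite [leRHS](_ : _ = T%:R `^ (q / 2) * (N ^+ T.*2 *
   ((2 `^ q * N * \sum_z \sum_s `|f (act s z) - f z| `^ q) / N ^+ 2))); last first.
  by field; rewrite gt_eqF.
do 2!rewrite ler_wpM2l ?powR_ge0 ?exprn_ge0 ?(ltW N0)//.
rewrite ler_wpM2r ?invr_ge0 ?exprn_ge0 ?(ltW N0)//; exact: incr_le.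
Qed.

End MarkovType.

Lemma markov_type (R : realType) (q : R) : 2 <= q -> exists2 C : R, 0 < C &
  forall (X A : finType) (act : A -> X -> X) (inv : A -> A),
  (forall s, cancel (act s) (act (inv s))) -> involutive inv -> (0 < #|A|)%N ->
  forall (f : X -> R) (T : nat), (0 < T)%N ->
  \sum_z \sum_(w <- words T.*2) `|f (run act z w) - f z| `^ q <=
  C * T%:R `^ (q / 2) * #|A|%:R ^+ T.*2 *
    ((\sum_z \sum_s `|f (act s z) - f z| `^ q) / #|A|%:R).
Proof.
move=> q2; have [C C0 HC] := powR_two_point q2.
exists (2 `^ (q - 1) * 2 * (expR C * C) * 2 `^ q).
  by rewrite !mulr_gt0 ?powR_gt0 ?expR_gt0.
by move=> X A act inv actK invK a0 f T T0; exact: (@markov_type_aux R X A act inv).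
Qed.

(** * A cotype inequality for signed sums in a finite abelian group *)

Section Cotype.
Context {R : realType} {V : finZmodType} (K : nat) (u : 'I_K -> V).
Implicit Types (e : {ffun 'I_K -> bool}) (x : V) (f : V -> R) (j : 'I_K).

Definition sgnv (V' : zmodType) (b : bool) (v : V') : V' := if b then v else - v.

Local Notation signs := {ffun 'I_K -> bool}.
Local Notation N := (#|{: signs}|%:R : R).
Let N0 : 0 < N. Proof. by rewrite ltr0n card_ffun card_bool expn_gt0. Qed.

Definition flip j e : signs := [ffun i => if i == j then ~~ e i else e i].

Lemma flipK j : involutive (flip j).
Proof.
move=> e; apply/ffunP => i; rewrite !ffunE; case: eqP => // _; exact: negbK.
Qed.

Lemma sum_flip j (F : signs -> R) : \sum_(e : signs) F (flip j e) = \sum_(e : signs) F e.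
Proof. by rewrite [RHS](reindex_inj (can_inj (flipK j))). Qed.

Definition shift e : V := \sum_i sgnv (e i) (u i).
Definition shift_but j e : V := \sum_(i | i != j) sgnv (e i) (u i).

Lemma shiftE j e : shift e = sgnv (e j) (u j) + shift_but j e.
Proof. by rewrite /shift (bigD1 j). Qed.

Lemma shift_but_flip j e : shift_but j (flip j e) = shift_but j e.
Proof. by apply: eq_bigr => i ij; rewrite ffunE (negbTE ij). Qed.

Definition sgnr (b : bool) : R := if b then 1 else -1.

Lemma sgnrN b : sgnr (~~ b) = - sgnr b.
Proof. by case: b => /=; rewrite ?opprK. Qed.

Lemma sgnr_sqr b : sgnr b * sgnr b = 1.
Proof. by case: b => /=; rewrite ?mulrNN mulr1. Qed.

Lemma sum_sgnr i j : \sum_(e : signs) sgnr (e i) * sgnr (e j) = (i == j)%:R * N.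
Proof.
case: eqVneq => [->|ij].
  by under eq_bigr do rewrite sgnr_sqr; rewrite sum_cst mul1r mulr1.
rewrite mul0r; set S := \sum_(e : signs) _.
suff : S = - S by lra.
rewrite {1}/S -(sum_flip i) /S -sumrN; apply: eq_bigr => e _.
by rewrite !ffunE eqxx eq_sym (negbTE ij) sgnrN mulNr.
Qed.

Lemma sum_sgnr1 j : \sum_(e : signs) sgnr (e j) = 0.
Proof.
set S := \sum_(e : signs) _; suff : S = - S by lra.
rewrite {1}/S -(sum_flip j) /S -sumrN; apply: eq_bigr => e _.
by rewrite !ffunE eqxx sgnrN.
Qed.

Definition rad (G : signs -> R) j : R := (\sum_(e : signs) sgnr (e j) * G e) / N.

(** The functions [sgnr (e j)] are orthonormal for the average over [e], and the sum of squares of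
    [G] minus its projection is nonnegative. *)
Lemma bessel (G : signs -> R) : \sum_j rad G j ^+ 2 <= (\sum_(e : signs) G e ^+ 2) / N.
Proof.
have radE j : \sum_(e : signs) sgnr (e j) * G e = N * rad G j.
  by rewrite /rad; field; rewrite gt_eqF.
rewrite ler_pdivlMr//.
have : 0 <= \sum_(e : signs) (G e - \sum_j rad G j * sgnr (e j)) ^+ 2.
  by apply: sumr_ge0 => e _; exact: sqr_ge0.
under eq_bigr => e _ do rewrite sqrrB.
rewrite big_split/= sumrB.
have -> : \sum_(e : signs) G e * (\sum_j rad G j * sgnr (e j)) *+ 2 =
    2 * (N * \sum_j rad G j ^+ 2).
  under eq_bigr => e _ do rewrite -mulr_natl mulr_sumr.
  rewrite -[LHS]mulr_sumr exchange_big/= [in RHS]mulr_sumr; congr (_ * _); apply: eq_bigr => j _.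
  rewrite (eq_bigr (fun e : signs => rad G j * (sgnr (e j) * G e))); last first.
    by move=> e _; ring.
  by rewrite -mulr_sumr radE; ring.
have -> : \sum_(e : signs) (\sum_j rad G j * sgnr (e j)) ^+ 2 = N * \sum_j rad G j ^+ 2.
  under eq_bigr => e _ do rewrite expr2 mulr_suml.
  rewrite exchange_big/= mulr_sumr; apply: eq_bigr => i _.
  under eq_bigr => e _ do rewrite mulr_sumr.
  rewrite exchange_big/= (bigD1 i)//= [X in _ + X]big1 ?addr0; last first.
    move=> j ji; rewrite (eq_bigr (fun e : signs =>
      (rad G i * rad G j) * (sgnr (e i) * sgnr (e j)))); last first.
      by move=> e _; ring.
    by rewrite -mulr_sumr sum_sgnr eq_sym (negbTE ji) mul0r mulr0.
  rewrite (eq_bigr (fun e : signs =>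
      (rad G i * rad G i) * (sgnr (e i) * sgnr (e i)))); last first.
    by move=> e _; ring.
  by rewrite -mulr_sumr sum_sgnr eqxx mul1r mulrC expr2.
lra.
Qed.

(** For q >= 2 the l_q norm of the coefficients is at most their l_2 norm, which Bessel's inequality
    bounds by the L_2 norm, hence by the L_q norm, of [G]. *)
Lemma bessel_pow (q : R) (G : signs -> R) : 2 <= q ->
  \sum_j `|rad G j| `^ q <= (\sum_(e : signs) `|G e| `^ q) / N.
Proof.
move=> q2; have q0 : 0 <= q / 2 by lra.
have q1 : 1 <= q / 2 by lra.
have pw (y : R) : `|y| `^ q = (y ^+ 2) `^ (q / 2).
  rewrite -(real_normK (num_real y)) -powR_mulrn// -powRrM.
  by congr powR; field.
set B := \sum_j rad G j ^+ 2.
have B0 : 0 <= B by apply: sumr_ge0 => j _; exact: sqr_ge0.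
apply: (@le_trans _ _ (B `^ (q / 2))).
  have [B00|Bn0] := eqVneq B 0.
    have z j : rad G j = 0.
      apply/eqP; rewrite -sqrf_eq0 eq_le sqr_ge0 andbT -B00 /B (bigD1 j)//=.
      by rewrite lerDl sumr_ge0// => i _; exact: sqr_ge0.
    rewrite big1 ?powR_ge0// => j _; rewrite z normr0 powR0//; lra.
  have -> : B `^ (q / 2) = \sum_j rad G j ^+ 2 * B `^ (q / 2 - 1).
    by rewrite -mulr_suml mulr_powRB1//; lra.
  apply: ler_sum => j _; rewrite pw -(mulr_powRB1 (sqr_ge0 _)); last lra.
  rewrite ler_wpM2l ?sqr_ge0//; apply: ler_pow; [lra|exact: sqr_ge0|].
  rewrite /B (bigD1 j)//= lerDl sumr_ge0// => i _; exact: sqr_ge0.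
apply: (@le_trans _ _ (((\sum_(e : signs) G e ^+ 2) / N) `^ (q / 2))).
  by apply: ler_pow => //; exact: bessel.
have := @average_pow R {: signs} (q / 2) (fun e => G e ^+ 2) q1.
rewrite  ger0_norm; last first.
  by rewrite divr_ge0 ?(ltW N0)// sumr_ge0// => e _; exact: sqr_ge0.
move=> /le_trans; apply; rewrite ler_wpM2r ?invr_ge0 ?(ltW N0)//.
by apply: ler_sum => e _; rewrite ger0_norm ?sqr_ge0// pw.
Qed.

(* The cotype inequality: f is averaged over all signs but the j-th one; the
   differences of this average in the direction u j are, after averaging, the
   Rademacher coefficients of the increments of f, so Bessel's inequality bounds
   the sum over j of their squares. *)
Definition smooth f j x : R := (\sum_(e : signs) f (x + shift_but j e)) / N.

Lemma smooth_diff f j x :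
  smooth f j (x + u j) - smooth f j (x - u j) =
  2 * rad (fun e => f (x + shift e) - f x) j.
Proof.
have -> : rad (fun e => f (x + shift e) - f x) j = rad (fun e => f (x + shift e)) j.
  rewrite /rad; congr (_ / _).
  under eq_bigr do rewrite mulrBr.
  by rewrite sumrB -mulr_suml sum_sgnr1 mul0r subr0.
rewrite /smooth /rad -mulrBl mulrA; congr (_ / _).
rewrite mulr_natl mulr2n -[X in _ = _ + X](sum_flip j) -big_split/= -sumrB.
apply: eq_bigr => e _; rewrite !(shiftE j) shift_but_flip !ffunE eqxx !addrA.
by case: (e j) => /=; rewrite ?opprK; ring.
Qed.

Context (q : R) (q2 : 2 <= q) (f : V -> R).

Local Notation W := ((\sum_x \sum_(e : signs) `|f (x + shift e) - f x| `^ q) / N).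

Lemma sum_transl (y : V) (F : V -> R) : \sum_x F (x + y) = \sum_x F x.
Proof. by rewrite [RHS](reindex_inj (addIr y)). Qed.

(** The point [x + u j + shift_but j e] is x shifted by [e] with its j-th sign made positive, so the
    error averages increments of [f] along [shift]. Keeping the terms of both [e] and [flip j e]
    gives the 2. *)
Lemma smooth_error j :
  \sum_x `|smooth f j (x + u j) - f x| `^ q <= 2 * W.
Proof.
have q1 : 1 <= q by apply: le_trans q2; rewrite ler1n.
rewrite mulr_suml mulr_sumr; apply: ler_sum => x _.
have -> : smooth f j (x + u j) - f x =
    (\sum_(e : signs) (f (x + u j + shift_but j e) - f x)) / N.
  rewrite /smooth sumrB sum_cst  mulrBl; congr (_ - _).
  by field; rewrite gt_eqF.
apply: le_trans (average_pow _ q1) _; rewrite  mulrA.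
rewrite ler_wpM2r ?invr_ge0 ?(ltW N0)//.
pose H e := `|f (x + shift e) - f x| `^ q.
apply: (@le_trans _ _ (\sum_(e : signs) (H e + H (flip j e)))).
  apply: ler_sum => e _; rewrite /H !(shiftE j) shift_but_flip ffunE eqxx.
  case: (e j) => /=; rewrite !addrA.
    by rewrite lerDl powR_ge0.
  by rewrite lerDr powR_ge0.
by rewrite big_split/= sum_flip [2 * _]mulr_natl mulr2n.
Qed.

(** The step from x + (2t+1) u_j to x + (2t+3) u_j is [smooth_diff] centred at x + (2t+2) u_j. *)
Lemma smooth_move j (M : nat) x :
  smooth f j (x + u j *+ M.*2 + u j) - smooth f j (x + u j) =
  \sum_(t < M) 2 * rad (fun e => f (x + u j *+ t.*2.+2 + shift e)
                             - f (x + u j *+ t.*2.+2)) j.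
Proof.
elim: M => [|M IH]; first by rewrite big_ord0 mulr0n addr0 subrr.
rewrite big_ord_recr/= -IH -smooth_diff.
have -> : x + u j *+ M.*2.+2 - u j = x + u j *+ M.*2 + u j.
  by rewrite mulrS mulrSr !addrA addrK addrAC.
rewrite doubleS; ring.
Qed.

Lemma smooth_moves (M : nat) :
  \sum_j \sum_x `|smooth f j (x + u j *+ M.*2 + u j) - smooth f j (x + u j)| `^ q
  <= M%:R `^ q * 2 `^ q * W.
Proof.
have q1 : 1 <= q by apply: le_trans q2; rewrite ler1n.
pose r x j := rad (fun e => f (x + shift e) - f x) j.
apply: (@le_trans _ _ (\sum_j \sum_x M%:R `^ (q - 1) *
    \sum_(t < M) 2 `^ q * `|r (x + u j *+ t.*2.+2) j| `^ q)).
  apply: ler_sum => j _; apply: ler_sum => x _; rewrite smooth_move.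
  apply: le_trans (power_mean_abs _ q1) _.
  rewrite card_ord ler_wpM2l ?powR_ge0//; apply: ler_sum => t _.
  by rewrite normrM powRM// ger0_norm.
under eq_bigr => j _.
  rewrite -mulr_sumr exchange_big/=.
  under eq_bigr => t _.
    rewrite -mulr_sumr (sum_transl (u j *+ t.*2.+2) (fun x => `|r x j| `^ q)).
    over.
  rewrite /= sum_cst card_ord.
  over.
rewrite -mulr_sumr -mulr_sumr -mulr_sumr exchange_big/=.
have -> : M%:R `^ q = M%:R `^ (q - 1) * M%:R.
  by rewrite mulrC mulr_powRB1//; apply: lt_le_trans q2.
rewrite -!mulrA !ler_wpM2l ?powR_ge0//.
rewrite mulr_suml; apply: ler_sum => x _; exact: bessel_pow.
Qed.

(** The path from x to x + 2M u_j goes through the averages at x + u_j and x + (2M+1) u_j: its two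
    ends cost 2W for each of the K coordinates, its middle part is of order M^q W in total by
    Bessel. For M^q <= K a coordinate thus costs on average a constant times W. *)
Lemma cotype_ge2 (M : nat) :
  \sum_j \sum_x `|f (x + u j *+ M.*2) - f x| `^ q <=
  3 `^ q * (4 * K%:R + 2 `^ q * M%:R `^ q) * W.
Proof.
have q1 : 1 <= q by apply: le_trans q2; rewrite ler1n.
have W0 : 0 <= W.
  rewrite divr_ge0 ?(ltW N0)//.
  by do 2!apply: sumr_ge0 => ? _; exact: powR_ge0.
pose S := smooth f.
apply: (@le_trans _ _ (\sum_j \sum_x 3 `^ (q - 1) * (
    `|S j (x + u j *+ M.*2 + u j) - f (x + u j *+ M.*2)| `^ q +
    `|S j (x + u j *+ M.*2 + u j) - S j (x + u j)| `^ q +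
    `|S j (x + u j) - f x| `^ q))).
  apply: ler_sum => j _; apply: ler_sum => x _.
  rewrite [in X in X <= _](_ : f (x + u j *+ M.*2) - f x =
    (f (x + u j *+ M.*2) - S j (x + u j *+ M.*2 + u j)) +
    (S j (x + u j *+ M.*2 + u j) - S j (x + u j)) + (S j (x + u j) - f x)); last ring.
  apply: le_trans (power_sum3 _ _ _ q1) _.
  by rewrite (distrC (f _) (S _ _)).
under eq_bigr => j _ do rewrite -mulr_sumr !big_split/=.
rewrite -mulr_sumr !big_split/=.
apply: (@le_trans _ _ (3 `^ (q - 1) * (K%:R * (2 * W) +
    M%:R `^ q * 2 `^ q * W + K%:R * (2 * W)))).
  rewrite ler_wpM2l ?powR_ge0//; apply: lerD; first apply: lerD.
  - rewrite -[K in K%:R]card_ord -sum_cst; apply: ler_sum => j _.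
    rewrite (sum_transl (u j *+ M.*2) (fun x => `|S j (x + u j) - f x| `^ q)).
    exact: smooth_error.
  - exact: smooth_moves.
  - by rewrite -[K in K%:R]card_ord -sum_cst; apply: ler_sum => j _; exact: smooth_error.
rewrite [leLHS](_ : _ = 3 `^ (q - 1) * ((4 * K%:R + 2 `^ q * M%:R `^ q) * W)); last ring.
rewrite -mulrA ler_wpM2r//; last by apply: ler_powR; [lra|rewrite lerBlDl lerDr].
by rewrite mulr_ge0// addr_ge0// mulr_ge0// powR_ge0.
Qed.

End Cotype.

(** * From squares to p-th powers for p < 2 *)

Section Snowflake.
Context {R : realType}.

(** The squared distance of two points of the unit circle at angle [x]. *)
Definition chord (x : R) : R := 2 - 2 * cos x.

Lemma chordE (x y : R) :
  (cos x - cos y) ^+ 2 + (sin x - sin y) ^+ 2 = chord (x - y).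
Proof.
rewrite /chord cosB !sqrrB.
have := cos2Dsin2 x; have := cos2Dsin2 y => h1 h2; lra.
Qed.

Lemma chord_ge0 (x : R) : 0 <= chord x.
Proof. by rewrite /chord; have := cos_le1 x; lra. Qed.

Lemma chord_le4 (x : R) : chord x <= 4.
Proof. by rewrite /chord; have := cos_geN1 x; lra. Qed.

Lemma chord_norm (x : R) : chord `|x| = chord x.
Proof. by rewrite /chord; case: (ger0P x) => // _; rewrite cosN. Qed.

Lemma sin_le_id (x : R) : 0 <= x -> `|sin x| <= x.
Proof.
move=> x0; have [->|xn0] := eqVneq x 0; first by rewrite sin0 normr0.
have xgt : 0 < x by rewrite lt_neqAle eq_sym xn0.
have [c _] := @MVT R sin cos 0 x xgt (fun y _ => is_derive_sin y)
  (continuous_subspaceT (@continuous_sin R)).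
rewrite sin0 !subr0 => ->.
by rewrite normrM (ger0_norm x0) ler_piMl// cos_max.
Qed.

Lemma chord_le_sqr (x : R) : chord x <= x ^+ 2.
Proof.
rewrite -(real_normK (num_real x)) -chord_norm.
have y0 : 0 <= `|x| / 2 by rewrite divr_ge0.
have -> : `|x| = (`|x| / 2) *+ 2 by rewrite -mulr_natr; field.
set y := `|x| / 2 in y0 *.
have -> : chord (y *+ 2) = 4 * sin y ^+ 2.
  by rewrite /chord cos_mulr2n; have := cos2Dsin2 y; lra.
have -> : (y *+ 2) ^+ 2 = 4 * y ^+ 2 by rewrite -mulr_natr; ring.
rewrite ler_pM2l// -(real_normK (num_real (sin y))) ler_sqr ?nnegrE//.
exact: sin_le_id.
Qed.

Lemma chord_ge (x : R) : 1 <= x <= 2 -> chord 1 <= chord x.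
Proof.
move=> /andP[x1 x2]; have p2 := @pi_ge2 R.
suff : cos x <= cos 1 by rewrite /chord; lra.
have [<-//|xn] := eqVneq 1 x.
rewrite ltW// (@ltr_cos R) ?in_itv/=; [|lra|lra].
by rewrite lt_neqAle xn.
Qed.

Lemma chord1_gt0 : 0 < chord 1.
Proof.
have p2 := @pi_ge2 R.
suff : cos 1 < cos 0 :> R by rewrite cos0 /chord; lra.
by rewrite (@ltr_cos R) ?in_itv/=; lra.
Qed.

Lemma powR_lt (a x y : R) : 1 < a -> x < y -> a `^ x < a `^ y.
Proof.
move=> a1 xy; have a0 : 0 < a by apply: lt_trans a1.
by rewrite /powR gt_eqF// ltr_expR ltr_pM2r// ln_gt0.
Qed.

(* For a = 2^-p with 0 < p < 2 this is comparable to |v|^p at all scales above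
   2^-n: it turns inequalities for squares into inequalities for p-th powers. *)
Definition dyadic_chord (a : R) n (v : R) : R :=
  \sum_(j < n) a ^+ j * chord (2 ^+ j * v).

Lemma dyadic_chordS a n v :
  dyadic_chord a n.+1 v = chord v + a * dyadic_chord a n (2 * v).
Proof.
rewrite /dyadic_chord big_ord_recl/= !expr0 !mul1r mulr_sumr; congr (_ + _).
apply: eq_bigr => j _; rewrite /bump/= add1n !exprS -!mulrA.
by congr (_ * (_ * chord _)); rewrite mulrCA.
Qed.

Lemma dyadic_chord_le (p : R) : 0 < p -> p < 2 -> exists2 C : R, 0 < C &
  forall n v, 0 <= v -> dyadic_chord (2 `^ (- p)) n v <= C * v `^ p.
Proof.
move=> p0 p2; set a := 2 `^ (- p).
have a4 : 1 / 4 < a.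
  have -> : 1 / 4 = 2 `^ (- 2%:R) :> R by rewrite powR_invn// -natrX div1r.
  by apply: powR_lt; rewrite ?ltrN2// ltr1n.
have a1 : a < 1 by rewrite -(powRr0 2); apply: powR_lt; rewrite ?oppr_lt0// ltr1n.
have a0 : 0 < a by rewrite powR_gt0.
pose D := 1 / (4 * a - 1).
have D0 : 0 < D by rewrite divr_gt0// subr_gt0; lra.
pose E := 4 / (1 - a).
have E0 : 0 < E by rewrite divr_gt0// subr_gt0.
pose C := (1 + D + a * E) / a.
have C0 : 0 < C by rewrite divr_gt0// !addr_gt0// mulr_gt0.
have pa v : 0 <= v -> a * (2 * v) `^ p = v `^ p.
  by move=> v0; rewrite powRM// mulrA /a powRN mulVf ?mul1r// gt_eqF ?powR_gt0.
(* The term - D v^2 makes the induction work: a (2v)^p = v^p and 4 a D = D + 1, so passing from 2v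
   to v frees exactly the v^2 that bounds the new chord. For v >= 1 the series is geometric with
   ratio a < 1. *)
have key n v : 0 <= v -> dyadic_chord a n v <= E /\
    (v < 1 -> dyadic_chord a n v <= C * v `^ p - D * v ^+ 2).
  elim: n v => [|n IH] v v0.
    rewrite /dyadic_chord big_ord0; split; first exact: ltW.
    move=> v1; rewrite subr_ge0.
    have [->|vn0] := eqVneq v 0; first by rewrite expr0n/= mulr0 mulr_ge0 ?powR_ge0 ?ltW.
    apply: ler_pM; rewrite ?sqr_ge0// ?(ltW D0)//.
      rewrite /C ler_pdivlMr// ; have := mulr_gt0 a0 E0.
      have : D * a <= D by rewrite ler_piMr// ltW.
      lra.
    rewrite -(powR_mulrn 2 v0); apply: ger_powR; last exact: ltW.
    by rewrite lt_neqAle eq_sym vn0 v0 ltW.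
  have v20 : 0 <= 2 * v by rewrite mulr_ge0.
  have [h1 h2] := IH _ v20; rewrite dyadic_chordS; split.
    have := chord_le4 v; have := ler_wpM2l (ltW a0) h1.
    have : 4 + a * E = E by rewrite /E; field; rewrite gt_eqF// subr_gt0.
    lra.
  move=> v1; have c1 := chord_le_sqr v.
  have [hv|hv] := ltP (2 * v) 1.
    have := ler_wpM2l (ltW a0) (h2 hv).
    rewrite mulrBr mulrCA pa//.
    have : 4 * a * D - D = 1 by rewrite /D; field; rewrite gt_eqF// subr_gt0; lra.
    set X := v ^+ 2 in c1 *; rewrite (_ : a * (D * (2 * v) ^+ 2) = 4 * a * D * X); last first.
      by rewrite /X; ring.
    move=> h; have {h}-> : 4 * a * D = 1 + D by lra.
    lra.
  have := ler_wpM2l (ltW a0) h1.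
  have hp : a <= v `^ p.
    have -> : a = (1 / 2) `^ p.
      by rewrite /a div1r -powR_inv1// -powRrM mulN1r.
    by apply: ler_pow; lra.
  have : C * a <= C * v `^ p by rewrite ler_wpM2l// ltW.
  have -> : C * a = 1 + D + a * E by rewrite /C; field; rewrite gt_eqF.
  have v21 : v ^+ 2 <= 1 by rewrite expr_le1// ltW.
  have : D * v ^+ 2 <= D by rewrite ler_piMr// ltW.
  lra.
exists (C + E); first exact: addr_gt0.
move=> n v v0; have [h1 h2] := key n v v0.
have [hv|hv] := ltP v 1.
  apply: le_trans (h2 hv) _; rewrite mulrDl.
  have := mulr_ge0 (ltW E0) (powR_ge0 v p); have := mulr_ge0 (ltW D0) (sqr_ge0 v); lra.
apply: le_trans h1 _.
have : 1 `^ p <= v `^ p by apply: ler_pow => //; exact: ltW.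
rewrite powR1.
move=> /(ler_wpM2l (ltW E0)); have := mulr_ge0 (ltW C0) (powR_ge0 v p); lra.
Qed.

(** A single frequency with 1 <= 2^j v <= 2 suffices: its chord is at least [chord 1]. *)
Lemma dyadic_chord_ge (p : R) n v : 0 < p -> 0 < v <= 1 -> 1 <= 2 ^+ n * v ->
  chord 1 * 2 `^ (- p) * v `^ p <= dyadic_chord (2 `^ (- p)) n.+1 v.
Proof.
move=> p0 /andP[v0 v1] hn.
have [j jn /andP[hj1 hj2]] : exists2 j, (j <= n)%N & 1 <= 2 ^+ j * v <= 2.
  elim: n hn => [|n IH] hn; first by exists 0%N => //; move: hn; rewrite expr0; lra.
  have [h|h] := leP 1 (2 ^+ n * v).
    by have [j jn hj] := IH h; exists j => //; rewrite (leq_trans jn).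
  exists n.+1 => //; rewrite hn/=; move: h; rewrite exprS; lra.
have jn' : (j < n.+1)%N by rewrite ltnS.
rewrite /dyadic_chord (bigD1 (Ordinal jn'))//=.
apply: (@le_trans _ _ ((2 `^ (- p)) ^+ j * chord (2 ^+ j * v))); last first.
  rewrite lerDl sumr_ge0// => i _.
  by rewrite mulr_ge0 ?chord_ge0// exprn_ge0// powR_ge0.
rewrite -mulrA mulrC; apply: ler_pM; rewrite ?chord_ge0 ?mulr_ge0 ?powR_ge0//; last first.
  by apply: chord_ge; rewrite hj1.
have -> : (2 `^ (- p)) ^+ j = (2 ^+ j)^-1 `^ p.
  rewrite -powR_mulrn ?powR_ge0// -powRrM -[_^-1]powR_inv1 ?exprn_ge0//.
  rewrite -powR_mulrn// -!powRrM; congr powR; ring.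
have -> : 2 `^ (- p) * v `^ p = (v / 2) `^ p.
  rewrite powRM// ?(ltW v0)// mulrC; congr (_ * _).
  by rewrite -[2^-1](@powR_inv1 _ 2)// -powRrM mulN1r.
apply: ler_pow; [exact: ltW|by rewrite divr_ge0// ltW|].
have j0 : 0 < 2 ^+ j :> R by rewrite exprn_gt0.
rewrite -[leRHS]mul1r ler_pdivlMr// mulrAC ler_pdivrMr// mul1r mulrC//.
Qed.

(** The hypothesis, a quadratic inequality valid for all functions, is applied to cos(s f) and sin(s
    f), which gives it for the chords of s (f(x) - f(y)); weighted sums over dyadic s are comparable
    to p-th powers. *)
Lemma snowflake (p : R) : 0 < p -> p < 2 -> exists2 C : R, 0 < C &
  forall (X : Type) (I J : finType) (x y : I -> X) (x' y' : J -> X) (D : R),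
  0 <= D ->
  (forall f : X -> R, \sum_i (f (x i) - f (y i)) ^+ 2 <=
     D * \sum_j (f (x' j) - f (y' j)) ^+ 2) ->
  forall f : X -> R, \sum_i `|f (x i) - f (y i)| `^ p <=
     C * D * \sum_j `|f (x' j) - f (y' j)| `^ p.
Proof.
move=> p0 p2; have [C C0 HC] := dyadic_chord_le p0 p2.
set a := 2 `^ (- p) in HC; pose c := chord 1 * a.
have a0 : 0 < a by rewrite powR_gt0.
have c0 : 0 < c by rewrite mulr_gt0// chord1_gt0.
exists (C / c); first exact: divr_gt0.
move=> X I J x y x' y' D D0 H f.
pose d i := f (x i) - f (y i); pose d' j := f (x' j) - f (y' j).
(* Division by [B] brings all differences on the left below 1, and [n] dyadic frequencies reach down
   to the smallest nonzero one. *)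
pose B := 1 + \sum_i `|d i|.
have B0 : 0 < B by rewrite ltr_pwDl// sumr_ge0.
have dB i : `|d i| / B <= 1.
  rewrite ler_pdivrMr// mul1r /B (bigD1 i)//= addrCA lerDl addr_ge0// sumr_ge0//.
pose n := (\sum_i Num.bound (B / `|d i|))%N.
have hn i : d i != 0 -> 1 <= 2 ^+ n * (`|d i| / B).
  move=> di0; have dp : 0 < `|d i| by rewrite normr_gt0.
  rewrite mulrA ler_pdivlMr// mul1r -ler_pdivrMr//.
  apply: (@le_trans _ _ (Num.bound (B / `|d i|))%:R).
    by apply/ltW/archi_boundP; rewrite divr_ge0// ltW.
  rewrite -natrX ler_nat; apply: leq_trans (ltnW (ltn_expl _ _)) => //.
  by rewrite /n (bigD1 i)//= leq_addr.
have lo i : c * (`|d i| / B) `^ p <= dyadic_chord a n.+1 (`|d i| / B).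
  have [di0|di0] := eqVneq (d i) 0.
    rewrite di0 normr0 mul0r powR0 ?gt_eqF// mulr0 sumr_ge0// => j _.
    by rewrite mulr_ge0 ?chord_ge0// exprn_ge0// ltW.
  apply: dyadic_chord_ge => //; last exact: hn.
  by rewrite dB andbT divr_gt0// normr_gt0.
have mid : \sum_i dyadic_chord a n.+1 (`|d i| / B) <=
    D * \sum_j dyadic_chord a n.+1 (`|d' j| / B).
  rewrite /dyadic_chord exchange_big [X in _ <= D * X]exchange_big/=.
  rewrite mulr_sumr; apply: ler_sum => t _.
  rewrite -!mulr_sumr mulrCA ler_wpM2l ?exprn_ge0 ?(ltW a0)//.
  pose s : R := 2 ^+ t / B.
  have s0 : 0 <= s by rewrite divr_ge0 ?exprn_ge0 ?ltW.
  have e (u v : R) : chord (2 ^+ t * (`|u - v| / B)) =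
     (cos (s * u) - cos (s * v)) ^+ 2 + (sin (s * u) - sin (s * v)) ^+ 2.
    rewrite chordE -mulrBr -[RHS]chord_norm normrM (ger0_norm s0).
    by congr chord; rewrite /s; field; rewrite gt_eqF.
  rewrite /d /d'; under eq_bigr do rewrite e; under [in leRHS]eq_bigr do rewrite e.
  rewrite !big_split/= mulrDr; apply: lerD.
    exact: (H (fun z => cos (s * f z))).
  exact: (H (fun z => sin (s * f z))).
have hi : \sum_j dyadic_chord a n.+1 (`|d' j| / B) <=
    \sum_j C * (`|d' j| / B) `^ p.
  by apply: ler_sum => j _; apply: HC; rewrite divr_ge0// ltW.
have : c * \sum_i (`|d i| / B) `^ p <= D * (C * \sum_j (`|d' j| / B) `^ p).
  rewrite !mulr_sumr; apply: le_trans (ler_sum _ (fun i _ => lo i)) _.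
  by apply: (le_trans mid); rewrite -mulr_sumr ler_wpM2l.
have e (u : R) : (`|u| / B) `^ p = `|u| `^ p * B^-1 `^ p.
  by rewrite powRM// invr_ge0 ltW.
under eq_bigr do rewrite e; under [in leRHS]eq_bigr do rewrite e.
rewrite -!mulr_suml !mulrA ler_pM2r ?powR_gt0 ?invr_gt0// => h.
rewrite -(ler_pM2l c0); apply: (le_trans h).
by rewrite le_eqVlt; apply/orP; left; apply/eqP; field; rewrite gt_eqF.
Qed.

End Snowflake.

(** * Khintchine inequalities *)

Section Rademacher.
Context {R : realType}.

Fixpoint signed_sum (w : seq bool) (c : seq R) : R :=
  match w, c with
  | b :: w', x :: c' => sgnr b * x + signed_sum w' c'
  | _, _ => 0
  end.

Lemma sum_words_bool n (F : seq bool -> R) : \sum_(w <- words n.+1) F w =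
  \sum_(w <- words n) (F (true :: w) + F (false :: w)).
Proof. by rewrite sum_wordsS big_bool big_split. Qed.

Let two_n n : #|{: bool}|%:R ^+ n = 2 ^+ n :> R.
Proof. by rewrite card_bool. Qed.

(** [powR_two_point] for x and -x with T = k: the linear terms cancel, and only nonzero entries cost
    a factor, so the bound depends on their number and not on the length. *)
Lemma rademacher_moment (q : R) : 2 <= q -> exists2 C : R, 0 < C &
  forall (k : nat) (c : seq R), (0 < k)%N -> all (fun x : R => `|x| <= 1) c ->
    (count (fun x : R => x != 0%R) c <= k)%N ->
    \sum_(w <- words (size c)) `|signed_sum w c| `^ q <=
    2 ^+ size c * (C * k%:R `^ (q / 2)).
Proof.
move=> q2; have [C C0 HC] := powR_two_point q2.
exists (expR C * C); first by rewrite mulr_gt0// expR_gt0.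
move=> k c k0 c1 ck; have k1 : 1 <= k%:R :> R by rewrite ler1n.
set B := 1 + C / k%:R; set E := C * k%:R `^ (q / 2 - 1).
have E0 : 0 <= E by rewrite mulr_ge0 ?powR_ge0 ?ltW.
have B1 : 1 <= B by rewrite lerDl divr_ge0 ?ltW// ltr0n.
pose m (c : seq R) := count (fun x : R => x != 0%R) c.
have key y : \sum_(w <- words (size c)) `|y + signed_sum w c| `^ q <=
    2 ^+ size c * (B ^+ m c * (`|y| `^ q + (m c)%:R * E)).
  elim: c c1 {ck} y => [_ y|x c IH /= /andP[x1 c1] y].
    by rewrite sum_words0/= addr0 !expr0 !mul1r mul0r addr0.
  rewrite sum_words_bool big_split/=.
  under eq_bigr do rewrite mul1r addrA.
  under [X in _ + X <= _]eq_bigr do rewrite mulN1r addrA.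
  apply: le_trans (lerD (IH c1 _) (IH c1 _)) _.
  rewrite exprS -mulrDr -mulrDr [2 * _]mulrC -!mulrA ler_wpM2l ?exprn_ge0//.
  rewrite /m/=; have [->|xn0] := eqVneq x 0.
    by rewrite subr0 addr0 add0n le_eqVlt; apply/orP; left; apply/eqP; ring.
  rewrite add1n exprS -/(m c).
  have [d Hd] := HC k%:R y k1.
  have h1 := Hd x; have h2 := Hd (- x); rewrite -/B -/E in h1 h2.
  have x1q : `|x| `^ q <= 1.
    have : `|x| `^ q <= 1 `^ q by apply: ler_pow => //; lra.
    by rewrite powR1.
  rewrite normrN in h2.
  have h3 : E * `|x| `^ q <= E by rewrite ler_piMr.
  rewrite [leRHS](_ : _ = B ^+ m c * (2 * B * (`|y| `^ q + (m c).+1%:R * E))); last ring.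
  rewrite ler_wpM2l ?exprn_ge0//; first lra.
  rewrite -[(m c).+1]addn1 natrD mulrDl mul1r.
  have mE : 0 <= (m c)%:R * E by apply: mulr_ge0.
  have h4 : (m c)%:R * E <= B * ((m c)%:R * E) by rewrite ler_peMl.
  have h5 : E <= B * E by rewrite ler_peMl.
  rewrite mulrDr; lra.
have := key 0; under eq_bigr do rewrite add0r.
rewrite normr0 powR0; last by rewrite gt_eqF//; lra.
rewrite add0r => /le_trans; apply; rewrite ler_wpM2l ?exprn_ge0//.
rewrite -mulrA; apply: ler_pM; rewrite ?exprn_ge0 ?mulr_ge0//; try lra.
  by apply: iter_growth => //; exact: ltW.
rewrite -(@mulr_powRB1 R k%:R (q / 2)) ?ler0n//; last lra.
by rewrite [leRHS]mulrCA -/E ler_wpM2r// ler_nat.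
Qed.

(** For p < 2 the second moment suffices, since |s|^p <= k^(p/2) (1 + s^2 / k). *)
Lemma rademacher_upper (p : R) : 1 <= p -> exists2 C : R, 0 < C &
  forall (k : nat) (c : seq R), (0 < k)%N -> all (fun x : R => `|x| <= 1) c ->
    (count (fun x : R => x != 0%R) c <= k)%N ->
    \sum_(w <- words (size c)) `|signed_sum w c| `^ p <=
    2 ^+ size c * (C * k%:R `^ (p / 2)).
Proof.
move=> p1; have [p2|p2] := leP 2 p; first exact: rademacher_moment.
have [C C0 HC] := rademacher_moment (lexx 2).
exists (1 + C) => [|k c k0 c1 ck]; first by rewrite addr_gt0.
have := HC k c k0 c1 ck; rewrite divff ?powRr1// => h.
have k0R : 0 < k%:R :> R by rewrite ltr0n.
have e (s : R) : `|s| `^ p <= k%:R `^ (p / 2) * (1 + `|s| `^ 2 / k%:R).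
  have -> : `|s| `^ p = k%:R `^ (p / 2) * ((`|s| `^ 2 / k%:R) `^ (p / 2)).
    rewrite powRM ?powR_ge0 ?invr_ge0 ?ler0n// -powRrM.
    rewrite -[k%:R^-1]powR_inv1 ?ler0n// -powRrM mulrCA -powRD; last first.
      by rewrite (gt_eqF k0R) implybT.
    by rewrite mulN1r subrr powRr0 mulr1; congr powR; field.
  rewrite ler_wpM2l ?powR_ge0//; set x := _ / _.
  have x0 : 0 <= x by rewrite divr_ge0 ?powR_ge0.
  have [x1|x1] := leP 1 x.
    by apply: (@le_trans _ _ x); [apply: ler1_powR => //; lra|lra].
  by apply: (@le_trans _ _ (1 `^ (p / 2))); [apply: ler_pow; lra|rewrite powR1; lra].
apply: le_trans (ler_sum _ (fun w _ => e _)) _.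
rewrite -mulr_sumr big_split/= -mulr_suml sum_words_cst two_n mulr1.
rewrite mulrCA [leRHS]mulrCA mulrC [leRHS]mulrC.
rewrite [leRHS](_ : _ = k%:R `^ (p / 2) * (2 ^+ size c * (1 + C))); last ring.
rewrite [leLHS](_ : _ = k%:R `^ (p / 2) * (2 ^+ size c +
   (\sum_(w <- words (size c)) `|signed_sum w c| `^ 2) / k%:R)); last ring.
rewrite ler_wpM2l ?powR_ge0// mulrDr mulr1 lerD2l ler_pdivrMr//.
by rewrite -mulrA.
Qed.

Lemma signed_sum_sqr (c : seq R) y :
  \sum_(w <- words (size c)) (y + signed_sum w c) ^+ 2 =
  2 ^+ size c * (y ^+ 2 + \sum_(x <- c) x ^+ 2).
Proof.
elim: c y => [|x c IH] y /=.
  by rewrite sum_words0/= big_nil expr0 mul1r !addr0.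
rewrite sum_words_bool big_split/=.
under eq_bigr do rewrite mul1r addrA.
under [X in _ + X = _]eq_bigr do rewrite mulN1r addrA.
by rewrite !IH big_cons [2 ^+ _.+1]exprS; ring.
Qed.

Lemma signed_sum_fourth (c : seq R) y :
  \sum_(w <- words (size c)) (y + signed_sum w c) ^+ 4 <=
  2 ^+ size c * (y ^+ 4 + 6 * y ^+ 2 * (\sum_(x <- c) x ^+ 2)
                  + 3 * (\sum_(x <- c) x ^+ 2) ^+ 2).
Proof.
elim: c y => [|x c IH] y /=.
  by rewrite sum_words0/= big_nil expr0 mul1r expr0n/= !mulr0 !addr0.
rewrite sum_words_bool big_split/=.
under eq_bigr do rewrite mul1r addrA.
under [X in _ + X <= _]eq_bigr do rewrite mulN1r addrA.
apply: le_trans (lerD (IH _) (IH _)) _.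
rewrite big_cons; set s := \sum_(j <- c) _.
have s0 : 0 <= s by apply: sumr_ge0 => ? _; exact: sqr_ge0.
rewrite [2 ^+ _.+1]exprS.
rewrite -subr_ge0 [X in 0 <= X](_ : _ = 2 ^+ size c * (4 * x ^+ 4)); last ring.
by rewrite mulr_ge0 ?exprn_ge0// mulr_ge0// exprn_even_ge0.
Qed.

(* Fourth moment method: averaged over s, this bounds a first moment below in
   terms of the second and fourth ones. *)
Lemma abs_ge_quartic (l s : R) : 0 <= l -> l * s ^+ 2 - l ^+ 3 * s ^+ 4 <= `|s|.
Proof.
move=> l0.
have [->|ln0] := eqVneq l 0; first by rewrite expr0n/= !mul0r subr0.
have lp : 0 < l by rewrite lt_neqAle eq_sym ln0.
rewrite -(ler_pM2l lp); set t := l * `|s|.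
have t0 : 0 <= t by rewrite mulr_ge0.
have -> : l * (l * s ^+ 2 - l ^+ 3 * s ^+ 4) = t ^+ 2 - t ^+ 4.
  rewrite /t !exprMn real_normK ?num_real//.
  have -> : `|s| ^+ 4 = s ^+ 4 by rewrite -normrX ger0_norm// exprn_even_ge0.
  ring.
rewrite lerBlDr; have [t1|t1] := leP t 1.
  apply: (@le_trans _ _ t); last by rewrite lerDl exprn_ge0.
  by rewrite expr2 ler_piMr.
apply: (@le_trans _ _ (t ^+ 4)); last by rewrite lerDr.
by apply: ler_weXn2l => //; exact: ltW.
Qed.

(** [abs_ge_quartic] bounds the first moment below by [m], a multiple of the square root of [s];
    Jensen's inequality, in tangent form at [m], raises it to the power p. *)
Lemma rademacher_lower (p : R) : 1 <= p -> exists2 c0 : R, 0 < c0 &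
  forall c : seq R, 2 ^+ size c * (c0 * (\sum_(x <- c) x ^+ 2) `^ (p / 2)) <=
    \sum_(w <- words (size c)) `|signed_sum w c| `^ p.
Proof.
move=> p1; have p0 : 0 < p by lra.
exists ((24 `^ (p / 2))^-1) => [|c]; first by rewrite invr_gt0 powR_gt0.
set s := \sum_(x <- c) x ^+ 2; set N : R := 2 ^+ size c.
have N0 : 0 < N by rewrite exprn_gt0.
have s0 : 0 <= s by apply: sumr_ge0 => ? _; exact: sqr_ge0.
have [->|sn0] := eqVneq s 0.
  rewrite powR0 ?mulr0; last by rewrite gt_eqF//; lra.
  by apply: sumr_ge0 => ? _; exact: powR_ge0.
have sp : 0 < s by rewrite lt_neqAle eq_sym sn0.
(* The fourth moment is at most 3 s^2, so this [l] leaves l s - 3 l^3 s^2 = l s / 2, which is the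
   square root of s / 24. *)
pose l : R := (Num.sqrt (6 * s))^-1.
have lp : 0 < l by rewrite invr_gt0 sqrtr_gt0 mulr_gt0.
have l2 : l ^+ 2 = (6 * s)^-1.
  by rewrite exprVn sqr_sqrtr// mulr_ge0.
have E1 : N * (l * s / 2) <= \sum_(w <- words (size c)) `|signed_sum w c|.
  have h := ler_sum _ (fun (w : seq bool) (_ : true) =>
     abs_ge_quartic (signed_sum w c) (ltW lp)).
  apply: le_trans (h (words (size c))); rewrite sumrB -!mulr_sumr.
  have := signed_sum_sqr c 0; under eq_bigr do rewrite add0r.
  move=> ->; have := signed_sum_fourth c 0; under eq_bigr do rewrite add0r.
  rewrite -/s -/N !expr0n/= mulr0 mul0r !add0r => h4.
  have := ler_wpM2l (exprn_ge0 3 (ltW lp)) h4.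
  have -> : l ^+ 3 * (N * (3 * s ^+ 2)) = N * (l * s / 2).
    by rewrite exprS l2; field; rewrite gt_eqF.
  lra.
pose m := (l * s / 2).
have m0 : 0 <= m by rewrite !mulr_ge0// ltW.
have -> : (24 `^ (p / 2))^-1 * s `^ (p / 2) = m `^ p.
  have -> : m = (s / 24) `^ (1 / 2).
    rewrite div1r powR12_sqrt; last by rewrite divr_ge0.
    apply/eqP; rewrite -(@eqrXn2 _ 2)// ?sqrtr_ge0// sqr_sqrtr ?divr_ge0//.
    by rewrite /m !exprMn l2; apply/eqP; field; rewrite gt_eqF.
  rewrite -powRrM powRM ?invr_ge0// mulrC; congr (_ * _).
    by congr powR; field.
  by rewrite -powRN -[24^-1](@powR_inv1 R 24)// -powRrM; congr powR; field.
have h (w : seq bool) := powR_tangent p1 (normr_ge0 (signed_sum w c)) m0.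
apply: le_trans (ler_sum _ (fun w _ => h w)).
rewrite big_split/= -mulr_sumr sumrB !sum_words_cst two_n -/N lerDl.
rewrite mulr_ge0 ?mulr_ge0 ?powR_ge0 ?(ltW p0)//.
by rewrite subr_ge0.
Qed.

End Rademacher.

(** * The lamplighter walk on a cycle *)

Section LamplighterWalk.
Context {R : realType} (n' K : nat).
Local Notation n := n'.+2.
Local Notation cyc := 'I_n.
Local Notation letter := (bool * {ffun 'I_K -> bool})%type.
Local Notation nsigns := (#|{: {ffun 'I_K -> bool}}|%:R : R).
Implicit Types (c b : cyc) (j : 'I_K) (w : seq letter).

(* The increment, at lamp j of block b, of the walk that starts at block c and
   reads w; the letter (true, e) adds the signs e to the current block and moves
   to the next one, (false, e) undoes such a step. *)
Fixpoint lamp_incr c w b j : int :=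
  if w is (d, e) :: w' then
    if d then (if c == b then sgnv (e j) 1 else 0) + lamp_incr (c + 1) w' b j
    else (if c - 1 == b then - sgnv (e j) 1 else 0) + lamp_incr (c - 1) w' b j
  else 0.

Definition walk_end c w : cyc :=
  foldl (fun c (a : letter) => if a.1 then c + 1 else c - 1) c w.

Lemma val_cyc1 c :
  nat_of_ord (c + 1) = (if c.+1 == n then 0 else c.+1)%N.
Proof.
rewrite /= (modn_small (isT : (1 < n)%N)) addn1.
case: eqP => [->|cn]; first by rewrite modnn.
rewrite modn_small// ltn_neqAle; apply/andP; split; [exact/eqP|exact: ltn_ord].
Qed.

Lemma val_cycB1 c :
  nat_of_ord (c - 1) = (if nat_of_ord c == 0 then n.-1 else c.-1)%N.
Proof.
have := val_cyc1 (c - 1); rewrite subrK; move: (c - 1) => x ->.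
by case E : (x.+1 == n) => //=; move/eqP: E => [->].
Qed.

(** Probability that one step from [c] changes the lamps of block [b], which sit on the edge between
    the cursor positions b and b + 1. *)
Definition edge b c : R := ((c == b)%:R + (c - 1 == b)%:R) / 2.

(** Expected number of such changes in [T] steps. *)
Fixpoint visits b T c : R :=
  if T is T'.+1 then edge b c + (visits b T' (c + 1) + visits b T' (c - 1)) / 2
  else 0.

(** Green function of the cycle: averaging over the two neighbours lowers it by 1/n, except at the
    positions 0 and 1. Its value at 0 is that of the formula at v = n. *)
Definition parabola (v : nat) : R :=
  if v is 0 then 1 else v%:R * (n.+1%:R - v%:R) / n%:R.

Definition green b c : R := parabola (c - b)%R.

Lemma green_step b c :
  (green b (c + 1) + green b (c - 1)) / 2 = green b c + edge b c - 1 / n%:R.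
Proof.
have e1 : (c == b) = (nat_of_ord (c - b) == 0%N).
  by rewrite -subr_eq0 -val_eqE.
have e2 : (c - 1 == b) = (nat_of_ord (c - b) == 1%N).
  have -> : 1%N = nat_of_ord (1 : cyc) by rewrite /= modn_small.
  by rewrite [RHS](_ : _ = (c - b == 1))// !subr_eq addrC.
have g1 : green b (c + 1) = parabola (c - b + 1)%R by rewrite /green addrAC.
have g2 : green b (c - 1) = parabola (c - b - 1)%R by rewrite /green addrAC.
rewrite /edge e1 e2 g1 g2 /green {e1 e2 g1 g2}.
have := val_cyc1 (c - b); have := val_cycB1 (c - b).
move: (c - b) => u; move: (u + 1) (u - 1) => up um -> ->.
have un := ltn_ord u; move: (nat_of_ord u) un => v vn.
have n0 : n%:R != 0 :> R by rewrite pnatr_eq0.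
have nE : n.+1%:R = n%:R + 1 :> R by rewrite -natr1.
rewrite /parabola nE.
case: v vn => [|[|v]] vn.
- have -> : (1%N == n) = false by [].
  have -> : n.-1%:R = n%:R - 1 :> R by rewrite -[n]/(n.-1.+1) -natr1 addrK.
  by rewrite /=; field.
- rewrite /=; case: eqP => [<-|_]; first by field.
  by field.
- have v1E : v.+1%:R = v%:R + 1 :> R by rewrite -addn1 natrD.
  have v2E : v.+2%:R = v%:R + 2 :> R by rewrite -addn2 natrD.
  have v3E : v.+3%:R = v%:R + 3 :> R by rewrite -addn3 natrD.
  case: eqP => [h|_] /=; rewrite v1E v2E ?v3E; last by field.
  have -> : v%:R = n%:R - 3 :> R by rewrite -h v3E; ring.
  by field.
Qed.

Lemma green_bounds b c : 0 <= green b c <= n.+1%:R.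
Proof.
rewrite /green; have := ltn_ord (c - b); move: (nat_of_ord (c - b)) => [|v] vn; rewrite /parabola.
  by rewrite ler01 ler1n.
have vR : v.+1%:R <= n%:R :> R by rewrite ler_nat ltnW.
have nE : n.+1%:R = n%:R + 1 :> R by rewrite -natr1.
have n0 : 0 < n%:R :> R by rewrite ltr0n.
have v0 : 0 <= v.+1%:R :> R by [].
rewrite ler_pdivrMr// divr_ge0 ?mulr_ge0//=; last by rewrite nE; lra.
by rewrite mulrC; apply: ler_pM => //; rewrite nE; lra.
Qed.

(** By [green_step] the expected visits equal T/n plus the expected change of the bounded potential
    [green]. *)
Lemma visits_le b T c : visits b T c <= n.+1%:R - green b c + T%:R / n%:R.
Proof.
elim: T c => [|T IH] c /=; first by rewrite mul0r addr0 subr_ge0; case/andP: (green_bounds b c).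
have := IH (c + 1); have := IH (c - 1); have := green_step b c.
have -> : T.+1%:R / n%:R = T%:R / n%:R + 1 / n%:R :> R by rewrite -natr1 mulrDl.
move: (T%:R / n%:R) (1 / n%:R : R) => x y; lra.
Qed.

Lemma sum_edge b : \sum_c edge b c = 1.
Proof.
rewrite /edge -mulr_suml big_split/=.
have e (x : cyc) : \sum_c (c == x)%:R = 1 :> R.
  by rewrite (bigD1 x)//= eqxx big1 ?addr0// => i /negbTE ->.
under [X in _ + X]eq_bigr do rewrite subr_eq.
by rewrite !e; field.
Qed.

Lemma sum_visits b T : \sum_c visits b T c = T%:R.
Proof.
elim: T => [|T IH]; first by rewrite big1.
rewrite /= big_split/= sum_edge -mulr_suml big_split/=.
have h (y : cyc) : \sum_c visits b T (c + y) = T%:R.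
  by rewrite -IH [RHS](reindex_inj (addIr y)).
by rewrite !h -[T.+1]addn1 natrD; field.
Qed.

Lemma sum_signs j (F : R -> R) :
  \sum_(e : {ffun 'I_K -> bool}) F (sgnr (e j)) = nsigns * ((F 1 + F (-1)) / 2).
Proof.
have h : \sum_(e : {ffun 'I_K -> bool}) F (sgnr (e j)) =
         \sum_(e : {ffun 'I_K -> bool}) F (- sgnr (e j)).
  rewrite -(sum_flip j); apply: eq_bigr => e _.
  by rewrite ffunE eqxx sgnrN.
rewrite [LHS](_ : _ = (\sum_(e : {ffun 'I_K -> bool}) F (sgnr (e j)) +
   \sum_(e : {ffun 'I_K -> bool}) F (- sgnr (e j))) / 2); last by rewrite -h; field.
rewrite -big_split/= -sum_cst mulr_suml; apply: eq_bigr => e _.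
by case: (e j) => //=; rewrite opprK [F (-1) + _]addrC.
Qed.

Lemma lamp_incr_step (F : R -> R) b j c T y :
  \sum_(w <- words T.+1) F (y + (lamp_incr c w b j)%:~R) =
  nsigns / 2 *
   \sum_(w <- words T)
    ((F (y + (c == b)%:R + (lamp_incr (c + 1) w b j)%:~R) +
      F (y - (c == b)%:R + (lamp_incr (c + 1) w b j)%:~R)) +
     (F (y + (c - 1 == b)%:R + (lamp_incr (c - 1) w b j)%:~R) +
      F (y - (c - 1 == b)%:R + (lamp_incr (c - 1) w b j)%:~R))).
Proof.
pose H (d : bool) (e : {ffun 'I_K -> bool}) := \sum_(w <- words T)
   F (y + (lamp_incr c ((d, e) :: w) b j)%:~R).
rewrite sum_wordsS (eq_bigr (fun p => H p.1 p.2)); last by case.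
rewrite -(pair_bigA _ H)/= big_bool /H/=.
rewrite big_split/= mulrDr; congr (_ + _).
  rewrite exchange_big/= mulr_sumr; apply: eq_bigr => w _.
  rewrite (eq_bigr (fun e : {ffun 'I_K -> bool} =>
     (fun s : R => F (y + s * (c == b)%:R + (lamp_incr (c + 1) w b j)%:~R))
        (sgnr (e j)))); last first.
    move=> e _; rewrite intrD addrA; congr (F (_ + _ + _)).
    by case: ifP => _; rewrite ?mulr0// mulr1; case: (e j).
  rewrite (sum_signs j (fun s => F (y + s * (c == b)%:R + (lamp_incr (c + 1) w b j)%:~R))).
  by rewrite mul1r mulN1r; field.
rewrite exchange_big/= mulr_sumr; apply: eq_bigr => w _.
rewrite (eq_bigr (fun e : {ffun 'I_K -> bool} =>
     (fun s : R => F (y - s * (c - 1 == b)%:R + (lamp_incr (c - 1) w b j)%:~R))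
        (sgnr (e j)))); last first.
  move=> e _; rewrite intrD addrA; congr (F (_ + _ + _)).
  case: ifP => _; rewrite ?mulr0 ?oppr0// mulr1.
  by rewrite rmorphN/=; case: (e j).
rewrite (sum_signs j (fun s => F (y - s * (c - 1 == b)%:R + (lamp_incr (c - 1) w b j)%:~R))).
by rewrite mul1r mulN1r opprK; field.
Qed.

Let N : R := #|{: letter}|%:R.
Let NE : N = 2 * nsigns. Proof. by rewrite /N card_prod card_bool natrM. Qed.

Lemma lamp_incr_sqr b j T c y :
  \sum_(w <- words T) (y + (lamp_incr c w b j)%:~R) ^+ 2 =
  N ^+ T * (y ^+ 2 + visits b T c).
Proof.
elim: T c y => [|T IH] c y.
  by rewrite sum_words0/= !addr0 expr0 mul1r.
rewrite (lamp_incr_step (fun x => x ^+ 2)) !big_split/= !IH [N ^+ T.+1]exprS NE /edge.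
by case: (c == b); case: (c - 1 == b) => /=; field.
Qed.

(** A visit replaces y by y + 1 or y - 1, which adds 6 y^2 + 1 to the mean of y^4 and raises the
    later contribution 6 y^2 v, with at most [G] expected visits v to come, by at most 6 G. *)
Lemma lamp_incr_fourth b j (G : R) T c y :
  (forall t c, (t < T)%N -> visits b t c <= G) ->
  \sum_(w <- words T) (y + (lamp_incr c w b j)%:~R) ^+ 4 <=
  N ^+ T * (y ^+ 4 + 6 * y ^+ 2 * visits b T c + (1 + 6 * G) * visits b T c).
Proof.
elim: T c y => [|T IH] c y hG.
  by rewrite sum_words0/= !addr0 expr0 mul1r !mulr0 !addr0.
have hG' t c0 : (t < T)%N -> visits b t c0 <= G by move=> /ltnW; exact: hG.
rewrite (lamp_incr_step (fun x => x ^+ 4)) !big_split/=.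
have g1 := hG T (c + 1) (ltnSn T); have g2 := hG T (c - 1) (ltnSn T).
have s0 : 0 <= nsigns / 2 by rewrite divr_ge0.
apply: (@le_trans _ _ (nsigns / 2 * (N ^+ T * (4 * y ^+ 4 +
   6 * y ^+ 2 * (4 * visits b T.+1 c) + (1 + 6 * G) * (4 * visits b T.+1 c))))); last first.
  rewrite [N ^+ T.+1]exprS NE le_eqVlt; by apply/orP; left; apply/eqP => /=; field.
rewrite ler_wpM2l//.
have h x z := IH x z hG'.
apply: le_trans (lerD (lerD (h _ _) (h _ _)) (lerD (h _ _) (h _ _))) _.
rewrite -!mulrDr ler_wpM2l ?exprn_ge0//=.
set v1 := visits b T (c + 1) in g1 *; set v2 := visits b T (c - 1) in g2 *.
rewrite -subr_ge0 /edge; case: (c == b); case: (c - 1 == b) => /=.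
- rewrite [X in 0 <= X](_ : _ = 12 * (G - v1) + 12 * (G - v2)); first lra.
  by field.
- rewrite [X in 0 <= X](_ : _ = 12 * (G - v1)); first lra.
  by field.
- rewrite [X in 0 <= X](_ : _ = 12 * (G - v2)); first lra.
  by field.
- rewrite [X in 0 <= X](_ : _ = 0)//.
  by field.
Qed.

(** Averaged over the start, 2 n^2 steps visit a lamp 2n = 2 r^2 times, so its increment has size
    about r. The subtracted square is the price of the truncation in [tent_parabola]. *)
Lemma lamp_incr_spread b j (r : nat) (Rd : R) : n = (r ^ 2)%N -> 40 * r%:R <= Rd ->
  N ^+ (n ^ 2).*2 * (r%:R ^+ 3 / 10) <=
  \sum_c \sum_(w <- words (n ^ 2).*2)
    (`|(lamp_incr c w b j)%:~R| - (lamp_incr c w b j)%:~R ^+ 2 / Rd).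
Proof.
move=> nr hR; set T := (n ^ 2).*2.
have r1 : (1 <= r)%N by case: (r) nr.
have r0 : 0 < r%:R :> R by rewrite ltr0n.
have nR : n%:R = r%:R ^+ 2 :> R by rewrite nr natrX.
have TR : T%:R = 2 * r%:R ^+ 4 :> R.
  by rewrite /T -muln2 natrM natrX nR; ring.
have n0 : 0 < n%:R :> R by rewrite ltr0n.
have R0 : 0 < Rd by apply: lt_le_trans hR; rewrite mulr_gt0.
pose G : R := 4 * r%:R ^+ 2.
have hG t c : (t < T)%N -> visits b t c <= G.
  move=> tT; apply: le_trans (visits_le b t c) _.
  have /andP[+ _] := green_bounds b c.
  have : t%:R / n%:R <= 2 * n%:R :> R.
    rewrite ler_pdivrMr// -mulrA -!natrM ler_nat (leq_trans (ltnW tT))//.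
    by rewrite /T -muln2 mulnC expnS expn1.
  have : n.+1%:R <= 2 * n%:R :> R by rewrite -natrM ler_nat; lia.
  rewrite /G -nR; move: (t%:R / n%:R : R) => x; lra.
have m2 : \sum_c \sum_(w <- words T) (lamp_incr c w b j)%:~R ^+ 2 = N ^+ T * T%:R :> R.
  rewrite -(sum_visits b T) mulr_sumr; apply: eq_bigr => c _.
  have := lamp_incr_sqr b j T c 0; rewrite expr0n add0r => <-.
  by apply: eq_bigr => w _; rewrite add0r.
have m4 : \sum_c \sum_(w <- words T) (lamp_incr c w b j)%:~R ^+ 4 <=
    N ^+ T * ((1 + 6 * G) * T%:R) :> R.
  rewrite -(sum_visits b T) !mulr_sumr; apply: ler_sum => c _.
  have := @lamp_incr_fourth b j G T c 0 hG; rewrite !expr0n/= mulr0 mul0r !add0r.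
  by under eq_bigr => w _ do rewrite add0r.
(* With this [l] the second moment contributes r^3 / 5, and the fourth moment and the term with [Rd]
   take away at most r^3 / 20 each. *)
pose l : R := (10 * r%:R)^-1.
have l0 : 0 <= l by rewrite invr_ge0 mulr_ge0.
apply: (@le_trans _ _ (\sum_c \sum_(w <- words T)
   (l * (lamp_incr c w b j)%:~R ^+ 2 - l ^+ 3 * (lamp_incr c w b j)%:~R ^+ 4
    - (lamp_incr c w b j)%:~R ^+ 2 / Rd))); last first.
  apply: ler_sum => c _; apply: ler_sum => w _.
  by rewrite lerD2r; exact: abs_ge_quartic.
under eq_bigr do rewrite !sumrB -!mulr_sumr -mulr_suml.
rewrite !sumrB -!mulr_sumr -mulr_suml m2.
have := ler_wpM2l (exprn_ge0 3 l0) m4.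
have N0 : 0 <= N ^+ T by rewrite exprn_ge0// ler0n.
have : N ^+ T * T%:R / Rd <= N ^+ T * (r%:R ^+ 3 / 20).
  rewrite -mulrA ler_wpM2l// ler_pdivrMr// TR.
  have : r%:R ^+ 3 / 20 * (40 * r%:R) <= r%:R ^+ 3 / 20 * Rd.
    by rewrite ler_wpM2l// divr_ge0 ?exprn_ge0 ?ler0n.
  by rewrite [X in X <= _ -> _](_ : _ = 2 * r%:R ^+ 4) //; field.
have -> : l * (N ^+ T * T%:R) = N ^+ T * (r%:R ^+ 3 / 5).
  by rewrite TR /l; field; rewrite gt_eqF.
have : l ^+ 3 * (N ^+ T * ((1 + 6 * G) * T%:R)) <= N ^+ T * (r%:R ^+ 3 / 20).
  rewrite mulrCA ler_wpM2l// TR /G /l.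
  have -> : (10 * r%:R)^-1 ^+ 3 * ((1 + 6 * (4 * r%:R ^+ 2)) * (2 * r%:R ^+ 4)) =
     r%:R * (1 + 24 * r%:R ^+ 2) / 500 :> R.
    by field; rewrite gt_eqF.
  have r1R : 1 <= r%:R ^+ 2 :> R by rewrite exprn_ege1// ler1n.
  have : r%:R * (1 + 24 * r%:R ^+ 2) <= r%:R * (25 * r%:R ^+ 2) :> R.
    by rewrite ler_wpM2l ?ler0n//; lra.
  have -> : r%:R * (25 * r%:R ^+ 2) = 25 * r%:R ^+ 3 :> R by ring.
  lra.
have -> : N ^+ T * (r%:R ^+ 3 / 10) = N ^+ T * (r%:R ^+ 3 / 5) -
   N ^+ T * (r%:R ^+ 3 / 20) - N ^+ T * (r%:R ^+ 3 / 20) by field.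
lra.
Qed.

End LamplighterWalk.

(** * Transfer to L_p *)

Section LpKernel.
Context (R : realType) (p : R) (p1 : (1 <= p%:E)%E).
Local Notation mu := (lebesgue01 R).
Local Notation Lp := (Lp01 p1).

Let p0 : 0 < p.
Proof. by move: p1; rewrite lee_fin => /(lt_le_trans ltr01). Qed.

Definition energy (f g : Lp) : R := fine ((Lp01_dist f g) `^ p)%E.

Lemma measurable_Lp (f : Lp) :
  measurable_fun (setT : set (measurableTypeR R)) (f : _ -> R).
Proof. exact: (measurable_funP (generic_quotient.repr (f : aeEqMfun _ _))). Qed.

Lemma measurable_diff_pow (f g : Lp) :
  measurable_fun (setT : set (measurableTypeR R))
    (fun x => (`|(f x : R) - (g x : R)| `^ p)%:E : \bar R).
Proof.
apply/measurable_EFinP.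
apply: (@measurableT_comp _ _ _ _ _ _ (fun x : R => x `^ p)).
  exact: measurable_powR.
apply: measurableT_comp => //; by apply: measurable_funB; exact: measurable_Lp.
Qed.

Lemma dist_powE (f g : Lp) :
  ((Lp01_dist f g) `^ p)%E = (\int[mu]_x (`|(f x : R) - (g x : R)| `^ p)%:E)%E.
Proof. by rewrite /Lp01_dist poweR_Lnorm ?gt_eqF. Qed.

Lemma dist_lty (f g : Lp) : (Lp01_dist f g < +oo)%E.
Proof.
have mf (h : Lp) : (h : measurableTypeR R -> R) \in Lfun mu p%:E.
  apply/andP; split; first by rewrite inE/=; exact: measurable_Lp.
  by rewrite inE; exact: Lebesgue_finite.
have h := rpredB (mf f) (mf g); have /andP[_] := h p1.
by rewrite inE.
Qed.

Lemma dist_ge0 (f g : Lp) : (0 <= Lp01_dist f g)%E.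
Proof. exact: Lnorm_ge0. Qed.

Lemma energyE (f g : Lp) :
  (energy f g)%:E = (\int[mu]_x (`|(f x : R) - (g x : R)| `^ p)%:E)%E.
Proof.
rewrite -dist_powE /energy fineK// ge0_fin_numE; last exact: poweR_ge0.
exact/poweR_lty/dist_lty.
Qed.

Lemma energy_ge0 (f g : Lp) : 0 <= energy f g.
Proof. exact/fine_ge0/poweR_ge0. Qed.

Lemma distE (f g : Lp) : Lp01_dist f g = ((energy f g) `^ (p^-1))%:E.
Proof.
have h : Lp01_dist f g \is a fin_num.
  by rewrite ge0_fin_numE ?dist_ge0// dist_lty.
rewrite -[LHS]fineK// /energy fine_poweR -powRrM divff ?gt_eqF// powRr1//.
exact/fine_ge0/dist_ge0.
Qed.

Lemma energy_dist (f g : Lp) (c : R) : 0 <= c ->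
  (Lp01_dist f g <= c%:E)%E = (energy f g <= c `^ p).
Proof.
move=> c0; rewrite distE lee_fin.
have e0 := energy_ge0 f g.
apply/idP/idP => h.
  have := ler_pow (ltW p0) (powR_ge0 _ _) h.
  by rewrite -powRrM mulVf ?gt_eqF// powRr1.
have := ler_pow (ltW (_ : 0 < p^-1)) e0 h; rewrite invr_gt0 => /(_ p0).
by rewrite -powRrM divff ?gt_eqF// powRr1.
Qed.

Lemma dist_energy_ge (f g : Lp) (c : R) : 0 <= c ->
  (c%:E <= Lp01_dist f g)%E = (c `^ p <= energy f g).
Proof.
move=> c0; rewrite distE lee_fin.
have e0 := energy_ge0 f g.
apply/idP/idP => h.
  have := ler_pow (ltW p0) c0 h.
  by rewrite -powRrM mulVf ?gt_eqF// powRr1.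
have := ler_pow (ltW (_ : 0 < p^-1)) (powR_ge0 _ _) h; rewrite invr_gt0 => /(_ p0).
by rewrite -powRrM divff ?gt_eqF// powRr1.
Qed.

Lemma sum_energyE (I : Type) (r : seq I) (F G : I -> Lp) :
  (\sum_(i <- r) energy (F i) (G i))%:E =
  (\int[mu]_x (\sum_(i <- r) `|(F i x : R) - (G i x : R)| `^ p)%:E)%E.
Proof.
rewrite -sumEFin; under eq_bigr do rewrite energyE.
rewrite -ge0_integral_sum//; last first.
- by move=> i; exact: measurable_diff_pow.
by apply: eq_integral => x _; rewrite sumEFin.
Qed.

(** At each point of [0,1] the values of [Psi] form a real-valued function on [X], to which the
    scalar inequality applies; integrate over the points. *)
Lemma energy_transfer (X I J : Type) (Psi : X -> Lp) (r : seq I) (r' : seq J)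
    (x y : I -> X) (x' y' : J -> X) (C : R) : 0 <= C ->
  (forall t : X -> R, \sum_(i <- r) `|t (x i) - t (y i)| `^ p <=
     C * \sum_(j <- r') `|t (x' j) - t (y' j)| `^ p) ->
  \sum_(i <- r) energy (Psi (x i)) (Psi (y i)) <=
  C * \sum_(j <- r') energy (Psi (x' j)) (Psi (y' j)).
Proof.
move=> C0 H; rewrite -lee_fin EFinM.
rewrite (sum_energyE r (Psi \o x) (Psi \o y)) (sum_energyE r' (Psi \o x') (Psi \o y')).
have ms (K : Type) (s : seq K) (F G : K -> Lp) :
    measurable_fun (setT : set (measurableTypeR R))
     (fun z => (\sum_(i <- s) `|(F i z : R) - (G i z : R)| `^ p)%:E).
  apply/measurable_EFinP; apply: measurable_sum => i.
  by apply/measurable_EFinP; exact: measurable_diff_pow.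
rewrite -ge0_integralZl_EFin//; last first.
  by move=> z _; rewrite lee_fin sumr_ge0// => *; exact: powR_ge0.
apply: ge0_le_integral.
- exact: measurableT.
- by move=> z _; rewrite lee_fin sumr_ge0// => *; exact: powR_ge0.
- exact: (ms _ r (Psi \o x) (Psi \o y)).
- by apply: measurable_funeM; exact: (ms _ r' (Psi \o x') (Psi \o y')).
- by move=> z _; rewrite -EFinM lee_fin; exact: (H (fun a => (Psi a z : R))).
Qed.

End LpKernel.

(** * Realizing l_p-valued maps in L_p([0,1]) *)

Section Realization.
Context (R : realType) (p : R) (p1 : (1 <= p%:E)%E).
Local Notation mu := (lebesgue01 R).
Local Notation mR := (measurableTypeR R).

Let p0 : 0 < p.
Proof. by move: p1; rewrite lee_fin => /(lt_le_trans ltr01). Qed.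

(** Cuts (0,1] into the intervals (1/(n+2), 1/(n+1)]; the functions constant on them form a weighted
    l_p. *)
Definition level (x : mR) : nat := Num.trunc ((x : R)^-1).

Lemma levelE n :
  level @^-1` [set n.+1] = [set` `]n.+2%:R^-1, n.+1%:R^-1]] :> set mR.
Proof.
apply/seteqP; split => x; rewrite /level /= in_itv/=.
  move=> /eqP; rewrite eqn_leq truncn_le_nat truncn_gt_nat => /andP[h1 h2].
  have x0 : 0 < (x : R) by rewrite -invr_gt0 (lt_le_trans _ h2).
  rewrite -[X in _ < X]invrK ltf_pV2 ?posrE ?invr_gt0// h1/=.
  by rewrite -[X in X <= _]invrK lef_pV2 ?posrE ?invr_gt0.
move=> /andP[h1 h2]; have x0 : 0 < (x : R) by apply: lt_trans h1; rewrite invr_gt0.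
apply/eqP; rewrite eqn_leq truncn_le_nat truncn_gt_nat; apply/andP; split.
  by rewrite -[ltRHS]invrK ltf_pV2 ?posrE ?invr_gt0.
by rewrite -[leLHS]invrK lef_pV2 ?posrE ?invr_gt0.
Qed.

Lemma measurable_level n : measurable (level @^-1` [set n]).
Proof.
have h k : measurable (level @^-1` [set k.+1]) by rewrite levelE; exact: measurable_itv.
case: n => [|n]; last exact: h.
rewrite (_ : _ @^-1` _ = ~` (\bigcup_k level @^-1` [set k.+1])).
  by apply: measurableC; exact: bigcup_measurable.
apply/seteqP; split => x /=.
  by move=> x0 [k _ /=]; rewrite x0.
by move=> h'; case E : (level x) => [//|k]; exfalso; apply: h'; exists k.
Qed.

Lemma measurable_comp_level (v : nat -> R) :
  measurable_fun (setT : set mR) (fun x => v (level x) : mR).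
Proof.
move=> _ B mB; rewrite setTI.
rewrite (_ : _ @^-1` B = \bigcup_(k in [set k | B (v k)]) level @^-1` [set k]).
  by apply: bigcup_measurable => k _; exact: measurable_level.
apply/seteqP; split => x /=; first by move=> h; exists (level x).
by move=> [k /= h ->].
Qed.

Definition weight n : R := n.+1%:R^-1 - n.+2%:R^-1.

Lemma weight_gt0 n : 0 < weight n.
Proof. by rewrite subr_gt0 ltf_pV2 ?posrE// ltr_nat. Qed.

Lemma mu_levelS n : mu (level @^-1` [set n.+1]) = (weight n)%:E.
Proof.
rewrite /lebesgue01 /= /mrestr levelE setIidl; last first.
  move=> x /=; rewrite !in_itv/= => /andP[h1 h2]; apply/andP; split.
    by apply/ltW; apply: lt_trans h1; rewrite invr_gt0.
  by apply: (le_trans h2); rewrite invf_le1// ler1n.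
rewrite lebesgue_measure_itv/= lte_fin ltf_pV2 ?posrE// ltr_nat ltnSn.
by rewrite -EFinB.
Qed.

Lemma integral_level (h : nat -> R) : (forall n, 0 <= h n) -> h 0%N = 0 ->
  (\int[mu]_x (h (level x))%:E =
   \esum_(n in setT) (if n is n'.+1 then h n * weight n' else 0)%:E)%E.
Proof.
move=> h0 h00.
have -> : (setT : set mR) = \bigcup_k level @^-1` [set k].
  by apply/seteqP; split => x //= _; exists (level x).
rewrite ge0_integral_bigcup//.
- rewrite nneseries_esum; last first.
    by move=> n _; apply: integral_ge0 => x _; rewrite lee_fin.
  rewrite [X in esum X _](_ : _ = setT); last by apply/seteqP.
  apply: eq_esum => n _.
  rewrite (eq_integral (cst (h n)%:E)); last first.
    by move=> x; rewrite inE/= => ->.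
  rewrite integral_cst; last exact: measurable_level.
  case: n => [|n]; first by rewrite h00 mul0e.
  by rewrite mu_levelS EFinM.
- by move=> n; exact: measurable_level.
- apply/measurable_EFinP; apply: measurable_funTS; exact: measurable_comp_level.
- by move=> x _; rewrite lee_fin.
- by apply/trivIsetP => i j _ _ ij; apply/seteqP; split => x //= [-> /eqP]; rewrite (negbTE ij).
Qed.

Lemma Lp01_exists (v : nat -> R) :
  (\int[mu]_x (`|v (level x)| `^ p)%:E < +oo)%E ->
  exists f : Lp01 p1, {ae mu, forall x, (f x : R) = v (level x)}.
Proof.
move=> vfin.
pose F : mR -> mR := fun x => v (level x).
have mF : measurable_fun setT F := measurable_comp_level v.
pose Fm : {mfun mR >-> mR} := HB.pack F (isMeasurableFun.Build _ _ _ _ F mF).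
pose G : {mfun_ mu, mR >-> mR} := generic_quotient.pi {mfun_ mu, mR >-> mR} Fm.
have GF : {ae mu, forall x, (G x : R) = v (level x)}.
  have : ae_eq_op mu (generic_quotient.repr G) Fm.
    by apply/eqmodP; rewrite generic_quotient.reprK.
  move=> /asboolP; apply: filterS => x /= h; exact: h.
have mG : measurable_fun (setT : set mR) (G : mR -> R).
  exact: (measurable_funP (generic_quotient.repr G)).
have mpow (f : mR -> R) : measurable_fun (setT : set mR) f ->
    measurable_fun (setT : set mR) (fun x => (`|f x| `^ p)%:E : \bar R).
  move=> mf; apply/measurable_EFinP.
  apply: (@measurableT_comp _ _ _ _ _ _ (fun x : R => x `^ p)).
    exact: measurable_powR.
  exact: measurableT_comp.
have Gfin : finite_norm mu p%:E G.
  rewrite /finite_norm unlock; apply: poweR_lty.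
  rewrite (@ge0_ae_eq_integral _ _ _ mu setT _ (fun x => (`|v (level x)| `^ p)%:E))//.
  - exact: (mpow _ mG).
  - exact: (mpow _ mF).
  - by move=> x _; rewrite lee_fin powR_ge0.
  - by apply: filterS GF => x /= ->.
pose H : Lp01 p1 := HB.pack G (isFinLebesgue.Build _ _ _ _ _ p1 G Gfin).
by exists H.
Qed.

Lemma Lp01_realize (I : countType) (H : Type) (h0 : H) (u : H -> I -> R) :
  (forall g h, \esum_(i in setT) (`|u g i - u h i| `^ p)%:E < +oo)%E ->
  exists Psi : H -> Lp01 p1, forall g h,
    ((energy (Psi g) (Psi h))%:E = \esum_(i in setT) (`|u g i - u h i| `^ p)%:E)%E.
Proof.
move=> ufin.
(* Subtracting the values at the base point [h0] makes each row p-summable, and the power of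
   [weight] cancels the measure of the interval. *)
pose v (g : H) n : R := if n is n'.+1 then
  if @pickle_inv I n' is Some i then (u g i - u h0 i) * weight n' `^ (- p^-1) else 0
  else 0.
have key g h : (\int[mu]_x (`|v g (level x) - v h (level x)| `^ p)%:E =
    \esum_(i in setT) (`|u g i - u h i| `^ p)%:E)%E.
  rewrite (integral_level (h := fun n => `|v g n - v h n| `^ p)); last 2 first.
  - by move=> n; exact: powR_ge0.
  - by rewrite /v subrr normr0 powR0// gt_eqF.
  pose D := range (fun i : I => (pickle i).+1).
  transitivity (\esum_(n in D) (if n is n'.+1 then
      `|v g n - v h n| `^ p * weight n' else 0)%:E)%E.
    rewrite [RHS]esum_mkcond; apply: eq_esum => n _.
    case: ifPn => // nD; case: n nD => // n nD.
    rewrite /v; case E : (@pickle_inv I n) => [i|]; last first.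
      by rewrite subrr normr0 powR0 ?mul0r// gt_eqF.
    exfalso; move/negP: nD; apply; rewrite inE; exists i => //.
    by have := @pickle_invK I n; rewrite E /= => ->.
  rewrite (@reindex_esum R I nat setT D (fun i : I => (pickle i).+1)); last first.
    split.
    - by move=> i _; exists i.
    - by move=> i j _ _ [] /(pcan_inj pickleK).
    - by move=> n [i _ <-]; exists i.
  apply: eq_esum => i _; congr (_%:E).
  rewrite /v pickleK_inv -mulrBl normrM powRM// (ger0_norm (powR_ge0 _ _)).
  rewrite -powRrM mulNr mulVf ?gt_eqF// powR_inv1 ?(ltW (weight_gt0 _))//.
  rewrite -mulrA mulVf ?mulr1 ?gt_eqF ?weight_gt0//.
  by rewrite opprB addrA subrK.
have fin g : (\int[mu]_x (`|v g (level x)| `^ p)%:E < +oo)%E.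
  rewrite (_ : (fun x => _) = (fun x => (`|v g (level x) - v h0 (level x)| `^ p)%:E)).
    by rewrite key.
  apply/funext => x; rewrite (_ : v h0 (level x) = 0) ?subr0//.
  rewrite /v; case: (level x) => // n; case: (@pickle_inv I n) => // i.
  by rewrite subrr mul0r.
have [Psi HPsi] := choice (fun g => Lp01_exists (fin g)).
exists Psi => g h; rewrite energyE -key.
apply: ge0_ae_eq_integral => //.
- exact: measurable_diff_pow.
- apply/measurable_EFinP.
  by apply: (measurable_comp_level (fun n => `|v g n - v h n| `^ p)).
- by apply: filterS2 (HPsi g) (HPsi h) => x /= -> ->.
Qed.

End Realization.

(** * Dihedral lamps *)

Section Tent.
Implicit Types (m : nat) (z q : int).


(* Distance from z to the multiples of m. *)
Definition tent m z : nat := minn `|(z %% m)%Z| (m - `|(z %% m)%Z|).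

Lemma tent_le m z q : (0 < m)%N -> (tent m z <= absz (z + q * m)%R)%N.
Proof.
move=> m0; rewrite /tent.
have h1 := modz_ge0 z (_ : m%:Z != 0); have h2 := ltz_pmod z (_ : 0 < m%:Z).
have {h1}h1 : 0 <= (z %% m)%Z by apply: h1; lia.
have {h2}h2 : (z %% m)%Z < m by apply: h2; lia.
have e := divz_eq z m.
set r := (z %% m)%Z in h1 h2 e *; set d := (z %/ m)%Z in e.
have -> : z + q * m = (d + q) * m + r by rewrite {1}e; ring.
move: (d + q) => t; case: (ltrgtP t 0) => ht.
- have : t * m <= - m%:Z by nia.
  lia.
- have : m%:Z <= t * m by nia.
  lia.
- by rewrite ht; lia.
Qed.

Lemma tent_ex m z : (0 < m)%N -> exists q, tent m z = absz (z + q * m)%R.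
Proof.
move=> m0; rewrite /tent.
have h1 : 0 <= (z %% m)%Z by apply: modz_ge0; lia.
have h2 : (z %% m)%Z < m by apply: ltz_pmod; lia.
have e := divz_eq z m.
set r := (z %% m)%Z in h1 h2 e *; set d := (z %/ m)%Z in e.
have [h|h] := leP `|r|%N (m - `|r|)%N.
  exists (- d); rewrite {1}e; have -> : d * m + r + - d * m = r by ring.
  lia.
exists (- d - 1); rewrite {1}e.
have -> : d * m + r + (- d - 1) * m = r - m%:Z by ring.
lia.
Qed.

Lemma tent_eqmod m z z' q : (0 < m)%N -> z' = z + q * m -> tent m z' = tent m z.
Proof.
move=> m0 ->; apply/eqP; rewrite eqn_leq; apply/andP; split.
  have [t ->] := tent_ex z m0; have := tent_le (z + q * m) (t - q) m0.
  by have -> : z + q * m + (t - q) * m = z + t * m by ring.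
have [t ->] := tent_ex (z + q * m) m0; have := tent_le z (q + t) m0.
by have -> : z + (q + t) * m = z + q * m + t * m by ring.
Qed.

Lemma tentN m z : (0 < m)%N -> tent m (- z) = tent m z.
Proof.
move=> m0; apply/eqP; rewrite eqn_leq; apply/andP; split.
  have [t ->] := tent_ex z m0; have := tent_le (- z) (- t) m0; lia.
have [t ->] := tent_ex (- z) m0; have := tent_le z (- t) m0; lia.
Qed.

Lemma tentD m z z' : (0 < m)%N -> (tent m (z + z') <= tent m z + tent m z')%N.
Proof.
move=> m0; have [t ->] := tent_ex z m0; have [t' ->] := tent_ex z' m0.
have := tent_le (z + z') (t + t') m0; lia.
Qed.

Lemma tent_abs m z : (0 < m)%N -> (tent m z <= `|z|)%N.
Proof. by move=> m0; have := tent_le z 0 m0; rewrite mul0r addr0. Qed.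

Lemma tent_lip m z z' : (0 < m)%N -> (tent m z <= tent m z' + absz (z - z')%R)%N.
Proof.
move=> m0; have := tentD z' (z - z') m0; have := tent_abs (z - z') m0.
have -> : z' + (z - z') = z by ring.
lia.
Qed.

Lemma tent_small m z : (0 < m)%N -> (2 * `|z| <= m)%N -> tent m z = `|z|%N.
Proof.
move=> m0 zm; apply/eqP; rewrite eqn_leq tent_abs//=.
have [q ->] := tent_ex z m0; case: (ltrgtP q 0) => hq.
- have : q * m <= - m%:Z by nia.
  lia.
- have : m%:Z <= q * m by nia.
  lia.
- by rewrite hq mul0r addr0.
Qed.

Lemma tent_le_half m z : (0 < m)%N -> (2 * tent m z <= m)%N.
Proof. by rewrite /tent; lia. Qed.

Lemma tent_double m z : (0 < m)%N -> tent (2 * m) (2 * z) = (2 * tent m z)%N.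
Proof.
move=> m0; have m20 : (0 < 2 * m)%N by lia.
apply/eqP; rewrite eqn_leq; apply/andP; split.
  have [q ->] := tent_ex z m0; have := tent_le (2 * z) q m20.
  have -> : 2 * z + q * (2 * m)%N = 2 * (z + q * m) by rewrite PoszM; ring.
  lia.
have [q ->] := tent_ex (2 * z) m20; have := tent_le z q m0.
have -> : 2 * z + q * (2 * m)%N = 2 * (z + q * m) by rewrite PoszM; ring.
lia.
Qed.

(* On the circle of length 4c the distances to two points a quarter turn apart
   determine the distance of two points up to a factor 2. *)
Lemma two_tents c z z' : (0 < c)%N ->
  (tent (4 * c) (z - z') <=
   2 * maxn (absz ((tent (4 * c) z)%:Z - (tent (4 * c) z')%:Z)%R)
            (absz ((tent (4 * c) (z + c))%:Z - (tent (4 * c) (z' + c))%:Z)%R))%N.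
Proof.
move=> c0; set m := (4 * c)%N; have m0 : (0 < m)%N by lia.
have red (y : int) : exists2 q : int, 0 <= y + q * m & y + q * m < m.
  have e := divz_eq y m; exists (- (y %/ m)%Z).
    have -> : y + - (y %/ m)%Z * m = (y %% m)%Z by rewrite {1}e; ring.
    by apply: modz_ge0; lia.
  have -> : y + - (y %/ m)%Z * m = (y %% m)%Z by rewrite {1}e; ring.
  by apply: ltz_pmod; lia.
have [q q1 q2] := red z; have [q' q1' q2'] := red z'.
rewrite -(tent_eqmod (z := z) (q := q) m0 erefl).
rewrite -(tent_eqmod (z := z') (q := q') m0 erefl).
have -> : tent m (z + c) = tent m (z + q * m + c).
  by symmetry; apply: (tent_eqmod (q := q)) => //; ring.
have -> : tent m (z' + c) = tent m (z' + q' * m + c).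
  by symmetry; apply: (tent_eqmod (q := q')) => //; ring.
have -> : tent m (z - z') = tent m (z + q * m - (z' + q' * m)).
  by symmetry; apply: (tent_eqmod (q := q - q')) => //; ring.
move: (z + q * m) (z' + q' * m) q1 q2 q1' q2' => x x' x1 x2 x1' x2'.
have small (y : int) : 0 <= y -> y < m -> tent m y = minn `|y|%N (m - `|y|)%N.
  by move=> y0 ym; rewrite /tent modz_small//; lia.
have shifted (y : int) : 0 <= y -> y < m ->
    tent m (y + c) = if y + c%:Z < m%:Z then minn (absz (y + c)%R) (m - absz (y + c)%R)%N
                     else absz (y + c%:Z - m%:Z)%R.
  move=> y0 ym; case: ifP => h; first by apply: small; lia.
  rewrite -(tent_eqmod (z := y + c) (q := -1) m0 erefl) small; lia.
have diff : tent m (x - x') = minn (absz (x - x')%R) (m - absz (x - x')%R)%N.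
  case: (lerP 0 (x - x')) => h; first by apply: small; lia.
  rewrite -tentN// small; lia.
have mE : m%:Z = 4 * c%:Z by rewrite /m PoszM.
have T1 (y : int) : 0 <= y -> y < m ->
    (tent m y)%:Z = if y <= 2 * c%:Z then y else 4 * c%:Z - y.
  by move=> y0 ym; rewrite small//; case: ifP; lia.
have T2 (y : int) : 0 <= y -> y < m -> (tent m (y + c))%:Z =
    if y <= c then y + c%:Z else if y <= 3 * c%:Z then 3 * c%:Z - y else y - 3 * c%:Z.
  by move=> y0 ym; rewrite shifted//; do 3?case: ifP; lia.
have d1 : (tent m (x - x'))%:Z <= `|x - x'| by rewrite diff; lia.
have d2 : (tent m (x - x'))%:Z <= 4 * c%:Z - `|x - x'| by rewrite diff; lia.
move: (T1 _ x1 x2) (T1 _ x1' x2') (T2 _ x1 x2) (T2 _ x1' x2').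
move: (tent m (x - x')) (tent m x) (tent m x') (tent m (x + c)) (tent m (x' + c)) d1 d2.
move=> d t t' s s' d1 d2 Et Et' Es Es'.
suff : d%:Z <= `|t%:Z - t'%:Z| + `|s%:Z - s'%:Z| by lia.
rewrite Et Et' Es Es'; clear - c0 mE x1 x2 x1' x2' d1 d2.
case: (lerP x (2 * c%:Z)) => h1; case: (lerP x' (2 * c%:Z)) => h2;
case: (lerP x c%:Z) => h3; case: (lerP x' c%:Z) => h4; try lia;
case: (lerP x (3 * c%:Z)) => h5; case: (lerP x' (3 * c%:Z)) => h6; lia.
Qed.

End Tent.

Section Dihedral.
Context (gT : finGroupType) (l : nat) (a b : gT).
Hypothesis oa : #[a]%g = 2%N.
Hypothesis ob : #[b]%g = 2%N.
Hypothesis gen : <<[set a; b]%SET>>%g = [set: gT]%SET.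
Hypothesis card : #|gT| = (2 * l)%N.
Hypothesis l_even : ~~ odd l.
Hypothesis l_gt0 : (0 < l)%N.
Local Open Scope group_scope.

Definition rot : gT := a * b.

Lemma mulaa : a * a = 1. Proof. by rewrite -[LHS](expgS a 1) -oa expg_order. Qed.
Lemma mulbb : b * b = 1. Proof. by rewrite -[LHS](expgS b 1) -ob expg_order. Qed.
Lemma inva : a^-1 = a. Proof. by apply/eqP; rewrite eq_invg_mul mulaa. Qed.
Lemma invb : b^-1 = b. Proof. by apply/eqP; rewrite eq_invg_mul mulbb. Qed.

Lemma rot_conj : rot ^ a = rot^-1.
Proof. by rewrite /rot conjgE inva invMg inva invb !mulgA mulaa mul1g. Qed.

Lemma a_neq_b : a != b.
Proof.
apply/eqP => ab; move: (gen); rewrite -ab finset.setUid => h.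
have := card; rewrite -cardsT -h -orderE oa => e.
by move: l_even; rewrite (_ : l = 1)%N//; lia.
Qed.

Lemma dihedral_gen : <[rot]> * <[a]> = [set: gT]%SET.
Proof.
have nra : <[a]> \subset 'N(<[rot]>).
  by rewrite cycle_subG; apply/normP; rewrite -cycleJ rot_conj cycleV.
rewrite -norm_joinEr//; apply/eqP; rewrite finset.eqEsubset finset.subsetT/= -gen gen_subG.
rewrite finset.subUset !finset.sub1set mem_gen ?finset.inE ?cycle_id ?orbT//=.
have -> : b = a^-1 * rot by rewrite /rot mulKg.
by rewrite groupM ?groupV// mem_gen ?finset.inE ?cycle_id ?orbT.
Qed.

(** Otherwise [b] is a power of [rot] too; a cyclic group has at most one subgroup of order 2, so a
    = b, against [a_neq_b]. *)
Lemma a_notin_rot : a \notin <[rot]>.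
Proof.
apply/negP => ar; have br : b \in <[rot]>.
  have -> : b = a^-1 * rot by rewrite /rot mulKg.
  by rewrite groupM ?groupV ?cycle_id.
have : <[a]> == <[b]>.
  by rewrite (eq_subG_cyclic (cycle_cyclic rot)) ?cycle_subG// -!orderE oa ob.
move=> /eqP e; have : a \in <[b]> by rewrite -e cycle_id.
by rewrite (cycle2g ob) finset.in_set2 -order_eq1 oa (negbTE a_neq_b).
Qed.

Lemma order_rot : #[rot] = l.
Proof.
have tI : <[rot]> :&: <[a]> = 1%g.
  rewrite finset.setIC prime_TIg ?cycle_subG ?a_notin_rot//.
  by rewrite -orderE oa.
have := TI_cardMg tI; rewrite dihedral_gen cardsT card -!orderE oa.
by rewrite mulnC => /eqP; rewrite eqn_pmul2r// => /eqP.
Qed.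

Definition zrot (z : int) : gT := rot ^+ `|(z %% l)%Z|.

Lemma zrotD z t : zrot (z + t)%R = zrot z * zrot t.
Proof.
have l0 : l%:Z != 0%R by lia.
rewrite /zrot -expgD -[in RHS]expg_mod_order -modzDm order_rot.
have h1 := modz_ge0 z l0; have h2 := modz_ge0 t l0.
case: (z %% l)%Z h1 => // x _; case: (t %% l)%Z h2 => // y _.
by rewrite -PoszD modz_nat.
Qed.

Lemma zrot0 : zrot 0 = 1. Proof. by rewrite /zrot mod0z expg0. Qed.

Lemma zrotN z : zrot (- z)%R = (zrot z)^-1.
Proof. by apply: (mulgI (zrot z)); rewrite mulgV -zrotD subrr zrot0. Qed.

Lemma zrot1 : zrot 1 = rot.
Proof.
have l1 : (1 < l)%N by case: (l) l_even l_gt0 => [|[]].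
by rewrite /zrot modz_small//; lia.
Qed.

Lemma zrot_eq z t : zrot z = zrot t -> exists q : int, t = (z + q * l)%R.
Proof.
have l0 : l%:Z != 0%R by lia.
move/eqP; rewrite /zrot eq_expg_mod_order order_rot => /eqP h.
exists ((t %/ l)%Z - (z %/ l)%Z)%R.
have h1 := modz_ge0 z l0; have h2 := modz_ge0 t l0.
have h1' := ltz_pmod z (_ : (0 < l%:Z)%R); have h2' := ltz_pmod t (_ : (0 < l%:Z)%R).
have {h1'}h1' := h1' l_gt0; have {h2'}h2' := h2' l_gt0.
move: h; rewrite !modn_small; [|lia|lia] => h.
rewrite {1}(divz_eq t l) {1}(divz_eq z l).
have -> : (t %% l)%Z = (z %% l)%Z by lia.
ring.
Qed.

Definition bexp (e : bool) (x : gT) : gT := if e then x else 1.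

Lemma a_zrot z : a * zrot z = zrot (- z)%R * a.
Proof.
have -> : zrot (- z)%R = zrot z ^ a.
  by rewrite zrotN /zrot conjXg rot_conj expVgn.
by rewrite conjgE inva -!mulgA mulaa mulg1.
Qed.

Lemma coord_ex x : exists c : int * bool, x = zrot c.1 * bexp c.2 a.
Proof.
have : x \in <[rot]> * <[a]> by rewrite dihedral_gen finset.inE.
case/imset2P => y t /cycleP[i ->]; rewrite cycle2g// !finset.inE => ta ->.
exists (i%:Z, t == a); congr (_ * _) => /=.
  by rewrite /zrot modz_nat /= -order_rot expg_mod_order.
by case/orP: ta => /eqP ->; rewrite /bexp ?eqxx//; case: eqP.
Qed.

(** Coordinates r^i a^e with i chosen in its class modulo [l]; hence the multiples [q * l] in the
    statements on [idx]. *)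
Definition coord x : int * bool := sval (cid (coord_ex x)).
Definition idx x : int := (coord x).1.
Definition refl x : bool := (coord x).2.

Lemma coordE x : x = zrot (idx x) * bexp (refl x) a.
Proof. exact: svalP (cid (coord_ex x)). Qed.

Lemma coord_inj z e z' e' : zrot z * bexp e a = zrot z' * bexp e' a ->
  e = e' /\ exists q : int, z' = (z + q * l)%R.
Proof.
have nr t : zrot t \in <[rot]> by rewrite mem_cycle.
have key t t' : zrot t * a = zrot t' -> False.
  move=> h; have := a_notin_rot.
  have -> : a = (zrot t)^-1 * zrot t' by rewrite -h mulKg.
  by rewrite groupM ?groupV.
case: e; case: e' => /=; rewrite /bexp ?mulg1 => h; split => //.
- by apply: zrot_eq; exact: (mulIg a).
- by have := key _ _ h.
- by have := key _ _ h.
- by have := key _ _ (esym h).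
- by have := key _ _ (esym h).
- exact: zrot_eq.
Qed.

Lemma bexp_zrot e z : bexp e a * zrot z = zrot (if e then - z else z)%R * bexp e a.
Proof. by case: e; rewrite /bexp ?a_zrot// mul1g mulg1. Qed.

Lemma coordM x y : refl (x * y) = refl x (+) refl y /\
  exists q : int, (idx (x * y) = idx x + (if refl x then - idx y else idx y) + q * l)%R.
Proof.
have h : zrot (idx x + (if refl x then - idx y else idx y))%R *
    bexp (refl x (+) refl y) a = zrot (idx (x * y)) * bexp (refl (x * y)) a.
  rewrite -coordE [in RHS](coordE x) [in RHS](coordE y) zrotD.
  have -> : zrot (idx x) * bexp (refl x) a * (zrot (idx y) * bexp (refl y) a) =
    zrot (idx x) * (bexp (refl x) a * zrot (idx y)) * bexp (refl y) a by rewrite !mulgA.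
  rewrite bexp_zrot -!mulgA; do 2!congr (_ * _).
  by case: (refl x); case: (refl y); rewrite /bexp/= ?mulaa ?mulg1 ?mul1g.
by have [<- [q ->]] := coord_inj h; split => //; exists q.
Qed.

Lemma coordP z e x : x = zrot z * bexp e a ->
  refl x = e /\ exists q : int, idx x = (z + q * l)%R.
Proof.
move=> h; have := coordE x; rewrite {1}h => /coord_inj[-> [q ->]].
by split => //; exists q.
Qed.

Lemma coord_a : refl a = true /\ exists q : int, idx a = (0 + q * l)%R.
Proof. by apply: coordP; rewrite zrot0 mul1g. Qed.

Lemma coord_b : refl b = true /\ exists q : int, idx b = (- 1 + q * l)%R.
Proof.
apply: coordP; rewrite zrotN zrot1 /rot invMg inva invb /bexp -mulgA mulaa mulg1//.
Qed.

Lemma coord_1 : refl 1 = false /\ exists q : int, idx 1 = (0 + q * l)%R.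
Proof. by apply: coordP; rewrite zrot0 mul1g. Qed.

(* Parities of the numbers of letters a and b in a word for x: the
   abelianization map, well defined since l is even. *)
Definition nb x : bool := odd `|idx x|.
Definition na x : bool := nb x (+) refl x.

Lemma odd_mod (z q : int) : odd `|(z + q * l)%R| = odd `|z|.
Proof.
have [h ->] : exists h, l = h.*2 by exists l./2; rewrite even_halfK.
have : odd (absz (q * h.*2%:Z)%R) = false by rewrite abszM oddM odd_double andbF.
move: (q * _)%R => t; lia.
Qed.

Lemma nbM x y : nb (x * y) = nb x (+) nb y.
Proof.
rewrite /nb; have [_ [q ->]] := coordM x y; rewrite odd_mod.
by case: (refl x); move: (idx x) (idx y) => [m|m] [n|n]; lia.
Qed.

Lemma naM x y : na (x * y) = na x (+) na y.
Proof.
by rewrite /na nbM; have [-> _] := coordM x y; rewrite !addbA; congr (_ (+) _); rewrite addbAC.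
Qed.

Lemma nb_a : nb a = false.
Proof. by rewrite /nb; have [_ [q ->]] := coord_a; rewrite odd_mod. Qed.
Lemma nb_b : nb b = true.
Proof. by rewrite /nb; have [_ [q ->]] := coord_b; rewrite odd_mod. Qed.
Lemma na_a : na a = true.
Proof. by rewrite /na nb_a; have [-> _] := coord_a. Qed.
Lemma na_b : na b = false.
Proof. by rewrite /na nb_b; have [-> _] := coord_b. Qed.
Lemma nb_1 : nb 1 = false.
Proof. by rewrite /nb; have [_ [q ->]] := coord_1; rewrite odd_mod. Qed.
Lemma na_1 : na 1 = false.
Proof. by rewrite /na nb_1; have [-> _] := coord_1. Qed.

Lemma nbV x : nb x^-1 = nb x.
Proof. by have := nbM x x^-1; rewrite mulgV nb_1; case: (nb x); case: (nb _). Qed.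
Lemma naV x : na x^-1 = na x.
Proof. by have := naM x x^-1; rewrite mulgV na_1; case: (na x); case: (na _). Qed.

Definition turns x : nat := tent l (idx x).

Lemma turnsM x y : (turns (x * y) <= turns x + turns y)%N.
Proof.
rewrite /turns; have [_ [q ->]] := coordM x y.
rewrite (tent_eqmod (q := q) l_gt0 erefl).
have := tentD (idx x) (if refl x then - idx y else idx y)%R l_gt0.
by case: ifP => _ //; rewrite tentN.
Qed.

Lemma turns_a : turns a = 0%N.
Proof.
rewrite /turns; have [_ [q ->]] := coord_a.
by rewrite (tent_eqmod (q := q) l_gt0 erefl); apply/eqP; rewrite -leqn0 (leq_trans (tent_abs _ _)).
Qed.

Lemma turns_1 : turns 1 = 0%N.
Proof.
rewrite /turns; have [_ [q ->]] := coord_1.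
by rewrite (tent_eqmod (q := q) l_gt0 erefl); apply/eqP; rewrite -leqn0 (leq_trans (tent_abs _ _)).
Qed.

Lemma turns_b : (turns b <= 1)%N.
Proof.
rewrite /turns; have [_ [q ->]] := coord_b.
by rewrite (tent_eqmod (q := q) l_gt0 erefl) (leq_trans (tent_abs _ _)).
Qed.

Definition comm_ab : gT := a * b * a^-1 * b^-1.

Lemma comm_abE : comm_ab = zrot 2.
Proof.
rewrite /comm_ab inva invb (_ : 2 = 1 + 1)%R// zrotD zrot1 /rot.
by rewrite !mulgA.
Qed.

(** Even parities leave the even powers of r, that is the powers of the commutator of a and b. The
    exponent of smallest absolute value modulo [l] is taken, so that its cost is governed by the
    number of turns. *)
Lemma kernel_na_nb x : na x = false -> nb x = false ->
  exists2 v : int, x = zrot (2 * v)%R & (2 * `|v|)%N = turns x.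
Proof.
rewrite /na => + nx; rewrite nx/= => rx.
have [q hq] := tent_ex (idx x) l_gt0.
have ev : odd `|(idx x + q * l)%R| = false by rewrite odd_mod.
have [v hv] : exists v : int, (idx x + q * l = 2 * v)%R.
  case: (idx x + q * l)%R ev => n /= hn.
    by exists (n./2)%:Z; have := odd_double_half n; lia.
  by exists (- (n.+1./2)%:Z)%R; have := odd_double_half n.+1; rewrite /=; lia.
exists v.
  rewrite {1}(coordE x) rx /bexp mulg1 -hv zrotD.
  have -> : zrot (q * l)%R = 1 by rewrite /zrot modzMl expg0.
  by rewrite mulg1.
by rewrite /turns hq hv; lia.
Qed.

End Dihedral.

(** * Word length in the diagonal product *)

Section Ball.
Context (G : groupType) (S : set G).
Local Open Scope group_scope.
Implicit Types (x y : G) (n m : nat).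

(** Length at most [n] together with membership in the subgroup, outside of which [word_length]
    takes a default value. *)
Definition ball n x : Prop :=
  exists w : seq G, [/\ is_word S w, \prod_(y <- w) y = x & (size w <= n)%N].

Lemma ball1 n : ball n 1.
Proof. by exists [::]; split => //; rewrite big_nil. Qed.

Lemma ball_leq n m x : (n <= m)%N -> ball n x -> ball m x.
Proof. by move=> nm [w [h1 h2 h3]]; exists w; split => //; exact: leq_trans nm. Qed.

Lemma ballM n m x y : ball n x -> ball m y -> ball (n + m) (x * y).
Proof.
move=> [w [h1 h2 h3]] [w' [h1' h2' h3']]; exists (w ++ w'); split.
- by move=> z; rewrite mem_cat => /orP[]; [exact: h1|exact: h1'].
- by rewrite big_cat/= h2 h2'.
- by rewrite size_cat leq_add.
Qed.

Lemma ball_gen x : S x -> ball 1 x.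
Proof.
move=> Sx; exists [:: x]; split => //; last by rewrite big_seq1.
by move=> y; rewrite mem_seq1 => /eqP ->; left.
Qed.

Lemma prod_rev_inv (w : seq G) :
  \prod_(y <- rev (map (fun z => z^-1) w)) y = (\prod_(y <- w) y)^-1.
Proof.
elim: w => [|z w IH] /=; first by rewrite !big_nil invg1.
by rewrite rev_cons -cats1 big_cat/= big_seq1 big_cons invMg IH.
Qed.

Lemma ballV n x : ball n x -> ball n x^-1.
Proof.
move=> [w [h1 h2 h3]]; exists (rev (map (fun z => z^-1) w)); split.
- move=> y; rewrite mem_rev => /mapP[z zw ->]; rewrite invgK.
  by have [|] := h1 z zw; [right|left].
- by rewrite prod_rev_inv h2.
- by rewrite size_rev size_map.
Qed.

Lemma ball_subgroup n x : ball n x -> generated_subgroup S x.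
Proof. by move=> [w [h1 h2 _]]; exists w. Qed.

Lemma word_length_spec x : generated_subgroup S x ->
  (exists w, [/\ is_word S w, \prod_(y <- w) y = x & size w = word_length S x])
    /\ (forall w, is_word S w -> \prod_(y <- w) y = x -> (word_length S x <= size w)%N).
Proof.
move=> [w0 h0 e0]; rewrite /word_length.
set P := (X in xget _ X).
suff [n Pn] : exists n, P n by exact: (xgetPex 0%N (ex_intro _ n Pn)).
pose Q n := `[< exists w, [/\ is_word S w, \prod_(y <- w) y = x & size w = n] >].
have exQ : exists n, Q n by exists (size w0); apply/asboolP; exists w0.
case: (ex_minnP exQ) => n /asboolP Qn hn; exists n; split => // w hw ew.
by apply: hn; apply/asboolP; exists w.
Qed.

Lemma ball_word_length x : generated_subgroup S x -> ball (word_length S x) x.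
Proof.
by move=> /word_length_spec[[w [h1 h2 h3]] _]; exists w; split => //; rewrite h3.
Qed.

Lemma word_length_le n x : ball n x -> (word_length S x <= n)%N.
Proof.
move=> h; have [_ hw] := word_length_spec (ball_subgroup h).
by move: h => [w [h1 h2 h3]]; apply: leq_trans h3; exact: hw.
Qed.

Lemma ballS n x : ball n.+1 x -> ball n x \/
  exists y s, [/\ ball n y, S s \/ S s^-1 & x = y * s].
Proof.
move=> [w]; case/lastP: w => [|w s] [h1 h2 h3].
  by left; rewrite -h2 big_nil; exact: ball1.
right; exists (\prod_(y <- w) y), s; split.
- exists w; split => //; last by move: h3; rewrite size_rcons.
  by move=> y yw; apply: h1; rewrite mem_rcons inE yw orbT.
- by apply: h1; rewrite mem_rcons inE eqxx.
- by rewrite -h2 -cats1 big_cat big_seq1.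
Qed.

Lemma ball0 x : ball 0 x -> x = 1.
Proof. by move=> [[|y w] [_ <- //]] _; rewrite big_nil. Qed.

Lemma generated_subgroup_ind (P : G -> Prop) :
  P 1 -> (forall x y, P x -> P y -> P (x * y)) -> (forall x, P x -> P x^-1) ->
  (forall s, S s -> P s) -> forall x, generated_subgroup S x -> P x.
Proof.
move=> P1 PM PV PS x [w hw <-]; elim: w hw => [|y w IH] hw.
  by rewrite big_nil.
rewrite big_cons; apply: PM.
  have [/PS//|/PS/PV] := hw y (mem_head _ _); by rewrite invgK.
by apply: IH => z zw; apply: hw; rewrite inE zw orbT.
Qed.

End Ball.

(** * Sweeps and elements supported at one level *)

Section Delta.
Context (G : nat -> groupType) (a b : forall s, G s) (k : nat -> nat).
Local Notation D := (dirprod (fun s => wreath (G s))).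
Local Notation tau := (diag_tau G).
Local Notation alpha := (diag_alpha a).
Local Notation beta := (diag_beta b k).
Local Notation gens := (diag_gens a b k).
Implicit Types (x y : D) (s t n : nat) (j i z : int).

Definition lam x s j : G s := lamp (x s) j.
Definition cur x s : int := cursor (x s).

Lemma lamM x y s j : lam (x * y)%g s j = (lam x s j * lam y s (j - cur x s)%R)%g.
Proof. by []. Qed.
Lemma curM x y s : cur (x * y)%g s = cur x s + cur y s.
Proof. by []. Qed.
Lemma lamV x s j : lam (x^-1)%g s j = ((lam x s (j + cur x s)%R)^-1)%g.
Proof. by []. Qed.
Lemma curV x s : cur (x^-1)%g s = - cur x s.
Proof. by []. Qed.
Lemma lam1 s j : lam (1%g : D) s j = 1%g.
Proof. by []. Qed.
Lemma cur1 s : cur (1%g : D) s = 0.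
Proof. by []. Qed.

Lemma D_ext x y : (forall s j, lam x s j = lam y s j) ->
  (forall s, cur x s = cur y s) -> x = y.
Proof.
move=> h1 h2; apply: functional_extensionality_dep => s.
by apply: wreath_ext; [exact: h1|exact: h2].
Qed.

Definition tauz (i : int) : D := fun s => Wreath i (lamp_finite (wreath_one (G s))).

Lemma lam_tauz i s j : lam (tauz i) s j = 1%g. Proof. by []. Qed.
Lemma cur_tauz i s : cur (tauz i) s = i. Proof. by []. Qed.

Lemma tauzD i i' : tauz (i + i')%R = (tauz i * tauz i')%g.
Proof. by apply: D_ext => // s j; rewrite lamM !lam_tauz mulg1. Qed.

Lemma tauzV i : tauz (- i)%R = ((tauz i)^-1)%g.
Proof. by apply: D_ext => // s j; rewrite lamV !lam_tauz invg1. Qed.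

Lemma tauz1 : tauz 1 = tau.
Proof. by apply: D_ext. Qed.

Lemma tauz0 : tauz 0 = 1%g.
Proof. by apply: D_ext. Qed.

Lemma lam_alpha s j : lam alpha s j = if j == 0 then a s else 1%g.
Proof. by []. Qed.
Lemma lam_beta s j : lam beta s j = if j == (k s)%:Z then b s else 1%g.
Proof. by []. Qed.
Lemma cur_alpha s : cur alpha s = 0. Proof. by []. Qed.
Lemma cur_beta s : cur beta s = 0. Proof. by []. Qed.

Lemma ball_tauz i : ball gens `|i|%N (tauz i).
Proof.
have h n : ball gens n (tauz n%:Z).
  elim: n => [|n IH]; first by rewrite tauz0; exact: ball1.
  rewrite -addn1 PoszD tauzD; apply: ballM => //.
  by rewrite tauz1; apply: ball_gen; constructor.
case: (intP i) => [|n|n]; first exact: (h 0%N).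
  exact: (h n.+1).
by rewrite tauzV abszN; apply: ballV; exact: (h n.+1).
Qed.

Lemma ball_alpha : ball gens 1 alpha.
Proof. by apply: ball_gen; constructor 2. Qed.
Lemma ball_beta : ball gens 1 beta.
Proof. by apply: ball_gen; constructor 3. Qed.

Section Sweep.
Context (gam : D) (P : nat -> nat) (c : forall s, G s).
Hypothesis lam_gam : forall s j, lam gam s j = if j == (P s)%:Z then c s else 1%g.
Hypothesis cur_gam : forall s, cur gam s = 0.
Hypothesis ball_gam : ball gens 1 gam.

Fixpoint sweep_word n (F : int -> bool) : D :=
  if n is n'.+1 then
    ((if F 0 then gam else 1) * (tau * sweep_word n' (fun i => F (i + 1)%R)))%g
  else 1%g.

Lemma ball_sweep_word n F : ball gens (2 * n) (sweep_word n F).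
Proof.
elim: n F => [|n IH] F; first exact: ball1.
rewrite mulnS -[2%N]/(1 + 1)%N -addnA; apply: ballM.
  by case: (F 0) => //; exact: ball1.
by apply: ballM => //; rewrite -tauz1; exact: (ball_tauz 1).
Qed.

Lemma cur_sweep_word n F s : cur (sweep_word n F) s = n%:Z.
Proof.
elim: n F => [|n IH] F //=; rewrite !curM IH.
have -> : cur (if F 0 then gam else 1%g) s = 0 by case: (F 0).
by rewrite add0r -tauz1 cur_tauz -[n.+1]addn1 PoszD addrC.
Qed.

Lemma lam_sweep_word n F s j : lam (sweep_word n F) s j =
  if [&& 0 <= j - (P s)%:Z, j - (P s)%:Z < n%:Z & F (j - (P s)%:Z)] then c s else 1%g.
Proof.
elim: n F j => [|n IH] F j /=.
  by rewrite lam1; case: ifP => // /and3P[]; lia.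
rewrite !lamM -tauz1 lam_tauz mul1g IH.
have -> : lam (if F 0 then gam else 1%g) s j =
    if (j == (P s)%:Z) && F 0 then c s else 1%g.
  by case: (F 0); rewrite ?andbT ?andbF.
have -> : cur (if F 0 then gam else 1%g) s = 0 by case: (F 0).
rewrite subr0 cur_tauz.
have [->|jP] := eqVneq j (P s)%:Z.
  rewrite subrr /=; case: (F 0) => /=.
    by rewrite ifF ?mulg1//; apply/negP => /and3P[]; lia.
  by rewrite mul1g ifF//; apply/negP => /and3P[]; lia.
rewrite mul1g; have -> : j - 1 - (P s)%:Z + 1 = j - (P s)%:Z by ring.
congr (if _ then _ else _); apply/and3P/and3P => -[h1 h2 h3]; split => //; lia.
Qed.

Definition sweep i n (F : int -> bool) : D :=
  (tauz i * sweep_word n (fun z => F (z + i)%R) * tauz (- (n%:Z + i)))%g.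

Lemma cur_sweep i n F s : cur (sweep i n F) s = 0.
Proof. by rewrite !curM !cur_tauz cur_sweep_word; ring. Qed.

Lemma lam_sweep i n (F : int -> bool) s j : (forall z, F z -> i <= z < i + n%:Z) ->
  lam (sweep i n F) s j = if F (j - (P s)%:Z)%R then c s else 1%g.
Proof.
move=> hF; rewrite !lamM !lam_tauz mul1g mulg1 lam_sweep_word cur_tauz.
have -> : j - i - (P s)%:Z + i = j - (P s)%:Z by ring.
case E : (F _); last by rewrite !andbF.
by have := hF _ E; move=> ?; rewrite ifT//; apply/and3P; split => //; lia.
Qed.

Lemma ball_sweep i n F : ball gens (`|i| + 2 * n + (n + `|i|)) (sweep i n F).
Proof.
apply: ballM; first apply: ballM; [exact: ball_tauz|exact: ball_sweep_word|].
by apply: ball_leq (ball_tauz _); lia.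
Qed.

End Sweep.

Definition sweep_a i n F := sweep alpha i n F.
Definition sweep_b i n F := sweep beta i n F.

Lemma lam_sweep_a i n (F : int -> bool) s j : (forall z, F z -> i <= z < i + n%:Z) ->
  lam (sweep_a i n F) s j = if F j then a s else 1%g.
Proof.
move=> hF; rewrite /sweep_a.
have h : forall s j, lam alpha s j = if j == ((fun=> 0%N) s)%:Z then a s else 1%g by [].
by rewrite (lam_sweep h)// subr0.
Qed.

Lemma lam_sweep_b i n (F : int -> bool) s j : (forall z, F z -> i <= z < i + n%:Z) ->
  lam (sweep_b i n F) s j = if F (j - (k s)%:Z) then b s else 1%g.
Proof.
move=> hF; rewrite /sweep_b.
have h : forall s j, lam beta s j = if j == (k s)%:Z then b s else 1%g by [].
by rewrite (lam_sweep h).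
Qed.

Lemma cur_sweep_a i n F s : cur (sweep_a i n F) s = 0.
Proof. exact: cur_sweep. Qed.
Lemma cur_sweep_b i n F s : cur (sweep_b i n F) s = 0.
Proof. exact: cur_sweep. Qed.

Lemma ball_sweep_a i n F : ball gens (`|i| + 2 * n + (n + `|i|)) (sweep_a i n F).
Proof. exact/ball_sweep/ball_alpha. Qed.
Lemma ball_sweep_b i n F : ball gens (`|i| + 2 * n + (n + `|i|)) (sweep_b i n F).
Proof. exact/ball_sweep/ball_beta. Qed.

Definition cab s : G s := (a s * b s * (a s)^-1 * (b s)^-1)%g.

Section Level.
Context (s K : nat).
Hypothesis sep : forall t, t <> s -> (K <= absz ((k t)%:Z - (k s)%:Z)%R)%N.
Hypothesis Kk : (K <= k s)%N.

(* The letters a on J and the letters b on J, brought to the same positions at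
   level s, sit at disjoint places at all other levels: their commutator
   lives at level s only. *)
Definition comm_sweep n (J : int -> bool) : D :=
  let A := sweep_a 0 n J in
  let B := (tauz (- (k s)%:Z) * sweep_b 0 n J * tauz (k s)%:Z)%g in
  (A * B * A^-1 * B^-1)%g.

Lemma cur_comm_sweep n J t : cur (comm_sweep n J) t = 0.
Proof.
rewrite /comm_sweep; set A := sweep_a _ _ _; set B := (tauz _ * _ * _)%g.
have cA : cur A t = 0 by exact: cur_sweep_a.
have cB : cur B t = 0.
  have -> : cur B t = - (k s)%:Z + cur (sweep_b 0 n J) t + (k s)%:Z by [].
  by rewrite cur_sweep_b; ring.
by move: (A) (B) cA cB => A' B' cA cB; rewrite !curM !curV cA cB; ring.
Qed.

Lemma lam_comm_sweep (J : int -> bool) t j : (forall z, J z -> 0 <= z < K%:Z) ->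
  lam (comm_sweep K J) t j = if (t == s) && J j then cab t else 1%g.
Proof.
move=> hJ; have hJ' z : J z -> 0 <= z < 0 + K%:Z by rewrite add0r; exact: hJ.
rewrite /comm_sweep; set A := sweep_a _ _ _; set B := (tauz _ * _ * _)%g.
have cA : cur A t = 0 by exact: cur_sweep_a.
have cB : cur B t = 0.
  have -> : cur B t = - (k s)%:Z + cur (sweep_b 0 K J) t + (k s)%:Z by [].
  by rewrite cur_sweep_b; ring.
have lA : lam A t j = if J j then a t else 1%g by exact: lam_sweep_a.
have lB : lam B t j = if J (j + (k s)%:Z - (k t)%:Z) then b t else 1%g.
  rewrite /B !lamM !lam_tauz mul1g mulg1 cur_tauz opprK; exact: lam_sweep_b.
have -> : lam (A * B * A^-1 * B^-1)%g t j = (lam A t j * lam B t j * (lam A t j)^-1 * (lam B t j)^-1)%g.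
  move: (A) (B) cA cB => A' B' cA cB; rewrite !lamM !lamV !curM !curV cA cB.
  by rewrite ?(addr0, subr0, oppr0).
rewrite lA lB.
have [->|ts] := eqVneq t s.
  by rewrite addrK /=; case: (J j); rewrite /cab ?mulg1 ?invg1 ?mulg1.
rewrite /=; case E1 : (J j); case E2 : (J _); rewrite ?mulg1 ?mul1g ?invg1 ?mulg1 ?mulgV//.
have := hJ _ E1; have := hJ _ E2; have := sep (elimN eqP ts); lia.
Qed.

Lemma ball_comm_sweep J : ball gens (16 * k s) (comm_sweep K J).
Proof.
have hA : ball gens (3 * k s) (sweep_a 0 K J).
  by apply: ball_leq (ball_sweep_a _ _ _); lia.
have hB : ball gens (5 * k s) (tauz (- (k s)%:Z) * sweep_b 0 K J * tauz (k s)%:Z)%g.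
  apply: (@ball_leq _ _ (k s + 3 * k s + k s)); first lia.
  apply: ballM; first apply: ballM.
  - by apply: ball_leq (ball_tauz _); lia.
  - by apply: ball_leq (ball_sweep_b _ _ _); lia.
  - by apply: ball_leq (ball_tauz _); lia.
apply: (@ball_leq _ _ (3 * k s + 5 * k s + 3 * k s + 5 * k s)); first lia.
by do 3?apply: ballM => //; exact: ballV.
Qed.

Context (rr : forall t, int -> G t).
Hypothesis rr0 : forall t, rr t 0 = 1%g.
Hypothesis rrD : forall t z z', rr t (z + z') = (rr t z * rr t z')%g.
Hypothesis rr1 : forall t, rr t 1 = cab t.

(** The lamps at level [s] are powers of the commutator: [rr t z] plays the role of the z-th power
    of [cab t]. *)
Definition at_level (v : int -> int) x : Prop :=
  (forall t, cur x t = 0) /\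
  forall t j, lam x t j = if t == s then rr t (v j) else 1%g.

Lemma rrN t z : rr t (- z) = ((rr t z)^-1)%g.
Proof. by apply: (mulgI (rr t z)); rewrite mulgV -rrD subrr rr0. Qed.

(** One commutator sweep on the positive sites and one on the negative sites bring all entries of
    the block closer to 0 at once. Hence [M] rounds of cost 32 k_s: the largest entry counts, not
    the sum. *)
Lemma at_level_block (M : nat) (v : int -> int) :
  (forall z, v z != 0 -> 0 <= z < K%:Z) -> (forall z, (`|v z| <= M)%N) ->
  exists2 x, at_level v x & ball gens (32 * k s * M) x.
Proof.
elim: M v => [|M IH] v hv hM.
  exists 1%g; last exact: ball1.
  split => // t j; rewrite lam1; case: eqP => // _.
  by have -> : v j = 0 by (have := hM j; lia); rewrite rr0.
pose v' z := v z - Num.sg (v z).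
have [|z|x [cx lx] bx] := IH v'.
- by move=> z h; apply: hv; move: h; rewrite /v'; case: (v z) => [[|n]|n].
- by have := hM z; rewrite /v'; case: sgzP; lia.
pose up := comm_sweep K (fun z => 0 < v z); pose dn := comm_sweep K (fun z => v z < 0).
have hup z : 0 < v z -> 0 <= z < K%:Z by move=> h; apply: hv; lia.
have hdn z : v z < 0 -> 0 <= z < K%:Z by move=> h; apply: hv; lia.
have cu t : cur up t = 0 by exact: cur_comm_sweep.
have cd t : cur dn t = 0 by exact: cur_comm_sweep.
have lu t j : lam up t j = if (t == s) && (0 < v j) then cab t else 1%g by exact: lam_comm_sweep.
have ld t j : lam dn t j = if (t == s) && (v j < 0) then cab t else 1%g by exact: lam_comm_sweep.
have bu : ball gens (16 * k s) up by exact: ball_comm_sweep.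
have bd : ball gens (16 * k s) dn by exact: ball_comm_sweep.
move: up dn cu cd lu ld bu bd => up dn cu cd lu ld bu bd.
exists (x * up * dn^-1)%g.
  split => [t|t j].
    by rewrite !curM curV cx cu cd oppr0 !addr0.
  rewrite !lamM lamV !curM cx cu cd ?addr0 ?subr0 lx lu ld.
   case: eqP => [_|_] /=; last by rewrite invg1 !mulg1.
  rewrite -rr1 -(rr0 t); case: (ltrgtP (v j) 0) => h /=.
  - by rewrite rr0 mulg1 -rrN -rrD /v' ltr0_sg// ; congr (rr t _); lia.
  - by rewrite rr0 invg1 mulg1 -rrD /v' gtr0_sg//; congr (rr t _); lia.
  - by rewrite rr0 invg1 !mulg1 /v' h sgr0 subr0.
apply: (@ball_leq _ _ (32 * k s * M + 16 * k s + 16 * k s)); first lia.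
by apply: ballM; [apply: ballM => //|apply: ballV].
Qed.

(** The later blocks are treated together, conjugated by tau^K, so that travelling adds only 2K per
    block. *)
Lemma at_level_blocks n (M : nat -> nat) (v : int -> int) : (0 < K)%N ->
  (forall z, v z != 0 -> 0 <= z < (n * K)%N%:Z) ->
  (forall (i : nat) z, (i < n)%N -> (i * K)%N%:Z <= z < (i.+1 * K)%N%:Z -> (`|v z| <= M i)%N) ->
  exists2 x, at_level v x &
    ball gens (\sum_(i < n) (32 * k s * M i) + 2 * (n * K)) x.
Proof.
move=> K0; elim: n M v => [|n IH] M v hv hM.
  exists 1%g; last exact: ball1.
  split => // t j; rewrite lam1; case: eqP => // _.
  have [->|/hv] := eqVneq (v j) 0; first by rewrite rr0.
  by rewrite mul0n; lia.
pose v0 z := if z < K%:Z then v z else 0.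
pose v' z := if 0 <= z then v (z + K%:Z) else 0.
have [z|z|x0 [cx0 lx0] bx0] := @at_level_block (M 0%N) v0.
- rewrite /v0; case: ifP => // h h'; have := hv _ h'; lia.
- rewrite /v0; case: ifP => // h; have [->//|h'] := eqVneq (v z) 0.
  by apply: hM => //; have := hv _ h'; rewrite mul0n mul1n; lia.
have [z|i z hi hz|x [cx lx] bx] := IH (fun i : nat => M i.+1) v'.
- by rewrite /v'; case: ifP => // h h'; have := hv _ h'; rewrite mulSn; lia.
- rewrite /v'; case: ifP => // h; apply: (hM i.+1) => //.
  by rewrite !mulSn in hz *; lia.
exists (x0 * (tauz K%:Z * x * tauz (- K%:Z)))%g.
  split => [t|t j].
    by rewrite !curM cx0 cx !cur_tauz; ring.
  rewrite !lamM cx0 subr0 !lam_tauz mul1g mulg1 cur_tauz lx0 lx.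
  case: eqP => [_|_]; last by rewrite mulg1.
  rewrite -rrD; congr (rr t _); rewrite /v0 /v' subr_ge0 subrK.
  by case: (ltrP j K%:Z) => h; rewrite ?addr0 ?add0r.
rewrite big_ord_recl/=.
have -> : (32 * k s * M 0 + \sum_(i < n) 32 * k s * M (bump 0 i) + 2 * (n.+1 * K) =
  32 * k s * M 0 + (K + (\sum_(i < n) 32 * k s * M i.+1 + 2 * (n * K)) + K))%N.
  rewrite (eq_bigr (fun i : 'I_n => 32 * k s * M i.+1)%N)//; rewrite mulSn; lia.
apply: ballM => //; apply: ballM; first apply: ballM => //.
  by have := ball_tauz K%:Z.
by have := ball_tauz (- K%:Z); rewrite abszN.
Qed.

Lemma at_level_interval (i0 : int) n (M : nat -> nat) (v : int -> int) : (0 < K)%N ->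
  (forall z, v z != 0 -> i0 <= z < i0 + (n * K)%N%:Z) ->
  (forall (i : nat) z, (i < n)%N -> i0 + (i * K)%N%:Z <= z < i0 + (i.+1 * K)%N%:Z ->
     (`|v z| <= M i)%N) ->
  exists2 x, at_level v x &
    ball gens (2 * `|i0| + (\sum_(i < n) (32 * k s * M i) + 2 * (n * K))) x.
Proof.
move=> K0 hv hM.
have [z h|i z hi hz|x [cx lx] bx] := @at_level_blocks n M (fun z => v (z + i0)) K0.
- by have := hv _ h; lia.
- by apply: (hM i) => //; lia.
exists (tauz i0 * x * tauz (- i0))%g.
  split => [t|t j]; first by rewrite !curM cx !cur_tauz; ring.
  by rewrite !lamM !lam_tauz mul1g mulg1 cur_tauz lx subrK.
rewrite mul2n -addnn -addnA addnCA addnA addnC addnA addnC.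
apply: (@ball_leq _ _ (`|i0| + (\sum_(i < n) (32 * k s * M i) + 2 * (n * K)) + `|i0|)).
  lia.
apply: ballM; first apply: ballM => //; first exact: ball_tauz.
by have := ball_tauz (- i0); rewrite abszN.
Qed.

End Level.

End Delta.

(** The argument sees the lamp groups through their generating involutions and orders; this
    abstracts from the concrete model of the dihedral groups. *)
Record diagonal := Diagonal {
  dl : nat -> nat; dk : nat -> nat;
  dG : nat -> finGroupType;
  da : forall s, dG s; db : forall s, dG s;
  doa : forall s, #[da s]%g = 2%N;
  dob : forall s, #[db s]%g = 2%N;
  dgen : forall s, <<[set da s; db s]%SET>>%g = [set: dG s]%SET;
  dcard : forall s, #|dG s| = (2 * dl s)%N;
  dl_even : forall s, ~~ odd (dl s);
  dl_gt0 : forall s, (0 < dl s)%N;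
  dl0 : dl 0%N = 2%N;
  dk_even : forall s, ~~ odd (dk s);
  dk0 : dk 0%N = 0%N;
  dk_growth : forall s, (2 * dk s < dk s.+1)%N }.

(** * Normal form and upper bound for the length *)

Section Diagonal.
Context (X : diagonal).
Local Notation l := (dl X).
Local Notation k := (dk X).
Local Notation a := (da X).
Local Notation b := (db X).
Local Notation D := (dirprod (fun s => wreath (dG X s))).
Implicit Types (x y : D) (s t n : nat) (j z : int).

Definition dgens : set D := diag_gens a b k.
Definition dna s (g : dG X s) : bool :=
  na (doa X s) (dob X s) (dgen X s) (dcard X s) (dl_even X s) (dl_gt0 X s) g.
Definition dnb s (g : dG X s) : bool :=
  nb (doa X s) (dob X s) (dgen X s) (dcard X s) (dl_even X s) (dl_gt0 X s) g.
Definition didx s (g : dG X s) : int :=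
  idx (doa X s) (dob X s) (dgen X s) (dcard X s) (dl_even X s) (dl_gt0 X s) g.
Definition drefl s (g : dG X s) : bool :=
  refl (doa X s) (dob X s) (dgen X s) (dcard X s) (dl_even X s) (dl_gt0 X s) g.
Definition dturns s (g : dG X s) : nat := tent (l s) (didx g).
Definition dzrot s z : dG X s := zrot (l s) (a s) (b s) z.

Lemma dk_lt s t : (s < t)%N -> (2 * k s < k t)%N.
Proof.
elim: t => // t IH; rewrite ltnS leq_eqVlt => /predU1P[->|/IH h]; first exact: dk_growth.
by have := dk_growth X t; lia.
Qed.

Lemma dk_exp s : (0 < s)%N -> (2 ^ s <= k s)%N.
Proof.
elim: s => // -[|s] IH _; last by have := dk_growth X s.+1; have := IH isT; rewrite !expnS; lia.
by have := dk_growth X 0; have := dk_even X 1; rewrite dk0; case: (k 1%N) => [|[|n]].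
Qed.

Lemma dk_leq s t : (s <= t)%N -> (k s <= k t)%N.
Proof. by rewrite leq_eqVlt => /predU1P[->//|/dk_lt]; lia. Qed.

Lemma dk_half s : (2 * (k s)./2)%N = k s.
Proof. by rewrite mul2n even_halfK ?dk_even. Qed.

Lemma dk_sep s t : t <> s -> ((k s)./2 <= absz ((k t)%:Z - (k s)%:Z)%R)%N.
Proof.
move=> ts; have := dk_half s; case: (ltngtP t s) => // /dk_lt; lia.
Qed.

(** Alpha acts at the same site on every level and beta is moved by k_s, so the parities at level
    [s] are shifted copies of those at level 0, where k_0 = 0. *)
Lemma abel x : generated_subgroup dgens x -> forall s,
  cur x s = cur x 0 /\ forall j, dna (lam x s j) = dna (lam x 0 j) /\
    dnb (lam x s j) = dnb (lam x 0 (j - (k s)%:Z)).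
Proof.
move: x; apply: generated_subgroup_ind.
- by move=> s; split => // j; rewrite !lam1 /dna /dnb !na_1 !nb_1.
- move=> x y hx hy s; have [cx {}hx] := hx s; have [cy {}hy] := hy s.
  split; first by rewrite !curM cx cy.
  move=> j; rewrite !lamM cx /dna /dnb !naM !nbM.
  have [h1 h2] := hx j; have [h3 h4] := hy (j - cur x 0).
  rewrite /dna /dnb in h1 h2 h3 h4; rewrite h1 h2 h3 h4.
  by have -> : j - cur x 0 - (k s)%:Z = j - (k s)%:Z - cur x 0 by ring.
- move=> x hx s; have [cx {}hx] := hx s; split; first by rewrite !curV cx.
  move=> j; rewrite !lamV cx /dna /dnb !naV !nbV.
  have [h1 h2] := hx (j + cur x 0); rewrite /dna /dnb in h1 h2; rewrite h1 h2.
  by have -> : j + cur x 0 - (k s)%:Z = j - (k s)%:Z + cur x 0 by ring.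
move=> x [] -> s; split => // j.
- by rewrite /dna /dnb [lam _ _ _]/= ![lam (diag_tau _) _ _]/= !na_1 !nb_1.
- rewrite !lam_alpha; split; first by case: eqP; rewrite /dna ?na_a ?na_1.
  by do 2!case: eqP => _; rewrite /dnb ?nb_a ?nb_1.
- rewrite !lam_beta dk0 subr_eq0; split; last by case: eqP; rewrite /dnb ?nb_b ?nb_1.
  by do 2!case: eqP => _; rewrite /dna ?na_b ?na_1.
Qed.

Lemma kernel_level s (g : dG X s) : dna g = false -> dnb g = false ->
  exists v : int, g = dzrot s (2 * v) /\ (2 * `|v|)%N = dturns g.
Proof. by move=> h1 h2; have [v] := kernel_na_nb h1 h2; exists v. Qed.

(** As l_0 = 2, at most one turn is possible, and 2|v| <= 1 forces v = 0: parities determine the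
    lamps of level 0. *)
Lemma kernel_level0 (g : dG X 0) : dna g = false -> dnb g = false -> g = 1%g.
Proof.
move=> h1 h2; have [v [gE hv]] := kernel_level h1 h2.
have := tent_le_half (didx g) (dl_gt0 X 0); rewrite -/(dturns g) -hv dl0 => v0.
have {}v0 : v = 0 by lia.
by rewrite gE v0 mulr0 /dzrot zrot0.
Qed.

(** The traces beyond [L] of a path whose cursor stays at most [L]: only letters [b], which are
    written [k s] to the right of the cursor. [left_range] is the mirror condition for [a]. *)
Definition right_range x (L : nat) : Prop := forall s j, L%:Z < j ->
  (lam x s j = 1%g \/ lam x s j = b s) /\ (L%:Z + (k s)%:Z < j -> lam x s j = 1%g).
Definition left_range x (L : nat) : Prop := forall s j, j < - L%:Z + (k s)%:Z ->
  (lam x s j = 1%g \/ lam x s j = a s) /\ (j < - L%:Z -> lam x s j = 1%g).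

(** For [x] of range [L] this has length O(L) and, by [abel], the same parities as [x] at all levels
    although only those of level 0 are copied. *)
Definition abelian_part x (L : nat) : D :=
  (sweep_a a (- L%:Z) (2 * L).+1 (fun j => dna (lam x 0 j)) *
   sweep_b b k (- L%:Z) (2 * L).+1 (fun j => dnb (lam x 0 j)))%g.

Section Bound.
Context (x : D) (L : nat).
Hypothesis Hx : generated_subgroup dgens x.
Hypothesis xr : right_range x L.
Hypothesis xl : left_range x L.

Lemma support0 j : ~~ (- L%:Z <= j < - L%:Z + (2 * L).+1%:Z) -> lam x 0 j = 1%g.
Proof.
move=> h; have [h'|h'] := lerP j L%:Z.
  by have [|_] := @xl 0%N j; [rewrite dk0; lia|apply; lia].
by have [_] := @xr 0%N j h'; apply; rewrite dk0; lia.
Qed.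

Lemma lam_abelian_part s j : lam (abelian_part x L) s j =
  ((if dna (lam x s j) then a s else 1) * (if dnb (lam x s j) then b s else 1))%g.
Proof.
rewrite /abelian_part lamM cur_sweep_a subr0 lam_sweep_a ?lam_sweep_b.
- by have [_ h] := abel Hx s; have [-> ->] := h j.
- by move=> z; apply: contraLR => /support0 ->; rewrite /dnb nb_1.
- by move=> z; apply: contraLR => /support0 ->; rewrite /dna na_1.
Qed.

Lemma cur_abelian_part s : cur (abelian_part x L) s = 0.
Proof. by rewrite /abelian_part curM cur_sweep_a cur_sweep_b. Qed.

Lemma ball_abelian_part : ball dgens (2 * (8 * L + 3)) (abelian_part x L).
Proof.
rewrite mul2n -addnn; apply: ballM.
  by apply: (ball_leq _ (@ball_sweep_a _ a b k _ _ _)); lia.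
by apply: (ball_leq _ (@ball_sweep_b _ a b k _ _ _)); lia.
Qed.

Definition kernel_part s j : dG X s := ((lam (abelian_part x L) s j)^-1 * lam x s j)%g.

Lemma kernel_part_na s j : dna (kernel_part s j) = false.
Proof.
rewrite /kernel_part lam_abelian_part /dna naM naV naM -/(dna (lam x s j)).
by case: (dna _); case: (dnb _); rewrite ?na_a ?na_b ?na_1.
Qed.

Lemma kernel_part_nb s j : dnb (kernel_part s j) = false.
Proof.
rewrite /kernel_part lam_abelian_part /dnb nbM nbV nbM -/(dnb (lam x s j)).
by case: (dna _); case: (dnb _); rewrite ?nb_a ?nb_b ?nb_1.
Qed.

Lemma kernel_part_turns s j : (dturns (kernel_part s j) <= (dturns (lam x s j)).+1)%N.
Proof.
rewrite /kernel_part lam_abelian_part invMg.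
set u := ((if dnb _ then _ else _)^-1 * _)%g.
suff hu : (dturns u <= 1)%N.
  by apply: leq_trans (turnsM _ _ _ _ _ _ u (lam x s j)) _; rewrite addnC -addn1 leq_add2l.
apply: leq_trans (turnsM _ _ _ _ _ _ _ _) _.
have h1 : (dturns (if dnb (lam x s j) then b s else 1)^-1%g <= 1)%N.
  case: (dnb _); rewrite ?invg1 ?(invb (dob X s)); first exact: turns_b.
  by rewrite /dturns /didx -/(turns _ _ _ _ _ _ _) turns_1.
have h2 : dturns (if dna (lam x s j) then a s else 1)^-1%g = 0%N.
  case: (dna _); rewrite ?invg1 ?(inva (doa X s)); first exact: turns_a.
  exact: turns_1.
by apply: (leq_add h1); rewrite -[X in (_ <= X)%N]h2.
Qed.

Lemma kernel_part_right s j : L%:Z < j -> kernel_part s j = 1%g.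
Proof.
move=> h; have [h1 _] := xr s h; rewrite /kernel_part lam_abelian_part.
by case: h1 => ->; rewrite /dna /dnb ?na_1 ?nb_1 ?na_b ?nb_b ?mul1g ?invg1 ?mul1g ?mulVg.
Qed.

Lemma kernel_part_left s j : j < - L%:Z + (k s)%:Z -> kernel_part s j = 1%g.
Proof.
move=> h; have [h1 _] := xl h; rewrite /kernel_part lam_abelian_part.
by case: h1 => ->; rewrite /dna /dnb ?na_1 ?nb_1 ?na_a ?nb_a ?mulg1 ?mul1g ?invg1 ?mul1g ?mulVg.
Qed.

Definition kernel_exp s j : int :=
  if kernel_part s j == 1%g then 0
  else sval (cid (kernel_level (kernel_part_na s j) (kernel_part_nb s j))).

Lemma kernel_exp_eq0 s j : kernel_part s j = 1%g -> kernel_exp s j = 0.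
Proof. by rewrite /kernel_exp => h; case: eqP => // /(_ h). Qed.

Lemma kernel_expE s j : kernel_part s j = dzrot s (2 * kernel_exp s j).
Proof.
rewrite /kernel_exp; case: eqP => [->|_]; first by rewrite mulr0 /dzrot zrot0.
by case: (cid _) => v [].
Qed.

Lemma kernel_exp_le s j : (2 * `|kernel_exp s j| <= (dturns (lam x s j)).+1)%N.
Proof.
rewrite /kernel_exp; case: eqP => // _; case: (cid _) => v [_ /= ->].
exact: kernel_part_turns.
Qed.

Lemma kernel_exp_supp s j : kernel_exp s j != 0 -> - L%:Z + (k s)%:Z <= j <= L%:Z.
Proof.
apply: contraR; rewrite negb_and -!ltNge => h; apply/eqP/kernel_exp_eq0.
by case/orP: h => [/kernel_part_left|/kernel_part_right].
Qed.

Definition blocks s : nat := ((2 * L).+1 %/ (k s)./2).+1.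

(** [M] counts only the turns beyond 4, the error of [circle_gap]. Paying for this slack in all
    blocks costs O(L), because k_s times the number of blocks is O(L) when k_s <= 2L; for larger k_s
    the support is empty. *)
Lemma level_part s (M : nat -> nat) : (0 < L)%N -> (0 < s)%N ->
  (forall (i : nat) z, (i < blocks s)%N ->
     - L%:Z + (i * (k s)./2)%N%:Z <= z < - L%:Z + (i.+1 * (k s)./2)%N%:Z ->
     (dturns (lam x s z) <= M i + 4)%N) ->
  exists2 y, at_level s (fun t z => dzrot t (2 * z)) (kernel_exp s) y &
    ball dgens (778 * L + \sum_(i < blocks s) (32 * k s * M i)) y.
Proof.
move=> L0 s0 hM.
have [h|h] := ltnP (2 * L) (k s).
  exists 1%g; last exact: ball1.
  split=> // t j; rewrite lam1; case: eqP => // _.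
  have [->|/kernel_exp_supp] := eqVneq (kernel_exp s j) 0; last lia.
  by rewrite mulr0 /dzrot zrot0.
have ks : (2 <= k s)%N by have := dk_exp s0; have := @leq_exp2l 2 1 s; lia.
have kh := dk_half s; have K0 : (0 < (k s)./2)%N by lia.
have nK : (blocks s * (k s)./2 <= 4 * L)%N.
  by rewrite /blocks mulSn; have := leq_trunc_div (2 * L).+1 (k s)./2; lia.
have nK' : (2 * L < blocks s * (k s)./2)%N.
  by rewrite /blocks; have := ltn_ceil (2 * L).+1 K0; lia.
have [||t|t z z'|t|z /kernel_exp_supp|i z hi hz|y hy by_] :=
  @at_level_interval _ a b k s (k s)./2 _ _ (fun t z => dzrot t (2 * z)) _ _ _ (- L%:Z)
    (blocks s) (fun i : nat => M i + 3)%N (kernel_exp s) K0.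
- exact: dk_sep.
- lia.
- by rewrite mulr0 /dzrot zrot0.
- by rewrite mulrDr /dzrot (zrotD (doa X t) (dob X t) (dgen X t) (dcard X t) (dl_even X t) (dl_gt0 X t)).
- rewrite mulr1 /cab -[RHS]/(comm_ab (a t) (b t)).
  by rewrite (comm_abE (doa X t) (dob X t) (dgen X t) (dcard X t) (dl_even X t) (dl_gt0 X t)).
- lia.
- by have := hM i z hi hz; have := kernel_exp_le s z; lia.
exists y => //; apply: ball_leq by_.
have -> : (\sum_(i < blocks s) 32 * k s * (M i + 3) =
  \sum_(i < blocks s) 32 * k s * M i + 192 * (blocks s * (k s)./2))%N.
  rewrite (eq_bigr (fun i : 'I__ => 32 * k s * M i + 192 * (k s)./2)%N).
    by rewrite big_split/= big_const_ord iter_addn_0; lia.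
  by move=> i _; lia.
lia.
Qed.

(** [x] is its abelian part times one element for each level below [S0] times a power of tau. *)
Lemma length_upper S0 (M : nat -> nat -> nat) : (0 < L)%N -> (2 * L < k S0)%N ->
  (`|cur x 0| <= L)%N ->
  (forall s (i : nat) z, (0 < s < S0)%N -> (i < blocks s)%N ->
     - L%:Z + (i * (k s)./2)%N%:Z <= z < - L%:Z + (i.+1 * (k s)./2)%N%:Z ->
     (dturns (lam x s z) <= M s i + 4)%N) ->
  ball dgens (778 * L * S0.+1 +
    \sum_(s < S0) \sum_(i < blocks s) (32 * k s * M s i)) x.
Proof.
move=> L0 LS cL hM.
have prod S1 : (S1 <= S0)%N -> exists y, [/\ forall t, cur y t = 0,
    forall t j, lam y t j = if (t < S1)%N then kernel_part t j else 1%g &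
    ball dgens (778 * L * S1 + \sum_(s < S1) \sum_(i < blocks s) (32 * k s * M s i)) y].
  elim: S1 => [|S1 IH] hS; first by exists 1%g; split => //; exact: ball1.
  have [y [cy ly by_]] := IH (ltnW hS).
  have [->|s0] := posnP S1.
    exists 1%g; split => //; last exact: ball1.
    by case=> // j; rewrite lam1/= (kernel_level0 (kernel_part_na 0 j) (kernel_part_nb 0 j)).
  have [i z hi hz|y' [cy' ly'] by'] := @level_part S1 (M S1) L0 s0; first by apply: hM hz => //; rewrite s0.
  exists (y * y')%g; split => [t|t j|].
  - by rewrite curM cy cy'.
  - rewrite lamM cy subr0 ly ly' ltnS; case: (ltngtP t S1) => [_|_|->]; rewrite ?mulg1//.
    by rewrite mul1g kernel_expE.
  - apply: ball_leq (ballM by_ by'); have -> : (\sum_(s < S1.+1) \sum_(i < blocks s) 32 * k s * M s i =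
      \sum_(s < S1) \sum_(i < blocks s) 32 * k s * M s i +
      \sum_(i < blocks S1) 32 * k S1 * M S1 i)%N by rewrite big_ord_recr.
    by rewrite mulnS; move: (\sum_(i < S1) _)%N (\sum_(i < blocks S1) _)%N => u v; lia.
have [y [cy ly by_]] := prod S0 (leqnn _).
have -> : x = (abelian_part x L * y * tauz _ (cur x 0))%g.
  apply: D_ext => [s j|s]; last first.
    have -> : cur (abelian_part x L * y * tauz _ (cur x 0))%g s =
      cur (abelian_part x L) s + cur y s + cur x 0 by [].
    by rewrite cy cur_abelian_part; have [-> _] := abel Hx s; ring.
  have -> : lam (abelian_part x L * y * tauz _ (cur x 0))%g s j =
    (lam (abelian_part x L) s j * lam y s (j - cur (abelian_part x L) s) * 1)%g by [].
  rewrite mulg1 cur_abelian_part subr0 ly.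
  case: ltnP => hs; first by rewrite /kernel_part mulKVg.
  (* Since k_s > 2L at these levels, each site lies to the right of L or to the left of -L + k_s. *)
  have h1 : kernel_part s j = 1%g.
    have [h'|h'] := ltrP L%:Z j; first exact: kernel_part_right.
    by apply: kernel_part_left; have := dk_leq hs; lia.
  by apply: (mulgI (lam (abelian_part x L) s j)^-1%g); rewrite mulgA mulVg mulg1.
apply: ball_leq (ballM (ballM ball_abelian_part by_) (ball_tauz a b k (cur x 0))).
by rewrite mulnS; lia.
Qed.

End Bound.
End Diagonal.

(** * Circle-valued functions and the detection of turns *)

Section CircleMap.
Context (X : diagonal).
Local Notation l := (dl X).
Local Notation k := (dk X).
Local Notation a := (da X).
Local Notation b := (db X).
Local Notation D := (dirprod (fun s => wreath (dG X s))).
Implicit Types (x y g h : D) (s t n : nat) (j z i : int) (w : bool).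

Definition clamp (n : nat) z : int := if z <= 0 then 0 else if n%:Z <= z then n%:Z else z.

(* The generators r = ab and a place the dihedral group on the circle of length
   2l in two ways: the point 2i+1 ignores right multiplication by a, and the
   point 2(i+e) ignores right multiplication by b (for r^i a^e).  They are
   adjacent, and the cursor moving from j-k to j interpolates between the two. *)
Definition circle s w g j : int :=
  let u := clamp (k s) (j - cur g s) in
  let c := if w then (l s)./2%:Z else 0 in
  let z := lam g s j in
  ((k s)%:Z - u) * (tent (2 * l s) (2 * didx z + 1 + c))%:Z +
  u * (tent (2 * l s) (2 * (didx z + (drefl z)%:Z) + c))%:Z.

(** The k_s sites where a step of the cursor to the right changes the interpolation parameter. *)
Definition active s g j : bool := 1 <= j - cur g s <= (k s)%:Z.

Lemma dl_half s : (2 * (l s)./2)%N = l s.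
Proof. by rewrite mul2n even_halfK ?dl_even. Qed.

Lemma l2_gt0 s : (0 < 2 * l s)%N. Proof. by have := dl_gt0 X s; lia. Qed.

(** Alpha acts at the cursor, where u = 0 and only the point insensitive to [a] is seen; beta acts
    at distance k_s, where u = k_s and only the other point is seen. *)
Lemma circle_alpha s w g j : circle s w (g * diag_alpha a)%g j = circle s w g j.
Proof.
rewrite /circle lamM curM cur_alpha addr0 lam_alpha subr_eq0.
case: eqP => [->|_]; last by rewrite mulg1.
rewrite subrr /clamp lexx !mul0r !addr0; congr (_ * Posz _).
have [_ [q]] := coordM (doa X s) (dob X s) (dgen X s) (dcard X s) (dl_even X s) (dl_gt0 X s)
  (lam g s (cur g s)) (a s).
rewrite -/(didx _) => ->; have [_ [q' ->]] := coord_a (doa X s) (dob X s) (dgen X s) (dcard X s) (dl_even X s) (dl_gt0 X s).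
rewrite -/(didx _) -/(drefl _).
apply: (tent_eqmod (q := q + (if drefl (lam g s (cur g s)) then - q' else q'))) (l2_gt0 s) _.
by rewrite PoszM; case: (drefl _); ring.
Qed.

Lemma circle_beta s w g j : circle s w (g * diag_beta b k)%g j = circle s w g j.
Proof.
rewrite /circle lamM curM cur_beta addr0 lam_beta.
case: eqP => [e|_]; last by rewrite mulg1.
have -> : clamp (k s) (j - cur g s) = k s.
  by rewrite e /clamp; case: ifP => h; [lia|rewrite lexx].
rewrite subrr !mul0r !add0r; congr (_ * Posz _).
have [+ [q]] := coordM (doa X s) (dob X s) (dgen X s) (dcard X s) (dl_even X s) (dl_gt0 X s)
  (lam g s j) (b s).
rewrite -!/(didx _) -!/(drefl _) => -> ->.
have [+ [q' +]] := coord_b (doa X s) (dob X s) (dgen X s) (dcard X s) (dl_even X s) (dl_gt0 X s).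
rewrite -/(didx _) -/(drefl _) => -> ->.
apply: (tent_eqmod (q := q + (if drefl (lam g s j) then - q' else q'))) (l2_gt0 s) _.
by rewrite PoszM; case: (drefl _); rewrite /=; ring.
Qed.

Lemma circle_tau s w g j :
  (absz (circle s w (g * diag_tau (fun s => dG X s))%g j - circle s w g j)%R <=
   active s g j)%N.
Proof.
rewrite /active /circle lamM curM -tauz1 lam_tauz mulg1 cur_tauz opprD addrA.
set u := clamp _ (j - _); set u' := clamp _ _.
set S := tent _ _; set T := tent _ _.
have ST : `|S%:Z - T%:Z| <= 1.
  have h1 := tent_lip (2 * didx (lam g s j) + 1 + (if w then (l s)./2%:Z else 0))
    (2 * (didx (lam g s j) + (drefl (lam g s j))%:Z) + (if w then (l s)./2%:Z else 0)) (l2_gt0 s).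
  have h2 := tent_lip (2 * (didx (lam g s j) + (drefl (lam g s j))%:Z) + (if w then (l s)./2%:Z else 0))
    (2 * didx (lam g s j) + 1 + (if w then (l s)./2%:Z else 0)) (l2_gt0 s).
  move: h1 h2; rewrite -/S -/T; case: (drefl _) => /=; lia.
have -> : ((k s)%:Z - u') * S%:Z + u' * T%:Z - (((k s)%:Z - u) * S%:Z + u * T%:Z) =
  (u - u') * (S%:Z - T%:Z) by ring.
have uE : u - u' = (1 <= j - cur g s <= (k s)%:Z)%R%:R.
  rewrite /u /u' /clamp; move: (j - cur g s) => y.
  by case: (lerP y 0) => h1; case: (lerP (y - 1) 0) => h2; case: (lerP (k s)%:Z y) => h3;
    case: (lerP (k s)%:Z (y - 1)) => h4; rewrite /=; lia.
by rewrite uE; case: (_ <= _ <= _) => /=; rewrite ?mul1r ?mul0r//; lia.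
Qed.

Lemma circle_step s w g j (c : D) : dgens c ->
  (absz (circle s w (g * c)%g j - circle s w g j)%R <= active s g j)%N.
Proof.
case=> ->; first exact: circle_tau.
  by rewrite circle_alpha subrr.
by rewrite circle_beta subrr.
Qed.

(** Both points of the circle lie within 2 of 2i, whence a loss of 2 k_s; comparing two elements
    doubles it, which is the 4 in [circle_gap]. *)
Lemma circle_center s w g j :
  (absz (circle s w g j - (k s)%:Z * (tent (2 * l s) (2 * didx (lam g s j) +
     (if w then (l s)./2%:Z else 0)))%:Z)%R <= 2 * k s)%N.
Proof.
rewrite /circle; set u := clamp _ _; set c := (if w then _ else _).
set i := didx _; set e := drefl _.
have h1 := tent_lip (2 * i + 1 + c) (2 * i + c) (l2_gt0 s).
have h2 := tent_lip (2 * i + c) (2 * i + 1 + c) (l2_gt0 s).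
have h3 := tent_lip (2 * (i + e%:Z) + c) (2 * i + c) (l2_gt0 s).
have h4 := tent_lip (2 * i + c) (2 * (i + e%:Z) + c) (l2_gt0 s).
move: h1 h2 h3 h4; set S := tent _ (_ + 1 + _); set T := tent _ (2 * (_ + _) + _); set U := tent _ _ => h1 h2 h3 h4.
have u0 : 0 <= u <= (k s)%:Z.
  by rewrite /u /clamp; case: ifP; [lia|case: ifP; lia].
have hS : `|S%:Z - U%:Z| <= 2 by lia.
have hT : `|T%:Z - U%:Z| <= 2 by case: (e) h3 h4 => /=; lia.
have -> : ((k s)%:Z - u) * S%:Z + u * T%:Z - (k s)%:Z * U%:Z =
   ((k s)%:Z - u) * (S%:Z - U%:Z) + u * (T%:Z - U%:Z) by ring.
have k1 : `|((k s)%:Z - u) * (S%:Z - U%:Z)| <= ((k s)%:Z - u) * 2.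
  by rewrite normrM ger0_norm ?ler_wpM2l; lia.
have k2 : `|u * (T%:Z - U%:Z)| <= u * 2.
  by rewrite normrM ger0_norm ?ler_wpM2l; lia.
lia.
Qed.

(** On the circle of length 2l the points 2i of the two elements are twice their turns apart; by
    [two_tents] one of the tents, plain or shifted by a quarter of the circle, sees at least half of
    this. *)
Lemma circle_gap s g h j : exists w,
  (k s * dturns (lam (g^-1 * h)%g s (j - cur g s)) <=
   absz (circle s w g j - circle s w h j)%R + 4 * k s)%N.
Proof.
set xi := lam (_ * _)%g _ _.
have hE : lam h s j = (lam g s j * xi)%g.
  rewrite /xi; have -> : lam (g^-1 * h)%g s (j - cur g s) =
    ((lam g s (j - cur g s + cur g s))^-1 * lam h s (j - cur g s - - cur g s))%g by [].
  by rewrite subrK opprK subrK mulKVg.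
have hl := dl_half s; have c0 : (0 < (l s)./2)%N by have := dl_gt0 X s; lia.
have [_ [q]] := coordM (doa X s) (dob X s) (dgen X s) (dcard X s) (dl_even X s) (dl_gt0 X s)
  (lam g s j) xi.
rewrite -hE -!/(didx _) -/(drefl _) => hi.
have tE : dturns xi = tent (l s) (didx (lam g s j) - didx (lam h s j)).
  rewrite /dturns hi; case: (drefl _).
    by symmetry; apply: (tent_eqmod (q := - q)) (dl_gt0 X s) _; ring.
  rewrite -tentN ?dl_gt0//.
  by symmetry; apply: (tent_eqmod (q := - q)) (dl_gt0 X s) _; ring.
have := two_tents (2 * didx (lam g s j)) (2 * didx (lam h s j)) c0.
have -> : (4 * (l s)./2 = 2 * l s)%N by lia.
have -> : 2 * didx (lam g s j) - 2 * didx (lam h s j) =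
  2 * (didx (lam g s j) - didx (lam h s j)) by ring.
rewrite tent_double ?dl_gt0// -tE.
have h1 := circle_center s false g j; have h2 := circle_center s false h j.
have h3 := circle_center s true g j; have h4 := circle_center s true h j.
move: h1 h2 h3 h4; rewrite !addr0.
move: (tent _ _) (tent _ _) (tent _ _) (tent _ _) => A1 A2 A3 A4 h1 h2 h3 h4 H.
have [H1|H1] : (dturns xi <= absz (A1%:Z - A2%:Z)%R)%N \/ (dturns xi <= absz (A3%:Z - A4%:Z)%R)%N by lia.
  exists true; have := leq_mul (leqnn (k s)) H1.
  have -> : (k s * absz (A1%:Z - A2%:Z)%R)%N = absz ((k s)%:Z * A1%:Z - (k s)%:Z * A2%:Z)%R.
    by rewrite -mulrBr abszM.
  lia.
exists false; have := leq_mul (leqnn (k s)) H1.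
have -> : (k s * absz (A3%:Z - A4%:Z)%R)%N = absz ((k s)%:Z * A3%:Z - (k s)%:Z * A4%:Z)%R.
  by rewrite -mulrBr abszM.
lia.
Qed.

End CircleMap.

(** * Obstruction from discrete tori *)

Section TorusChain.
Context {R : realType} (V : finZmodType) (n' K' M : nat) (u : 'I_n'.+2 -> 'I_K'.+1 -> V).
Local Notation n := n'.+2.
Local Notation K := K'.+1.
Local Notation letter := (bool * {ffun 'I_1 -> bool})%type.
Local Notation state := ({ffun 'I_n -> 'I_K} * V * 'I_n)%type.
Local Notation signs := {ffun 'I_K -> bool}.
Implicit Types (z : state) (s : letter) (w : seq letter) (c b : 'I_n).

(* A state (g, v, c) consists of a choice g of one coordinate in every block of a
   torus, a point v of this torus and a cursor c on the cycle of blocks. *)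
Definition push (d : {ffun 'I_1 -> bool}) (g : {ffun 'I_n -> 'I_K}) c : V :=
  sgnv (d ord0) (u c (g c) *+ M.*2).

Definition chain_act s z : state :=
  let: (g, v, c) := z in
  if s.1 then (g, v + push s.2 g c, c + 1) else (g, v - push s.2 g (c - 1), c - 1).

Definition chain_inv s : letter := (~~ s.1, s.2).

Lemma chain_actK s : cancel (chain_act s) (chain_act (chain_inv s)).
Proof.
by case: s => [[] e] [[g v] c] /=; rewrite ?addrK ?subrK.
Qed.

Lemma chain_invK : involutive chain_inv.
Proof. by case=> [[] e]. Qed.

Lemma chain_run w g v c : run chain_act (g, v, c) w =
  (g, v + \sum_b (u b (g b) *+ M.*2) *~ lamp_incr c w b ord0, walk_end c w).
Proof.
elim: w v c => [|[d e] w IH] v c.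
  by rewrite /run/= /walk_end/= big1 ?addr0// => b _; rewrite mulr0z.
rewrite /run/= -/(run chain_act _ w) /chain_act/=; case: d => /=; rewrite IH.
  congr (_, _, _); rewrite -addrA; congr (_ + _).
  rewrite [RHS](eq_bigr (fun b => (u b (g b) *+ M.*2) *~ (if c == b then sgnv (e ord0) 1 else 0) +
    (u b (g b) *+ M.*2) *~ lamp_incr (c + 1) w b ord0)); last by move=> b _; rewrite mulrzDr.
  rewrite big_split/=; congr (_ + _); rewrite (bigD1 c)//= eqxx big1 ?addr0.
    by rewrite /push; case: (e ord0); rewrite /= ?mulr1z ?mulrN1z.
  by move=> b bc; rewrite eq_sym (negbTE bc) mulr0z.
congr (_, _, _); rewrite -addrA; congr (_ + _).
rewrite [RHS](eq_bigr (fun b => (u b (g b) *+ M.*2) *~ (if c - 1 == b then - sgnv (e ord0) 1 else 0) +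
  (u b (g b) *+ M.*2) *~ lamp_incr (c - 1) w b ord0)); last by move=> b _; rewrite mulrzDr.
rewrite big_split/=; congr (_ + _); rewrite (bigD1 (c - 1))//= eqxx big1 ?addr0.
  by rewrite /push; case: (e ord0); rewrite /= ?opprK ?mulr1z ?mulrN1z.
by move=> b bc; rewrite eq_sym (negbTE bc) mulr0z.
Qed.

Lemma sum_coord (F : 'I_K -> R) c :
  K%:R * \sum_(g : {ffun 'I_n -> 'I_K}) F (g c) = K%:R ^+ n * \sum_j F j.
Proof.
have -> : K%:R * \sum_(g : {ffun 'I_n -> 'I_K}) F (g c) =
    \sum_(j : 'I_K) \sum_(g : {ffun 'I_n -> 'I_K}) F (g c).
  by rewrite sum_cst card_ord.
rewrite (eq_bigr (fun j => \sum_(g : {ffun 'I_n -> 'I_K}) F (g c + j))); last first.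
  move=> j _; rewrite (reindex_inj (addIr ([ffun => j] : {ffun 'I_n -> 'I_K})))/=.
  by apply: eq_bigr => g _; rewrite !ffunE.
rewrite exchange_big/= (eq_bigr (fun=> \sum_j F j)); last first.
  by move=> g _; rewrite [RHS](reindex_inj (addrI (g c))).
by rewrite sum_cst card_ffun !card_ord natrX.
Qed.

Section Pow.
Context (q : R) (q2 : 2 <= q) (f : V * 'I_n -> R).
Hypothesis MK : M%:R `^ q <= K%:R.
Local Notation N := (#|{: signs}|%:R : R).
Local Notation F z := (f (z.1.2, z.2)).

Definition moves : R := \sum_v \sum_c `|f (v, c + 1) - f (v, c)| `^ q.
Definition pushes : R :=
  \sum_v \sum_c \sum_(e : signs) `|f (v + shift (u c) e, c) - f (v, c)| `^ q.

Lemma q_ge1 : 1 <= q. Proof. by apply: le_trans q2; rewrite ler1n. Qed.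

Lemma sum_state (G : {ffun 'I_n -> 'I_K} -> V -> 'I_n -> R) :
  \sum_(z : state) G z.1.1 z.1.2 z.2 = \sum_g \sum_v \sum_c G g v c.
Proof.
rewrite (pair_bigA _ (fun g v => \sum_c G g v c))/=.
by rewrite (pair_bigA _ (fun (y : _ * _) c => G y.1 y.2 c))/=.
Qed.

(** For a uniformly chosen coordinate the cotype inequality is divided by K, and M^q <= K absorbs
    its second term. *)
Lemma sum_push c :
  \sum_(g : {ffun 'I_n -> 'I_K}) \sum_v `|f (v + u c (g c) *+ M.*2, c) - f (v, c)| `^ q <=
  K%:R ^+ n * (3 `^ q * (4 + 2 `^ q)) *
    ((\sum_v \sum_(e : signs) `|f (v + shift (u c) e, c) - f (v, c)| `^ q) / N).
Proof.
have K0 : 0 < K%:R :> R by rewrite ltr0n.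
have W0 : 0 <= (\sum_v \sum_(e : signs) `|f (v + shift (u c) e, c) - f (v, c)| `^ q) / N.
  by rewrite divr_ge0//; do 2!apply: sumr_ge0 => ? _; exact: powR_ge0.
rewrite -(ler_pM2l K0) (sum_coord (fun j => \sum_v `|f (v + u c j *+ M.*2, c) - f (v, c)| `^ q) c).
have := cotype_ge2 (u c) q2 (fun v => f (v, c)) M.
set W := (_ / N) in W0 *; move=> h.
have {}h := le_trans h (ler_wpM2r W0 (ler_wpM2l (powR_ge0 3 q)
  (lerD (lexx (4 * K%:R)) (ler_wpM2l (powR_ge0 2 q) MK)))).
apply: le_trans (ler_wpM2l _ h) _; first by rewrite exprn_ge0.
by rewrite le_eqVlt; apply/orP; left; apply/eqP; ring.
Qed.

(** A letter pushes and moves; the two parts are separated at an intermediate point, and a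
    translation of the torus reduces pushes of either sign to positive ones. Letters that move back
    are inverses of the others. *)
Lemma chain_step (s : letter) :
  \sum_z `|F (chain_act s z) - F z| `^ q <=
  2 `^ q * K%:R ^+ n * (3 `^ q * (4 + 2 `^ q)) * (moves + pushes / N).
Proof.
have N1 : 1 <= 3 `^ q * (4 + 2 `^ q) :> R.
  have h3 : 1 <= 3 `^ q :> R.
    by rewrite -[X in X <= _](powRr0 (3 : R)); apply: ler_powR; have := q_ge1; lra.
  have := powR_ge0 2 q => h2; apply: le_trans h3 _.
  by rewrite -[X in X <= _]mulr1 ler_wpM2l ?powR_ge0//; lra.
have M0 : 0 <= moves by do 2!apply: sumr_ge0 => ? _; exact: powR_ge0.
have hE : \sum_z `|F (chain_act s z) - F z| `^ q <=
    2 `^ (q - 1) * (\sum_(z : state) `|f (z.1.2, z.2 + 1) - f (z.1.2, z.2)| `^ q +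
      \sum_(z : state) `|f (z.1.2 + u z.2 (z.1.1 z.2) *+ M.*2, z.2) - f (z.1.2, z.2)| `^ q).
  have key e : \sum_(z : state) `|F (chain_act (true, e) z) - F z| `^ q <=
      2 `^ (q - 1) * (\sum_(z : state) `|f (z.1.2, z.2 + 1) - f (z.1.2, z.2)| `^ q +
        \sum_(z : state) `|f (z.1.2 + u z.2 (z.1.1 z.2) *+ M.*2, z.2) - f (z.1.2, z.2)| `^ q).
    pose tr e' (z : state) : state := (z.1.1, z.1.2 + push e' z.1.1 z.2, z.2).
    have tr_inj e' : injective (tr e').
      by move=> [[g v] c] [[g' v'] c'] /= [eg ev ec]; move: ev; rewrite eg ec => /addIr ->.
    have h1 : \sum_(z : state) `|f (z.1.2, z.2 + 1) - f (z.1.2, z.2)| `^ q =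
        \sum_(z : state) `|f (z.1.2 + push e z.1.1 z.2, z.2 + 1) - f (z.1.2 + push e z.1.1 z.2, z.2)| `^ q.
      exact: (reindex_inj (tr_inj e)).
    have h2 : \sum_(z : state) `|f (z.1.2 + u z.2 (z.1.1 z.2) *+ M.*2, z.2) - f (z.1.2, z.2)| `^ q =
        \sum_(z : state) `|f (z.1.2 + push e z.1.1 z.2, z.2) - f (z.1.2, z.2)| `^ q.
      rewrite /push /sgnv; case E : (e ord0) => //.
      rewrite [RHS](reindex_inj (tr_inj [ffun=> true]))/=; apply: eq_bigr => -[[g v] c] _ /=.
      by rewrite /push ffunE /= addrK distrC.
    rewrite h1 h2 -big_split/= mulr_sumr; apply: ler_sum => -[[g v] c] _ /=.
    have := power_sum2 (f (v + push e g c, c + 1) - f (v + push e g c, c))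
      (f (v + push e g c, c) - f (v, c)) q_ge1.
    by rewrite addrA subrK.
  case: s => [[] e]; first exact: key.
  rewrite (reindex_inj (can_inj (chain_actK (true, e))))/=.
  rewrite (eq_bigr (fun z => `|F (chain_act (true, e) z) - F z| `^ q)) ?key//.
  by move=> z _; rewrite -[(false, e)]/(chain_inv (true, e)) chain_actK distrC.
apply: le_trans hE _.
have -> : \sum_(z : state) `|f (z.1.2, z.2 + 1) - f (z.1.2, z.2)| `^ q = K%:R ^+ n * moves.
  rewrite (sum_state (fun _ v c => `|f (v, c + 1) - f (v, c)| `^ q)).
  by rewrite sum_cst card_ffun !card_ord natrX.
have hB : \sum_(z : state) `|f (z.1.2 + u z.2 (z.1.1 z.2) *+ M.*2, z.2) - f (z.1.2, z.2)| `^ q <=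
    K%:R ^+ n * (3 `^ q * (4 + 2 `^ q)) * (pushes / N).
  rewrite (sum_state (fun g v c => `|f (v + u c (g c) *+ M.*2, c) - f (v, c)| `^ q)).
  rewrite (eq_bigr (fun g : {ffun 'I_n -> 'I_K} => \sum_c \sum_v `|f (v + u c (g c) *+ M.*2, c) - f (v, c)| `^ q)); last first.
    by move=> g _; rewrite exchange_big.
  rewrite exchange_big/=.
  have -> : pushes = \sum_c \sum_v \sum_(e : signs) `|f (v + shift (u c) e, c) - f (v, c)| `^ q.
    by rewrite /pushes exchange_big.
  rewrite mulr_suml mulr_sumr.
  by apply: ler_sum => c _; exact: sum_push.
set c0 := 3 `^ q * _ in N1 hB *; set B := \sum_(z : state) _ in hB *.
have P0 : 0 <= pushes / N.
  by rewrite divr_ge0//; do 3!apply: sumr_ge0 => ? _; exact: powR_ge0.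
have Kn : 0 <= K%:R ^+ n :> R by rewrite exprn_ge0.
have h1 : K%:R ^+ n * moves <= K%:R ^+ n * c0 * moves.
  by rewrite -mulrA ler_wpM2l// ler_peMl.
have h2 : 2 `^ (q - 1) <= 2 `^ q :> R by apply: ler_powR; lra.
apply: le_trans (ler_wpM2l (powR_ge0 _ _) (lerD h1 hB)) _.
rewrite -mulrDr -!(mulrA (2 `^ _)) ler_wpM2r//.
have c1 : 0 <= c0 := le_trans ler01 N1.
by apply: mulr_ge0; [apply: mulr_ge0|exact: addr_ge0].
Qed.

End Pow.
End TorusChain.

(** Markov type over 2 n^2 steps contributes (n^2)^(q/2) = n^q, and [chain_step] bounds a single
    step; the constant is uniform in the torus. *)
Lemma chain_ineq (R : realType) (q : R) : 2 <= q -> exists2 C : R, 0 < C &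
  forall (V : finZmodType) (n' K' M : nat) (u : 'I_n'.+2 -> 'I_K'.+1 -> V),
  M%:R `^ q <= K'.+1%:R -> forall f : V * 'I_n'.+2 -> R,
  \sum_(g : {ffun 'I_n'.+2 -> 'I_K'.+1}) \sum_v \sum_c \sum_(w <- words (n'.+2 ^ 2).*2)
     `|f (v + \sum_b (u b (g b) *+ M.*2) *~ lamp_incr c w b (ord0 : 'I_1), walk_end c w)
       - f (v, c)| `^ q <=
  C * n'.+2%:R `^ q * #|{: bool * {ffun 'I_1 -> bool}}|%:R ^+ (n'.+2 ^ 2).*2 *
    K'.+1%:R ^+ n'.+2 *
    (moves q f + pushes u q f / #|{: {ffun 'I_K'.+1 -> bool}}|%:R).
Proof.
move=> q2; have [C C0 HC] := markov_type q2.
have c0 : 0 < 3 `^ q * (4 + 2 `^ q) :> R.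
  by rewrite mulr_gt0 ?powR_gt0// addr_gt0 ?powR_gt0.
exists (C * (2 `^ q * (3 `^ q * (4 + 2 `^ q)))).
  by rewrite mulr_gt0// mulr_gt0 ?powR_gt0.
move=> V n' K' M u MK f.
set A := #|{: bool * {ffun 'I_1 -> bool}}|.
have A0 : (0 < A)%N by apply/card_gt0P; exists (true, [ffun=> true]).
have AR : 0 < A%:R :> R by rewrite ltr0n.
have := HC _ _ (chain_act M u) chain_inv (@chain_actK V n' K' M u) chain_invK A0
  (fun z => f (z.1.2, z.2)) (n'.+2 ^ 2)%N isT.
rewrite -(sum_state (fun (g : {ffun 'I_n'.+2 -> 'I_K'.+1}) v c => \sum_(w <- words (n'.+2 ^ 2).*2)
     `|f (v + \sum_b (u b (g b) *+ M.*2) *~ lamp_incr c w b (ord0 : 'I_1), walk_end c w)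
       - f (v, c)| `^ q)).
rewrite [X in _ -> X <= _](eq_bigr (fun z => \sum_(w <- words (n'.+2 ^ 2).*2)
  `|f ((run (chain_act M u) z w).1.2, (run (chain_act M u) z w).2) - f (z.1.2, z.2)| `^ q)); last first.
  by move=> [[g v] c] _; apply: eq_bigr => w _; rewrite chain_run.
move=> /le_trans; apply.
have -> : (n'.+2 ^ 2)%:R `^ (q / 2) = n'.+2%:R `^ q :> R.
  by rewrite natrX -powR_mulrn// -powRrM; congr (_ `^ _); field.
have hs : (\sum_z \sum_s `|f ((chain_act M u s z).1.2, (chain_act M u s z).2) - f (z.1.2, z.2)| `^ q) / A%:R <=
    2 `^ q * K'.+1%:R ^+ n'.+2 * (3 `^ q * (4 + 2 `^ q)) *
    (moves q f + pushes u q f / #|{: {ffun 'I_K'.+1 -> bool}}|%:R).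
  rewrite ler_pdivrMr// exchange_big/=.
  apply: le_trans (ler_sum _ (fun s _ => chain_step u q2 f MK s)) _.
  by rewrite sum_cst mulrC.
apply: le_trans (ler_wpM2l _ hs) _.
  apply: mulr_ge0; first by apply: mulr_ge0; [exact: ltW|exact: powR_ge0].
  exact: exprn_ge0.
by rewrite le_eqVlt; apply/orP; left; apply/eqP; ring.
Qed.

HB.instance Definition _ (I : finType) (Z : finZmodType) :=
  GRing.Zmodule.on {ffun I -> Z}.

(** * Lower bounds for distances from spaced sites *)

Section CircleDistance.
Context (X : diagonal) (s : nat).
Local Notation l := (dl X).
Local Notation k := (dk X).
Local Notation gens := (@dgens X).
Local Notation zr := (@dzrot X).
Local Notation D := (dirprod (fun s => wreath (dG X s))).
Context (I : finType) (site : I -> int).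
Hypothesis spaced : forall i i', i != i' -> (k s <= absz (site i - site i')%R)%N.

Lemma sum_active (g : D) : (\sum_i active s g (site i) <= 1)%N.
Proof.
case: (pickP (fun i => active s g (site i))) => [i hi|h]; last by rewrite big1// => i _; rewrite h.
rewrite (bigD1 i)//= hi big1 ?addn0// => i' ii'.
have := spaced ii'; move: hi; rewrite /active; case: (_ <= _ <= _) / boolP => // h h'.
by move: h h'; lia.
Qed.

Lemma sum_circle_ball (w : I -> bool) N (g u : D) : ball gens N u ->
  (\sum_i absz (circle s (w i) (g * u)%g (site i) - circle s (w i) g (site i))%R <= N)%N.
Proof.
elim: N u => [|N IH] u.
  by move=> /ball0 ->; rewrite mulg1 big1// => i _; rewrite subrr.
case/ballS => [/IH/leq_trans-> //|[y [c [hy hc ->]]]].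
have step : (\sum_i absz (circle s (w i) (g * (y * c))%g (site i) - circle s (w i) (g * y)%g (site i))%R <= 1)%N.
  rewrite mulgA; case: hc => hc.
    by apply: leq_trans (sum_active (g * y)%g); apply: leq_sum => i _; exact: circle_step.
  have := sum_active (g * y * c)%g; apply: leq_trans; apply: leq_sum => i _.
  by have := circle_step s (w i) (g * y * c)%g (site i) hc; rewrite mulgK distnC.
have := leq_add (IH _ hy) step; rewrite addn1; apply: leq_trans.
rewrite -big_split/=; apply: leq_sum => i _.
move: (circle _ _ _ _) (circle _ _ _ _) (circle _ _ _ _) => p1 p2 p3; lia.
Qed.

(** Spaced sites are never active together, so a generator changes the sum of the circle functions
    by at most one; [w] selects at each site the tent that sees the turns between [g] and [h]. *)
Lemma circle_distance (g h : D) N : ball gens N (g^-1 * h)%g ->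
  (k s * \sum_i dturns ((lam g s (site i))^-1 * lam h s (site i))%g <= N + 4 * k s * #|I|)%N.
Proof.
move=> hN.
have gap i := circle_gap s g h (site i).
pose w i := sval (cid (gap i)).
have hw i : (k s * dturns ((lam g s (site i))^-1 * lam h s (site i))%g <=
    absz (circle s (w i) g (site i) - circle s (w i) h (site i))%R + 4 * k s)%N.
  have := svalP (cid (gap i)); rewrite -/(w i).
  have -> // : lam (g^-1 * h)%g s (site i - cur g s) = ((lam g s (site i))^-1 * lam h s (site i))%g.
  rewrite lamM lamV curV subrK opprK.
  by congr (_ * lam h s _)%g; ring.
have := sum_circle_ball w g hN; rewrite mulKVg => hs.
rewrite big_distrr/=.
apply: (@leq_trans (\sum_i (absz (circle s (w i) g (site i) - circle s (w i) h (site i))%R + 4 * k s))).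
  by apply: leq_sum => i _; exact: hw.
rewrite big_split/= sum_nat_const mulnC leq_add2r.
by apply: leq_trans hs; apply: leq_sum => i _; rewrite distnC.
Qed.

End CircleDistance.

(** * Discrete tori in the group *)

Section Torus.
Context (X : diagonal) (s : nat).
Hypothesis s_gt0 : (0 < s)%N.
Local Notation l := (dl X).
Local Notation k := (dk X).
Local Notation gens := (@dgens X).
Local Notation zr := (@dzrot X).
Local Notation D := (dirprod (fun s => wreath (dG X s))).
Local Notation K := ((k s)./2.-1.+1).
Local Notation m := ((l s)./2.-1.+1).
Context (n' : nat).
Local Notation n := n'.+2.
Local Notation V := {ffun 'I_n * 'I_K -> 'I_m}.
Implicit Types (v : V) (b c : 'I_n) (j : 'I_K).

Lemma K_half : (2 * K)%N = k s.
Proof.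
have := dk_half X s; have := dk_exp X s_gt0; have := @leq_exp2l 2 1 s; lia.
Qed.

Lemma m_half : (2 * m)%N = l s.
Proof. by have := dl_half X s; have := dl_gt0 X s; lia. Qed.

Lemma l_int : (l s)%:Z = 2 * m%:Z.
Proof. by rewrite -PoszM m_half. Qed.

(* Orders the cycle Z/n as 0, 2, 4, .., 3, 1 on the line, so that neighbours on
   the cycle stay at distance at most two. *)
Definition fold (c : nat) : nat := if (2 * c < n)%N then (2 * c)%N else (2 * (n - c)).-1.

Lemma fold_inj b c : fold b = fold c -> b = c.
Proof.
move=> h; apply/val_inj; move: h; rewrite /fold /=.
have := ltn_ord b; have := ltn_ord c; case: ifP; case: ifP; lia.
Qed.

Lemma fold_next c : (absz ((fold (c + 1)%R)%:Z - (fold c)%:Z)%R <= 2)%N.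
Proof.
rewrite val_cyc1 /fold; have := ltn_ord c.
move=> cn; case: eqP => h; first by rewrite muln0 /=; case: ltnP; lia.
by case: ltnP => h1; case: ltnP => h2; lia.
Qed.

(** Blocks start at distinct multiples of 2 k_s and have k_s / 2 sites, so sites of different blocks
    are at least k_s apart, as [circle_distance] requires. *)
Definition place b j : int := (2 * k s * fold b + j)%N%:Z.

Lemma place_inj b c j j' : place b j = place c j' -> b = c /\ j = j'.
Proof.
have hj := ltn_ord j; have hj' := ltn_ord j'; have hK := K_half.
rewrite /place => h.
have k0 : (0 < 2 * k s)%N by lia.
have {h}h : (2 * k s * fold b + j = 2 * k s * fold c + j')%N by lia.
have e1 := divnMDl (fold b) j k0; have e2 := divnMDl (fold c) j' k0.
have d1 : (j %/ (2 * k s) = 0)%N by apply: divn_small; lia.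
have d2 : (j' %/ (2 * k s) = 0)%N by apply: divn_small; lia.
rewrite d1 addn0 in e1; rewrite d2 addn0 in e2.
have bc : fold b = fold c by rewrite -e1 -e2 -![(fold _ * _)%N]mulnC h.
by split; [exact: fold_inj|apply/val_inj => /=; rewrite bc in h; lia].
Qed.

Definition lift_lamps v z : int := \sum_(x : 'I_n * 'I_K) if place x.1 x.2 == z then (v x : nat)%:Z else 0.

Lemma lift_lamps_place v b j : lift_lamps v (place b j) = (v (b, j) : nat)%:Z.
Proof.
rewrite /lift_lamps (bigD1 (b, j))//= eqxx big1 ?addr0// => -[b' j'] /=.
by move=> h; case: eqP => // /place_inj[e1 e2]; rewrite e1 e2 eqxx in h.
Qed.

Lemma lift_lamps_off v z : (forall b j, place b j <> z) -> lift_lamps v z = 0.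
Proof. by move=> h; apply: big1 => -[b j] _ /=; case: eqP => // /h. Qed.

Lemma torus_lamps_ex v : exists y : D, generated_subgroup gens y /\
  at_level s (fun t z => zr t (2 * z)) (lift_lamps v) y.
Proof.
have hK := K_half.
have [||t|t z z'|t||z hz|i z hi hz|y hy /ball_subgroup by_] :=
  @at_level_interval _ (da X) (db X) k s K _ _ (fun t z => zr t (2 * z)) _ _ _ 0
    (4 * n).+1 (fun i : nat => l s) (lift_lamps v).
- by move=> t ts; have := @dk_sep X _ _ ts; lia.
- lia.
- by rewrite mulr0 /zr zrot0.
- by rewrite mulrDr /zr (zrotD (doa X t) (dob X t) (dgen X t) (dcard X t) (dl_even X t) (dl_gt0 X t)).
- rewrite mulr1 /cab -[RHS]/(comm_ab (da X t) (db X t)).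
  by rewrite (comm_abE (doa X t) (dob X t) (dgen X t) (dcard X t) (dl_even X t) (dl_gt0 X t)).
- by [].
- have [h|h] := pselect (exists b j, place b j = z); last first.
    by rewrite lift_lamps_off ?eqxx// in hz; move=> b j e; apply: h; exists b, j.
  have [b [j <-]] := h; have hj := ltn_ord j; have hb := ltn_ord b.
  have fb : (fold b < n)%N by rewrite /fold; case: ifP; lia.
  by rewrite /place; nia.
- have [h|h] := pselect (exists b j, place b j = z); last first.
    by rewrite lift_lamps_off// => b j e; apply: h; exists b, j.
  have [b [j <-]] := h; rewrite lift_lamps_place; have := ltn_ord (v (b, j)).
  by have := m_half; lia.
by exists y.
Qed.

Definition torus_lamps v : D := sval (cid (torus_lamps_ex v)).

Lemma torus_lamps_sub v : generated_subgroup gens (torus_lamps v).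
Proof. by have [] := svalP (cid (torus_lamps_ex v)). Qed.

Lemma cur_torus_lamps v t : cur (torus_lamps v) t = 0.
Proof. by have [_ []] := svalP (cid (torus_lamps_ex v)). Qed.

Lemma lam_torus_lamps v t z : lam (torus_lamps v) t z =
  if t == s then zr t (2 * lift_lamps v z) else 1%g.
Proof. by have [_ []] := svalP (cid (torus_lamps_ex v)). Qed.

(** The homomorphism from Z/m to the even powers of the rotation, where m = l_s / 2 is the order of
    r^2. *)
Definition crot (x : 'I_m) : dG X s := zr s (2 * (x : nat)%:Z).

Lemma dzrotD t z z' : zr t (z + z') = (zr t z * zr t z')%g :> dG X t.
Proof. exact: (zrotD (doa X t) (dob X t) (dgen X t) (dcard X t) (dl_even X t) (dl_gt0 X t)). Qed.

Lemma dzrotN t z : zr t (- z) = ((zr t z)^-1)%g :> dG X t.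
Proof. exact: (zrotN (doa X t) (dob X t) (dgen X t) (dcard X t) (dl_even X t) (dl_gt0 X t)). Qed.

Lemma dzrot_mod z q : zr s (2 * (z + q * m%:Z)) = zr s (2 * z).
Proof.
have -> : 2 * (z + q * m%:Z) = 2 * z + q * l s.
  by rewrite l_int; ring.
rewrite dzrotD; have -> : zr s (q * l s) = 1%g by rewrite /dzrot /zrot modzMl expg0.
by rewrite mulg1.
Qed.

Lemma crotD x y : crot (x + y) = (crot x * crot y)%g.
Proof.
rewrite /crot -dzrotD -mulrDr.
have -> : (nat_of_ord (x + y)%R)%:Z = ((x : nat)%:Z + (y : nat)%:Z) + - ((x + y) %/ m)%N%:Z * m%:Z.
  by rewrite /=; have := divn_eq (x + y) m; nia.
by rewrite dzrot_mod.
Qed.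

Lemma crot0 : crot 0 = 1%g.
Proof. by rewrite /crot /= /zr zrot0. Qed.

Lemma crotN x : crot (- x) = ((crot x)^-1)%g.
Proof. by apply: (mulgI (crot x)); rewrite mulgV -crotD subrr crot0. Qed.

Lemma crot1 : crot (inZp 1) = zr s 2.
Proof.
rewrite -[in RHS](mulr1 2) -(dzrot_mod 1 (- ((1 %/ m)%N%:Z))) /crot /=; congr (zr _ (2 * _)).
by have := divn_eq 1 m; nia.
Qed.

Lemma crotMz z x : crot (x *~ z) = zr s (2 * (z * (x : nat)%:Z)).
Proof.
have h i : crot (x *+ i) = zr s (2 * (i%:Z * (x : nat)%:Z)).
  elim: i => [|i IH]; first by rewrite mulr0n crot0 mul0r mulr0 /zr zrot0.
  by rewrite mulrS crotD IH /crot -dzrotD -[i.+1]addn1 PoszD; congr (zr _ _); ring.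
case: (intP z) => [|i|i]; first exact: (h 0%N).
  exact: h.
by rewrite mulrNz crotN h -dzrotN mulNr mulrN.
Qed.

(** [inZp 1] generates Z/m also for m = 1, that is for l_s = 2. *)
Definition unit_lamp b j : V := [ffun x => if x == (b, j) then inZp 1 else 0].

Definition torus_pt (y : V * 'I_n) : D :=
  (torus_lamps y.1 * tauz _ (2 * k s * fold y.2)%N%:Z)%g.

Lemma torus_pt_sub y : generated_subgroup gens (torus_pt y).
Proof.
have h1 := ball_word_length (torus_lamps_sub y.1).
exact: ball_subgroup (ballM h1 (ball_tauz (da X) (db X) k _)).
Qed.

Lemma lam_torus_pt y t z : lam (torus_pt y) t z = lam (torus_lamps y.1) t z.
Proof. by rewrite /torus_pt lamM lam_tauz mulg1. Qed.

Lemma lam_torus_place v b j : lam (torus_lamps v) s (place b j) = crot (v (b, j)).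
Proof. by rewrite lam_torus_lamps eqxx lift_lamps_place. Qed.

Lemma cur_torus_pt y t : cur (torus_pt y) t = (2 * k s * fold y.2)%N%:Z.
Proof.
have -> : cur (torus_pt y) t = cur (torus_lamps y.1) t + (2 * k s * fold y.2)%N%:Z by [].
by rewrite cur_torus_lamps add0r.
Qed.

Lemma torus_move v c : ball gens (4 * k s)
  ((torus_pt (v, c))^-1 * torus_pt (v, c + 1)%R)%g.
Proof.
rewrite /torus_pt/= invMg -mulgA mulKg -tauzV -tauzD.
apply: ball_leq (ball_tauz (da X) (db X) k _).
have := fold_next c; move: (fold _) (fold _) => i j; nia.
Qed.

(** A signed sum of all basis vectors of a block is a pattern of entries 1 and -1 at one level,
    which [at_level_block] with M = 1 writes at cost 32 k_s. *)
Lemma torus_push v c (e : {ffun 'I_K -> bool}) : ball gens (32 * k s)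
  ((torus_pt (v, c))^-1 * torus_pt (v + shift (unit_lamp c) e, c)%R)%g.
Proof.
have hK := K_half.
pose eta (z : int) : int := if (0 <= z) && (z < K%:Z) then sgnv (e (inord `|z|)) 1 else 0.
have [||t|t z z'|t|z|z|y [cy ly]] :=
  @at_level_block _ (da X) (db X) k s K _ _ (fun t z => zr t (2 * z)) _ _ _ 1 eta.
- by move=> t ts; have := @dk_sep X _ _ ts; lia.
- lia.
- by rewrite mulr0 /zr zrot0.
- by rewrite mulrDr dzrotD.
- rewrite mulr1 /cab -[RHS]/(comm_ab (da X t) (db X t)).
  by rewrite (comm_abE (doa X t) (dob X t) (dgen X t) (dcard X t) (dl_even X t) (dl_gt0 X t)).
- by rewrite /eta; case: ifP.
- by rewrite /eta; case: ifP => // _; case: (e _).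
rewrite muln1; suff -> : y = ((torus_pt (v, c))^-1 * torus_pt (v + shift (unit_lamp c) e, c)%R)%g by [].
apply: D_ext => [t z|t]; last by rewrite curM curV !cur_torus_pt cy; ring.
set v' := v + _.
have -> : lam ((torus_pt (v, c))^-1 * torus_pt (v', c))%g t z =
    ((lam (torus_pt (v, c)) t (z + cur (torus_pt (v, c)) t))^-1 *
     lam (torus_pt (v', c)) t (z - - cur (torus_pt (v, c)) t))%g by [].
rewrite opprK !lam_torus_pt cur_torus_pt/= ly.
set z' := z + _.
case: (eqVneq t s) => [->|ts]; last by rewrite !lam_torus_lamps (negbTE ts) mulVg.
have shiftE b j : (shift (unit_lamp c) e) (b, j) = if b == c then sgnv (e j) (inZp 1) else 0.
  rewrite /shift sum_ffunE (bigD1 j)//= big1 ?addr0.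
    by rewrite /sgnv; case: (e j); rewrite !ffunE xpair_eqE eqxx andbT; case: eqP => //; rewrite oppr0.
  move=> i ij; rewrite /sgnv; case: (e i); rewrite !ffunE xpair_eqE (eq_sym j) (negbTE ij) andbF//.
  by rewrite oppr0.
have [h|h] := pselect (exists b j, place b j = z'); last first.
  rewrite !lam_torus_lamps eqxx !lift_lamps_off; try by move=> b j e'; apply: h; exists b, j.
  rewrite mulr0 mulVg /eta; case: ifP => // hz; last by rewrite mulr0 /zr zrot0.
  by exfalso; apply: h; exists c, (inord `|z|); rewrite /place inordK; lia.
have [b [j hbj]] := h; rewrite -hbj !lam_torus_place /v' ffunE crotD mulKg shiftE.
have hj := ltn_ord j.
case: (eqVneq b c) => [bc|bc].
  have zj : z = (j : nat)%:Z by move: hbj; rewrite /z' /place bc; lia.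
  rewrite /eta zj /= ltz_nat hj /= inord_val; case: (e j) => /=; first by rewrite crot1 mulr1.
  by rewrite crotN crot1 mulrN1 dzrotN.
rewrite crot0 /eta; case: ifP => [hz|_]; last by rewrite mulr0 /zr zrot0.
exfalso; have [bc' _] : b = c /\ j = inord `|z|.
  by apply: place_inj; rewrite hbj /z' /place inordK; lia.
by rewrite bc' eqxx in bc.
Qed.

Lemma ffunMzE (I : finType) (Z : zmodType) (f : {ffun I -> Z}) (z : int) x :
  (f *~ z) x = f x *~ z.
Proof.
case: z => i; first exact: ffunMnE.
by rewrite !NegzE !mulrNz ffunE -!pmulrn ffunMnE.
Qed.

Lemma dturns_dzrot t z : dturns (zr t z) = tent (l t) z.
Proof.
have [_ [q hq]] := @coordP _ _ _ _ (doa X t) (dob X t) (dgen X t) (dcard X t) (dl_even X t) (dl_gt0 X t)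
  z false (zr t z) (esym (mulg1 _)).
by rewrite /dturns /didx hq; exact: tent_eqmod (dl_gt0 X t) erefl.
Qed.

(** One site in each block gives a spaced family. A basis vector stands for r^2 and is taken 2M
    times, so the lamp in block b is turned by r^(4 M S_b). *)
Lemma torus_distance (v : V) (c c' : 'I_n) (g : {ffun 'I_n -> 'I_K}) (S : 'I_n -> int) M N :
  ball gens N ((torus_pt (v, c))^-1 *
     torus_pt (v + \sum_b (unit_lamp b (g b) *+ M.*2) *~ S b, c')%R)%g ->
  (k s * \sum_b tent (l s) (4 * M%:Z * S b) <= N + 4 * k s * n)%N.
Proof.
have hK := K_half.
move=> hN; have := @circle_distance X s _ (fun b => place b (g b)) _ _ _ _ hN.
rewrite card_ord => H; apply: leq_trans (H _) => {H}; last first.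
  move=> b b' bb'; have fbb' : fold b <> fold b' by move=> /fold_inj e; rewrite e eqxx in bb'.
  have := ltn_ord (g b); have := ltn_ord (g b'); rewrite /place.
  move: (fold b) (fold b') fbb' (nat_of_ord (g b)) (nat_of_ord (g b')) => p p' pp' q q' h1 h2.
  by case: (ltngtP p p') pp' => // hp _; nia.
rewrite leq_mul2l; apply/orP; right; apply: leq_sum => b _.
rewrite !lam_torus_pt/= !lam_torus_place ffunE crotD mulKg.
have -> : (\sum_b0 (unit_lamp b0 (g b0) *+ M.*2) *~ S b0) (b, g b) = inZp 1 *~ (M.*2%:Z * S b).
  rewrite sum_ffunE (bigD1 b)//= big1 ?addr0.
    by rewrite ffunMzE ffunMnE ffunE eqxx mulrzA.
  by move=> b' bb'; rewrite ffunMzE ffunMnE ffunE xpair_eqE eq_sym (negbTE bb') mul0rn mul0rz.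
rewrite crotMz dturns_dzrot leq_eqVlt; apply/orP; left; apply/eqP.
apply: (tent_eqmod (q := (1 %/ m)%N%:Z * (M.*2%:Z * S b))) (dl_gt0 X s) _.
have e1 := divn_eq 1 m; have -> : M.*2%:Z = 2 * M%:Z by lia.
rewrite l_int /=; move: (1 %/ m)%N (1 %% m)%N e1 => q1 r1 e1.
have e2 : r1%:Z = 1 - q1%:Z * m%:Z by rewrite -PoszM; lia.
by rewrite e2; ring.
Qed.

End Torus.

Section ChainPairs.
Context {R : realType} (V : finZmodType) (n' K' M : nat) (u : 'I_n'.+2 -> 'I_K'.+1 -> V).
Local Notation n := n'.+2.
Local Notation K := K'.+1.
Local Notation letter := (bool * {ffun 'I_1 -> bool})%type.
Local Notation signs := {ffun 'I_K -> bool}.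
Local Notation W := (words (A := letter) (n ^ 2).*2).
Local Notation pt := (V * 'I_n)%type.
(** The nested sums are flattened into sums over one finite index, the form in which [snowflake] and
    [energy_transfer] take them. *)
Definition walks : Type := ({ffun 'I_n -> 'I_K} * V * 'I_n * 'I_(size W))%type.
HB.instance Definition _ := Finite.on walks.
Definition edges : Type := (pt * signs * bool)%type.
HB.instance Definition _ := Finite.on edges.

Definition walk_start (i : walks) : pt := (i.1.1.2, i.1.2).
Definition walk_stop (i : walks) : pt :=
  (i.1.1.2 + \sum_b (u b (i.1.1.1 b) *+ M.*2) *~ lamp_incr i.1.2 (nth [::] W i.2) b ord0,
   walk_end i.1.2 (nth [::] W i.2)).
Definition edge_src (j : edges) : pt := j.1.1.
Definition edge_dst (j : edges) : pt :=
  if j.2 then (j.1.1.1, j.1.1.2 + 1) else (j.1.1.1 + shift (u j.1.1.2) j.1.2, j.1.1.2).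

Lemma sum_walks (F : {ffun 'I_n -> 'I_K} -> V -> 'I_n -> seq letter -> R) :
  \sum_(i : walks) F i.1.1.1 i.1.1.2 i.1.2 (nth [::] W i.2) =
  \sum_g \sum_v \sum_c \sum_(w <- W) F g v c w.
Proof.
rewrite -(pair_bigA _ (fun (y : {ffun 'I_n -> 'I_K} * V * 'I_n) (i : 'I_(size W)) =>
  F y.1.1 y.1.2 y.2 (nth [::] W i)))/=.
rewrite (sum_state (fun g v c => \sum_(i < size W) F g v c (nth [::] W i))).
do 3!(apply: eq_bigr => ? _).
by rewrite (big_nth [::]) big_mkord.
Qed.

Lemma sum_edges q (f : pt -> R) :
  \sum_(j : edges) `|f (edge_dst j) - f (edge_src j)| `^ q =
  #|{: signs}|%:R * (moves q f + pushes u q f / #|{: signs}|%:R).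
Proof.
pose N : R := #|{: signs}|%:R; rewrite -/N.
have N0 : 0 < N by rewrite ltr0n; apply/card_gt0P; exists [ffun=> true].
rewrite mulrDr mulrCA divff ?gt_eqF// mulr1.
rewrite -(pair_bigA _ (fun (y : pt * signs) (d : bool) =>
  `|f (if d then (y.1.1, y.1.2 + 1) else (y.1.1 + shift (u y.1.2) y.2, y.1.2)) - f y.1| `^ q))/=.
rewrite -(pair_bigA _ (fun (y : pt) (e : signs) =>
  \sum_(d : bool) `|f (if d then (y.1, y.2 + 1) else (y.1 + shift (u y.2) e, y.2)) - f y| `^ q))/=.
rewrite (eq_bigr (fun y : pt => \sum_(e : signs) \sum_(d : bool)
  `|f (if d then (y.1, y.2 + 1) else (y.1 + shift (u y.2) e, y.2)) - f (y.1, y.2)| `^ q)); last by case.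
rewrite -(pair_bigA _ (fun (v : V) (c : 'I_n) => \sum_(e : signs)
  \sum_(d : bool) `|f (if d then (v, c + 1) else (v + shift (u c) e, c)) - f (v, c)| `^ q))/=.
rewrite /moves /pushes mulr_sumr -big_split/=; apply: eq_bigr => v _.
rewrite mulr_sumr -big_split/=; apply: eq_bigr => c _.
rewrite -sum_cst -big_split/=; apply: eq_bigr => e _.
by rewrite big_bool.
Qed.

End ChainPairs.

(** For p < 2 the case q = 2 is passed through [snowflake], which keeps the dependence on the factor
    [D] linear. *)
Lemma chain_pairs (R : realType) (p : R) : 1 <= p ->
  let q := Num.max p 2 in exists2 C : R, 0 < C &
  forall (V : finZmodType) (n' K' M : nat) (u : 'I_n'.+2 -> 'I_K'.+1 -> V),
  M%:R `^ q <= K'.+1%:R -> forall f : V * 'I_n'.+2 -> R,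
  \sum_(i : walks V n' K') `|f (walk_stop M u i) - f (walk_start i)| `^ p <=
  C * (n'.+2%:R `^ q * #|{: bool * {ffun 'I_1 -> bool}}|%:R ^+ (n'.+2 ^ 2).*2 * K'.+1%:R ^+ n'.+2 /
       #|{: {ffun 'I_K'.+1 -> bool}}|%:R) *
    \sum_(j : edges V n' K') `|f (edge_dst u j) - f (edge_src j)| `^ p.
Proof.
move=> p1 q; have q2 : 2 <= q by rewrite le_max lexx orbT.
have [C C0 HC] := chain_ineq q2.
have key (V : finZmodType) (n' K' M : nat) (u : 'I_n'.+2 -> 'I_K'.+1 -> V) :
    M%:R `^ q <= K'.+1%:R -> forall f : V * 'I_n'.+2 -> R,
  \sum_(i : walks V n' K') `|f (walk_stop M u i) - f (walk_start i)| `^ q <=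
  C * (n'.+2%:R `^ q * #|{: bool * {ffun 'I_1 -> bool}}|%:R ^+ (n'.+2 ^ 2).*2 * K'.+1%:R ^+ n'.+2 /
       #|{: {ffun 'I_K'.+1 -> bool}}|%:R) *
    \sum_(j : edges V n' K') `|f (edge_dst u j) - f (edge_src j)| `^ q.
  move=> MK f; have := HC V n' K' M u MK f.
  rewrite sum_edges; pose N : R := #|{: {ffun 'I_K'.+1 -> bool}}|%:R; rewrite -/N.
  have N0 : 0 < N by rewrite ltr0n; apply/card_gt0P; exists [ffun=> true].
  rewrite -(sum_walks (fun g v c w =>
     `|f (v + \sum_b (u b (g b) *+ M.*2) *~ lamp_incr c w b (ord0 : 'I_1), walk_end c w)
       - f (v, c)| `^ q)).
  move=> /le_trans; apply; rewrite le_eqVlt; apply/orP; left; apply/eqP.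
  by field; rewrite gt_eqF.
have [p2|p2] := leP 2 p.
  have qE : q = p by apply/max_idPl.
  by exists C => // V n' K' M u MK f /=; have := key V n' K' M u MK f; rewrite qE.
have qE : q = 2 by apply/max_idPr/ltW.
have p0 : 0 < p by lra.
have [C' C'0 HC'] := snowflake p0 p2.
exists (C' * C) => [|V n' K' M u MK f /=]; first by rewrite mulr_gt0.
set D := (_ / _); rewrite -(mulrA C').
apply: HC'.
  apply: mulr_ge0; first exact: ltW.
  by rewrite /D; apply: divr_ge0.
move=> {}f; have := key V n' K' M u MK f; rewrite /D qE /=.
have sq (x : R) : `|x| `^ 2 = x ^+ 2 by rewrite (powR_mulrn 2)// real_normK ?num_real.
by rewrite (eq_bigr _ (fun i _ => sq _)) [\sum_(j : edges V n' K') _](eq_bigr _ (fun j _ => sq _)).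
Qed.

(** * The compression inequality from one torus *)

Section Obstruction.
Context {R : realType} (p : R) (p1 : (1 <= p%:E)%E) (X : diagonal).
Local Notation l := (dl X).
Local Notation k := (dk X).
Local Notation gens := (@dgens X).
Local Notation D := (dirprod (fun s => wreath (dG X s))).
Local Notation H := (generated_subgroup gens).
Local Notation q := (Num.max p 2).
Local Notation letter := (bool * {ffun 'I_1 -> bool})%type.
Context (Psi : H -> Lp01 p1).

Definition mem_H (x : D) (hx : H x) : H := SigSub (mem_set hx).

Lemma val_mem_H x (hx : H x) : val (mem_H hx) = x. Proof. by []. Qed.

Lemma p_ge1 : 1 <= p. Proof. by rewrite -lee_fin. Qed.

Lemma lipschitz_energy (C : R) (x y : H) (d : nat) :
  (forall x y, (Lp01_dist (Psi x) (Psi y) <= (C * (subgroup_dist x y)%:R)%:E)%E) ->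
  ball gens d ((val x)^-1 * val y)%g ->
  energy (Psi x) (Psi y) <= (`|C| * d%:R) `^ p.
Proof.
move=> hC /word_length_le h; rewrite -energy_dist ?mulr_ge0//.
apply: le_trans (hC x y) _; rewrite lee_fin.
apply: (@le_trans _ _ (`|C| * (subgroup_dist x y)%:R)).
  by rewrite ler_wpM2r// ler_norm.
by rewrite ler_wpM2l// ler_nat.
Qed.

(** Up to [A] the circle is too long for a wrap-around, and beyond [A] the left side is negative.
    The mean of this minorant is accessible by moments. *)
Lemma tent_parabola (m : nat) (A : R) (y : int) : (0 < m)%N -> 0 < A -> 2 * A <= m%:R ->
  `|y%:~R| - y%:~R ^+ 2 / A <= Num.min (tent m y)%:R A.
Proof.
move=> m0 A0 Am; rewrite le_min; set t : R := y%:~R.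
have [h|h] := lerP `|t| A.
  have -> : (tent m y)%:R = `|t|.
    rewrite tent_small//; first by rewrite /t -intr_norm -abszE.
    rewrite -(ler_nat R) natrM; apply: le_trans Am; rewrite ler_wpM2l//.
    by apply: le_trans h; rewrite /t -intr_norm -abszE.
  have h2 : 0 <= t ^+ 2 / A by rewrite divr_ge0 ?sqr_ge0// ltW.
  by apply/andP; split; lra.
have h2 : `|t| <= t ^+ 2 / A.
  rewrite ler_pdivlMr// -real_normK ?num_real// expr2 ler_wpM2l//.
  exact: ltW.
have h3 : 0 <= (tent m y)%:R :> R by [].
by apply/andP; split; lra.
Qed.

Lemma cancel_counts (Kn NV n NW Ns L t C n_q E : R) : 0 < Kn -> 0 < NV -> 0 < n ->
  0 < NW -> 0 < Ns ->
  Kn * NV * L * (n * NW * t) <= C * (n_q * NW * Kn / Ns) * (NV * n * Ns * 2 * E) ->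
  L * t <= 2 * C * n_q * E.
Proof.
move=> K0 V0 n0 W0 N0; have F0 : 0 < Kn * NV * n * NW by rewrite !mulr_gt0.
move=> h; rewrite -(ler_pM2l F0); apply: le_trans (le_trans _ h) _.
  by rewrite le_eqVlt; apply/orP; left; apply/eqP; ring.
by rewrite le_eqVlt; apply/orP; left; apply/eqP; field; rewrite gt_eqF.
Qed.

(* A walk of r^4 steps across r^2 blocks of a torus at level s moves by k r^3 M on
   average, whereas Markov type and cotype bound its displacement in L_p. *)
Lemma obstruction (C c e : R) : 0 < c -> 0 <= e ->
  (forall x y, (Lp01_dist (Psi x) (Psi y) <= (C * (subgroup_dist x y)%:R)%:E)%E) ->
  (forall t : R, 1 <= t -> ((c * t `^ e)%:E <= compression_fun Psi t)%E) ->
  exists2 C1 : R, 0 < C1 & forall (s r M : nat), (0 < s)%N -> (0 < M)%N -> (20 <= r)%N ->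
    (320 * r * M <= l s)%N -> M%:R `^ q <= (k s)%:R / 2 ->
    ((k s)%:R * r%:R ^+ 3 * M%:R) `^ (e * p) <= C1 * (r%:R `^ (2 * q) * (k s)%:R `^ p).
Proof.
move=> c0 e0 hC hc; have [C2 C20 HC2] := chain_pairs p_ge1.
have p0 : 0 < p by apply: lt_le_trans p_ge1.
set q := Num.max p 2 in HC2 *.
(* For the [A] and [t0] chosen below, [B * t0] equals k n A, which bounds [G]. *)
have [B BE] : exists B : R, B = 1600 by exists 1600.
have B0 : 0 < B by rewrite BE ltr0n.
exists (2 * B * C2 * (32 * `|C|) `^ p / c `^ p * 10 `^ (e * p) + 1).
  apply: ltr_wpDl; last exact: ltr01.
  apply: mulr_ge0; last exact: powR_ge0.
  apply: divr_ge0; last exact: powR_ge0.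
  apply: mulr_ge0; last exact: powR_ge0.
  by apply: mulr_ge0; [apply: mulr_ge0; [exact: ler0n|exact: ltW]|exact: ltW].
move=> s r M s0 M0 r20 hl MK.
have [n' nE] : exists n', n'.+2 = (r ^ 2)%N.
  exists (r ^ 2).-2; rewrite -mulnn.
  move: (leq_trans (isT : (2 <= 20 * 20)%N) (leq_mul r20 r20)).
  by case: (r * r)%N => [|[]].
have hK : (2 * (k s)./2.-1.+1 = k s)%N by exact: K_half.
pose F y := mem_H (torus_pt_sub (n' := n') s0 y).
have MK' : M%:R `^ q <= (k s)./2.-1.+1%:R.
  by apply: le_trans MK _; have := congr1 (fun i => i%:R : R) hK; rewrite natrM; lra.
have r0 : 0 < r%:R :> R by rewrite ltr0n (leq_trans _ r20).
have M0' : 0 < M%:R :> R by rewrite ltr0n.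
have k0 : 0 < (k s)%:R :> R by rewrite ltr0n -hK.
have nR : n'.+2%:R = r%:R ^+ 2 :> R by rewrite nE natrX.
set W := words (A := letter) (n'.+2 ^ 2).*2.
pose NW : R := #|{: letter}|%:R ^+ (n'.+2 ^ 2).*2.
have NW0 : 0 < NW.
  by rewrite exprn_gt0// ltr0n; apply/card_gt0P; exists (true, [ffun=> true]).
pose Ns : R := #|{: {ffun 'I_(k s)./2.-1.+1 -> bool}}|%:R.
have Ns0 : 0 < Ns by rewrite ltr0n; apply/card_gt0P; exists [ffun=> true].
pose V := {ffun 'I_n'.+2 * 'I_(k s)./2.-1.+1 -> 'I_(l s)./2.-1.+1}.
pose NV : R := #|{: V}|%:R.
have NV0 : 0 < NV by rewrite ltr0n; apply/card_gt0P; exists 0.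
pose Kn : R := (k s)./2.-1.+1%:R ^+ n'.+2.
have Kn0 : 0 < Kn by rewrite exprn_gt0.
pose E : R := (`|C| * (32 * k s)%N%:R) `^ p.
(* A = 4M * 40r: distances at a site are 4M times lamp increments, and 40 r is the least truncation
   that [lamp_incr_spread] allows. The hypothesis on 320 r M says 2A <= l_s. *)
have [A AE] : exists A : R, A = 160 * r%:R * M%:R by exists (160 * r%:R * M%:R).
pose t0 : R := (k s)%:R * n'.+2%:R * M%:R * r%:R / 10.
have rM : 20 <= r%:R * M%:R :> R by rewrite -natrM ler_nat -[20%N]muln1 leq_mul.
have A0 : 0 < A by rewrite AE -mulrA; lra.
have t01 : 1 <= t0.
  have k1 : 1 <= (k s)%:R * n'.+2%:R :> R by rewrite -natrM ler1n muln_gt0 -hK.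
  have : 1 * 20 <= (k s)%:R * n'.+2%:R * (M%:R * r%:R) :> R.
    by apply: ler_pM => //; rewrite mulrC.
  by rewrite /t0 -!mulrA; lra.
have Lp : 0 < t0 by apply: lt_le_trans t01.
pose u := @unit_lamp X s n'.
have nsum (x : R) : n'.+2%:R * x = \sum_(b : 'I_n'.+2) x by rewrite sum_cst card_ord.
have coef0 : 0 <= n'.+2%:R `^ q * NW * Kn / Ns.
  apply: divr_ge0; last exact: ltW.
  apply: mulr_ge0; last exact: ltW.
  by apply: mulr_ge0; [exact: powR_ge0|exact: ltW].
have upper : \sum_(i : walks V n' (k s)./2.-1) energy (Psi (F (walk_stop M u i))) (Psi (F (walk_start i))) <=
    C2 * (n'.+2%:R `^ q * NW * Kn / Ns) * (NV * n'.+2%:R * Ns * 2 * E).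
  apply: (@le_trans _ _ (C2 * (n'.+2%:R `^ q * NW * Kn / Ns) *
      \sum_(j : edges V n' (k s)./2.-1) energy (Psi (F (edge_dst u j))) (Psi (F (edge_src j))))).
    apply: (energy_transfer (fun y => Psi (F y))).
      by apply: mulr_ge0; first exact: ltW.
    by move=> t; exact: HC2.
  rewrite ler_wpM2l//.
    by apply: mulr_ge0; first exact: ltW.
  apply: (@le_trans _ _ (\sum_(j : edges V n' (k s)./2.-1) E)); last first.
    by rewrite sum_cst !card_prod card_bool card_ord !natrM /NV /Ns.
  apply: ler_sum => -[[[v c'] eps] d] _; apply: lipschitz_energy hC _.
  rewrite /edge_dst /edge_src/=; case: d => /=.
    rewrite -[X in ball _ _ X]invgK; apply: ballV; rewrite invMg invgK.
    by apply: ball_leq (torus_move s0 v c'); rewrite leq_mul2r orbT.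
  rewrite -[X in ball _ _ X]invgK; apply: ballV; rewrite invMg invgK.
  exact: torus_push.
pose S c' w (b : 'I_n'.+2) : int := lamp_incr c' w b (ord0 : 'I_1).
(* A lower bound for the distance travelled, with the contribution of each block truncated at [A] so
   that [Gmax] holds. *)
pose G (c' : 'I_n'.+2) (w : seq letter) : R :=
  (k s)%:R * \sum_b Num.min (tent (l s) (4 * M%:Z * S c' w b))%:R A - 4 * (k s)%:R * n'.+2%:R.
have Gmax c' w : G c' w <= B * t0.
  have : \sum_b Num.min (tent (l s) (4 * M%:Z * S c' w b))%:R A <= n'.+2%:R * A.
    rewrite nsum; apply: ler_sum => b _.
    by rewrite ge_min lexx orbT.
  move=> /(ler_wpM2l (ltW k0)) h; rewrite /G.
  have -> : B * t0 = (k s)%:R * (n'.+2%:R * A) by rewrite BE AE /t0; field.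
  by have := mulr_ge0 (ltW k0) (ler0n R n'.+2); lra.
(* Where G > t0 the compression bound gives energy at least (c t0^e)^p, while G - t0 <= B t0. Hence
   L0 (G - t0) is a linear minorant of the energy, and by [spread] its mean is at least L0 t0. *)
pose L0 : R := c `^ p * t0 `^ (e * p) / (B * t0).
have L00 : 0 <= L0.
  by apply: divr_ge0; apply: mulr_ge0; rewrite ?powR_ge0// ltW.
have pointwise (i : walks V n' (k s)./2.-1) : L0 * (G i.1.2 (nth [::] W i.2) - t0) <=
    energy (Psi (F (walk_stop M u i))) (Psi (F (walk_start i))).
  set w := nth _ _ _; have [h|h] := lerP (G i.1.2 w) t0.
    by apply: le_trans (energy_ge0 _ _); rewrite mulr_ge0_le0// subr_le0.
  set N := subgroup_dist (F (walk_stop M u i)) (F (walk_start i)).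
  have hN : ball gens N ((val (F (walk_start i)))^-1 * val (F (walk_stop M u i)))%g.
    rewrite -[X in ball _ _ X]invgK; apply: ballV; rewrite invMg invgK.
    apply: ball_word_length.
    have [n1 h1] : exists n, ball gens n (val (F (walk_start i))).
      by exists (word_length gens (val (F (walk_start i)))); exact: ball_word_length (torus_pt_sub s0 _).
    have [n2 h2] : exists n, ball gens n (val (F (walk_stop M u i))).
      by exists (word_length gens (val (F (walk_stop M u i)))); exact: ball_word_length (torus_pt_sub s0 _).
    exact: ball_subgroup (ballM (ballV h2) h1).
  have := @torus_distance X s s0 n' i.1.1.2 i.1.2 (walk_end i.1.2 w) i.1.1.1 (S i.1.2 w) M N hN; rewrite -(ler_nat R) natrM natrD !natrM natr_sum => hd.
  have tN : t0 <= N%:R.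
    apply: le_trans (ltW h) _; rewrite /G lerBlDr; apply: le_trans hd.
    by rewrite ler_wpM2l//; apply: ler_sum => b _; rewrite ge_min lexx.
  have hen : c `^ p * t0 `^ (e * p) <= energy (Psi (F (walk_stop M u i))) (Psi (F (walk_start i))).
    rewrite powRrM -powRM ?powR_ge0//; last exact: ltW.
    rewrite -dist_energy_ge ?mulr_ge0 ?powR_ge0//; last exact: ltW.
    apply: le_trans (hc _ t01) _; apply: ereal_inf_lbound.
    by exists (F (walk_stop M u i), F (walk_start i)).
  apply: le_trans hen; rewrite /L0 -[leRHS]mulr1 -!mulrA ler_wpM2l ?powR_ge0//.
  rewrite ler_wpM2l ?powR_ge0// mulrC ler_pdivrMr ?mul1r; last by rewrite mulr_gt0.
  by have := Gmax i.1.2 w; lra.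
have spread : n'.+2%:R * NW * t0 <= \sum_c' \sum_(w <- W) (G c' w - t0).
  pose Z c' w b : R := `|(S c' w b)%:~R| - (S c' w b)%:~R ^+ 2 / (40 * r%:R).
  have hG c' w : (k s)%:R * (4 * M%:R) * \sum_b Z c' w b - (4 * (k s)%:R * n'.+2%:R + t0) <= G c' w - t0.
    suff : (k s)%:R * (4 * M%:R) * \sum_b Z c' w b <=
        (k s)%:R * \sum_b Num.min (tent (l s) (4 * M%:Z * S c' w b))%:R A by rewrite /G; lra.
    rewrite -mulrA ler_wpM2l// mulr_sumr; apply: ler_sum => b _.
    have Al : 2 * A <= (l s)%:R.
      by rewrite AE; apply: le_trans (_ : (320 * r * M)%N%:R <= _); rewrite ?ler_nat// !natrM; lra.
    apply: le_trans (tent_parabola _ (dl_gt0 X s) A0 Al).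
    rewrite /Z !intrM !normrM AE; move: (S c' w b)%:~R => x.
    rewrite [`|4%:~R|]ger0_norm// [`|_%:~R|]ger0_norm//.
    rewrite le_eqVlt; apply/orP; left; apply/eqP.
    by rewrite -!pmulrn; field; rewrite !gt_eqF.
  have hZ : n'.+2%:R * (NW * (r%:R ^+ 3 / 10)) <= \sum_c' \sum_(w <- W) \sum_b Z c' w b.
    under eq_bigr do rewrite exchange_big/=.
    rewrite exchange_big/= nsum; apply: ler_sum => b _.
    exact: lamp_incr_spread.
  apply: (@le_trans _ _ ((k s)%:R * (4 * M%:R) * (\sum_c' \sum_(w <- W) \sum_b Z c' w b) -
     n'.+2%:R * NW * (4 * (k s)%:R * n'.+2%:R + t0))); last first.
    rewrite mulr_sumr -[n'.+2%:R * NW * _]mulrA nsum -sumrB.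
    apply: ler_sum => c' _; rewrite mulr_sumr -sum_words_cst -sumrB.
    by apply: ler_sum => w _; exact: hG.
  have := ler_wpM2l (mulr_ge0 (ltW k0) (mulr_ge0 (ler0n R 4) (ltW M0'))) hZ.
  set SZ := \sum_c' _ => hSZ; rewrite lerBrDr; apply: le_trans hSZ.
  have -> : n'.+2%:R * NW * t0 + n'.+2%:R * NW * (4 * (k s)%:R * n'.+2%:R + t0) =
    n'.+2%:R * NW * (2 * t0 + 4 * (k s)%:R * n'.+2%:R) by ring.
  have -> : (k s)%:R * (4 * M%:R) * (n'.+2%:R * (NW * (r%:R ^+ 3 / 10))) =
    n'.+2%:R * NW * ((k s)%:R * (4 * M%:R) * (r%:R ^+ 3 / 10)) by ring.
  apply: ler_wpM2l; first by apply: mulr_ge0; [exact: ler0n|exact: ltW].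
  have -> : 2 * t0 + 4 * (k s)%:R * n'.+2%:R = ((k s)%:R * r%:R ^+ 2) * (r%:R * M%:R / 5 + 4) :> R.
    by rewrite /t0 nR; field.
  have -> : (k s)%:R * (4 * M%:R) * (r%:R ^+ 3 / 10) = ((k s)%:R * r%:R ^+ 2) * (r%:R * M%:R * 4 / 10) :> R.
    by field.
  by rewrite ler_wpM2l ?mulr_ge0 ?exprn_ge0//; lra.
have lower : Kn * NV * L0 * (n'.+2%:R * NW * t0) <=
    \sum_(i : walks V n' (k s)./2.-1) energy (Psi (F (walk_stop M u i))) (Psi (F (walk_start i))).
  apply: le_trans (ler_sum _ (fun i _ => pointwise i)).
  rewrite (sum_walks (fun _ _ c' w => L0 * (G c' w - t0))) !sum_cst card_ffun !card_ord natrX.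
  rewrite -(mulrA Kn NV) -(mulrA Kn) -(mulrA NV).
  apply: ler_wpM2l; first exact: ltW.
  apply: ler_wpM2l; first exact: ltW.
  apply: le_trans (ler_wpM2l L00 spread) _; rewrite mulr_sumr.
  by apply: ler_sum => c' _; rewrite mulr_sumr.
have {lower upper}main := le_trans lower upper.
have n0 : 0 < n'.+2%:R :> R by [].
have hd : c `^ p * t0 `^ (e * p) <= 2 * B * C2 * n'.+2%:R `^ q * E.
  have := cancel_counts Kn0 NV0 n0 NW0 Ns0 main.
  have -> : L0 * t0 = c `^ p * t0 `^ (e * p) / B by rewrite /L0; field; rewrite !gt_eqF.
  by rewrite ler_pdivrMr// => /le_trans; apply; rewrite le_eqVlt; apply/orP; left; apply/eqP; ring.
have cp0 : 0 < c `^ p by rewrite powR_gt0.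
have -> : (k s)%:R * r%:R ^+ 3 * M%:R = 10 * t0 by rewrite /t0 nR; field.
rewrite powRM// ?(ltW Lp)//.
have Ep : E = (32 * `|C|) `^ p * (k s)%:R `^ p.
  by rewrite /E natrM mulrCA mulrA powRM ?mulr_ge0.
have rq : n'.+2%:R `^ q = r%:R `^ (2 * q) :> R.
  by rewrite nR -powR_mulrn// -powRrM.
rewrite Ep rq in hd.
set P := r%:R `^ _ in hd *; set Q := (k s)%:R `^ p in hd *; set CC := (32 * _) `^ p in hd *.
have PQ : 0 <= P * Q by rewrite mulr_ge0 ?powR_ge0.
rewrite mulrDl mul1r; apply: ler_wpDr => //.
have -> : 2 * B * C2 * CC / c `^ p * 10 `^ (e * p) * (P * Q) =
  10 `^ (e * p) * ((2 * B * C2 * P * (CC * Q)) / c `^ p) by ring.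
rewrite ler_wpM2l ?powR_ge0// ler_pdivlMr// mulrC.
exact: hd.
Qed.

End Obstruction.

(** * The embedding *)

Section SubsetSums.
Context {R : realType}.

Lemma ler_sum_uniq (T : eqType) (F G : seq T) (a : T -> R) :
  uniq F -> uniq G -> {subset F <= G} -> (forall x, 0 <= a x) ->
  \sum_(x <- F) a x <= \sum_(x <- G) a x.
Proof.
move=> uF uG FG a0.
have p : perm_eq F [seq x <- G | x \in F].
  apply: uniq_perm => //; first exact: filter_uniq.
  by move=> x; rewrite mem_filter; case E : (x \in F) => //=; rewrite FG.
rewrite (perm_big _ p)/= big_filter big_mkcond/=; apply: ler_sum => x _.
by case: ifP.
Qed.

Lemma sum_pair_le (S T : eqType) (F : seq (S * T)) (a : S -> T -> R) (C W : R) (v : S -> R) :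
  uniq F -> (forall x y, 0 <= a x y) -> (forall x, 0 <= v x) -> 0 <= C ->
  (forall x G, uniq G -> \sum_(y <- G) a x y <= v x * C) ->
  (forall G, uniq G -> \sum_(x <- G) v x <= W) ->
  \sum_(z <- F) a z.1 z.2 <= W * C.
Proof.
move=> uF a0 v0 C0 ha hv.
set F1 := undup (map fst F); set F2 := undup (map snd F).
apply: (@le_trans _ _ (\sum_(z <- [seq (x, y) | x <- F1, y <- F2]) a z.1 z.2)).
  apply: ler_sum_uniq => //.
    by apply: allpairs_uniq => [||[x y] [x' y'] _ _ //]; exact: undup_uniq.
  move=> [x y] h; apply/allpairsP; exists (x, y); split => //=; rewrite mem_undup.
    by apply/mapP; exists (x, y).
  by apply/mapP; exists (x, y).
rewrite big_allpairs_dep/=.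
apply: (@le_trans _ _ (\sum_(x <- F1) v x * C)).
  by apply: ler_sum => x _; apply: ha; exact: undup_uniq.
by rewrite -mulr_suml ler_wpM2r// hv// undup_uniq.
Qed.

End SubsetSums.

Section Assemble.
Context {R : realType} (p : R) (p1 : (1 <= p%:E)%E) (X : diagonal).
Local Notation gens := (@dgens X).
Local Notation D := (dirprod (fun s => wreath (dG X s))).
Local Notation H := (generated_subgroup gens).

Definition step_bounded (T : eqType) (C : R) (f : D -> T -> R) : Prop :=
  forall (g c : D) (F : seq T), H g -> gens c -> uniq F ->
    \sum_(i <- F) `|f (g * c)%g i - f g i| `^ p <= C.

Lemma H_mul (x y : D) : H x -> H y -> H (x * y)%g.
Proof. by move=> /ball_word_length hx /ball_word_length hy; exact: ball_subgroup (ballM hx hy). Qed.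

Lemma H_inv (x : D) : H x -> H (x^-1)%g.
Proof. by move=> /ball_word_length hx; exact: ball_subgroup (ballV hx). Qed.

Lemma H_gen (c : D) : gens c -> H c.
Proof. by move=> /ball_gen; exact: ball_subgroup. Qed.

Lemma step_bounded_ball (T : eqType) (C : R) (f : D -> T -> R) (n : nat) (g u : D) (F : seq T) :
  0 <= C -> step_bounded C f -> H g -> ball gens n u -> uniq F ->
  \sum_(i <- F) `|f (g * u)%g i - f g i| `^ p <= n%:R `^ p * C.
Proof.
move=> C0 hf Hg [w [hw <- sw]] uF.
have p0 : 0 < p by apply: lt_le_trans ltr01 _; rewrite -lee_fin.
have p1' : 1 <= p by rewrite -lee_fin.
pose x m := (g * \prod_(y <- take m w) y)%g.
have Hx m : H (x m).
  apply: H_mul => //; exists (take m w) => // y /mem_take; exact: hw.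
have step m G : (m < size w)%N -> uniq G ->
    \sum_(i <- G) `|f (x m.+1) i - f (x m) i| `^ p <= C.
  move=> mw uG; pose y := nth 1%g w m.
  have xE : x m.+1 = (x m * y)%g.
    by rewrite /x (take_nth 1%g mw) -cats1 big_cat big_seq1 mulgA.
  have [hy|hy] := hw y (mem_nth _ mw); rewrite xE; first exact: hf.
  have := hf (x m * y)%g (y^-1)%g G (H_mul (Hx m) _) hy uG; rewrite mulgK => h.
  under eq_bigr do rewrite distrC; apply: h.
  by rewrite -[y]invgK; apply/H_inv/H_gen.
have x0 : x 0%N = g by rewrite /x take0 big_nil mulg1.
have xn : x (size w) = (g * \prod_(y <- w) y)%g by rewrite /x take_size.
apply: (@le_trans _ _ ((size w)%:R `^ p * C)); last first.
  by rewrite ler_wpM2r//; apply: ler_pow; rewrite ?ler_nat// ltW.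
have [w0|w0] := posnP (size w).
  rewrite -xn w0 x0 big1 ?mulr_ge0 ?powR_ge0// => i _.
  by rewrite subrr normr0 powR0// gt_eqF.
apply: (@le_trans _ _ (\sum_(i <- F) (size w)%:R `^ (p - 1) *
    \sum_(m < size w) `|f (x m.+1) i - f (x m) i| `^ p)).
  apply: ler_sum => i _.
  have -> : f (g * \prod_(y <- w) y)%g i - f g i = \sum_(m < size w) (f (x m.+1) i - f (x m) i).
    by rewrite -xn -[in f g i]x0 -(big_mkord xpredT (fun m => f (x m.+1) i - f (x m) i)) telescope_sumr.
  by have := power_mean_abs (fun m : 'I_(size w) => f (x m.+1) i - f (x m) i) p1'; rewrite card_ord.
rewrite -mulr_sumr exchange_big/=.
apply: (@le_trans _ _ ((size w)%:R `^ (p - 1) * ((size w)%:R * C))).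
  rewrite ler_wpM2l ?powR_ge0// -[X in X%:R * C](card_ord (size w)) -sum_cst.
  by apply: ler_sum => m _; exact: step.
by rewrite mulrA -{2}[(size w)%:R]powRr1// -powRD ?subrK// pnatr_eq0 -lt0n w0 implybT.
Qed.

(** The l_p sum of the components scaled by v_j^(1/p): summable weights keep it Lipschitz, and its
    energy dominates each weighted component. *)
Lemma assemble (J : countType) (f : J -> D -> nat -> R) (v : J -> R) (C W : R) :
  0 <= C -> (forall j, 0 <= v j) -> (forall F, uniq F -> \sum_(j <- F) v j <= W) ->
  (forall j, step_bounded C (f j)) ->
  exists Psi : H -> Lp01 p1, lipschitz_map Psi /\
    forall j (g h : H) (F : seq nat), uniq F ->
      v j * \sum_(i <- F) `|f j (val g) i - f j (val h) i| `^ p <= energy (Psi g) (Psi h).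
Proof.
move=> C0 v0 hW hf.
have p0 : 0 < p by apply: lt_le_trans ltr01 _; rewrite -lee_fin.
have W0 : 0 <= W by have := hW [::] isT; rewrite big_nil.
pose u (g : H) (x : J * nat) : R := v x.1 `^ p^-1 * f x.1 (val g) x.2.
have uE g h x : `|u g x - u h x| `^ p = v x.1 * `|f x.1 (val g) x.2 - f x.1 (val h) x.2| `^ p.
  rewrite /u -mulrBr normrM ger0_norm ?powR_ge0// powRM ?powR_ge0//.
  by rewrite -powRrM mulVf ?gt_eqF// powRr1.
have fin g h (F : seq (J * nat)) : uniq F ->
    \sum_(x <- F) `|u g x - u h x| `^ p <=
    W * ((subgroup_dist h g)%:R `^ p * C).
  move=> uF; under eq_bigr do rewrite uE.
  apply: (@sum_pair_le _ _ _ _ (fun j i => v j * `|f j (val g) i - f j (val h) i| `^ p) _ _ v) => //.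
  - by move=> j i; rewrite mulr_ge0 ?powR_ge0.
  - by rewrite mulr_ge0 ?powR_ge0.
  move=> j G uG; rewrite -mulr_sumr ler_wpM2l//.
  have Hv (z : H) : H (val z) by exact: set_valP.
  have hd : ball gens (subgroup_dist h g) ((val h)^-1 * val g)%g.
    by apply: ball_word_length; apply: H_mul; [apply: H_inv|].
  have := step_bounded_ball C0 (hf j) (Hv h) hd uG.
  by rewrite mulKVg.
have esum_le g h : (\esum_(x in setT) (`|u g x - u h x| `^ p)%:E <=
    (W * ((subgroup_dist h g)%:R `^ p * C))%:E)%E.
  apply: ge_ereal_sup => _ [S [finS _] <-].
  rewrite fsbig_finite//= sumEFin lee_fin; apply: fin; exact: finmap.fset_uniq.
have [|Psi hPsi] := @Lp01_realize R p p1 _ H (mem_H (ball_subgroup (ball1 gens 0))) u.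
  by move=> g h; apply: le_lt_trans (esum_le g h) (ltry _).
exists Psi; split.
  exists ((W * C) `^ p^-1) => x y.
  rewrite energy_dist ?mulr_ge0 ?powR_ge0//.
  rewrite powRM ?powR_ge0// -powRrM mulVf ?gt_eqF// powRr1 ?mulr_ge0//.
  rewrite -lee_fin hPsi.
  under eq_esum do rewrite distrC.
  apply: le_trans (esum_le y x) _; rewrite lee_fin le_eqVlt; apply/orP; left; apply/eqP; ring.
move=> j g h F uF; rewrite -lee_fin hPsi; apply: esum_ge.
exists [set` [seq (j, i) | i <- F]]; first by split => //; exact: finite_seq.
rewrite -fsbig_seq ?map_inj_uniq//; last by move=> i i' [].
rewrite big_map sumEFin lee_fin mulr_sumr.
by apply: ler_sum => i _; rewrite uE.
Qed.

(** Reindexing by natural numbers lets components over different index types enter one sum. *)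
Definition code_fun (T : countType) (f : D -> T -> R) (g : D) (n : nat) : R :=
  if @pickle_inv T n is Some i then f g i else 0.

Lemma code_step_bounded (T : countType) (C : R) (f : D -> T -> R) :
  step_bounded C f -> step_bounded C (code_fun f).
Proof.
move=> hf g c F Hg hc uF; have p0 : p != 0.
  by rewrite gt_eqF//; apply: lt_le_trans ltr01 _; rewrite -lee_fin.
apply: le_trans (hf g c (pmap (@pickle_inv T) F) Hg hc (pmap_uniq (@pickle_invK T) uF)).
elim: F {uF} => [|n F IH]; first by rewrite !big_nil.
rewrite big_cons /= /code_fun; case: (pickle_inv n) => [i|] /=.
  by rewrite big_cons lerD2l.
by rewrite subrr normr0 powR0// add0r.
Qed.

Lemma code_sum (T : countType) (f : D -> T -> R) (g h : D) (F : seq T) :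
  \sum_(n <- map pickle F) `|code_fun f g n - code_fun f h n| `^ p =
  \sum_(i <- F) `|f g i - f h i| `^ p.
Proof. by rewrite big_map; apply: eq_bigr => i _; rewrite /code_fun pickleK_inv. Qed.

End Assemble.

Section Codes.
Context (X : diagonal).
Local Notation gens := (@dgens X).
Local Notation D := (dirprod (fun s => wreath (dG X s))).
Local Notation H := (generated_subgroup gens).

(** Words in the generators serve as countably many names of elements, among which [cls] picks one
    for each coset. *)
Definition code : Type := seq (bool * 'I_3).
HB.instance Definition _ := Countable.on code.

Definition letter_of (c : bool * 'I_3) : D :=
  let x := nth (diag_tau _) [:: diag_tau _; diag_alpha (da X); diag_beta (db X) (dk X)] c.2 in
  if c.1 then (x^-1)%g else x.

Definition decode (c : code) : D := (\prod_(y <- map letter_of c) y)%g.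

Lemma gens_letter (x : D) : gens x -> exists i, x = letter_of (false, i).
Proof.
case=> ->; [exists ord0|exists (inord 1)|exists (inord 2)] => //=;
by rewrite /letter_of /= inordK.
Qed.

Lemma decode_surj (x : D) : H x -> exists c, decode c = x.
Proof.
case=> w hw <-; elim: w hw => [|y w IH] hw; first by exists [::].
have [c hc] := IH (fun z zw => hw z (@mem_behead _ (y :: w) z zw)).
have [i hi] : exists i, y = letter_of i.
  have [/gens_letter[i ->]|/gens_letter[i hi]] := hw y (mem_head _ _); first by exists (false, i).
  by exists (true, i); rewrite -[LHS]invgK hi.
by exists (i :: c); rewrite /decode /= !big_cons -hi -hc.
Qed.

End Codes.

(** * Coset functions and the range *)

Section Cosets.
Context {R : realType} (p : R) (p1 : (1 <= p%:E)%E) (X : diagonal).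
Local Notation gens := (@dgens X).
Local Notation D := (dirprod (fun s => wreath (dG X s))).
Local Notation H := (generated_subgroup gens).
Local Notation tz := (tauz (fun s => dG X s)).
Local Notation dec := (@decode X).
Context (P : D -> Prop) (right : bool).

Definition dirz (z : int) : int := if right then z else - z.

Lemma dirzK z : dirz (dirz z) = z.
Proof. by rewrite /dirz; case: right; rewrite ?opprK. Qed.

Hypothesis P1 : P 1%g.
Hypothesis PM : forall x y, P x -> P y -> P (x * y)%g.
Hypothesis PV : forall x, P x -> P (x^-1)%g.
Hypothesis Pcur : forall x, P x -> cur x 0 = 0.
Hypothesis Pstep : forall c (z : int), gens c -> c <> diag_tau _ -> 0 <= z ->
  P (tz (- dirz z) * c * tz (dirz z))%g.

(* A code of the coset x P; the default [::] is never used for x in H. *)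
Definition cls (x : D) : code := xget [::] [set c | P (x^-1 * dec c)%g].

Lemma cls_eq x y : P (x^-1 * y)%g -> cls x = cls y.
Proof.
move=> h; rewrite /cls; congr xget; apply/seteqP; split => c /= hc.
  by have := PM (PV h) hc; rewrite invMg invgK -mulgA mulKVg.
by have := PM h hc; rewrite -mulgA mulKVg.
Qed.

Lemma clsP x : H x -> P (x^-1 * dec (cls x))%g.
Proof.
move=> /decode_surj[c hc]; apply: (@xgetPex _ [::] [set c | P (x^-1 * dec c)%g]).
by exists c; rewrite /= hc mulVg.
Qed.

Definition hat (L : nat) (n : int) : nat := if n is Posz m then minn m (L - m) else 0.

Lemma hat_neg L n : n <= 0 -> hat L n = 0%N.
Proof. by case: n => [[|n]|n]//= _; rewrite min0n. Qed.

Lemma hat_step L (m n : int) : (absz (m - n) <= 1)%N ->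
  (absz ((hat L m)%:Z - (hat L n)%:Z)%R <= ((- 1 <= m)%R && (m <= L.+1%:Z)%R))%N.
Proof.
move=> mn; case: (boolP (_ && _)) => h /=.
  by move: mn; rewrite /hat; case: m {h} => m; case: n => n; lia.
by move: mn h; rewrite /hat; case: m => m; case: n => n; lia.
Qed.

(* If c codes the coset of g t^z then the cursor of c recovers z: the coset
   functions of g and h have disjoint supports as soon as g t^z and h t^z' never
   agree modulo P in the range where the hat is large. *)
Definition coset_fun (L : nat) (g : D) (c : code) : R :=
  let z := cur (dec c) 0 - cur g 0 in
  if c == cls (g * tz z)%g then L%:R `^ (- p^-1) * (hat L (dirz z))%:R else 0.

Lemma p_gt0 : 0 < p. Proof. by apply: lt_le_trans ltr01 _; rewrite -lee_fin. Qed.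

Lemma coset_pow (L : nat) (x : R) : `|L%:R `^ (- p^-1) * x| `^ p = L%:R^-1 * `|x| `^ p.
Proof.
rewrite normrM ger0_norm ?powR_ge0// powRM ?powR_ge0//.
by rewrite -powRrM mulNr mulVf ?gt_eqF ?p_gt0// powR_inv1.
Qed.

(** A generator other than tau, suitably conjugated, lies in [P] by [Pstep] and so changes no coset
    where the hat is positive. Tau shifts the hat by one: at most L + 3 codes change, each by at
    most L^(-1/p), and (L + 3) / L <= 4. *)
Lemma coset_fun_step (L : nat) : (0 < L)%N -> step_bounded p 4 (coset_fun L).
Proof.
move=> L0 g c F Hg hc uF; have p0 := p_gt0.
have [ct|ct] := pselect (c = diag_tau _); last first.
  rewrite big1// => i _; suff -> : coset_fun L (g * c)%g i = coset_fun L g i.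
    by rewrite subrr normr0 powR0// gt_eqF.
  have cc : cur (g * c)%g 0 = cur g 0.
    have -> : cur (g * c)%g 0 = cur g 0 + cur c 0 by [].
    by case: hc ct => -> // _; rewrite ?cur_alpha ?cur_beta addr0.
  rewrite /coset_fun cc; set z := _ - _.
  have [h|h] := lerP 0 (dirz z); last by rewrite (hat_neg L (ltW h)) mulr0; do 2!case: ifP.
  rewrite (cls_eq (y := (g * tz z)%g))//.
  have := PV (Pstep hc ct h); rewrite dirzK !invMg -!tauzV opprK.
  by rewrite -!mulgA mulKg.
pose in_range (i : code) := (i == cls (g * tz (cur (dec i) 0 - cur g 0))%g) &&
  ((- 1 <= dirz (cur (dec i) 0 - cur g 0)) && (dirz (cur (dec i) 0 - cur g 0) <= L.+1%:Z)).
have hstep i : `|coset_fun L (g * c)%g i - coset_fun L g i| `^ p <= (in_range i)%:R / L%:R.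
  have cc : cur (dec i) 0 - cur (g * c)%g 0 = cur (dec i) 0 - cur g 0 - 1.
    have -> : cur (g * c)%g 0 = cur g 0 + 1 by rewrite ct.
    by ring.
  rewrite /coset_fun cc /in_range; set z := _ - cur g 0.
  have -> : (g * c * tz (z - 1))%g = (g * tz z)%g.
    by rewrite ct -tauz1 -mulgA -tauzD addrC subrK.
  case: ifP => _; last by rewrite subrr normr0 powR0 ?gt_eqF//= mul0r.
  rewrite -mulrBr coset_pow mulrC ler_wpM2r ?invr_ge0//=.
  have := @hat_step L (dirz z) (dirz (z - 1)).
  have -> : (absz (dirz z - dirz (z - 1))%R <= 1)%N by rewrite /dirz; case: right; lia.
  move=> /(_ isT); move: (hat _ _) (hat _ _) => h1 h2.
  have e : `|h1%:R - h2%:R| = (absz (h2%:Z - h1%:Z)%R)%:R :> R.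
    by rewrite natr_absz intr_norm rmorphB distrC.
  rewrite e; case: (_ && _) => /=; case: (absz _) => [|[|]]// _; rewrite ?powR1// ?powR0 ?gt_eqF//.
apply: le_trans (ler_sum _ (fun i _ => hstep i)) _.
pose G := [seq cls (g * tz (dirz (m%:Z - 1)))%g | m <- iota 0 L.+3].
apply: (@le_trans _ _ (\sum_(i <- undup G) (L%:R^-1 : R))).
  rewrite -[X in X <= _](_ : \sum_(i <- [seq i <- F | in_range i]) (L%:R^-1 : R) = _); last first.
    by rewrite big_filter big_mkcond/=; apply: eq_bigr => i _; case: (in_range i); rewrite ?mul1r ?mul0r.
  apply: ler_sum_uniq => //; [exact: filter_uniq|exact: undup_uniq|].
  move=> i; rewrite mem_filter mem_undup => /andP[/andP[/eqP ic h] _].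
  set z := _ - _ in ic h; apply/mapP; exists (absz (dirz z + 1)%R).
    by rewrite mem_iota; lia.
  have -> : (absz (dirz z + 1)%R)%:Z - 1 = dirz z by lia.
  by rewrite dirzK.
rewrite big_const_seq count_predT iter_addr addr0.
apply: (@le_trans _ _ (L.+3%:R * L%:R^-1)).
  rewrite -[leLHS]mulr_natl ler_wpM2r ?invr_ge0// ler_nat.
  by rewrite (leq_trans (size_undup _))// size_map size_iota.
rewrite ler_pdivrMr ?ltr0n// -natrM ler_nat; lia.
Qed.

(** For n between L and 3L the hat of width 4L is at least L, while the function of [h] vanishes at
    these cosets: 2L + 1 terms of size at least L^p / (4L). *)
Lemma coset_fun_far (L : nat) (g h : D) : (0 < L)%N -> H g -> H h ->
  (forall (n : nat) (m : int), (n <= 4 * L)%N -> 0 < m ->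
     ~ P (tz (- dirz n%:Z) * (g^-1 * h) * tz (dirz m))%g) ->
  exists2 F, uniq F & L%:R `^ p / 2 <=
    \sum_(c <- F) `|coset_fun (4 * L) g c - coset_fun (4 * L) h c| `^ p.
Proof.
move=> L0 Hg Hh hP; have p0 := p_gt0.
pose e (n : nat) := cls (g * tz (dirz n%:Z))%g.
have Htz z : H (tz z) by apply: ball_subgroup (ball_tauz (da X) (db X) (dk X) z).
have eP n : P ((g * tz (dirz n%:Z))^-1 * dec (e n))%g by apply: clsP; exact: H_mul.
have ecur n : cur (dec (e n)) 0 = cur g 0 + dirz n%:Z.
  have := Pcur (eP n).
  have -> : cur ((g * tz (dirz n%:Z))^-1 * dec (e n))%g 0 =
    - (cur g 0 + dirz n%:Z) + cur (dec (e n)) 0 by [].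
  by lia.
have einj : injective e.
  move=> n n' h'; have := ecur n; rewrite h' ecur => /addrI h2.
  by have := congr1 dirz h2; rewrite !dirzK => -[].
exists [seq e n | n <- iota L (2 * L).+1]; first by rewrite map_inj_uniq ?iota_uniq.
rewrite big_map.
apply: (@le_trans _ _ (\sum_(n <- iota L (2 * L).+1) (4 * L)%:R^-1 * L%:R `^ p)).
  rewrite big_const_seq count_predT iter_addr addr0 size_iota -[leRHS]mulr_natl mulrA.
  rewrite mulrC ler_wpM2r ?powR_ge0//.
  have L40 : 0 < (4 * L)%:R :> R by rewrite ltr0n; lia.
  by rewrite ler_pdivlMr// -[(2 * L).+1]addn1 natrD !natrM; lra.
rewrite [leLHS]big_seq [leRHS]big_seq; apply: ler_sum => n; rewrite mem_iota => hn.
have -> : coset_fun (4 * L) h (e n) = 0.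
  rewrite /coset_fun; set z := _ - cur h 0; case: ifP => // /eqP he.
  have [hz|hz] := lerP (dirz z) 0; first by rewrite (hat_neg _ hz) mulr0.
  exfalso; apply: (hP n (dirz z)); [lia|by []|].
  rewrite dirzK; have h1 : P ((h * tz z)^-1 * dec (e n))%g.
    by rewrite he; apply: clsP; exact: H_mul.
  have := PM (eP n) (PV h1); rewrite !invMg invgK -tauzV.
  by rewrite !mulgA mulgK invgK.
have -> : coset_fun (4 * L) g (e n) = (4 * L)%:R `^ (- p^-1) * (hat (4 * L) n%:Z)%:R.
  by rewrite /coset_fun ecur addrAC subrr add0r dirzK eqxx.
rewrite subr0 coset_pow ler_wpM2l ?invr_ge0//; apply: ler_pow; [exact: ltW|by []|].
by rewrite ger0_norm// ler_nat /hat; lia.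
Qed.

End Cosets.

Section Range.
Context {R : realType} (p : R) (p1 : (1 <= p%:E)%E) (X : diagonal).
Local Notation gens := (@dgens X).
Local Notation k := (dk X).
Local Notation D := (dirprod (fun s => wreath (dG X s))).
Local Notation H := (generated_subgroup gens).
Local Notation tz := (tauz (fun s => dG X s)).

Section Mask.
Context (c : forall s, dG X s) (A B : nat -> int -> bool).
Hypothesis cc : forall s, (c s * c s = 1)%g.

(** A common form of the two subgroups used for the range: on [A] only the involution [c] may occur,
    on [B] no letter at all. Closure under products comes from c^2 = 1. *)
Definition masked (y : D) : Prop := (forall s, cur y s = 0) /\
  forall s j, (A s j -> lam y s j = 1%g \/ lam y s j = c s) /\ (B s j -> lam y s j = 1%g).

Lemma masked1 : masked 1%g.
Proof. by split => // s j; split => // _; left. Qed.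

Lemma maskedM x y : masked x -> masked y -> masked (x * y)%g.
Proof.
move=> [cx hx] [cy hy]; split => [s|s j].
  by have -> : cur (x * y)%g s = cur x s + cur y s by []; rewrite cx cy.
have -> : lam (x * y)%g s j = (lam x s j * lam y s (j - cur x s))%g by [].
rewrite cx subr0; have [h1 h2] := hx s j; have [h3 h4] := hy s j.
split => [/[dup]/h1 h /h3|/[dup]/h2 -> /h4 ->]; last by rewrite mulg1.
by move: h => [] -> [] ->; rewrite ?mulg1 ?mul1g ?cc; [left|right|right|left].
Qed.

Lemma maskedV x : masked x -> masked (x^-1)%g.
Proof.
move=> [cx hx]; split => [s|s j].
  by have -> : cur (x^-1)%g s = - cur x s by []; rewrite cx oppr0.
have -> : lam (x^-1)%g s j = ((lam x s (j + cur x s))^-1)%g by [].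
rewrite cx addr0; have [h1 h2] := hx s j; split => [/h1|/h2 ->]; last by rewrite invg1.
case=> ->; first by left; rewrite invg1.
by right; apply/eqP; rewrite eq_invg_mul cc.
Qed.

Lemma maskedT x (z z' : int) s j : masked (tz (- z) * x * tz z')%g ->
  (A s (j - z) -> lam x s j = 1%g \/ lam x s j = c s) /\ (B s (j - z) -> lam x s j = 1%g).
Proof.
move=> [_ /(_ s (j - z))]; rewrite (_ : lam _ s (j - z) = lam x s j)//.
have -> : lam (tz (- z) * x * tz z')%g s (j - z) = (1 * lam x s (j - z - - z) * 1)%g by [].
by rewrite mul1g mulg1 opprK subrK.
Qed.

Lemma masked_conj x (z : int) : (forall s, cur x s = 0) ->
  (forall s j, (A s j -> lam x s (j + z) = 1%g \/ lam x s (j + z) = c s) /\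
     (B s j -> lam x s (j + z) = 1%g)) -> masked (tz (- z) * x * tz z)%g.
Proof.
move=> cx hx; split => [s|s j].
  have -> : cur (tz (- z) * x * tz z)%g s = - z + cur x s + z by [].
  by rewrite cx; ring.
have -> : lam (tz (- z) * x * tz z)%g s j = (1 * lam x s (j - - z) * 1)%g by [].
by rewrite mul1g mulg1 opprK; exact: hx.
Qed.

End Mask.

(* Seen from a cursor far on the right, a letter applied further to the left only
   changes such invisible entries. *)
Definition right_mask := masked (db X) (fun _ j => 0 < j) (fun s j => (k s)%:Z < j).
Definition left_mask := masked (da X) (fun s j => j < (k s)%:Z) (fun _ j => j < 0).

Lemma right_mask_step (c : D) (z : int) : gens c -> c <> diag_tau _ -> 0 <= z ->
  right_mask (tz (- dirz true z) * c * tz (dirz true z))%g.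
Proof.
move=> hc ct z0; apply: masked_conj => [s|s j].
  by case: hc ct => -> //.
rewrite /dirz; case: hc ct => -> // _.
  by rewrite lam_alpha; split => h; (rewrite ifF; first by [left|]); apply/eqP; lia.
rewrite lam_beta; split; first by case: ifP; [right|left].
by move=> h; rewrite ifF//; apply/eqP; lia.
Qed.

Lemma left_mask_step (c : D) (z : int) : gens c -> c <> diag_tau _ -> 0 <= z ->
  left_mask (tz (- dirz false z) * c * tz (dirz false z))%g.
Proof.
move=> hc ct z0; apply: masked_conj => [s|s j].
  by case: hc ct => -> //.
rewrite /dirz; case: hc ct => -> // _.
  rewrite lam_alpha; split; first by case: ifP; [right|left].
  by move=> h; rewrite ifF//; apply/eqP; lia.
by rewrite lam_beta; split => h; (rewrite ifF; first by [left|]); apply/eqP; lia.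
Qed.

Definition range_fun (right : bool) (L : nat) : D -> code -> R :=
  if right then coset_fun p right_mask true (4 * L) else coset_fun p left_mask false (4 * L).

Lemma range_fun_step right L : (0 < L)%N -> step_bounded p 4 (range_fun right L).
Proof.
move=> L0; case: right; apply: coset_fun_step => //; try lia.
- exact: maskedM (fun s => mulbb (dob X s)).
- exact: maskedV (fun s => mulbb (dob X s)).
- exact: right_mask_step.
- exact: maskedM (fun s => mulaa (doa X s)).
- exact: maskedV (fun s => mulaa (doa X s)).
- exact: left_mask_step.
Qed.

(** An element tau^(-n) x tau^m of the right mask with n <= 4L and m > 0 forces the right range and
    the cursor of [x] to be at most 4L. If these bounds fail, [coset_fun_far] therefore separates
    [g] from [h]; the left side is symmetric. *)
Lemma range_fun_far L (g h : D) : (0 < L)%N -> H g -> H h ->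
  let x := (g^-1 * h)%g in
  [/\ right_range x (4 * L), left_range x (4 * L) & (`|cur x 0| <= 4 * L)%N] \/
  exists right F, uniq F /\
    L%:R `^ p / 2 <= \sum_(c <- F) `|range_fun right L g c - range_fun right L h c| `^ p.
Proof.
move=> L0 Hg Hh x.
have [rr|rr] := pselect (right_range x (4 * L) /\ cur x 0 <= (4 * L)%N%:Z); last first.
  right; have [] := @coset_fun_far R p p1 X right_mask true _ _ _ _ L g h L0 Hg Hh.
  - exact: masked1.
  - exact: maskedM (fun s => mulbb (dob X s)).
  - exact: maskedV (fun s => mulbb (dob X s)).
  - by move=> y [].
  - move=> n m nL m0 hm; apply: rr; split; last first.
      have := hm.1 0%N.
      have -> : cur (tz (- dirz true n%:Z) * x * tz (dirz true m))%g 0 = - n%:Z + cur x 0 + m by [].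
      lia.
    move=> s j hj; have [h1 h2] := maskedT s j hm; split.
      by apply: h1; rewrite /dirz; lia.
    by move=> h'; apply: h2; rewrite /dirz; lia.
  - by move=> F uF hF; exists true, F.
have [ll|ll] := pselect (left_range x (4 * L) /\ - cur x 0 <= (4 * L)%N%:Z); last first.
  right; have [] := @coset_fun_far R p p1 X left_mask false _ _ _ _ L g h L0 Hg Hh.
  - exact: masked1.
  - exact: maskedM (fun s => mulaa (doa X s)).
  - exact: maskedV (fun s => mulaa (doa X s)).
  - by move=> y [].
  - move=> n m nL m0 hm; apply: ll; split; last first.
      have := hm.1 0%N.
      have -> : cur (tz (- dirz false n%:Z) * x * tz (dirz false m))%g 0 = - - n%:Z + cur x 0 + - m by [].
      lia.
    move=> s j hj; have [h1 h2] := maskedT s j hm; split.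
      by apply: h1; rewrite /dirz; lia.
    by move=> h'; apply: h2; rewrite /dirz; lia.
  - by move=> F uF hF; exists false, F.
by left; split; [exact: rr.1|exact: ll.1|have := rr.2; have := ll.2; lia].
Qed.

End Range.

(** * Site functions and signed block sums *)

Section CircleComponents.
Context {R : realType} (p : R) (p1 : (1 <= p%:E)%E) (X : diagonal).
Local Notation gens := (@dgens X).
Local Notation k := (dk X).
Local Notation D := (dirprod (fun s => wreath (dG X s))).
Local Notation H := (generated_subgroup gens).

Definition circleR s (w : bool) (g : D) (j : int) : R := (circle s w g j)%:~R.

Lemma circleR_step s w (g c : D) (j : int) : gens c ->
  `|circleR s w (g * c)%g j - circleR s w g j| <= (active s g j)%:R.
Proof.
move=> hc; have := circle_step s w g j hc.
by rewrite -(ler_nat R) natr_absz intr_norm rmorphB.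
Qed.

(** The factor compensates that one step may change k_s sites. *)
Definition site_fun s (g : D) (x : int * bool) : R :=
  (k s)%:R `^ (- p^-1) * circleR s x.2 g x.1.

Let p0 : 0 < p. Proof. by apply: lt_le_trans ltr01 _; rewrite -lee_fin. Qed.

Lemma active_window s (g : D) (j : int) : active s g j ->
  j \in [seq cur g s + m.+1%:Z | m <- iota 0 (k s)].
Proof.
rewrite /active => h; apply/mapP; exists (absz (j - cur g s)%R).-1; rewrite ?mem_iota; lia.
Qed.

Lemma site_fun_step s : step_bounded p 2 (site_fun s).
Proof.
move=> g c F Hg hc uF.
have hstep x : `|site_fun s (g * c)%g x - site_fun s g x| `^ p <= (active s g x.1)%:R / (k s)%:R.
  rewrite /site_fun -mulrBr coset_pow// mulrC ler_wpM2r ?invr_ge0//.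
  have := circleR_step s x.2 g x.1 hc; case: (active _ _ _) => /= h.
    by have := ler_pow (ltW p0) (normr_ge0 _) h; rewrite powR1.
  by move: h; rewrite normr_le0 => /eqP ->; rewrite normr0 powR0 ?gt_eqF.
apply: le_trans (ler_sum _ (fun x _ => hstep x)) _.
pose G := [seq (j, w) | j <- [seq cur g s + m.+1%:Z | m <- iota 0 (k s)], w <- [:: true; false]].
apply: (@le_trans _ _ (\sum_(x <- undup G) ((k s)%:R^-1 : R))).
  rewrite -[X in X <= _](_ : \sum_(x <- [seq x <- F | active s g x.1]) ((k s)%:R^-1 : R) = _); last first.
    by rewrite big_filter big_mkcond/=; apply: eq_bigr => x _; case: (active s g _); rewrite ?mul1r ?mul0r.
  apply: ler_sum_uniq => //; [exact: filter_uniq|exact: undup_uniq|].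
  move=> [j w]; rewrite mem_filter mem_undup => /andP[/active_window hj _].
  by apply/allpairsP; exists (j, w); split => //=; rewrite !inE; case: (w).
rewrite big_const_seq count_predT iter_addr addr0.
apply: (@le_trans _ _ ((2 * k s)%:R * (k s)%:R^-1)).
  rewrite -[leLHS]mulr_natl ler_wpM2r ?invr_ge0// ler_nat.
  by rewrite (leq_trans (size_undup _))// size_allpairs size_map size_iota mulnC.
have [->|k0] := posnP (k s); first by rewrite muln0 mul0r.
by rewrite natrM mulfK// pnatr_eq0 -lt0n.
Qed.

Definition block_diff s (w : bool) (L : nat) (g h : D) (m : int) : seq R :=
  [seq circleR s w g (m * L%:Z + i%:Z) - circleR s w h (m * L%:Z + i%:Z) | i <- iota 0 L].

(* Signed sums over all choices of signs: by Khintchine they measure the square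
   norm of a block in any L_p. *)
Definition block_fun s (L : nat) (g : D) (x : int * bool * seq bool) : R :=
  if (size x.2 == L) && (0 < k s <= L)%N then
    (2 ^+ L)%R `^ (- p^-1) * ((k s)%:R `^ (- 2^-1) *
       signed_sum x.2 [seq circleR s x.1.2 g (x.1.1 * L%:Z + i%:Z) | i <- iota 0 L])
  else 0.

Lemma signed_sumB (w : seq bool) (T : Type) (r : seq T) (f g : T -> R) :
  signed_sum w (map f r) - signed_sum w (map g r) = signed_sum w [seq f x - g x | x <- r].
Proof.
elim: w r => [|b w IH] [|x r] /=; rewrite ?subrr//.
by rewrite -IH; ring.
Qed.

Lemma block_fun_diff s (L : nat) (g h : D) x :
  `|block_fun s L g x - block_fun s L h x| `^ p =
  if (size x.2 == L) && (0 < k s <= L)%N then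
    (2 ^+ L)^-1 * ((k s)%:R `^ (- (p / 2)) * `|signed_sum x.2 (block_diff s x.1.2 L g h x.1.1)| `^ p)
  else 0.
Proof.
rewrite /block_fun; case: ifP => _; last by rewrite subrr normr0 powR0 ?gt_eqF.
rewrite -!mulrBr signed_sumB normrM ger0_norm ?powR_ge0// powRM ?powR_ge0//.
rewrite -powRrM mulNr mulVf ?gt_eqF// powR_inv1 ?exprn_ge0//; congr (_ * _).
rewrite normrM ger0_norm ?powR_ge0// powRM ?powR_ge0// -powRrM; congr (_ `^ _ * _).
by rewrite mulNr mulrC.
Qed.

Lemma mem_words (n : nat) (w : seq bool) : (w \in words n) = (size w == n).
Proof.
elim: n w => [|n IH] [|b w] //=.
  by apply/negbTE/negP => /allpairsP[[? ?] [_ _]].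
rewrite eqSS -IH; apply/allpairsP/idP => [[[b' w'] [_ h [_ ->]]]//|h].
by exists (b, w); split => //; rewrite mem_enum.
Qed.

Lemma uniq_words (n : nat) : uniq (words n : seq (seq bool)).
Proof.
elim: n => // n IH; apply: allpairs_uniq => //; first exact: enum_uniq.
by move=> [b w] [b' w'] _ _ [-> ->].
Qed.

Lemma size_block_diff s w L (g h : D) m : size (block_diff s w L g h m) = L.
Proof. by rewrite size_map size_iota. Qed.

(** The k_s active sites meet at most two consecutive blocks of length L >= k_s. In each,
    Khintchine's inequality with at most k_s nonzero terms gives k_s^(p/2), which the normalization
    cancels; two blocks and two values of [w] make the factor 4. *)
Lemma block_fun_step : exists2 C : R, 0 < C & forall s L, (0 < L)%N ->
  step_bounded p C (block_fun s L).
Proof.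
have p1' : 1 <= p by rewrite -lee_fin.
have [C C0 HC] := rademacher_upper p1'.
exists (4 * C); first by rewrite mulr_gt0.
move=> s L L0 g c F Hg hc uF.
have [/andP[k0 kL]|kL] := boolP (0 < k s <= L)%N; last first.
  rewrite big1; first by rewrite mulr_ge0// ltW.
  by move=> x _; rewrite block_fun_diff (negbTE kL) andbF.
pose blk (j : int) : int := (j %/ L%:Z)%Z.
pose B := [:: blk (cur g s + 1); blk (cur g s + (k s)%:Z)].
pose T (x : int * bool * seq bool) : R := (2 ^+ L)^-1 * ((k s)%:R `^ (- (p / 2)) *
  `|signed_sum x.2 (block_diff s x.1.2 L (g * c)%g g x.1.1)| `^ p).
have T0 x : 0 <= T x by rewrite !mulr_ge0 ?invr_ge0 ?exprn_ge0 ?powR_ge0.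
have blkE m i : (i < L)%N -> blk (m * L%:Z + i%:Z) = m.
  by move=> iL; rewrite /blk divzMDl ?divz_small ?addr0//; lia.
have active_blk j : active s g j -> blk j \in B.
  rewrite /active => h; rewrite !inE.
  have b1 : blk (cur g s + 1) <= blk j by apply: lez_pdiv2r; lia.
  have b2 : blk j <= blk (cur g s + (k s)%:Z) by apply: lez_pdiv2r; lia.
  have b3 : blk (cur g s + (k s)%:Z) <= blk (cur g s + 1) + 1.
    have -> : blk (cur g s + 1) + 1 = blk (1 * L%:Z + (cur g s + 1)).
      by rewrite /blk divzMDl 1?addrC//; lia.
    by apply: lez_pdiv2r; lia.
  lia.
have diff_le w m i : `|circleR s w (g * c)%g (m * L%:Z + i%:Z) - circleR s w g (m * L%:Z + i%:Z)| <=
    (active s g (m * L%:Z + i%:Z))%:R by exact: circleR_step.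
have off_block x : x.1.1 \notin B -> T x = 0.
  move=> xB; rewrite /T; suff -> : block_diff s x.1.2 L (g * c)%g g x.1.1 = nseq L 0.
    have -> : signed_sum x.2 (nseq L (0 : R)) = 0.
      by elim: (L) (x.2) => [|n IH] [|b e] //=; rewrite IH mulr0 addr0.
    by rewrite normr0 powR0 ?gt_eqF// !mulr0.
  rewrite /block_diff; apply: (@eq_from_nth _ 0); first by rewrite size_map size_iota size_nseq.
  move=> i; rewrite size_map size_iota => iL; rewrite nth_nseq iL (nth_map 0%N) ?size_iota// nth_iota// add0n.
  have := diff_le x.1.2 x.1.1 i; case E : (active _ _ _) => /= h.
    by move: xB; rewrite -(blkE x.1.1 i iL) active_blk.
  by apply/eqP; rewrite -normr_eq0 eq_le normr_ge0 h.
pose G := [seq (y, e) | y <- [seq (m, w) | m <- undup B, w <- [:: true; false]], e <- (words L : seq (seq bool))].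
have uG : uniq G.
  apply: allpairs_uniq; [|exact: uniq_words|by move=> [? ?] [? ?] _ _ [-> ->]].
  by apply: allpairs_uniq => //; [exact: undup_uniq|move=> [? ?] [? ?] _ _ [-> ->]].
apply: (@le_trans _ _ (\sum_(x <- G) T x)).
  apply: (@le_trans _ _ (\sum_(x <- [seq x <- F | (x.1.1 \in B) && (size x.2 == L)]) T x)).
    rewrite big_filter [leRHS]big_mkcond/=; apply: ler_sum => x _; rewrite block_fun_diff k0 kL andbT.
    case: (size x.2 == L); rewrite ?andbF// ?andbT.
    case: (boolP (x.1.1 \in B)) => //= xB.
    by have := off_block x xB; rewrite /T => ->.
  apply: ler_sum_uniq => //; first exact: filter_uniq.
  move=> [[m w] e]; rewrite mem_filter /= => /andP[/andP[mB se] _].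
  apply/allpairsP; exists ((m, w), e); split; [|by rewrite mem_words|by []].
  by apply/allpairsP; exists (m, w); split; [rewrite mem_undup|rewrite !inE; case: (w)|].
have block_le m w : \sum_(e <- (words L : seq (seq bool))) T (m, w, e) <= C.
  rewrite /T/= -!mulr_sumr.
  set cc := block_diff _ _ _ _ _ _.
  have sc : size cc = L by exact: size_block_diff.
  have h : \sum_(e <- words (size cc)) `|signed_sum e cc| `^ p <= 2 ^+ size cc * (C * (k s)%:R `^ (p / 2)).
    apply: HC => //.
      apply/allP => y /mapP[i _ ->]; apply: le_trans (diff_le _ _ _) _.
      by case: (active _ _ _).
    rewrite count_map.
    apply: (@leq_trans (count (fun i => active s g (m * L%:Z + i%:Z)) (iota 0 L))).
      apply: sub_count => i /=; apply: contraNT => na.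
      by have := diff_le w m i; rewrite (negbTE na) normr_le0.
    rewrite -size_filter -(size_map (fun i : nat => m * L%:Z + i%:Z)).
    have -> : k s = size [seq cur g s + m.+1%:Z | m <- iota 0 (k s)] by rewrite size_map size_iota.
    apply: uniq_leq_size.
      by rewrite map_inj_uniq ?filter_uniq ?iota_uniq// => i i' /addrI[].
    by move=> y /mapP[i]; rewrite mem_filter => /andP[hi _] ->; exact: active_window.
  rewrite sc in h; have N0 : 0 < 2 ^+ L :> R by rewrite exprn_gt0.
  apply: (@le_trans _ _ ((2 ^+ L)^-1 * ((k s)%:R `^ (- (p / 2)) * (2 ^+ L * (C * (k s)%:R `^ (p / 2)))))).
    apply: ler_wpM2l; first by rewrite invr_ge0 exprn_ge0.
    by apply: ler_wpM2l; first exact: powR_ge0.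
  rewrite powRN; have K0 : 0 < (k s)%:R `^ (p / 2) :> R by rewrite powR_gt0// ltr0n.
  by rewrite le_eqVlt; apply/orP; left; apply/eqP; field; rewrite !gt_eqF.
rewrite /G 2!big_allpairs_dep.
apply: (@le_trans _ _ (\sum_(m <- undup B) 2 * C)).
  apply: ler_sum => m _; rewrite big_cons big_seq1.
  by rewrite (_ : 2 * C = C + C); [apply: lerD; exact: block_le|ring].
rewrite big_const_seq count_predT iter_addr addr0 -[leLHS]mulr_natl.
have : (size (undup B))%:R <= 2 :> R by rewrite ler_nat (leq_trans (size_undup _)).
by move=> h; apply: le_trans (ler_wpM2r _ h) _; [rewrite mulr_ge0// ltW|lra].
Qed.

End CircleComponents.

(** * Assembling the embedding *)

Section Embedding.
Context {R : realType} (p : R) (p1 : (1 <= p%:E)%E) (X : diagonal).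
Local Notation gens := (@dgens X).
Local Notation l := (dl X).
Local Notation k := (dk X).
Local Notation D := (dirprod (fun s => wreath (dG X s))).
Local Notation H := (generated_subgroup gens).

Let p0 : 0 < p. Proof. by apply: lt_le_trans ltr01 _; rewrite -lee_fin. Qed.
Let p_ge1 : 1 <= p. Proof. by rewrite -lee_fin. Qed.

Lemma geometric_uniq (om : R) (F : seq nat) : 0 < om -> om < 1 -> uniq F ->
  \sum_(j <- F) om ^+ j <= (1 - om)^-1.
Proof.
move=> om0 om1 uF; pose N := (\max_(j <- F) j).+1.
apply: (@le_trans _ _ (\sum_(j <- iota 0 N) om ^+ j)).
  apply: ler_sum_uniq => //; [exact: iota_uniq| |by move=> j; rewrite exprn_ge0// ltW].
  by move=> j jF; rewrite mem_iota add0n ltnS/=; apply: leq_bigmax_seq.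
have -> : iota 0 N = index_iota 0 N by rewrite /index_iota subn0.
rewrite big_mkord; have h1 : 0 < 1 - om by rewrite subr_gt0.
rewrite -(ler_pM2r h1) mulVf ?gt_eqF// mulrC -opprB mulNr -subrX1 opprB.
by rewrite lerBlDr lerDl exprn_ge0// ltW.
Qed.

(** Modulo the trivial subgroup [cls] names single elements; these indicators give distinct elements
    energy at least 1, which settles small distances. *)
Definition delta_fun (g : D) (c : code) : R := (c == cls (fun x => x = 1%g) g)%:R.

Lemma delta_step : step_bounded p 2 delta_fun.
Proof.
move=> g c F Hg hc uF.
set a := cls (fun x => x = 1%g) (g * c)%g; set b := cls (fun x => x = 1%g) g.
have hx x : `|delta_fun (g * c)%g x - delta_fun g x| `^ p <= (x \in [:: a; b])%:R.
  rewrite /delta_fun -/a -/b !inE; case: (x == a); case: (x == b) => /=;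
  by rewrite ?subrr ?subr0 ?sub0r ?normrN ?normr1 ?normr0 ?powR1 ?powR0 ?gt_eqF.
apply: le_trans (ler_sum _ (fun x _ => hx x)) _.
apply: (@le_trans _ _ (\sum_(x <- undup [:: a; b]) (1 : R))).
  rewrite (eq_bigr (fun x => if x \in [:: a; b] then 1 else 0 : R)); last by move=> x _; case: (_ \in _).
  rewrite -big_mkcond -big_filter; apply: ler_sum_uniq => //; [exact: filter_uniq|exact: undup_uniq|].
  by move=> x; rewrite mem_filter mem_undup => /andP[].
rewrite big_const_seq count_predT iter_addr addr0 ler_nat.
by rewrite (leq_trans (size_undup _)).
Qed.

Lemma delta_far (g h : D) : H g -> H h -> g <> h ->
  1 <= \sum_(c <- [:: cls (fun x => x = 1%g) g]) `|delta_fun g c - delta_fun h c| `^ p.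
Proof.
move=> Hg Hh gh; rewrite big_seq1 /delta_fun eqxx.
case: eqP => [e|_]; last by rewrite subr0 normr1 powR1.
exfalso; apply: gh.
have PM (x y : D) : x = 1%g -> y = 1%g -> (x * y)%g = 1%g by move=> -> ->; rewrite mulg1.
have h1 := clsP (P := fun x => x = 1%g) erefl Hg; have h2 := clsP (P := fun x => x = 1%g) erefl Hh.
rewrite -e in h2; have k1 := mulKVg g (decode X (cls (fun x => x = 1%g) g)).
have k2 := mulKVg h (decode X (cls (fun x => x = 1%g) g)).
by rewrite h1 mulg1 in k1; rewrite h2 mulg1 in k2; rewrite k1 -k2.
Qed.

Lemma embedding_exists (om : R) : 0 < om -> om < 1 ->
  exists2 Psi : H -> Lp01 p1, lipschitz_map Psi & forall g h : H,
  [/\ val g <> val h -> 1 <= energy (Psi g) (Psi h),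
     forall right j F, uniq F -> om ^+ j *
       \sum_(c <- F) `|range_fun p right (2 ^ j) (val g) c - range_fun p right (2 ^ j) (val h) c| `^ p
       <= energy (Psi g) (Psi h),
     forall s F, uniq F -> om ^+ s *
       \sum_(x <- F) `|site_fun p s (val g) x - site_fun p s (val h) x| `^ p
       <= energy (Psi g) (Psi h) &
     forall s j F, uniq F -> om ^+ (j + s) *
       \sum_(x <- F) `|block_fun p s (2 ^ (j + 4)) (val g) x - block_fun p s (2 ^ (j + 4)) (val h) x| `^ p
       <= energy (Psi g) (Psi h)].
Proof.
move=> om0 om1; have [Cb Cb0 hblock] := block_fun_step p1 X.
(* The index is a kind of component, a range scale j and a level s. The block length 2^(j+4) is 4L
   for the range L = 4 * 2^j, the width of the window containing all sites in [energy_dichotomy]. *)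
pose f (x : 'I_5 * nat * nat) : D -> nat -> R := match nat_of_ord x.1.1 with
  | 0%N => code_fun delta_fun
  | 1%N => code_fun (range_fun p true (2 ^ x.1.2))
  | 2%N => code_fun (range_fun p false (2 ^ x.1.2))
  | 3%N => code_fun (site_fun p x.2)
  | _ => code_fun (block_fun p x.2 (2 ^ (x.1.2 + 4))) end.
pose v (x : 'I_5 * nat * nat) : R := om ^+ (x.1.2 + x.2).
have q0 : 0 <= (1 - om)^-1 by rewrite invr_ge0 subr_ge0 ltW.
have om_ge0 n : 0 <= om ^+ n by rewrite exprn_ge0 // ltW.
have [||F uF|[[i j] s]|Psi [lip hPsi]] :=
  @assemble R p p1 X _ f v (4 + Cb) ((5 * (1 - om)^-1) * (1 - om)^-1).
- by rewrite addr_ge0// ltW.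
- by move=> x; exact: om_ge0.
- apply: (@sum_pair_le _ _ _ F (fun x s => om ^+ (x.2 + s)) _ _ (fun x => om ^+ x.2)) => //.
    move=> x G uG; under eq_bigr do rewrite exprD.
    by rewrite -mulr_sumr ler_wpM2l// geometric_uniq.
  move=> G uG; apply: (@sum_pair_le _ _ _ G (fun _ j => om ^+ j) _ _ (fun=> 1)) => //.
    by move=> _ G' uG'; rewrite mul1r geometric_uniq.
  move=> G' uG'; rewrite big_const_seq count_predT iter_addr addr0 ler_nat.
  by rewrite -(card_uniqP uG') (leq_trans (max_card _)) ?card_ord.
- have weaken (T : eqType) C (u : D -> T -> R) : C <= 4 + Cb -> step_bounded p C u ->
      step_bounded p (4 + Cb) u.
    by move=> hC hu g c F Hg hc uF; apply: le_trans (hu g c F Hg hc uF) hC.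
  have n0 m : (0 < 2 ^ m)%N by rewrite expn_gt0.
  rewrite /f/=; case: i => -[|[|[|[|i]]]] ? /=.
  + by apply: (weaken _ 2); [lra|apply: code_step_bounded => //; exact: delta_step].
  + by apply: (weaken _ 4); [lra|apply: code_step_bounded => //; exact: (range_fun_step p1 true (n0 j))].
  + by apply: (weaken _ 4); [lra|apply: code_step_bounded => //; exact: (range_fun_step p1 false (n0 j))].
  + by apply: (weaken _ 2); [lra|apply: code_step_bounded => //; exact: site_fun_step].
  + by apply: (weaken _ Cb); [lra|apply: code_step_bounded => //; exact: hblock].
have get (T : countType) (u : D -> T -> R) x : f x = code_fun u -> forall (g h : H) (F : seq T), uniq F ->
    v x * \sum_(i <- F) `|u (val g) i - u (val h) i| `^ p <= energy (Psi g) (Psi h).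
  move=> fx g h F uF; have := hPsi x g h (map pickle F).
  rewrite map_inj_uniq ?uF; last exact: pcan_inj pickleK_inv.
  by rewrite fx code_sum => /(_ isT).
exists Psi => // g h; split.
- move=> gh; have Hv (z : H) : H (val z) by exact: set_valP.
  have := get _ _ (inord 0, 0%N, 0%N) _ g h [:: cls (fun x => x = 1%g) (val g)].
  rewrite /f/= inordK// => /(_ _ erefl isT); rewrite /v/= expr0 mul1r.
  exact: le_trans (delta_far (Hv g) (Hv h) gh).
- move=> right j F uF; case: right.
    have := get _ _ (inord 1, j, 0%N) _ g h F uF.
    by rewrite /f/= inordK// => /(_ _ erefl); rewrite /v/= addn0.
  have := get _ _ (inord 2, j, 0%N) _ g h F uF.
  by rewrite /f/= inordK// => /(_ _ erefl); rewrite /v/= addn0.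
- move=> s F uF; have := get _ _ (inord 3, 0%N, s) _ g h F uF.
  by rewrite /f/= inordK// => /(_ _ erefl); rewrite /v/= add0n.
move=> s j F uF; have := get _ _ (inord 4, j, s) _ g h F uF.
by rewrite /f/= inordK// => /(_ _ erefl); rewrite /v/=.
Qed.

End Embedding.

(** * Power sums over the blocks of one level *)

Section NumericBlocks.
Context {R : realType} (p : R) (p1 : 1 <= p) (B k Y : nat) (M : 'I_B -> nat).
Hypothesis k0 : (0 < k)%N.
Hypothesis B0 : (0 < B)%N.
Hypothesis kB : (k * B <= 32 * Y)%N.
Local Notation N := ((\sum_i 32 * k * M i)%N%:R : R).

Lemma N_sum : N = 32 * k%:R * \sum_i (M i)%:R.
Proof. by rewrite natr_sum mulr_sumr; apply: eq_bigr => i _; rewrite !natrM. Qed.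

Lemma Y_gt0 : (0 < Y)%N.
Proof. by move: kB; case: Y => //; rewrite muln0 leqn0 muln_eq0; case: k k0 => //; case: B B0. Qed.

(** Hoelder's inequality over B blocks, where B <= 32 Y / k; [square_blocks] is its quadratic
    form. *)
Lemma power_blocks : N `^ p * k%:R `^ (p - 2) * Y%:R `^ (1 - p) <=
  32 `^ (2 * p - 1) * (k%:R^-1 * \sum_i (k%:R * (M i)%:R) `^ p).
Proof.
have kR : 0 < k%:R :> R by rewrite ltr0n.
have YR : 0 < Y%:R :> R by rewrite ltr0n Y_gt0.
have S0 : 0 <= \sum_i (M i)%:R `^ p :> R by apply: sumr_ge0 => i _; exact: powR_ge0.
have h := power_mean (fun i => (M i)%:R : R) p1.
have hn : \sum_i `|(M i)%:R : R| = \sum_i (M i)%:R by apply: eq_bigr => i _; rewrite ger0_norm.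
have hp : \sum_i `|(M i)%:R : R| `^ p = \sum_i (M i)%:R `^ p by apply: eq_bigr => i _; rewrite ger0_norm.
rewrite hn hp card_ord in h.
have hB : B%:R `^ (p - 1) <= (32 * Y%:R) `^ (p - 1) * k%:R `^ (1 - p) :> R.
  have hk : B%:R <= 32 * Y%:R / k%:R :> R by rewrite ler_pdivlMr// -!natrM ler_nat mulnC.
  apply: le_trans (ler_pow _ _ hk) _ => //; first by rewrite subr_ge0.
  rewrite [X in X <= _]powRM ?invr_ge0 ?mulr_ge0// ler_wpM2l ?powR_ge0//.
  by rewrite -[k%:R^-1]powR_inv1// -powRrM mulN1r opprB.
have -> : \sum_i (k%:R * (M i)%:R) `^ p = k%:R `^ p * \sum_i (M i)%:R `^ p :> R.
  by rewrite mulr_sumr; apply: eq_bigr => i _; rewrite powRM.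
rewrite N_sum powRM ?mulr_ge0 ?sumr_ge0// powRM//.
set S := \sum_i _ `^ p in h S0 *; set T := (\sum_i _) in h *.
have {}h : T `^ p <= (32 * Y%:R) `^ (p - 1) * k%:R `^ (1 - p) * S.
  by apply: le_trans h _; rewrite ler_wpM2r.
apply: (@le_trans _ _ (32 `^ p * k%:R `^ p * ((32 * Y%:R) `^ (p - 1) * k%:R `^ (1 - p) * S) *
    k%:R `^ (p - 2) * Y%:R `^ (1 - p))).
  by rewrite ler_wpM2r ?powR_ge0// ler_wpM2r ?powR_ge0// ler_wpM2l// mulr_ge0 ?powR_ge0.
rewrite powRM// le_eqVlt; apply/orP; left; apply/eqP.
have kn : k%:R != 0 :> R by rewrite gt_eqF.
have -> : 32 `^ (2 * p - 1) = 32 `^ p * 32 `^ (p - 1) :> R.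
  by rewrite -powRD ?pnatr_eq0 ?implybT//; congr (_ `^ _); ring.
have -> : k%:R^-1 = k%:R `^ (1 - p) * k%:R `^ (p - 2) :> R.
  by rewrite -powRD ?kn ?implybT// -powR_inv1//; congr (_ `^ _); ring.
have e : Y%:R `^ (p - 1) * Y%:R `^ (1 - p) = 1 :> R.
  rewrite -powRD; last by rewrite (gt_eqF YR) implybT.
  by have -> : p - 1 + (1 - p) = 0; [ring|rewrite powRr0].
rewrite [LHS](_ : _ = 32 `^ p * 32 `^ (p - 1) * (k%:R `^ (1 - p) * k%:R `^ (p - 2) *
  (k%:R `^ p * S)) * (Y%:R `^ (p - 1) * Y%:R `^ (1 - p))); last by ring.
by rewrite e mulr1.
Qed.

Lemma square_blocks : N ^+ 2 <= 32 ^+ 3 * Y%:R * (k%:R^-1 * \sum_i (k%:R * (M i)%:R) ^+ 2).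
Proof.
have kR : 0 < k%:R :> R by rewrite ltr0n.
have := power_mean (fun i => (M i)%:R : R) (ler1n R 2 : 1 <= 2).
have hn : \sum_i `|(M i)%:R : R| = \sum_i (M i)%:R by apply: eq_bigr => i _; rewrite ger0_norm.
have hp : \sum_i `|(M i)%:R : R| `^ 2 = \sum_i (M i)%:R ^+ 2.
  by apply: eq_bigr => i _; rewrite ger0_norm// powR_mulrn.
rewrite hn hp card_ord (_ : 2 - 1 = 1 :> R); last by ring.
rewrite powRr1// powR_mulrn ?sumr_ge0// => h.
have -> : \sum_i (k%:R * (M i)%:R) ^+ 2 = k%:R ^+ 2 * \sum_i (M i)%:R ^+ 2 :> R.
  by rewrite mulr_sumr; apply: eq_bigr => i _; rewrite exprMn.
rewrite N_sum exprMn; set S := \sum_i _ ^+ 2 in h *; set T := (\sum_i _) in h *.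
have S0 : 0 <= S by apply: sumr_ge0 => i _; exact: sqr_ge0.
apply: (@le_trans _ _ ((32 * k%:R) ^+ 2 * (B%:R * S))).
  by rewrite ler_wpM2l ?sqr_ge0.
have -> : (32 * k%:R) ^+ 2 * (B%:R * S) = 32 * 32 * k%:R * S * (k%:R * B%:R) by ring.
have -> : 32 ^+ 3 * Y%:R * (k%:R^-1 * (k%:R ^+ 2 * S)) = 32 * 32 * k%:R * S * (32 * Y%:R) :> R.
  by field; rewrite gt_eqF.
apply: ler_wpM2l; first by rewrite !mulr_ge0.
by rewrite -!natrM ler_nat.
Qed.

End NumericBlocks.

Section SiteEnergy.
Context {R : realType} (p : R) (p1 : (1 <= p%:E)%E) (X : diagonal).
Local Notation k := (dk X).
Local Notation D := (dirprod (fun s => wreath (dG X s))).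
Context (s : nat) (g h : D) (n : nat) (site : 'I_n -> int) (w : 'I_n -> bool) (M : 'I_n -> nat).
Hypothesis site_inj : injective site.
Hypothesis gap : forall i,
  (k s * M i <= absz (circle s (w i) g (site i) - circle s (w i) h (site i))%R)%N.

Let p0 : 0 < p. Proof. by apply: lt_le_trans ltr01 _; rewrite -lee_fin. Qed.

Lemma gapR i : (k s)%:R * (M i)%:R <=
  `|circleR (R := R) s (w i) g (site i) - circleR s (w i) h (site i)|.
Proof. by rewrite /circleR -rmorphB -intr_norm -natr_absz -natrM ler_nat. Qed.

Lemma site_energy : exists2 F, uniq F &
  (k s)%:R^-1 * \sum_i ((k s)%:R * (M i)%:R) `^ p <=
  \sum_(x <- F) `|site_fun (R := R) p s g x - site_fun p s h x| `^ p.
Proof.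
exists [seq (site i, w i) | i <- enum 'I_n].
  by rewrite map_inj_uniq ?enum_uniq// => i i' [/site_inj].
rewrite big_map big_enum mulr_sumr; apply: ler_sum => i _.
rewrite /site_fun -mulrBr coset_pow// ler_wpM2l ?invr_ge0//.
by apply: ler_pow; [exact: ltW|exact: mulr_ge0|exact: gapR].
Qed.

(** A window of length L meets at most two blocks of length L, and [w] takes two values, so one of
    four combinations carries a quarter of the square sum; Khintchine's lower bound is applied to
    it. *)
Lemma block_energy_aux (c0 : R) (L : nat) (a : int) : 0 < c0 ->
  (forall c : seq R, 2 ^+ size c * (c0 * (\sum_(x <- c) x ^+ 2) `^ (p / 2)) <=
    \sum_(w <- words (size c)) `|signed_sum w c| `^ p) ->
  (0 < k s <= L)%N -> (forall i, a <= site i < a + L%:Z) ->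
  exists2 F, uniq F &
  c0 * 4 `^ (- (p / 2)) * ((k s)%:R^-1 * \sum_i ((k s)%:R * (M i)%:R) ^+ 2) `^ (p / 2) <=
  \sum_(x <- F) `|block_fun (R := R) p s L g x - block_fun p s L h x| `^ p.
Proof.
move=> c00 hc /andP[k0 kL] ha.
have L0 : (0 < L)%N by exact: leq_trans kL.
pose m0 := (a %/ L%:Z)%Z.
pose Q w m : R := \sum_(v <- block_diff s w L g h m) v ^+ 2.
set S := \sum_i _.
have divE (u : int) (v : nat) : (v < L)%N -> ((u * L%:Z + v%:Z) %/ L%:Z)%Z = u.
  by move=> vL; rewrite divzMDl ?divz_small ?addr0//; lia.
have QE w' m : Q w' m = \sum_(i <- iota 0 L)
    (circleR s w' g (m * L%:Z + i%:Z) - circleR s w' h (m * L%:Z + i%:Z)) ^+ 2.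
  by rewrite /Q big_map.
have key : S <= \sum_(w' <- [:: true; false]) \sum_(m <- [:: m0; m0 + 1]) Q w' m.
  apply: (@le_trans _ _ (\sum_(w' <- [:: true; false]) \sum_(y <- [seq site i | i <- enum 'I_n])
      (circleR s w' g y - circleR s w' h y) ^+ 2)).
    rewrite exchange_big/= big_map big_enum; apply: ler_sum => i _.
    have h1 : ((k s)%:R * (M i)%:R) ^+ 2 <=
        (circleR s (w i) g (site i) - circleR s (w i) h (site i)) ^+ 2 :> R.
      by rewrite -[leRHS]real_normK ?num_real//; apply: lerXn2r; rewrite ?nnegrE ?mulr_ge0//; exact: gapR.
    rewrite big_cons big_seq1; apply: le_trans h1 _.
    by case: (w i); rewrite ?lerDl ?lerDr sqr_ge0.
  apply: ler_sum => w' _.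
  under [leRHS]eq_bigr do rewrite QE.
  pose G := [seq m * L%:Z + i%:Z | m <- [:: m0; m0 + 1], i <- iota 0 L].
  apply: (@le_trans _ _ (\sum_(y <- G) (circleR s w' g y - circleR s w' h y) ^+ 2)).
    apply: ler_sum_uniq.
    - by rewrite map_inj_uniq ?enum_uniq.
    - apply: allpairs_uniq; [by rewrite /= inE andbT; lia|exact: iota_uniq|].
      move=> [m i] [m' i'] /allpairsP[[? ?] [_ + [_ ->]]] /allpairsP[[? ?] [_ + [_ ->]]] /=.
      rewrite !mem_iota !add0n /= => hi hi' e.
      have mm : m = m' by rewrite -(divE m _ hi) e divE.
      by congr (_, _) => //; move: e; rewrite mm => /addrI[].
    - move=> y /mapP[i _ ->]; have := ha i; move: (site i) => z hz.
      have ez := divz_eq z L%:Z; have zm := modz_ge0 z (_ : L%:Z != 0).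
      have zl := ltz_pmod z (_ : 0 < L%:Z).
      apply/allpairsP; exists ((z %/ L%:Z)%Z, `|(z %% L%:Z)%Z|%N); split => /=.
      + have b1 : m0 <= (z %/ L%:Z)%Z by apply: lez_pdiv2r; lia.
        have b2 : (z %/ L%:Z)%Z <= m0 + 1.
          have -> : m0 + 1 = ((1 * L%:Z + a) %/ L%:Z)%Z by rewrite divzMDl 1?addrC//; lia.
          by apply: lez_pdiv2r; lia.
        by rewrite !inE; lia.
      + by rewrite mem_iota; lia.
      + by rewrite {1}ez; lia.
    - by move=> y; exact: sqr_ge0.
  by rewrite /G big_allpairs_dep.
have Q0 w' m : 0 <= Q w' m by apply: sumr_ge0 => *; exact: sqr_ge0.
have [w' [m hQ]] : exists w' m, S / 4 <= Q w' m.
  move: key; rewrite !big_cons !big_nil => key.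
  have [h1|h1] := lerP (S / 4) (Q true m0); first by exists true, m0.
  have [h2|h2] := lerP (S / 4) (Q true (m0 + 1)); first by exists true, (m0 + 1).
  have [h3|h3] := lerP (S / 4) (Q false m0); first by exists false, m0.
  by exists false, (m0 + 1); lra.
exists [seq ((m, w'), e) | e <- (words L : seq (seq bool))].
  by rewrite map_inj_uniq ?uniq_words// => e e' [].
rewrite big_map [leRHS](_ : _ = \sum_(e <- (words L : seq (seq bool)))
  (2 ^+ L)^-1 * ((k s)%:R `^ (- (p / 2)) * `|signed_sum e (block_diff s w' L g h m)| `^ p)); last first.
  rewrite big_seq [RHS]big_seq; apply: eq_bigr => e; rewrite mem_words => se.
  by rewrite block_fun_diff// se k0 kL.
rewrite -!mulr_sumr.
have := hc (block_diff s w' L g h m); rewrite size_block_diff -/(Q w' m) => hR.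
have N0 : 0 < 2 ^+ L :> R by rewrite exprn_gt0.
apply: (@le_trans _ _ ((2 ^+ L)^-1 * ((k s)%:R `^ (- (p / 2)) * (2 ^+ L * (c0 * Q w' m `^ (p / 2)))))); last first.
  apply: ler_wpM2l; first by rewrite invr_ge0 ltW.
  by apply: ler_wpM2l; first exact: powR_ge0.
have -> : (2 ^+ L)^-1 * ((k s)%:R `^ (- (p / 2)) * (2 ^+ L * (c0 * Q w' m `^ (p / 2)))) =
  c0 * ((k s)%:R `^ (- (p / 2)) * Q w' m `^ (p / 2)) by field; rewrite gt_eqF.
have S0 : 0 <= S by apply: sumr_ge0 => *; exact: sqr_ge0.
have pp : 0 <= p / 2 by rewrite divr_ge0 ?ltW.
rewrite -mulrA ler_wpM2l ?(ltW c00)// powRM ?invr_ge0// mulrCA.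
have -> : (k s)%:R^-1 `^ (p / 2) = (k s)%:R `^ (- (p / 2)) :> R.
  by rewrite -[_^-1]powR_inv1// -powRrM mulN1r.
rewrite ler_wpM2l ?powR_ge0//.
apply: le_trans (ler_pow pp _ hQ); last by rewrite divr_ge0.
rewrite powRM ?invr_ge0// mulrC le_eqVlt; apply/orP; left; apply/eqP; congr (_ * _).
by rewrite -[4^-1]powR_inv1// -powRrM mulN1r.
Qed.

End SiteEnergy.

Lemma block_energy (R : realType) (p : R) (p1 : (1 <= p%:E)%E) (X : diagonal) :
  exists2 c : R, 0 < c &
  forall s (g h : dirprod (fun s => wreath (dG X s))) n (site : 'I_n -> int) (w : 'I_n -> bool)
    (M : 'I_n -> nat), injective site ->
  (forall i, (dk X s * M i <=
     absz (circle s (w i) g (site i) - circle s (w i) h (site i))%R)%N) ->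
  forall (L : nat) (a : int), (0 < dk X s <= L)%N -> (forall i, a <= site i < a + L%:Z) ->
  exists2 F, uniq F &
  c * ((dk X s)%:R^-1 * \sum_i ((dk X s)%:R * (M i)%:R) ^+ 2) `^ (p / 2) <=
  \sum_(x <- F) `|block_fun p s L g x - block_fun p s L h x| `^ p.
Proof.
have p1' : 1 <= p by rewrite -lee_fin.
have [c0 c00 hc] := rademacher_lower p1'.
exists (c0 * 4 `^ (- (p / 2))) => [|s g h n site w M hs hg L a hL ha].
  by rewrite mulr_gt0 ?powR_gt0.
exact: block_energy_aux hc hL ha.
Qed.

(** * Energy against word length *)

Section Dichotomy.
Context {R : realType} (p : R) (p1 : (1 <= p%:E)%E) (X : diagonal).
Local Notation gens := (@dgens X).
Local Notation l := (dl X).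
Local Notation k := (dk X).
Local Notation D := (dirprod (fun s => wreath (dG X s))).
Local Notation H := (generated_subgroup gens).

Let p0 : 0 < p. Proof. by apply: lt_le_trans ltr01 _; rewrite -lee_fin. Qed.
Let p_ge1 : 1 <= p. Proof. by rewrite -lee_fin. Qed.

Section Level.
Context (x : D) (L s : nat).
Hypothesis s0 : (0 < s)%N.
Hypothesis xr : right_range x L.
Hypothesis xl : left_range x L.
Local Notation K := (k s)./2.

Definition block_site (i o : nat) : int := - L%:Z + (i * K + o)%N%:Z.

(** The truncated subtraction discards the 4 turns that [circle_gap] may miss. *)
Definition block_max (i : nat) : nat := \max_(o < K) (dturns (lam x s (block_site i o)) - 4).

Lemma block_maxP (i : nat) z : - L%:Z + (i * K)%N%:Z <= z < - L%:Z + (i.+1 * K)%N%:Z ->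
  (dturns (lam x s z) <= block_max i + 4)%N.
Proof.
move=> hz; have oK : (absz (z + L%:Z - (i * K)%N%:Z)%R < K)%N.
  by move: hz; rewrite mulSn; lia.
have := @bigop.leq_bigmax _ (fun o : 'I_K => dturns (lam x s (block_site i o)) - 4)%N (Ordinal oK).
rewrite -/(block_max i) /=.
have -> : block_site i (absz (z + L%:Z - (i * K)%N%:Z)%R) = z by rewrite /block_site; lia.
lia.
Qed.

Lemma K_gt0 : (0 < K)%N.
Proof.
have := dk_half X s; have := dk_exp X s0; have := @leq_exp2l 2 1 s; lia.
Qed.

Lemma block_max_site (i : nat) : exists o : 'I_K,
  block_max i = (dturns (lam x s (block_site i o)) - 4)%N.
Proof.
have [|o h] := @bigop.eq_bigmax 'I_K (fun o : 'I_K => dturns (lam x s (block_site i o)) - 4)%N.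
  by rewrite card_ord K_gt0.
by exists o.
Qed.

Lemma block_max_le (i : nat) : (block_max i <= l s)%N.
Proof.
have [u ->] := block_max_site i.
have := tent_le_half (didx (lam x s (block_site i u))) (dl_gt0 X s).
by rewrite -/(dturns _); lia.
Qed.

Lemma block_max_small (i : nat) : (2 * L < k s)%N -> block_max i = 0%N.
Proof.
move=> h; have [u ->] := block_max_site i; move: (block_site i u) => z.
have [hz|hz] := lerP z L%:Z.
  have [|[->|->] _] := @xl s z; first lia.
    by rewrite /dturns /didx -/(turns _ _ _ _ _ _ _) turns_1.
  by rewrite /dturns /didx -/(turns _ _ _ _ _ _ _) turns_a.
have [[->|->] _] := xr s hz.
  by rewrite /dturns /didx -/(turns _ _ _ _ _ _ _) turns_1.
have := turns_b (doa X s) (dob X s) (dgen X s) (dcard X s) (dl_even X s) (dl_gt0 X s).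
by rewrite /dturns /didx -/(turns _ _ _ _ _ _ _); lia.
Qed.

Lemma blocks_le : (0 < L)%N -> (k s <= 2 * L)%N -> (blocks X L s * K <= 4 * L)%N.
Proof.
move=> L0 h; rewrite /blocks mulSn; have := leq_trunc_div (2 * L).+1 K.
by have := dk_half X s; lia.
Qed.

Lemma block_site_lt i i' o o' : (o < K)%N -> (i < i')%N -> block_site i o < block_site i' o'.
Proof.
move=> oK ii'; rewrite /block_site ltrD2l ltz_nat.
apply: leq_trans (leq_addr o' _); apply: leq_trans (leq_mul ii' (leqnn K)).
by rewrite mulSn addnC ltn_add2r.
Qed.

Lemma block_site_range i o : (0 < L)%N -> (k s <= 2 * L)%N -> (i < blocks X L s)%N -> (o < K)%N ->
  - L%:Z <= block_site i o < - L%:Z + (4 * L)%N%:Z.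
Proof.
move=> L0 h ib oK; rewrite /block_site lerDl ltrD2l ltz_nat le0z_nat /=.
apply: leq_trans (blocks_le L0 h); apply: leq_trans (leq_mul ib (leqnn K)).
by rewrite mulSn addnC ltn_add2r.
Qed.

End Level.

Lemma square_power (a y N : R) : 0 < a -> 0 < y -> 0 <= N ->
  a `^ (- (p / 2)) * (N `^ p * y `^ (- (p / 2))) = (N ^+ 2 / (a * y)) `^ (p / 2).
Proof.
move=> a0 y0 N0; have ay : 0 < a * y by exact: mulr_gt0.
rewrite [RHS]powRM ?sqr_ge0 ?invr_ge0 ?ltW// -powR_mulrn// -powRrM.
rewrite -[(a * y)^-1]powR_inv1 ?ltW// -powRrM mulN1r powRM ?ltW//.
have -> : 2%:R * (p / 2) = p by field.
ring.
Qed.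

(* Either the range of g^-1 h is larger than 2^j, or its length is at most the
   range plus the cost N of the turns at one level s; this cost is detected site
   by site and by the signed sums. *)
Lemma energy_dichotomy (om : R) : 0 < om -> om < 1 ->
  exists2 Psi : H -> Lp01 p1, lipschitz_map Psi & exists2 c : R, 0 < c &
  forall g h : H, let n := subgroup_dist g h in let E := energy (Psi g) (Psi h) in
  ((0 < n)%N -> 1 <= E) /\
  forall j, let Y := (2 ^ j)%N in c * om ^+ (2 * j) * Y%:R `^ p <= E \/
    exists s N : nat, [/\ (n <= 778 * (4 * Y) * (j + 5) + (j + 4) * N)%N,
      (0 < N)%N -> (0 < k s <= 8 * Y)%N, (N <= 32 * 32 * (Y * l s))%N,
      c * om ^+ (2 * j) * (N%:R `^ p * (k s)%:R `^ (p - 2) * Y%:R `^ (1 - p)) <= E &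
      c * om ^+ (2 * j) * (N%:R `^ p * Y%:R `^ (- (p / 2))) <= E].
Proof.
move=> om0 om1; have [Psi lip hPsi] := embedding_exists p1 X om0 om1.
exists Psi => //; have [cb cb0 hblock] := block_energy p1 X.
pose c1 : R := om ^+ 4 * 32 `^ (1 - 2 * p).
pose c2 : R := om ^+ 4 * (cb * (32 ^+ 3) `^ (- (p / 2))).
pose c : R := Num.min (1 / 2) (Num.min c1 c2).
have c10 : 0 < c1 by rewrite mulr_gt0 ?exprn_gt0 ?powR_gt0.
have c20 : 0 < c2 by rewrite mulr_gt0 ?exprn_gt0 ?mulr_gt0 ?powR_gt0 ?exprn_gt0.
have c_half : c <= 1 / 2 by rewrite ge_min lexx.
have c_1 : c <= c1 by rewrite !ge_min lexx orbT.
have c_2 : c <= c2 by rewrite !ge_min lexx !orbT.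
exists c; first by rewrite !lt_min c10 c20 divr_gt0.
have om_le i i' : (i <= i')%N -> om ^+ i' <= om ^+ i.
  by move=> ii'; apply: ler_wiXn2l => //; exact: ltW.
move=> g h n E; have [h0 hrange hsite hblk] := hPsi g h.
have Hv (z : H) : H (val z) by exact: set_valP.
have om_ge0 i : 0 <= om ^+ i by rewrite exprn_ge0 // ltW.
have E0 : 0 <= E by exact: energy_ge0.
split.
  move=> n0; apply: h0 => gh; move: n0; rewrite /n /subgroup_dist gh mulVg.
  by have := word_length_le (ball1 gens 0); rewrite leqn0 => /eqP ->.
move=> j Y; have Y0 : (0 < Y)%N by rewrite expn_gt0.
have YR : 0 < Y%:R :> R by rewrite ltr0n.
have [[rr ll cc]|[right [F [uF hF]]]] := range_fun_far p1 Y0 (Hv g) (Hv h); last first.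
  left; apply: le_trans (hrange right j F uF).
  apply: le_trans (ler_wpM2l (om_ge0 j) hF).
  have om2 : om ^+ (2 * j) <= om ^+ j.
    by apply: om_le; rewrite leq_pmull.
  have Yp := powR_ge0 (Y%:R : R) p.
  have h1 : c * om ^+ (2 * j) <= 1 / 2 * om ^+ j by apply: ler_pM => //; rewrite !le_min !ltW ?divr_gt0.
  by apply: le_trans (ler_wpM2r Yp h1) _; rewrite le_eqVlt; apply/orP; left; apply/eqP; field.
right; set x := ((val g)^-1 * val h)%g in rr ll cc.
have Hx : H x by apply: H_mul; [exact: H_inv|].
pose L := (4 * Y)%N; have L0 : (0 < L)%N by rewrite muln_gt0.
pose Nf s := (\sum_(i < blocks X L s) 32 * k s * block_max x L s i)%N.
have S0 : (0 < j + 4)%N by rewrite addn_gt0 orbT.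
(* Since k_(j+4) >= 2^(j+4) > 2L, the levels below j + 4 suffice, and the most expensive one bounds
   the total up to the factor j + 4. *)
have [s NE] : exists s : 'I_(j + 4), \max_(s < j + 4) Nf s = Nf s.
  have [|s hs] := @bigop.eq_bigmax 'I_(j + 4) Nf; first by rewrite card_ord.
  by exists s.
exists s, (Nf s).
have hn : (n <= 778 * (4 * Y) * (j + 5) + (j + 4) * Nf s)%N.
  apply: word_length_le.
  have LS : (2 * L < k (j + 4))%N.
    apply: leq_trans (dk_exp X S0); rewrite /L /Y mulnA expnD mulnC ltn_pmul2l ?expn_gt0//.
  have := @length_upper X x L Hx rr ll (j + 4) (fun s i => block_max x L s i) L0 LS cc
    (fun s i z hs _ hz => @block_maxP x L s (proj1 (elimT andP hs)) i z hz).
  apply: ball_leq; rewrite -[(j + 4).+1]addn1 -addnA leq_add2l -NE.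
  apply: (@leq_trans (\sum_(s < j + 4) \max_(s < j + 4) Nf s)).
    by apply: leq_sum => i _; exact: bigop.leq_bigmax.
  by rewrite sum_nat_const card_ord.
have hs := ltn_ord s.
have [N0|Npos] := posnP (Nf s).
  rewrite N0 powR0 ?gt_eqF// !mul0r !mulr0; split => //.
  by move: hn; rewrite N0.
have s0 : (0 < s)%N.
  by case: (posnP s) => // e; move: Npos; rewrite /Nf e dk0 big1// => i _; rewrite muln0.
have k2 : (2 <= k s)%N by have := dk_exp X s0; have := @leq_exp2l 2 1 s; clear -s0; lia.
have kL : (k s <= 2 * L)%N.
  rewrite leqNgt; apply/negP => hk; move: Npos; rewrite /Nf big1// => i _.
  by rewrite (block_max_small s0 rr ll)// muln0.
have kB : (k s * blocks X L s <= 32 * Y)%N.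
  apply: (@leq_trans (2 * (4 * L))).
    by rewrite -dk_half mulnAC -mulnA leq_mul2l blocks_le.
  by rewrite /L mulnA (mulnA _ 4) leqnn.
(* The level is below j + 4, so the weights om^s and om^(j+s) are at least om^(2j+4); this is the
   om^4 in [c1] and [c2]. *)
have om_s : om ^+ (2 * j) * om ^+ 4 <= om ^+ s.
  by rewrite -exprD; apply: om_le; clear -hs; lia.
have om_js : om ^+ (2 * j) * om ^+ 4 <= om ^+ (j + s).
  by rewrite -exprD; apply: om_le; clear -hs; lia.
have B0 : (0 < blocks X L s)%N by [].
have k0 : (0 < k s)%N by apply: leq_trans k2.
pose M (i : 'I_(blocks X L s)) := block_max x L s i.
pose o (i : nat) : 'I_(k s)./2 := sval (cid (block_max_site x L s0 i)).
have oE i : block_max x L s i = (dturns (lam x s (block_site L s i (o i))) - 4)%N.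
  exact: svalP (cid (block_max_site x L s0 i)).
pose site (i : 'I_(blocks X L s)) : int := block_site L s i (o i) + cur (val g) s.
have gap i := circle_gap s (val g) (val h) (site i).
pose w i := sval (cid (gap i)).
have hgap i : (k s * M i <=
    absz (circle s (w i) (val g) (site i) - circle s (w i) (val h) (site i))%R)%N.
  have := svalP (cid (gap i)); rewrite -/(w i).
  have -> : site i - cur (val g) s = block_site L s i (o i) by rewrite /site addrK.
  move=> hi; rewrite /M oE mulnBr leq_subLR [(k s * 4)%N]mulnC [leqRHS]addnC; exact: hi.
have site_lt (i i' : 'I_(blocks X L s)) : (i < i')%N -> site i < site i'.
  by move=> ii'; rewrite /site ltrD2r block_site_lt.
have site_inj : injective site.
  move=> i i' e; apply/val_inj => /=; case: (ltngtP i i') => // hi;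
  by have := site_lt _ _ hi; rewrite e ltxx.
have NfE : Nf s = (\sum_i 32 * k s * M i)%N by [].
split => //.
- by rewrite k0 (leq_trans kL)// /L mulnA.
- rewrite NfE; apply: (@leq_trans (\sum_(i < blocks X L s) 32 * k s * l s)).
    by apply: leq_sum => i _; rewrite leq_mul2l (block_max_le _ _ s0) orbT.
  rewrite sum_nat_const card_ord; have := leq_mul kB (leqnn (32 * l s)).
  have -> : (blocks X L s * (32 * k s * l s) = k s * blocks X L s * (32 * l s))%N.
    by rewrite (mulnC 32 (k s)) -(mulnA (k s)) mulnA (mulnC (blocks X L s)).
  by rewrite (mulnACA 32 Y).
- have [F uF hF] := site_energy p1 site_inj hgap.
  apply: le_trans (hsite s F uF).
  apply: le_trans (ler_wpM2l (om_ge0 s) hF).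
  have hN := @power_blocks R p p_ge1 _ _ _ M k0 B0 kB; rewrite -NfE in hN.
  move: hN; set A := _ * _ `^ (1 - p); set Z := _^-1 * _ => hN.
  have A0 : 0 <= A by rewrite !mulr_ge0 ?powR_ge0.
  apply: (@le_trans _ _ (c1 * om ^+ (2 * j) * A)).
    by rewrite ler_wpM2r// ler_wpM2r.
  have h32 : 32 `^ (1 - 2 * p) * A <= Z.
    apply: le_trans (ler_wpM2l (powR_ge0 _ _) hN) _.
    rewrite mulrA -powRD ?pnatr_eq0 ?implybT//.
    by rewrite (_ : 1 - 2 * p + (2 * p - 1) = 0) ?powRr0 ?mul1r//; ring.
  apply: (@le_trans _ _ (om ^+ (2 * j) * om ^+ 4 * (32 `^ (1 - 2 * p) * A))).
    by rewrite le_eqVlt; apply/orP; left; apply/eqP; rewrite /c1; ring.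
  by apply: ler_pM => //; apply: mulr_ge0 => //; exact: powR_ge0.
have [|i|F uF hF] := hblock s (val g) (val h) _ site w M site_inj hgap (2 ^ (j + 4))%N
    (- L%:Z + cur (val g) s).
- rewrite k0 (leq_trans kL)// /L /Y expnD mulnA mulnC leq_mul2l.
  by rewrite orbT.
- have -> : (2 ^ (j + 4))%N = (4 * L)%N by rewrite /L /Y expnD mulnC mulnA.
  rewrite /site lerD2r [ltRHS]addrAC ltrD2r; exact: (block_site_range s0 L0 kL (ltn_ord i) (ltn_ord (o i))).
apply: le_trans (hblk s j F uF); apply: le_trans (ler_wpM2l (om_ge0 _) hF).
have := @square_blocks R _ _ _ M k0 kB; rewrite -NfE; set Z := _^-1 * _ => hN.
have Z0 : 0 <= Z by rewrite mulr_ge0 ?invr_ge0//; apply: sumr_ge0 => *; exact: sqr_ge0.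
have pp : 0 <= p / 2 by rewrite divr_ge0 ?ltW.
have hZ : (32 ^+ 3) `^ (- (p / 2)) * ((Nf s)%:R `^ p * Y%:R `^ (- (p / 2))) <= Z `^ (p / 2).
  have c3 : 0 < 32 ^+ 3 :> R by rewrite exprn_gt0.
  have hq : (Nf s)%:R ^+ 2 / (32 ^+ 3 * Y%:R) <= Z by rewrite ler_pdivrMr ?mulr_gt0// mulrC.
  apply: le_trans (ler_pow pp _ hq); last by rewrite divr_ge0 ?mulr_ge0 ?sqr_ge0// ltW.
  by rewrite square_power.
set A := _ `^ p * _ in hZ *.
have A0 : 0 <= A by rewrite mulr_ge0 ?powR_ge0.
apply: (@le_trans _ _ (c2 * om ^+ (2 * j) * A)).
  by rewrite ler_wpM2r// ler_wpM2r.
apply: (@le_trans _ _ (om ^+ (2 * j) * om ^+ 4 * (cb * ((32 ^+ 3) `^ (- (p / 2)) * A)))).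
  by rewrite le_eqVlt; apply/orP; left; apply/eqP; rewrite /c2; ring.
apply: ler_pM => //; first by apply: mulr_ge0.
  apply: mulr_ge0; first exact: ltW.
  by apply: mulr_ge0 => //; exact: powR_ge0.
by rewrite ler_wpM2l// ltW.
Qed.

End Dichotomy.

(** * From dyadic scales to a power of the distance *)

Section Growth.
Context {R : realType}.

Lemma log_absorb (d : R) : 0 < d -> exists2 C : R, 0 < C &
  forall j : nat, (j + 5)%:R <= C * ((2 ^ j)%N%:R : R) `^ d.
Proof.
move=> d0; have ln2 : 0 < ln 2 :> R by apply: ln_gt0; rewrite ltr1n.
have dl : 0 < d * ln 2 by exact: mulr_gt0.
exists (5 + (d * ln 2)^-1) => [|j]; first by rewrite addr_gt0 ?invr_gt0.
have -> : ((2 ^ j)%N%:R : R) `^ d = expR (j%:R * (d * ln 2)).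
  rewrite natrX -powR_mulrn// -powRrM /powR gt_eqF// ?ltr0n//; congr expR; ring.
have j0 : 0 <= j%:R :> R by exact: ler0n.
have h := expR_ge1Dx (j%:R * (d * ln 2)).
have c0 : 0 <= 5 + (d * ln 2)^-1 by rewrite addr_ge0 ?invr_ge0// ltW.
apply: le_trans (ler_wpM2l c0 h).
have -> : (5 + (d * ln 2)^-1) * (1 + j%:R * (d * ln 2)) =
  j%:R + 5 + ((d * ln 2)^-1 + 5 * (j%:R * (d * ln 2))).
  by field; rewrite !gt_eqF.
rewrite natrD lerDl addr_ge0 ?invr_ge0 ?mulr_ge0//; exact: ltW.
Qed.

Lemma dyadic_floor (x : R) : 1 <= x -> exists j : nat,
  (2 ^ j)%N%:R <= x /\ x <= 2 * (2 ^ j)%N%:R.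
Proof.
move=> x1; have x0 : 0 <= x by apply: le_trans x1.
have /andP[h1 h2] := truncn_itv x0.
have m0 : (0 < Num.trunc x)%N by rewrite Num.Theory.truncn_gt0.
have /andP[h3 h4] := trunc_log_bounds (isT : (1 < 2)%N) m0.
exists (trunc_log 2 (Num.trunc x)); split.
  by apply: le_trans h1; rewrite ler_nat.
apply: le_trans (ltW h2) _; rewrite -natrM ler_nat -expnS; exact: h4.
Qed.

(* The dyadic scale is the largest one with Y^(1 + eps) <= c n^al, where the loss
   eps absorbs the logarithms. *)
Lemma scale_growth (p al eps c c1 c2 : R) : 0 < p -> 0 < al -> al <= 1 -> 0 < eps -> eps < p ->
  0 < c -> 0 < c1 -> 0 < c2 ->
  exists2 c3 : R, 0 < c3 & forall (n : nat) (E : R), (0 < n)%N -> 1 <= E ->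
  (forall j, let Y : nat := (2 ^ j)%N in c * Y%:R `^ (- eps) * Y%:R `^ p <= E \/
    exists N : nat, (n <= 778 * (4 * Y) * (j + 5) + (j + 4) * N)%N /\
     (Y%:R <= c1 * N%:R `^ al -> c * Y%:R `^ (- eps) * (c2 * Y%:R `^ p) <= E)) ->
  c3 * n%:R `^ (al * (p - eps) / (1 + eps)) <= E.
Proof.
move=> p0 al0 al1 e0 ep c0 c10 c20.
have [C C0 HC] := log_absorb e0.
have e1 : 0 < 1 + eps by rewrite addr_gt0.
have pe : 0 < p - eps by rewrite subr_gt0.
have [B [B0 BE]] : exists B : R, 0 < B /\ B = (778 * 4)%N%:R by exists (778 * 4)%N%:R; rewrite ltr0n.
(* The first bound makes the range term at most n/2, so that N is at least a constant times n
   Y^(-eps); the second turns this into Y <= c1 N^al. *)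
pose c4 : R := Num.min (1 / (2 * B * C)) (c1 * (2 * C) `^ (- al)).
have c40 : 0 < c4 by rewrite lt_min !mulr_gt0 ?invr_gt0 ?powR_gt0 ?mulr_gt0.
set ex := al * _ / _; have ex0 : 0 < ex by rewrite !mulr_gt0 ?invr_gt0.
pose u := (1 + eps)^-1.
have u0 : 0 <= u by rewrite invr_ge0 ltW.
pose c5 := (c4 `^ u / 2) `^ (p - eps).
have c50 : 0 < c5 by apply: powR_gt0; rewrite divr_gt0// powR_gt0.
pose c6 := c * Num.min 1 c2 * c5.
have c60 : 0 < c6 by rewrite !mulr_gt0// lt_min ltr01.
pose c7 := c4 `^ (ex / al).
have c70 : 0 < c7 by rewrite powR_gt0.
exists (Num.min c6 c7); first by rewrite lt_min c60.
move=> n E n0 E1 H; have nR : 0 < n%:R :> R by rewrite ltr0n.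
(* For small n the assumption 1 <= E suffices, and [c7] is chosen to this end. *)
have [small|large] := ltP (c4 * n%:R `^ al) 1.
  apply: le_trans (E1); apply: (@le_trans _ _ (c7 * n%:R `^ ex)).
    by rewrite ler_wpM2r ?powR_ge0// ge_min lexx orbT.
  have -> : c7 * n%:R `^ ex = (c4 * n%:R `^ al) `^ (ex / al).
    rewrite [RHS]powRM ?powR_ge0 ?ltW// -powRrM; congr (_ * _ `^ _); field.
    by rewrite gt_eqF.
  apply: le_trans (@ler_pow _ _ _ 1 _ _ (ltW small)) _; rewrite ?powR1//.
    by rewrite divr_ge0 ?ltW.
  by rewrite mulr_ge0 ?powR_ge0 ?ltW.
set x := (c4 * n%:R `^ al) in large.
have x0 : 0 < x by apply: lt_le_trans large.
have xu1 : 1 <= x `^ u.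
  by have := ler_pow u0 ler01 large; rewrite powR1.
have [j [jl ju]] := dyadic_floor xu1.
set Y : nat := (2 ^ j)%N in jl ju.
have Y0 : 0 < Y%:R :> R by rewrite ltr0n expn_gt0.
have Yx : Y%:R `^ (1 + eps) <= x.
  apply: le_trans (ler_pow (ltW e1) (ltW Y0) jl) _.
  have uE : u * (1 + eps) = 1 by rewrite /u mulVf// gt_eqF.
  by rewrite -powRrM uE powRr1// ltW.
have YE : Y%:R `^ (- eps) * Y%:R `^ p = Y%:R `^ (p - eps) :> R.
  by rewrite -powRD 1?addrC// (gt_eqF Y0) implybT.
have Ylow : c5 * n%:R `^ ex <= Y%:R `^ (p - eps).
  have -> : c5 * n%:R `^ ex = (x `^ u / 2) `^ (p - eps).
    rewrite /x [(_ * _) `^ u]powRM ?powR_ge0 ?(ltW c40)// mulrAC.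
    rewrite [RHS]powRM ?powR_ge0 ?divr_ge0 ?powR_ge0// -!powRrM; congr (_ * _ `^ _).
    by rewrite /ex /u; field; rewrite gt_eqF.
  apply: ler_pow; [exact: ltW|by rewrite divr_ge0 ?powR_ge0|].
  by rewrite ler_pdivrMr// mulrC.
have fin : c * Num.min 1 c2 * Y%:R `^ (p - eps) <= E -> Num.min c6 c7 * n%:R `^ ex <= E.
  apply: le_trans; apply: (@le_trans _ _ (c6 * n%:R `^ ex)).
    by rewrite ler_wpM2r ?powR_ge0// ge_min lexx.
  by rewrite /c6 -mulrA ler_wpM2l// mulr_ge0 ?(ltW c0)// le_min ler01 ltW.
have [hY|[N [hn hN]]] := H j; apply: fin.
  rewrite -/Y -mulrA YE in hY; apply: le_trans hY; rewrite ler_wpM2r ?powR_ge0//.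
  by rewrite ler_piMr ?(ltW c0)// ge_min lexx.
have cY : 0 <= c * Y%:R `^ (- eps) by rewrite mulr_ge0 ?powR_ge0 ?ltW.
apply: (@le_trans _ _ (c * Y%:R `^ (- eps) * (c2 * Y%:R `^ p))).
  rewrite -YE [leRHS]mulrACA ler_wpM2r ?mulr_ge0 ?powR_ge0//.
  by rewrite ler_wpM2l ?(ltW c0)// ge_min lexx orbT.
apply: hN.
have hn' : n%:R <= B * Y%:R * (j + 5)%:R + (j + 5)%:R * N%:R :> R.
  rewrite BE -!natrM -natrD ler_nat; apply: leq_trans hn _.
  by rewrite mulnA leq_add// leq_mul2r leq_add2l orbT.
have j0 : 0 < (j + 5)%:R :> R by rewrite ltr0n addnS.
have half : B * Y%:R * (j + 5)%:R <= n%:R / 2.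
  apply: (@le_trans _ _ (B * Y%:R * (C * Y%:R `^ eps))).
    by rewrite ler_wpM2l ?HC// mulr_ge0 ?ltW.
  have -> : B * Y%:R * (C * Y%:R `^ eps) = B * C * Y%:R `^ (1 + eps).
    rewrite powRD ?(gt_eqF Y0) ?implybT// powRr1 ?ltW//; ring.
  apply: (@le_trans _ _ (B * C * (1 / (2 * B * C) * n%:R))); last first.
    by rewrite le_eqVlt; apply/orP; left; apply/eqP; field; rewrite !gt_eqF.
  rewrite ler_wpM2l ?mulr_ge0 ?(ltW B0) ?(ltW C0)//; apply: le_trans Yx _.
  apply: ler_pM; rewrite ?powR_ge0 ?(ltW c40)//; first by rewrite ge_min lexx.
  have n1 : 1 <= n%:R :> R by rewrite ler1n.
  by rewrite -[leRHS]powRr1 ?ler0n//; apply: ler_powR.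
have nN : n%:R / 2 <= C * Y%:R `^ eps * N%:R.
  apply: (@le_trans _ _ ((j + 5)%:R * N%:R)); last by rewrite ler_wpM2r.
  lra.
have nal : n%:R `^ al <= (2 * C) `^ al * (Y%:R `^ eps * N%:R `^ al).
  have h1 : n%:R <= 2 * C * (Y%:R `^ eps * N%:R).
    by move: nN; rewrite ler_pdivrMr// => h; apply: le_trans h _; rewrite le_eqVlt; apply/orP; left; apply/eqP; ring.
  apply: le_trans (ler_pow (ltW al0) (ler0n _ _) h1) _.
  have C2 : 0 <= 2 * C by rewrite mulr_ge0 ?ltW.
  have YN : 0 <= Y%:R `^ eps * N%:R by rewrite mulr_ge0 ?powR_ge0.
  rewrite [leLHS]powRM//.
  apply: ler_wpM2l; first exact: powR_ge0.
  rewrite [leLHS]powRM ?powR_ge0//; apply: ler_wpM2r; first exact: powR_ge0.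
  have Ye1 : 1 <= Y%:R `^ eps :> R.
    have Y1 : 1 <= Y%:R :> R by rewrite ler1n expn_gt0.
    by have := ler_pow (ltW e0) ler01 Y1; rewrite powR1.
  by rewrite -[leRHS]powRr1 ?powR_ge0//; apply: ler_powR.
have Yep : 0 < Y%:R `^ eps :> R by rewrite powR_gt0.
rewrite -(ler_pM2r Yep).
have -> : Y%:R * Y%:R `^ eps = Y%:R `^ (1 + eps) :> R.
  by rewrite powRD ?(gt_eqF Y0) ?implybT// powRr1 ?ltW.
apply: le_trans Yx _.
apply: (@le_trans _ _ (c1 * (2 * C) `^ (- al) * ((2 * C) `^ al * (Y%:R `^ eps * N%:R `^ al)))).
  apply: ler_pM; rewrite ?powR_ge0 ?(ltW c40)//.
  by rewrite ge_min lexx orbT.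
rewrite mulrA -[c1 * _ * _]mulrA -powRD ?addNr ?eqxx ?powRr0 ?mulr1; last first.
  by rewrite gt_eqF ?implybT// mulr_gt0.
by rewrite le_eqVlt; apply/orP; left; apply/eqP; ring.
Qed.

End Growth.

(** * Compression exponents *)

Section Lower.
Context {R : realType} (p : R) (p1 : (1 <= p%:E)%E) (X : diagonal).
Local Notation gens := (@dgens X).
Local Notation l := (dl X).
Local Notation k := (dk X).
Local Notation comp := (compression_exponent p1 gens).

Let p_ge1 : 1 <= p. Proof. by rewrite -lee_fin. Qed.
Let p0 : 0 < p. Proof. exact: lt_le_trans p_ge1. Qed.

Lemma lee_lower_approx (al : R) (y : \bar R) :
  (forall e : R, e < al -> (e%:E <= y)%E) -> (al%:E <= y)%E.
Proof.
case: y => [r||] h; last 2 first.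
- exact: leey.
- by have := h (al - 1); rewrite gtrBl ltr01 => /(_ isT); rewrite leeNy_eq.
rewrite lee_fin; apply/ler_addgt0Pr => d d0.
by have := h (al - d); rewrite gtrBl d0 lee_fin lerBlDr => /(_ isT).
Qed.

(** Leaves a purely numerical condition: at a scale Y <= c1 N^al one of the two energies of the
    level must reach Y^p. Small powers lost to weights and logarithms disappear in the supremum. *)
Lemma compression_ge (al c1 c2 : R) : 0 < al -> al <= 1 -> 0 < c1 -> 0 < c2 ->
  (forall j s N : nat, let Y : nat := (2 ^ j)%N in
    ((0 < N)%N -> (0 < k s <= 8 * Y)%N) -> (N <= 32 * 32 * (Y * l s))%N ->
    Y%:R <= c1 * N%:R `^ al ->
    c2 * Y%:R `^ p <= Num.max (N%:R `^ p * (k s)%:R `^ (p - 2) * Y%:R `^ (1 - p))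
      (N%:R `^ p * Y%:R `^ (- (p / 2)))) ->
  (al%:E <= comp)%E.
Proof.
move=> al0 al1 c10 c20 hal; apply: lee_lower_approx => e eal.
pose eps : R := Num.min (1 / 2) ((al - e) / 2).
have e0 : 0 < eps by rewrite lt_min divr_gt0//= divr_gt0// subr_gt0.
have e12 : eps <= 1 / 2 by rewrite ge_min lexx.
have eae : eps <= (al - e) / 2 by rewrite ge_min lexx orbT.
have ep : eps < p by apply: le_lt_trans e12 _; apply: lt_le_trans p_ge1; lra.
have e1 : 0 < 1 + eps by rewrite addr_gt0.
pose be := al * (p - eps) / (p * (1 + eps)).
have pe : 0 < p * (1 + eps) by rewrite mulr_gt0.
have be0 : 0 <= be.
  by rewrite divr_ge0 ?mulr_ge0 ?subr_ge0 ?(ltW ep) ?(ltW al0) ?(ltW pe)// ltW.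
have ebe : e <= be.
  apply: (@le_trans _ _ (al * (1 - 2 * eps))).
    have : al * eps <= eps by rewrite ler_piMl// ltW.
    lra.
  rewrite /be -mulrA ler_wpM2l ?(ltW al0)// ler_pdivlMr//.
  have h1 : eps <= p * eps by rewrite ler_peMl// ltW.
  have h2 : 0 <= p * eps ^+ 2 by rewrite mulr_ge0 ?sqr_ge0// ltW.
  by move: h1 h2; rewrite expr2; nra.
apply: (@le_trans _ _ be%:E); first by rewrite lee_fin.
(* With this base the weight om^(2j) equals Y^(-eps) for Y = 2^j. *)
pose om : R := 2 `^ (- (eps / 2)).
have om0 : 0 < om by rewrite powR_gt0.
have om1 : om < 1.
  have ln2 : 0 < ln 2 :> R by apply: ln_gt0; rewrite ltr1n.
  by rewrite /om /powR gt_eqF// expR_lt1 mulNr oppr_lt0 mulr_gt0// divr_gt0.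
have omE j : om ^+ (2 * j) = ((2 ^ j)%N%:R : R) `^ (- eps).
  rewrite -powR_mulrn ?(ltW om0)// /om -powRrM natrX -powR_mulrn// -powRrM; congr (_ `^ _).
  by rewrite natrM; field.
have [Psi lip [c c0 hPsi]] := energy_dichotomy p1 X om0 om1.
have [c3 c30 hc3] := scale_growth p0 al0 al1 e0 ep c0 c10 c20.
apply: (@le_trans _ _ (map_compression_exponent Psi)); last first.
  by apply: ereal_sup_ubound; exists Psi.
apply: ereal_sup_ubound; exists be => //; split => //.
exists (c3 `^ p^-1) => [|t t1]; first by rewrite powR_gt0.
apply: le_ereal_inf_tmp => _ [[g h] /= tn <-].
have t0 : 0 < t by apply: lt_le_trans t1.
have [hE hj] := hPsi g h; set n := subgroup_dist g h in hE hj tn.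
have n0 : (0 < n)%N by rewrite -(ltr0n R); apply: lt_le_trans tn.
rewrite dist_energy_ge; last by rewrite mulr_ge0 ?powR_ge0.
apply: (@le_trans _ _ (c3 * n%:R `^ (al * (p - eps) / (1 + eps)))).
  rewrite powRM ?powR_ge0// -powRrM mulVf ?(gt_eqF p0)// powRr1 ?(ltW c30)//.
  rewrite ler_wpM2l ?(ltW c30)// -powRrM.
  have -> : be * p = al * (p - eps) / (1 + eps) by rewrite /be; field; rewrite !gt_eqF.
  by apply: ler_pow => //; [rewrite divr_ge0 ?mulr_ge0 ?subr_ge0 ?(ltW ep) ?(ltW al0) ?(ltW e1)|exact: ltW].
apply: hc3 => //; first exact: hE.
move=> j Y; have [h1|[s [N [h1 h2 h3 h4 h5]]]] := hj j.
  by left; rewrite -omE.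
right; exists N; split => // hY; rewrite -omE.
have w0 : 0 <= c * om ^+ (2 * j) by rewrite mulr_ge0 ?exprn_ge0 ?ltW.
apply: le_trans (ler_wpM2l w0 (hal j s N h2 h3 hY)) _.
by rewrite /Num.max; case: ifP.
Qed.

(** The signed sums give N^p Y^(-p/2), which is at least Y^p as soon as Y <= N^(2/3). *)
Lemma compression_ge_two_thirds : ((2 / 3)%:E <= comp)%E.
Proof.
apply: (@compression_ge _ 1 1); rewrite ?ltr01 ?divr_gt0// ?ler_pdivrMr// ?mul1r ?ler_nat//.
move=> j s N Y _ _; rewrite !mul1r => h.
have Y0 : 0 < Y%:R :> R by rewrite ltr0n expn_gt0.
rewrite le_max; apply/orP; right.
have e0 : 0 <= 3 / 2 * p by rewrite mulr_ge0 ?(ltW p0)// divr_ge0.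
have := ler_pow e0 (ltW Y0) h; rewrite -powRrM (_ : 2 / 3 * (3 / 2 * p) = p); last by field.
move=> hp; apply: le_trans (ler_wpM2r (powR_ge0 _ _) hp); rewrite -powRD ?(gt_eqF Y0) ?implybT//.
by rewrite (_ : 3 / 2 * p + - (p / 2) = p)//; field.
Qed.

Section Bounded.
Context (th C : R) (C0 : 0 < C).
Hypothesis hl : forall s, (0 < s)%N -> (l s)%:R <= C * (k s)%:R `^ th.

Lemma level_gt0 s : (0 < k s)%N -> (0 < s)%N.
Proof. by case: s => //; rewrite dk0. Qed.

(** N is at most a constant times Y l_s, hence at most D Y^(1+th), so for small [c1] the condition Y
    <= c1 N^al is never met: the range alone detects the length. *)
Lemma compression_ge_circle : 0 <= th -> ((1 / (1 + th))%:E <= comp)%E.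
Proof.
move=> th0; have t1 : 0 < 1 + th by rewrite ltr_wpDr.
set al := 1 / _; have al0 : 0 < al by rewrite divr_gt0.
have [B [B0 BE]] : exists B : R, 0 < B /\ B = (32 * 32)%N%:R by exists (32 * 32)%N%:R; rewrite ltr0n.
pose D := B * C * 8 `^ th.
have D0 : 0 < D by rewrite mulr_gt0 ?powR_gt0 ?mulr_gt0.
have Da : 0 < D `^ al by rewrite powR_gt0.
apply: (@compression_ge _ (1 / (2 * D `^ al)) 1) => //.
- by rewrite ler_pdivrMr// mul1r lerDl.
- by rewrite divr_gt0// mulr_gt0.
move=> j s N Y hk hN hY; exfalso.
have Y0 : 0 < Y%:R :> R by rewrite ltr0n expn_gt0.
have [N0|Npos] := posnP N.
  by move: hY; rewrite N0 powR0 ?gt_eqF// mulr0 leNgt Y0.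
have /andP[k0 kY] := hk Npos.
have hN' : N%:R <= D * Y%:R `^ (1 + th).
  apply: (@le_trans _ _ (B * (Y%:R * (l s)%:R))); first by rewrite BE -!natrM ler_nat.
  have h8 : (k s)%:R `^ th <= 8 `^ th * Y%:R `^ th :> R.
    by rewrite -powRM ?ler0n//; apply: ler_pow => //; rewrite -natrM ler_nat.
  have hlk : (l s)%:R <= C * (8 `^ th * Y%:R `^ th).
    by apply: le_trans (hl (level_gt0 k0)) _; rewrite ler_wpM2l// ltW.
  apply: (@le_trans _ _ (B * (Y%:R * (C * (8 `^ th * Y%:R `^ th))))).
    by rewrite ler_wpM2l ?(ltW B0)// ler_wpM2l// ltW.
  rewrite powRD ?(gt_eqF Y0) ?implybT// powRr1 ?(ltW Y0)// /D.
  by rewrite le_eqVlt; apply/orP; left; apply/eqP; ring.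
have h1 : N%:R `^ al <= D `^ al * Y%:R.
  apply: le_trans (ler_pow (ltW al0) (ler0n _ _) hN') _.
  rewrite powRM ?powR_ge0 ?(ltW D0)// -powRrM (_ : (1 + th) * al = 1) ?powRr1 ?(ltW Y0)//.
  by rewrite /al mul1r mulfV// gt_eqF.
have : Y%:R <= Y%:R / 2 :> R.
  apply: le_trans hY _.
  apply: (@le_trans _ _ (1 / (2 * D `^ al) * (D `^ al * Y%:R))).
    by rewrite ler_wpM2l// divr_ge0// mulr_ge0 ?powR_ge0.
  by rewrite le_eqVlt; apply/orP; left; apply/eqP; field; rewrite gt_eqF.
by move: Y0; lra.
Qed.

(** N <= B Y l_s and l_s <= C k_s^th force k_s^th >= N / (B C Y), so for p >= 2 the factor k_s^(p-2)
    of the site energy gains (N / (B C Y))^g; the exponent [al] balances this against Y^p. *)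
Lemma compression_ge_mixed : 2 <= p -> 0 < th ->
  (((th + 1 - 2 / p) / ((2 - 1 / p) * th + 1 - 2 / p))%:E <= comp)%E.
Proof.
move=> p2 th0; pose g := (p - 2) / th.
have g0 : 0 <= g by rewrite divr_ge0 ?subr_ge0// ltW.
have d0 : 0 < 2 * p - 1 + g by apply: ltr_wpDr => //; move: p_ge1; lra.
have n0 : 0 < p + g by apply: ltr_wpDr.
pose al := (p + g) / (2 * p - 1 + g).
have al0 : 0 < al by rewrite divr_gt0.
have p0' : p != 0 by rewrite gt_eqF.
have th0' : th != 0 by rewrite gt_eqF.
have -> : (th + 1 - 2 / p) / ((2 - 1 / p) * th + 1 - 2 / p) = al.
  have e1 : th + 1 - 2 / p = (p + g) * (th / p) by rewrite /g; field; rewrite p0' th0'.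
  have e2 : (2 - 1 / p) * th + 1 - 2 / p = (2 * p - 1 + g) * (th / p).
    by rewrite /g; field; rewrite p0' th0'.
  by rewrite e1 e2 -mulf_div divff ?mulr1// mulf_neq0 ?invr_eq0.
have [B [B0 BE]] : exists B : R, 0 < B /\ B = (32 * 32)%N%:R by exists (32 * 32)%N%:R; rewrite ltr0n.
have BC : 0 < B * C by rewrite mulr_gt0.
apply: (@compression_ge _ 1 ((B * C) `^ (- g))) => //.
- by rewrite ler_pdivrMr// mul1r; move: p_ge1; lra.
- by rewrite powR_gt0.
move=> j s N Y hk hN; rewrite mul1r => hY.
have Y0 : 0 < Y%:R :> R by rewrite ltr0n expn_gt0.
have Ne : Y%:R != 0 :> R by rewrite gt_eqF.
have [N0|Npos] := posnP N.
  by move: hY; rewrite N0 powR0 ?gt_eqF// leNgt Y0.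
have NR : 0 < N%:R :> R by rewrite ltr0n.
have /andP[k0 kY] := hk Npos.
rewrite le_max; apply/orP; left.
have hk' : N%:R / (B * C * Y%:R) <= (k s)%:R `^ th.
  rewrite ler_pdivrMr; last by rewrite mulr_gt0.
  apply: (@le_trans _ _ (B * (Y%:R * (l s)%:R))); first by rewrite BE -!natrM ler_nat.
  apply: (@le_trans _ _ (B * (Y%:R * (C * (k s)%:R `^ th)))).
    by rewrite ler_wpM2l ?(ltW B0)// ler_wpM2l ?(ltW Y0)// hl// (level_gt0 k0).
  by rewrite le_eqVlt; apply/orP; left; apply/eqP; ring.
have BY : 0 < B * C * Y%:R by rewrite mulr_gt0.
have hkp : (B * C) `^ (- g) * Y%:R `^ (- g) * N%:R `^ g <= (k s)%:R `^ (p - 2).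
  have := ler_pow g0 (divr_ge0 (ltW NR) (ltW BY)) hk'.
  rewrite -powRrM (_ : th * g = p - 2); last by rewrite /g mulrC divfK.
  apply: le_trans; rewrite [leRHS]powRM ?(ltW NR) ?invr_ge0 ?(ltW BY)//.
  rewrite -[(B * C * Y%:R)^-1]powR_inv1 ?(ltW BY)// -powRrM mulN1r.
  by rewrite [(B * C * _) `^ _]powRM ?(ltW BC) ?(ltW Y0)// mulrC.
have hNY : Y%:R `^ (2 * p - 1 + g) <= N%:R `^ (p + g).
  have := ler_pow (ltW d0) (ltW Y0) hY; rewrite -powRrM /al divfK// gt_eqF//.
apply: (@le_trans _ _ (N%:R `^ p * ((B * C) `^ (- g) * Y%:R `^ (- g) * N%:R `^ g) * Y%:R `^ (1 - p))).
  have -> : N%:R `^ p * ((B * C) `^ (- g) * Y%:R `^ (- g) * N%:R `^ g) * Y%:R `^ (1 - p) =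
     (B * C) `^ (- g) * (N%:R `^ (p + g) * Y%:R `^ (1 - p - g)).
    rewrite [N%:R `^ (p + g)]powRD ?(gt_eqF NR) ?implybT//.
    by rewrite [Y%:R `^ (1 - p - g)]powRD ?Ne ?implybT//; ring.
  rewrite ler_wpM2l ?powR_ge0//; apply: le_trans (ler_wpM2r (powR_ge0 _ _) hNY).
  rewrite -powRD ?Ne ?implybT//.
  by rewrite (_ : 2 * p - 1 + g + (1 - p - g) = p)//; ring.
by rewrite ler_wpM2r ?powR_ge0// ler_wpM2l ?powR_ge0.
Qed.

End Bounded.
End Lower.

(** * Upper bounds from the obstruction *)

Section Upper.
Context {R : realType} (p : R) (p1 : (1 <= p%:E)%E) (X : diagonal).
Local Notation gens := (@dgens X).
Local Notation l := (dl X).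
Local Notation k := (dk X).
Local Notation D := (dirprod (fun s => wreath (dG X s))).
Local Notation H := (generated_subgroup gens).
Local Notation comp := (compression_exponent p1 gens).
Local Notation q := (Num.max p 2).

Let p_ge1 : 1 <= p. Proof. by rewrite -lee_fin. Qed.
Let p0 : 0 < p. Proof. exact: lt_le_trans p_ge1. Qed.

Lemma exponent_le (A B C : R) :
  (forall K : nat, exists x : R, [/\ K%:R <= x, 1 <= x & x `^ A <= C * x `^ B]) -> A <= B.
Proof.
move=> h; rewrite leNgt; apply/negP => BA; pose d := A - B.
have d0 : 0 < d by rewrite subr_gt0.
pose z := (`|C| + 1) `^ d^-1.
have z0 : 0 <= z by exact: powR_ge0.
have [x [hK x1 hx]] := h (Num.trunc z).+1.
have x0 : 0 < x by apply: lt_le_trans x1.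
have zx : z <= x.
  by apply: le_trans hK; have /andP[_ /ltW] := truncn_itv z0.
have C0 : 0 <= `|C| + 1 by rewrite addr_ge0.
have h1 : `|C| + 1 <= x `^ d.
  have := ler_pow (ltW d0) z0 zx.
  by rewrite /z -powRrM mulVf ?gt_eqF// powRr1.
have h2 : x `^ d <= C.
  have xB : 0 < x `^ B by exact: powR_gt0.
  rewrite -(ler_pM2r xB); apply: le_trans hx; rewrite -powRD ?(gt_eqF x0) ?implybT//.
  by rewrite /d subrK.
by have := le_trans h1 h2; have := ler_norm C; lra.
Qed.

Lemma nat_floor (x : R) : 1 <= x -> exists m : nat, [/\ (0 < m)%N, m%:R <= x & x <= 2 * m%:R].
Proof.
by move=> /dyadic_floor[j [h1 h2]]; exists (2 ^ j)%N; rewrite expn_gt0.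
Qed.

Lemma ball_cur n (x : D) : ball gens n x -> (absz (cur x 0) <= n)%N.
Proof.
elim: n x => [|n IH] x; first by move/ball0 ->; rewrite cur1.
case/ballS => [/IH h|[y [c [/IH h hc ->]]]]; first exact: leqW.
have hc1 : (absz (cur c 0) <= 1)%N.
  have hcc : cur c 0 = - cur (c^-1)%g 0 by rewrite curV opprK.
  by case: hc => -[] h'; rewrite ?h'// hcc h'.
have -> : cur (y * c)%g 0 = cur y 0 + cur c 0 by [].
lia.
Qed.

Section Map.
Context (Psi : H -> Lp01 p1) (C c e : R).
Hypothesis c0 : 0 < c.
Hypothesis e0 : 0 <= e.
Hypothesis hC : forall x y, (Lp01_dist (Psi x) (Psi y) <= (C * (subgroup_dist x y)%:R)%:E)%E.
Hypothesis hc : forall t : R, 1 <= t -> ((c * t `^ e)%:E <= compression_fun Psi t)%E.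

(** Tau^n has length exactly n, because a generator moves the cursor by at most one. *)
Lemma exponent_le1 : e <= 1.
Proof.
apply: (@exponent_le _ _ (`|C| / c)) => K.
pose n := K.+1; have n1 : 1 <= n%:R :> R by rewrite ler1n.
exists n%:R; split => //; first by rewrite ler_nat.
have ht : H (tauz _ n%:Z) := ball_subgroup (ball_tauz (da X) (db X) k n%:Z).
have h1 : H 1%g := ball_subgroup (ball1 gens 0).
pose x := mem_H h1; pose y := mem_H ht.
have xy : ((val x)^-1 * val y)%g = tauz _ n%:Z by rewrite !val_mem_H invg1 mul1g.
have d1 : (subgroup_dist x y <= n)%N.
  by rewrite /subgroup_dist xy; exact: word_length_le (ball_tauz (da X) (db X) k n%:Z).
have d2 : (n <= subgroup_dist x y)%N.
  by rewrite /subgroup_dist xy; have := ball_cur (ball_word_length ht).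
have h2 := hc n1.
have h3 : (compression_fun Psi n%:R <= Lp01_dist (Psi x) (Psi y))%E.
  by apply: ereal_inf_lbound; exists (x, y) => //=; rewrite ler_nat.
have := le_trans (le_trans h2 h3) (hC x y); rewrite lee_fin => h4.
rewrite powRr1 ?ler0n// mulrAC ler_pdivlMr// mulrC; apply: le_trans h4 _.
apply: (@le_trans _ _ (`|C| * (subgroup_dist x y)%:R)).
  by rewrite ler_wpM2r// ler_norm.
by rewrite ler_wpM2l// ler_nat.
Qed.

(** The information that the limit superior provides for eta below theta: arbitrarily large levels,
    not all of them. *)
Definition often (eta : R) := forall K : nat, exists s,
  [/\ (0 < s)%N, (K <= k s)%N & (k s)%:R `^ eta <= (l s)%:R].

(** The number of blocks stays fixed with r = 20, and M is about k_s^eta / 6400, the largest size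
    allowed by l_s; eta q <= 1 gives M^q <= k_s / 2. *)
Lemma exponent_le_circle eta : 0 < eta -> eta * q <= 1 -> often eta -> e <= 1 / (1 + eta).
Proof.
move=> eta0 etaq hl; have [C1 C10 hC1] := obstruction c0 e0 hC hc.
have t1 : 0 < 1 + eta by rewrite addr_gt0.
rewrite ler_pdivlMr// mulrC.
rewrite -(ler_pM2r p0) mul1r.
have [B [B1 BE]] : exists B : R, 1 <= B /\ B = (320 * 20)%N%:R.
  by exists (320 * 20)%N%:R; rewrite ler1n.
have B0 : 0 < B by apply: lt_le_trans B1.
have q2 : 2 <= q by rewrite le_max lexx orbT.
have q0 : 0 <= q by apply: le_trans q2.
pose c2 : R := (20 ^+ 3 / (2 * B)) `^ (e * p).
have c20 : 0 < c2 by apply: powR_gt0; rewrite divr_gt0 ?exprn_gt0 ?mulr_gt0.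
apply: (@exponent_le _ _ (C1 * 20 `^ (2 * q) / c2)) => K.
pose z : R := (2 * B) `^ (eta^-1).
have [s [s0 hs hls]] := hl (K + (Num.trunc z).+1)%N.
have z0 : 0 <= z by exact: powR_ge0.
have zk : z <= (k s)%:R.
  apply: (@le_trans _ _ (Num.trunc z).+1%:R); first by have /andP[_ /ltW] := truncn_itv z0.
  by rewrite ler_nat; apply: leq_trans hs; exact: leq_addl.
have k1 : 1 <= (k s)%:R :> R.
  by rewrite ler1n; apply: leq_trans hs; rewrite addnS.
have k0 : 0 < (k s)%:R :> R by apply: lt_le_trans k1.
exists (k s)%:R; split => //.
  by rewrite ler_nat; apply: leq_trans hs; exact: leq_addr.
have keta : 2 * B <= (k s)%:R `^ eta.
  have := ler_pow (ltW eta0) z0 zk; rewrite /z -powRrM mulVf ?gt_eqF// powRr1//.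
  by rewrite mulr_ge0// ltW.
have [|M [M0 M1 M2]] := @nat_floor ((k s)%:R `^ eta / B).
  by rewrite ler_pdivlMr// mul1r; apply: le_trans keta; move: B0; lra.
have hM : M%:R `^ q <= (k s)%:R / 2.
  apply: (@le_trans _ _ (((k s)%:R `^ eta / 2) `^ q)).
    apply: ler_pow => //; apply: le_trans M1 _.
    rewrite ler_wpM2l ?powR_ge0// lef_pV2 ?posrE// BE ler_nat.
    by [].
  rewrite powRM ?powR_ge0 ?invr_ge0// -powRrM.
  apply: ler_pM; rewrite ?powR_ge0//.
    by rewrite -[leRHS]powRr1 ?(ltW k0)//; apply: ler_powR.
  rewrite -[leRHS]powRr1 ?invr_ge0//.
  rewrite -powR_inv1// -!powRrM !mulN1r; apply: ler_powR; first by rewrite ler1n.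
  by rewrite lerN2; apply: le_trans q2; rewrite ler1n.
have hM' : (320 * 20 * M <= l s)%N.
  rewrite -(ler_nat R); apply: le_trans hls.
  by rewrite natrM -BE mulrC -ler_pdivlMr.
have := hC1 s 20%N M s0 M0 (leqnn _) hM' hM => h.
rewrite -(ler_pM2l c20) [leRHS]mulrA [c2 * (_ / _)]mulrC divfK ?gt_eqF//.
rewrite -[leRHS]mulrA; apply: le_trans h.
have -> : (1 + eta) * e * p = (1 + eta) * (e * p) by rewrite mulrA.
have -> : (k s)%:R `^ ((1 + eta) * (e * p)) = ((k s)%:R `^ (1 + eta)) `^ (e * p) :> R.
  by rewrite -powRrM.
rewrite /c2 -powRM ?powR_ge0 ?divr_ge0 ?exprn_ge0 ?mulr_ge0 ?(ltW B0)//.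
apply: ler_pow.
- by rewrite mulr_ge0// ltW.
- by rewrite mulr_ge0 ?powR_ge0// divr_ge0 ?exprn_ge0 ?mulr_ge0 ?(ltW B0).
have -> : (k s)%:R `^ (1 + eta) = (k s)%:R * (k s)%:R `^ eta :> R.
  by rewrite powRD ?(gt_eqF k0) ?implybT// powRr1// ltW.
have h20 : 0 <= (k s)%:R * 20%:R ^+ 3 :> R by rewrite mulr_ge0 ?exprn_ge0.
have hk : (k s)%:R `^ eta / (2 * B) <= M%:R.
  by rewrite ler_pdivrMr ?mulr_gt0// mulrA [M%:R * 2]mulrC -ler_pdivrMr.
apply: le_trans (ler_wpM2l h20 hk).
rewrite le_eqVlt; apply/orP; left; apply/eqP; ring.
Qed.

(** Here M is about (k_s / 2)^(1/p), as large as the cotype condition permits, and r about k_s^nu /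
    320 uses up the remaining factor of l_s >= k_s^eta. *)
Lemma exponent_le_torus eta : 2 <= p -> 1 / p < eta -> often eta ->
  e <= (2 * eta + 1 - 2 / p) / (3 * eta + 1 - 2 / p).
Proof.
move=> p2 etap hl; have [C1 C10 hC1] := obstruction c0 e0 hC hc.
have qE : q = p by apply/max_idPl.
rewrite qE in hC1.
have ip0 : 0 < 1 / p by rewrite divr_gt0.
have ip2 : 1 / p <= 1 / 2 by rewrite !div1r lef_pV2 ?posrE.
have ipE : 2 / p = 2 * (1 / p) by rewrite mul1r.
have d0 : 0 < 3 * eta + 1 - 2 / p by rewrite ipE; lra.
rewrite ler_pdivlMr// -(ler_pM2r p0).
pose nu := eta - 1 / p; have nu0 : 0 < nu by rewrite subr_gt0.
have [B [B1 BE]] : exists B : R, 1 <= B /\ B = 320%:R.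
  by exists 320%:R; rewrite ler1n.
have B0 : 0 < B by apply: lt_le_trans B1.
pose c2 : R := ((2 * B) ^- 3 / 4) `^ (e * p).
have c20 : 0 < c2 by apply: powR_gt0; rewrite divr_gt0 ?invr_gt0 ?exprn_gt0 ?mulr_gt0.
apply: (@exponent_le _ _ (C1 / c2)) => K.
(* Beyond this size k_s^nu >= 40 B, hence r >= 20. *)
pose z : R := (B * 40) `^ (nu^-1).
have [s [s0 hs hls]] := hl (K + ((Num.trunc z).+1 + 2))%N.
have z0 : 0 <= z by exact: powR_ge0.
have zk : z <= (k s)%:R.
  apply: (@le_trans _ _ (Num.trunc z).+1%:R); first by have /andP[_ /ltW] := truncn_itv z0.
  by rewrite ler_nat; apply: leq_trans hs; rewrite addnCA leq_addr.
have k2 : 2 <= (k s)%:R :> R.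
  by rewrite ler_nat; apply: leq_trans hs; rewrite addnA leq_addl.
have k1 : 1 <= (k s)%:R :> R by apply: le_trans k2; rewrite ler1n.
have k0 : 0 < (k s)%:R :> R by apply: lt_le_trans k1.
exists (k s)%:R; split => //.
  by rewrite ler_nat; apply: leq_trans hs; exact: leq_addr.
have knu : B * 40 <= (k s)%:R `^ nu.
  have := ler_pow (ltW nu0) z0 zk; rewrite /z -powRrM mulVf ?gt_eqF// powRr1//.
  by rewrite mulr_ge0// ltW.
have [|r [r0 r1 r2]] := @nat_floor ((k s)%:R `^ nu / B).
  by rewrite ler_pdivlMr// mul1r; apply: le_trans knu; move: B0; lra.
have r20 : (20 <= r)%N.
  rewrite -(ler_nat R) -(ler_pM2l (ltr0n R 2)); apply: le_trans r2.
  by rewrite ler_pdivlMr// -natrM mulrC.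
have kh1 : 1 <= (k s)%:R / 2 :> R by rewrite ler_pdivlMr// mul1r.
have kh0 : 0 <= (k s)%:R / 2 :> R by apply: le_trans kh1.
have [|M [M0 M1 M2]] := @nat_floor (((k s)%:R / 2) `^ (1 / p)).
  by have := ler_pow (ltW ip0) ler01 kh1; rewrite powR1.
have hM : M%:R `^ p <= (k s)%:R / 2.
  apply: le_trans (ler_pow (ltW p0) (ler0n _ _) M1) _.
  by rewrite -powRrM (_ : 1 / p * p = 1) ?powRr1// mul1r mulVf// gt_eqF.
have etaE : (k s)%:R `^ nu * (k s)%:R `^ (1 / p) = (k s)%:R `^ eta :> R.
  by rewrite -powRD ?(gt_eqF k0) ?implybT// /nu subrK.
have hM' : (320 * r * M <= l s)%N.
  rewrite -(ler_nat R); apply: le_trans hls; rewrite !natrM -BE -etaE.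
  apply: ler_pM; rewrite ?mulr_ge0 ?(ltW B0)//.
    by rewrite mulrC -ler_pdivlMr.
  apply: le_trans M1 _; apply: ler_pow => //; first exact: ltW.
  by rewrite ler_pdivrMr// ler_peMr ?(ltW k0)// ler1n.
have := hC1 s r M s0 M0 r20 hM' hM => h.
rewrite -(ler_pM2l c20) [leRHS]mulrA [c2 * (_ / _)]mulrC divfK ?gt_eqF//.
have hr : r%:R `^ (2 * p) * (k s)%:R `^ p <= (k s)%:R `^ ((2 * eta + 1 - 2 / p) * p).
  have -> : (2 * eta + 1 - 2 / p) * p = nu * (2 * p) + p by rewrite /nu; field; rewrite gt_eqF.
  have kE : (k s)%:R `^ (nu * (2 * p)) = ((k s)%:R `^ nu) `^ (2 * p) :> R by rewrite -powRrM.
  rewrite powRD ?(gt_eqF k0) ?implybT// kE ler_wpM2r ?powR_ge0//.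
  apply: ler_pow => //; first by rewrite mulr_ge0// ltW.
  by apply: le_trans r1 _; rewrite ler_pdivrMr// ler_peMr ?powR_ge0.
apply: le_trans (ler_wpM2l (ltW C10) hr); apply: le_trans h.
have -> : e * (3 * eta + 1 - 2 / p) * p = (1 + nu * 3 + 1 / p) * (e * p).
  by rewrite /nu; field; rewrite gt_eqF.
have c3 : 0 <= (2 * B) ^- 3 / 4 by rewrite divr_ge0 ?invr_ge0 ?exprn_ge0 ?mulr_ge0 ?(ltW B0).
have -> : (k s)%:R `^ ((1 + nu * 3 + 1 / p) * (e * p)) =
    ((k s)%:R `^ (1 + nu * 3 + 1 / p)) `^ (e * p) :> R by rewrite -powRrM.
rewrite /c2 -powRM ?powR_ge0//; apply: ler_pow.
- by rewrite mulr_ge0// ltW.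
- by rewrite mulr_ge0 ?powR_ge0.
rewrite !powRD ?(gt_eqF k0) ?implybT// powRr1 ?(ltW k0)//.
have hr' : (k s)%:R `^ nu / (2 * B) <= r%:R.
  by rewrite ler_pdivrMr ?mulr_gt0// mulrA [r%:R * 2]mulrC -ler_pdivrMr.
have hM2 : (k s)%:R `^ (1 / p) / 4 <= M%:R.
  have hk : (k s)%:R `^ (1 / p) / 2 <= ((k s)%:R / 2) `^ (1 / p) :> R.
    rewrite [leRHS]powRM ?(ltW k0) ?invr_ge0// ler_wpM2l ?powR_ge0//.
    rewrite -powR_inv1// -powRrM mulN1r; apply: ler_powR; first by rewrite ler1n.
    by rewrite lerN2; apply: le_trans ip2 _; rewrite ler_pdivrMr// mul1r ler1n.
  by have := le_trans hk M2; lra.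
have hr3 : ((k s)%:R `^ nu / (2 * B)) ^+ 3 <= r%:R ^+ 3.
  by rewrite lerXn2r ?nnegrE// divr_ge0 ?powR_ge0 ?mulr_ge0 ?(ltW B0).
have -> : (k s)%:R `^ (nu * 3) = ((k s)%:R `^ nu) ^+ 3 :> R by rewrite -powR_mulrn ?powR_ge0// -powRrM.
apply: (@le_trans _ _ ((k s)%:R * ((k s)%:R `^ nu / (2 * B)) ^+ 3 * ((k s)%:R `^ (1 / p) / 4))).
  by rewrite le_eqVlt; apply/orP; left; apply/eqP; field; rewrite gt_eqF.
apply: ler_pM => //.
- by rewrite mulr_ge0 ?(ltW k0)// exprn_ge0// divr_ge0 ?powR_ge0 ?mulr_ge0 ?(ltW B0).
- by rewrite ler_wpM2l// ltW.
Qed.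

End Map.

Lemma compression_le (B : R) :
  (forall (Psi : H -> Lp01 p1) (C c e : R), 0 < c -> 0 <= e ->
    (forall x y, (Lp01_dist (Psi x) (Psi y) <= (C * (subgroup_dist x y)%:R)%:E)%E) ->
    (forall t : R, 1 <= t -> ((c * t `^ e)%:E <= compression_fun Psi t)%E) -> e <= B) ->
  (comp <= B%:E)%E.
Proof.
move=> h; apply: ge_ereal_sup => _ [Psi [C hC] <-]; apply: ge_ereal_sup => _ [e [e0 [c c0 hc]] <-].
by rewrite lee_fin; exact: (h Psi C c e).
Qed.

End Upper.

(** * Passage to the limit in theta *)

Section Exponents.
Context {R : realType}.

Lemma limit_le (F : set_system R) {PF : ProperFilter F} (f : R -> R) (L : R) (y : \bar R) :
  f @ F --> L -> (\forall x \near F, ((f x)%:E <= y)%E) -> (L%:E <= y)%E.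
Proof. by move=> fL; apply: cvge_to_le; apply: cvg_EFin => //; exact: nearW. Qed.

Lemma le_limit (F : set_system R) {PF : ProperFilter F} (f : R -> R) (L : R) (y : \bar R) :
  f @ F --> L -> (\forall x \near F, (y <= (f x)%:E)%E) -> (y <= L%:E)%E.
Proof. by move=> fL; apply: cvge_to_ge; apply: cvg_EFin => //; exact: nearW. Qed.

Lemma ratio_cvg (a b c d r : R) : c * r + d != 0 ->
  (fun t : R => (a * t + b) / (c * t + d)) @ r --> (a * r + b) / (c * r + d).
Proof.
move=> nz; apply: cvgM; last apply: cvgV => //.
- by apply: cvgD; [apply: cvgM; [exact: cvg_cst|exact: cvg_id]|exact: cvg_cst].
- by apply: cvgD; [apply: cvgM; [exact: cvg_cst|exact: cvg_id]|exact: cvg_cst].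
Qed.

Lemma ratio_cvg_pinfty (a b c d : R) : 0 < c ->
  (fun t : R => (a * t + b) / (c * t + d)) @ +oo --> a / c.
Proof.
move=> c0; apply/cvgrPdist_lt => e e0.
pose m := Num.max (- d / c) ((`|a * d - b * c| / (c * e) - d) / c).
have mr : m \is Num.real by exact: num_real.
have := nbhs_pinfty_gt mr; apply: filterS => t.
rewrite /m gt_max !ltr_pdivrMr// ltrBlDr => /andP[h1 h2].
have w0 : 0 < c * t + d by rewrite mulrC -ltrBlDr sub0r.
have -> : a / c - (a * t + b) / (c * t + d) = (a * d - b * c) / (c * (c * t + d)).
  by field; rewrite !gt_eqF.
have cw : 0 < c * (c * t + d) by exact: mulr_gt0.
rewrite normrM normfV (gtr0_norm cw) ltr_pdivrMr//.
by move: h2; rewrite ltr_pdivrMr ?mulr_gt0// => h2; apply: lt_le_trans h2 _; rewrite le_eqVlt; apply/orP; left; apply/eqP; ring.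
Qed.

Context (X : diagonal).
Local Notation gens := (@dgens X).
Local Notation l := (dl X).
Local Notation k := (dk X).

(** At s = 0 the value is 0, by the conventions for ln 0 and for division by 0. *)
Definition growth_ratio (s : nat) : \bar R := (ln (l s)%:R / ln (k s)%:R)%:E.
Local Notation theta := (limn_esup growth_ratio).

Lemma thetaE : theta = ereal_inf (range (esups growth_ratio)).
Proof. by rewrite limn_esup_lim; apply/cvg_lim => //; exact: cvg_esups_inf. Qed.

Lemma k_ge2 s : (0 < s)%N -> (2 <= k s)%N.
Proof. by move=> s0; apply: leq_trans (dk_exp X s0); rewrite -[leqLHS]expn1 leq_exp2l. Qed.

Lemma ln_k_gt0 s : (0 < s)%N -> 0 < ln (k s)%:R :> R.
Proof. by move=> s0; apply: ln_gt0; rewrite ltr1n k_ge2. Qed.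

Lemma theta_ge0 : (0 <= theta)%E.
Proof.
rewrite thetaE; apply: le_ereal_inf_tmp => _ [n _ <-].
apply: (@le_trans _ _ (growth_ratio n)).
  have l1 : 0 <= ln (l n)%:R :> R by apply: ln_ge0; rewrite ler1n dl_gt0.
  rewrite lee_fin divr_ge0//; case: n {l1} => [|n]; first by rewrite dk0 ln0.
  exact: ltW (ln_k_gt0 _).
by apply: ereal_sup_ubound; exists n => /=.
Qed.

Lemma k_pow_expR s (t : R) : (0 < s)%N -> (k s)%:R `^ t = expR (t * ln (k s)%:R).
Proof. by move=> s0; rewrite /powR pnatr_eq0 gtn_eqF// ltnW// k_ge2. Qed.

Lemma l_expR s : (l s)%:R = expR (ln (l s)%:R) :> R.
Proof. by rewrite lnK// posrE ltr0n dl_gt0. Qed.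

(** The finitely many levels before the tail are absorbed into [C], since k_s^t >= 1 there. *)
Lemma theta_lt (t : R) : (theta < t%:E)%E ->
  exists2 C : R, 0 < C & forall s, (0 < s)%N -> (l s)%:R <= C * (k s)%:R `^ t.
Proof.
move=> h; have t0 : 0 <= t by rewrite -lee_fin; apply: le_trans theta_ge0 (ltW h).
move: h; rewrite thetaE => /ereal_inf_lt[_ [n _ <-] hn].
have C0 : 0 < 1 + \sum_(s < n) (l s)%:R :> R by rewrite ltr_wpDr ?sumr_ge0.
exists (1 + \sum_(s < n) (l s)%:R) => // s s0.
have k1 : 1 <= (k s)%:R `^ t :> R.
  have : 1 <= (k s)%:R :> R by rewrite ler1n ltnW// k_ge2.
  by move=> /(ler_pow t0 ler01); rewrite powR1.
have [sn|ns] := ltnP s n.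
  apply: (@le_trans _ _ (1 + \sum_(s < n) (l s)%:R)); last by rewrite ler_peMr// ltW.
  rewrite (bigD1 (Ordinal sn))//= addrCA lerDl addr_ge0// sumr_ge0//.
apply: (@le_trans _ _ (1 * (k s)%:R `^ t)); last first.
  by rewrite ler_wpM2r ?powR_ge0// lerDl sumr_ge0.
rewrite mul1r k_pow_expR// l_expR ler_expR -ler_pdivrMr ?ln_k_gt0//.
rewrite -lee_fin; apply: le_trans (ltW hn).
by apply: ereal_sup_ubound; exists s.
Qed.

Lemma theta_gt (t : R) : (t%:E < theta)%E -> often X t.
Proof.
rewrite thetaE => h K.
have hK : (t%:E < esups growth_ratio K.+1)%E.
  by apply: lt_le_trans h _; apply: ereal_inf_lbound; exists K.+1.
have [_ [s /= hs <-] ts] := ereal_sup_gt hK.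
have s0 : (0 < s)%N by apply: leq_trans hs.
exists s; split => //.
  apply: leq_trans (dk_exp X s0); apply: leq_trans (ltnW hs) _.
  exact: ltnW (ltn_expl _ _).
rewrite k_pow_expR// l_expR ler_expR -ler_pdivlMr ?ln_k_gt0//.
by move: ts; rewrite lte_fin => /ltW.
Qed.

Section Compression.
Context (p : R) (p1 : (1 <= p%:E)%E).
Local Notation comp := (compression_exponent p1 gens).

Let p_ge1 : 1 <= p. Proof. by rewrite -lee_fin. Qed.
Let p0 : 0 < p. Proof. exact: lt_le_trans p_ge1. Qed.

Lemma inv1D_cvg (r : R) : 0 <= r -> (fun t : R => 1 / (1 + t)) @ r --> 1 / (1 + r).
Proof.
move=> r0; have := @ratio_cvg 0 1 1 1 r; rewrite mul0r mul1r add0r [r + 1]addrC.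
have -> : (fun t : R => (0 * t + 1) / (1 * t + 1)) = (fun t => 1 / (1 + t)).
  by apply/funext => t; rewrite mul0r mul1r add0r addrC.
by apply; rewrite gt_eqF// ltr_wpDr.
Qed.

(** For each t > r one has theta < t, so [theta_lt] applies; the bound passes to the limit from the
    right. *)
Lemma theta_compression_ge_circle (r : R) : (theta <= r%:E)%E -> ((1 / (1 + r))%:E <= comp)%E.
Proof.
move=> tr; have r0 : 0 <= r by rewrite -lee_fin; apply: le_trans theta_ge0 tr.
apply: limit_le (cvg_at_right_filter (inv1D_cvg r0)) _.
have := nbhs_right_gt r; apply: filterS => t rt.
have [|C C0 hl] := @theta_lt t; first by apply: le_lt_trans tr _; rewrite lte_fin.
by apply: (compression_ge_circle p1 C0 hl); apply: le_trans r0 (ltW rt).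
Qed.

Lemma theta_compression_ge_mixed (r : R) : 2 <= p -> 0 < r -> (theta <= r%:E)%E ->
  (((r + 1 - 2 / p) / ((2 - 1 / p) * r + 1 - 2 / p))%:E <= comp)%E.
Proof.
move=> p2 r0 tr.
have ip1 : 2 / p <= 1 by rewrite ler_pdivrMr// mul1r.
have nz : (2 - 1 / p) * r + (1 - 2 / p) != 0.
  have h : 0 < 2 - 1 / p by move: ip1 p2; rewrite -[2 / p]mulr1 -mulrA; nra.
  by rewrite gt_eqF// ltr_wpDr ?subr_ge0// mulr_gt0.
have h := @ratio_cvg 1 (1 - 2 / p) (2 - 1 / p) (1 - 2 / p) r nz.
rewrite -(addrA r) -(addrA (_ * r)) -{1}[r]mul1r.
apply: limit_le (cvg_at_right_filter h) _.
have := nbhs_right_gt r; apply: filterS => t rt.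
have [|C C0 hl] := @theta_lt t; first by apply: le_lt_trans tr _; rewrite lte_fin.
have := compression_ge_mixed p1 C0 hl p2 (lt_trans r0 rt).
by rewrite -(addrA t) -(addrA (_ * t)) (mul1r t).
Qed.

(** For 0 < t < r, [theta_gt] provides large levels, and the bound passes to the limit from the
    left. At r = 0 there is no such t, and [exponent_le1] takes over. *)
Lemma theta_compression_le_circle (r : R) : 0 <= r -> r * Num.max p 2 <= 1 ->
  (r%:E <= theta)%E -> (comp <= (1 / (1 + r))%:E)%E.
Proof.
move=> r0 rq rt; have [->|rn] := eqVneq r 0.
  rewrite addr0 divr1; apply: compression_le => Psi C c e c0 e0 hC hc.
  exact: exponent_le1 c0 hC hc.
have rp : 0 < r by rewrite lt_neqAle eq_sym rn.
apply: le_limit (cvg_at_left_filter (inv1D_cvg r0)) _.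
have := nbhs_left_lt r; have := nbhs_left_gt rp; apply: filterS2 => t t0 tr.
apply: compression_le => Psi C c e c0 e0 hC hc.
apply: (exponent_le_circle c0 e0 hC hc t0).
  apply: le_trans rq; apply: ler_wpM2r; last exact: ltW.
  by rewrite le_max ler0n orbT.
by apply: theta_gt; apply: lt_le_trans rt; rewrite lte_fin.
Qed.

Lemma theta_compression_le_torus (r : R) : 2 <= p -> 1 / p < r -> (r%:E <= theta)%E ->
  (comp <= ((2 * r + 1 - 2 / p) / (3 * r + 1 - 2 / p))%:E)%E.
Proof.
move=> p2 pr rt.
have ip1 : 2 / p <= 1 by rewrite ler_pdivrMr// mul1r.
have ip0 : 0 < 1 / p by rewrite divr_gt0.
have r0 : 0 < r by exact: lt_trans pr.
have nz : 3 * r + (1 - 2 / p) != 0 by rewrite gt_eqF// ltr_wpDr ?subr_ge0// mulr_gt0.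
have h := @ratio_cvg 2 (1 - 2 / p) 3 (1 - 2 / p) r nz.
rewrite -!addrA; apply: le_limit (cvg_at_left_filter h) _.
have := nbhs_left_lt r; have := nbhs_left_gt pr; apply: filterS2 => t t0 tr.
rewrite !addrA; apply: compression_le => Psi C c e c0 e0 hC hc.
apply: (exponent_le_torus c0 e0 hC hc p2 t0).
by apply: theta_gt; apply: lt_le_trans rt; rewrite lte_fin.
Qed.

End Compression.

Lemma diagonal_compression :
  (forall (p : R) (p1 : (1 <= p%:E)%E), p <= 2 ->
     compression_exponent p1 gens =
       (ext_eval (fun t => Num.max (1 / (1 + t)) (2 / 3)) theta)%:E) /\
  (forall (q : R) (q1 : (1 <= q%:E)%E), 2 <= q ->
     ((0 <= theta)%E -> (theta <= (1 / q)%:E)%E ->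
        compression_exponent q1 gens = (ext_eval (fun t => 1 / (1 + t)) theta)%:E) /\
     (((1 / q)%:E < theta)%E ->
        ((ext_eval (fun t => Num.max
            ((t + 1 - 2 / q) / ((2 - 1 / q) * t + 1 - 2 / q)) (2 / 3)) theta)%:E
           <= compression_exponent q1 gens)%E /\
        (compression_exponent q1 gens <=
          (ext_eval (fun t =>
            (2 * t + 1 - 2 / q) / (3 * t + 1 - 2 / q)) theta)%:E)%E)).
Proof.
have max_le (x y : R) (z : \bar R) : (x%:E <= z)%E -> (y%:E <= z)%E -> ((Num.max x y)%:E <= z)%E.
  by move=> xz yz; rewrite /Num.max; case: ifP.
have half : 1 / (1 + 1 / 2) = 2 / 3 :> R by field.
split=> [p p1 p2|q q1 q2].
  have pm : Num.max p 2 = 2 by apply/max_idPr.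
  have hhalf : 1 / 2 * Num.max p 2 <= 1 by rewrite pm div1r mulVf.
  apply/eqP; rewrite eq_le; move: theta_ge0.
  case E : theta => [r||] // r0; last first.
    (* For t > 1/2 the maximum is constantly 2/3. *)
    have -> : ext_eval (fun t => Num.max (1 / (1 + t)) (2 / 3)) (+oo : \bar R)%E = 2 / 3 :> R.
      apply/cvg_lim => //; apply: cvg_near_cst.
      have hr : (1 / 2 : R) \is Num.real by exact: num_real.
      have := nbhs_pinfty_gt hr; apply: filterS => t ht; apply/max_idPr.
      rewrite -half ler_pdivrMr; last by lra.
      by rewrite mulrAC mul1r ler_pdivlMr; lra.
    rewrite compression_ge_two_thirds andbT -half.
    by apply: theta_compression_le_circle => //; rewrite ?divr_ge0// E leey.
  have {}r0 : 0 <= r by rewrite -lee_fin.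
  rewrite /ext_eval; apply/andP; split; last first.
    apply: max_le; last exact: compression_ge_two_thirds.
    by apply: theta_compression_ge_circle; rewrite E.
  have [r2|r2] := leP r (1 / 2).
    apply: (@le_trans _ _ (1 / (1 + r))%:E); last by rewrite lee_fin le_max lexx.
    apply: theta_compression_le_circle; rewrite ?E//.
    by rewrite pm -ler_pdivlMr.
  (* Beyond theta = 1/2 the circle bound is applied at 1/2, the largest value with r q <= 1 for q =
     2. *)
  apply: (@le_trans _ _ (2 / 3)%:E); last by rewrite lee_fin le_max lexx orbT.
  rewrite -half; apply: theta_compression_le_circle => //; rewrite ?divr_ge0//.
  by rewrite E lee_fin ltW.
have q0 : 0 < q by apply: lt_le_trans q2.
have qm : Num.max q 2 = q by apply/max_idPl.
split=> [t0 tq|qt].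
  move: t0 tq; case E : theta => [r||] // r0 rq; rewrite /ext_eval.
  have {}r0 : 0 <= r by rewrite -lee_fin.
  apply/eqP; rewrite eq_le; apply/andP; split.
    apply: theta_compression_le_circle; rewrite ?E//.
    by rewrite qm -ler_pdivlMr// -lee_fin.
  by apply: theta_compression_ge_circle; rewrite E.
have iq0 : 0 < 1 / q by rewrite divr_gt0.
have iq1 : 2 / q <= 1 by rewrite ler_pdivrMr// mul1r.
move: qt; case E : theta => [r||] // qr.
  rewrite /ext_eval; split.
    apply: max_le; last exact: compression_ge_two_thirds.
    apply: theta_compression_ge_mixed; rewrite ?E//.
    by apply: lt_trans iq0 _; rewrite -lte_fin.
  by apply: theta_compression_le_torus; rewrite ?E// -lte_fin.
split.
  have -> : ext_eval (fun t => Num.max ((t + 1 - 2 / q) / ((2 - 1 / q) * t + 1 - 2 / q)) (2 / 3))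
      (+oo : \bar R)%E = 2 / 3 :> R; last exact: compression_ge_two_thirds.
  apply/cvg_lim => //; apply: cvg_near_cst.
  have hr : (1 : R) \is Num.real by exact: num_real.
  have := nbhs_pinfty_gt hr; apply: filterS => t ht; apply/max_idPr.
  have e2 : 2 / q = 2 * (1 / q) by rewrite mul1r.
  rewrite e2 in iq1 *; move: (1 / q) iq0 iq1 => u u0 u1.
  rewrite ler_pdivrMr; last by nra.
  by rewrite mulrAC ler_pdivlMr//; nra.
have -> : ext_eval (fun t => (2 * t + 1 - 2 / q) / (3 * t + 1 - 2 / q)) (+oo : \bar R)%E = 2 / 3 :> R.
  apply/cvg_lim => //; have := @ratio_cvg_pinfty 2 (1 - 2 / q) 3 (1 - 2 / q) (ltr0n R 3).
  by under eq_fun do rewrite !addrA.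
have c3 : 0 < 3 :> R by rewrite ltr0n.
(* For infinite theta the torus bound holds at every t > 1/q, and it tends to 2/3. *)
apply: le_limit (@ratio_cvg_pinfty 2 (1 - 2 / q) 3 (1 - 2 / q) c3) _.
have hr : (1 / q : R) \is Num.real by exact: num_real.
have := nbhs_pinfty_gt hr; apply: filterS => t ht; rewrite !addrA.
by apply: theta_compression_le_torus; rewrite ?E ?leey.
Qed.

End Exponents.


Theorem theorem8p1 (R : realType) (l k : nat -> nat)
  (a b : forall s, dihedral_gtype (2 * l s))
  (l_gt0 : forall s, (0 < l s)%N)
  (l_even : forall s, ~~ odd (l s))
  (l0 : l 0%N = 2%N)
  (ab_gen : forall s, dihedral_generators (a s) (b s))
  (k_even : forall s, ~~ odd (k s))
  (k_incr : forall s, (k s < k s.+1)%N)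
  (k0 : k 0%N = 0%N)
  (k_growth : forall s, (2 * k s < k s.+1)%N) :
  let theta : \bar R := limn_esup (fun s => (ln (l s)%:R / ln (k s)%:R)%:E) in
  let alpha (p : R) (p1 : (1 <= p%:E)%E) : \bar R :=
    compression_exponent p1 (diag_gens a b k) in
  (forall (p : R) (p1 : (1 <= p%:E)%E), p <= 2 ->
     alpha p p1 = (ext_eval (fun t => Num.max (1 / (1 + t)) (2 / 3)) theta)%:E)
  /\
  (forall (q : R) (q1 : (1 <= q%:E)%E), 2 <= q ->
     ((0 <= theta)%E -> (theta <= (1 / q)%:E)%E ->
        alpha q q1 = (ext_eval (fun t => 1 / (1 + t)) theta)%:E)
     /\
     (((1 / q)%:E < theta)%E ->
        ((ext_eval (fun t => Num.max
            ((t + 1 - 2 / q) / ((2 - 1 / q) * t + 1 - 2 / q)) (2 / 3)) theta)%:E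
           <= alpha q q1)%E /\
        (alpha q q1 <=
          (ext_eval (fun t =>
            (2 * t + 1 - 2 / q) / (3 * t + 1 - 2 / q)) theta)%:E)%E)).
Proof.
have gen s : [/\ #[a s]%g = 2%N, #[b s]%g = 2%N &
  <<[set a s; b s]%SET>>%g = [set: dihedral_gtype (2 * l s)]%SET] := ab_gen s.
have card s : #|dihedral_gtype (2 * l s)| = (2 * l s)%N.
  rewrite mul2n -cardsT card_dihedral//.
  by have := l_even s; have := l_gt0 s; case: (l s) => [|[]].
exact: (@diagonal_compression R (@Diagonal l k (fun s => dihedral_gtype (2 * l s)) a b
  (fun s => let: And3 h _ _ := gen s in h) (fun s => let: And3 _ h _ := gen s in h)
  (fun s => let: And3 _ _ h := gen s in h) card l_even l_gt0 l0 k_even k0 k_growth)).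
Qed.
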